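(* For every $\varepsilon > 0$ there exist $\alpha = \alpha(\varepsilon) > 0$, a smooth, convex, bounded domain $X \subset \mathbb{R}^2$, and a bounded domain $Y \subset \mathbb{R}^2$ with $|X| = |Y|$, such that $Y$ is an $\varepsilon$-small $C^{1,\alpha}$ perturbation of $X$ and the optimal transport taking $X$ to $Y$ is discontinuous.
   Context: A domain is a (bounded) connected open set; $|E|$ denotes Lebesgue measure and $\mathbf{1}_E$ the indicator function of $E$. Optimal transport: for bounded open sets $X, Y \subset \mathbb{R}^n$ with $|X| = |Y|$, the optimal transport taking $X$ to $Y$ is the ($\mathrm{a.e.}$ unique) map $T$ minimizing $\int_X |x - T(x)|^2 \, dx$ among all measurable maps satisfying $T_{\#}(\mathbf{1}_X\,dx) = \mathbf{1}_Y\,dy$. By Brenier's theorem it exists and has the form $T = \nabla u$ a.e. in $X$ with $u : \mathbb{R}^n \to \mathbb{R}$ convex. ''$T$ is discontinuous'' means that no continuous map on $X$ agrees with $T$ a.e. in $X$. $\varepsilon$-small $C^{1,\alpha}$ perturbation (with $\alpha \in (0,1)$): $Y$ is an $\varepsilon$-small $C^{1,\alpha}$ perturbation of $X$ if there is a $C^{1,\alpha}$ diffeomorphism $\Phi : \overline{X} \to \overline{Y}$ with $\Phi(X)=Y$ and $\|\Phi - \mathrm{Id}\|_{C^{1,\alpha}(\overline{X})} \le \varepsilon$, where the $C^{1,\alpha}$ norm is the sum of the sup norms of the map and of its gradient and the $\alpha$-Hölder seminorm of its gradient. *)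

(* Defs.v *)
From HB Require Import structures.
From mathcomp Require Import all_boot all_order all_algebra.
From mathcomp Require Import all_classical all_reals all_analysis.

Set Implicit Arguments.
Unset Strict Implicit.
Unset Printing Implicit Defensive.

Import Order.TTheory GRing.Theory Num.Theory.
Import numFieldNormedType.Exports.

Local Open Scope classical_set_scope.
Local Open Scope ring_scope.

(* The plane is [R * R].  Its library norm is the max norm, which induces the
   usual topology and notion of boundedness; lengths are measured with the
   Euclidean norm [enorm]. *)

Definition dotp (R : realType) (x y : R * R) : R := x.1 * y.1 + x.2 * y.2.

Definition enorm (R : realType) (x : R * R) : R := Num.sqrt (dotp x x).

Definition area (R : realType) : set (R * R) -> \bar R :=
  (@lebesgue_measure R \x @lebesgue_measure R)%E.

Definition bounded_domain (R : realType) (X : set (R * R)) : Prop :=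
  [/\ open X, connected X, X !=set0 & bounded_set X].

Definition smooth_function (R : realType) (g : R -> R) : Prop :=
  forall (k : nat) (t : R), derivable (derive1n k g) t 1.

(* Near each boundary point, [X] is the part lying above the graph of a smooth
   function, in the rotated orthonormal frame [((nu.2, - nu.1), nu)]. *)
Definition smooth_domain (R : realType) (X : set (R * R)) : Prop :=
  forall p, closure X p -> ~ X° p ->
  exists (nu : R * R) (g : R -> R) (r : R),
    [/\ enorm nu = 1, smooth_function g, 0 < r &
      forall x, enorm (x - p) < r ->
        (X x <-> g (dotp x (nu.2, - nu.1)) < dotp x nu)].

(* The two partial derivatives, i.e. the columns of the Jacobian matrix. *)
Definition gradient (R : realType) (f : R * R -> R * R) (x : R * R) :
    (R * R) * (R * R) :=
  ('D_((1, 0) : R * R) f x, 'D_((0, 1) : R * R) f x).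

Definition gnorm (R : realType) (A : (R * R) * (R * R)) : R :=
  Num.sqrt (enorm A.1 ^+ 2 + enorm A.2 ^+ 2).

(* [f] is [C^1] up to the boundary of the open set [X]: [J] is the continuous
   extension to [closure X] of the gradient of [f] on [X]. *)
Definition C1_upto_boundary (R : realType) (X : set (R * R))
    (f : R * R -> R * R) (J : R * R -> (R * R) * (R * R)) : Prop :=
  [/\ {within closure X, continuous f},
      {within closure X, continuous J} &
      forall x, X x -> differentiable f x /\ gradient f x = J x].

Definition C1alpha_norm (R : realType) (alpha : R) (X : set (R * R))
    (f : R * R -> R * R) (J : R * R -> (R * R) * (R * R)) : \bar R :=
  (ereal_sup [set (enorm (f x))%:E | x in closure X] +
   ereal_sup [set (gnorm (J x))%:E | x in closure X] +
   ereal_sup [set (gnorm (J z.1 - J z.2) / enorm (z.1 - z.2) `^ alpha)%:E |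
     z in [set z : (R * R) * (R * R) |
       [/\ closure X z.1, closure X z.2 & z.1 <> z.2]]])%E.

Definition C1alpha (R : realType) (alpha : R) (X : set (R * R))
    (f : R * R -> R * R) : Prop :=
  exists2 J, C1_upto_boundary X f J & (C1alpha_norm alpha X f J < +oo)%E.

Definition C1alpha_norm_le (R : realType) (alpha : R) (X : set (R * R))
    (f : R * R -> R * R) (eps : R) : Prop :=
  exists2 J, C1_upto_boundary X f J & (C1alpha_norm alpha X f J <= eps%:E)%E.

Definition C1alpha_diffeo (R : realType) (alpha : R) (X Y : set (R * R))
    (Phi : R * R -> R * R) : Prop :=
  [/\ set_bij (closure X) (closure Y) Phi, C1alpha alpha X Phi &
      exists2 Psi, forall x, closure X x -> Psi (Phi x) = x
                 & C1alpha alpha Y Psi].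

Definition C1alpha_perturbation (R : realType) (eps alpha : R)
    (X Y : set (R * R)) : Prop :=
  exists Phi : R * R -> R * R,
    [/\ C1alpha_diffeo alpha X Y Phi, Phi @` X = Y &
        C1alpha_norm_le alpha X (fun x => Phi x - x) eps].

(* [T] pushes the restriction of Lebesgue measure to [X] forward to its
   restriction to [Y]. *)
Definition transport_map (R : realType) (X Y : set (R * R))
    (T : R * R -> R * R) : Prop :=
  measurable_fun X T /\
  forall A : set (R * R), measurable A ->
    area (X `&` T @^-1` A) = area (Y `&` A).

Definition transport_cost (R : realType) (X : set (R * R))
    (T : R * R -> R * R) : \bar R :=
  (\int[@area R]_(x in X) (enorm (x - T x) ^+ 2)%:E)%E.

Definition optimal_transport (R : realType) (X Y : set (R * R))
    (T : R * R -> R * R) : Prop :=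
  transport_map X Y T /\
  forall S, transport_map X Y S ->
    (transport_cost X T <= transport_cost X S)%E.

Definition discontinuous (R : realType) (X : set (R * R))
    (T : R * R -> R * R) : Prop :=
  ~ exists2 g : R * R -> R * R, {within X, continuous g} &
      {ae @area R, forall x, X x -> g x = T x}.

(* Main.v *)
(** Put z = a + i b and A + i B = (z ^ 2 + rho ^ 2) ^ (1 + mu) / z on a > 0.  By
    the Cauchy-Riemann equations (B, a) |-> (b, A) preserves area and is the
    gradient of a partial Legendre transform of a primitive of A + i B; where
    B > 0 and b > 0 the derivative of B in b is positive, so this potential, whose
    Hessian has determinant 1, is locally convex.  Used on the right half of a
    stadium and reflected in the axis B = 0, it gives an even potential whose
    gradient T is an optimal transport, by duality.  Since B <= 0 for b > 0 and
    small |z|, the points of the right half that are near the origin have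
    b > rho / 2: T jumps across the axis, and monotonicity carries the jump over
    to every optimal map.

    The image of T is nevertheless close to the stadium.  Away from the pole T is
    close to the identity for small mu and rho.  Near the pole only the boundary
    of the image matters: it is the graph of the values of A along the curve
    B = 0 (continued by a = 0 for b >= rho), an even C^(1, mu) function of b
    whose slope is small when mu is small and then rho is small. *)
Require Import Defs.
From HB Require Import structures.
From mathcomp Require Import all_boot all_order all_algebra.
From mathcomp Require Import all_classical all_reals all_analysis.
From mathcomp Require Import measurable_realfun ring lra.
Import Order.TTheory GRing.Theory Num.Theory.
Import numFieldNormedType.Exports.
Local Open Scope classical_set_scope.
Local Open Scope ring_scope.

Set Implicit Arguments.
Unset Strict Implicit.
Unset Printing Implicit Defensive.

(** * Complex powers on the right half-plane *)

Section ComplexPower.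
Context {R : realType}.
Implicit Types (a b m : R).

(** At mu = 0 the function is z + rho^2 / z: B vanishes on the circle |z| = rho, and the image
    boundary 2 sqrt(rho^2 - b^2) has a vertical tangent at b = rho. The factor (z^2 + rho^2)^mu
    vanishes at z = i rho and bends the curve B = 0, on which a becomes a function of b of slope at
    most 3 / mu ([cone]). The boundary slope q + p^2 / q is then controlled by |z^2 + rho^2|^mu.
    This dictates the order of the choices: mu first, since beyond b = rho the slope is of size mu;
    then rho, so small that rho^(2 mu) beats 1 / mu; the Hoelder exponent of the theorem last. Only
    the C^1 size of the corrections is made small by mu and rho, while the mu-Hoelder constants of
    their gradients may be large. An exponent far below mu interpolates between the two and makes
    the Hoelder seminorm comparable with the C^1 size ([C1alpha_bound]), so the exponent depends on
    eps. *)

Definition nrm a b : R := Num.sqrt (a ^+ 2 + b ^+ 2).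
(** [asin] is the right branch only on a >= 0, imaginary axis included; at the origin division by 0
    makes the angle 0. *)
Definition arg a b : R := asin (b / nrm a b).

Definition cm (x y : R * R) : R * R := (x.1 * y.1 - x.2 * y.2, x.1 * y.2 + x.2 * y.1).

Definition cpow m a b : R * R :=
  (nrm a b `^ m * cos (m * arg a b), nrm a b `^ m * sin (m * arg a b)).

(** Complex differentiability in real coordinates. The Cauchy-Riemann equations are built in: all
    four partial derivatives are read off the single complex number f'. *)
Definition holo (f f' : R -> R -> R * R) a b : Prop :=
  [/\ is_derive a 1 (fun t => (f t b).1) (f' a b).1,
      is_derive a 1 (fun t => (f t b).2) (f' a b).2,
      is_derive b 1 (fun t => (f a t).1) (- (f' a b).2) &
      is_derive b 1 (fun t => (f a t).2) (f' a b).1].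

Lemma nrm_ge0 a b : 0 <= nrm a b. Proof. exact: sqrtr_ge0. Qed.

Lemma sqr_nrm a b : nrm a b ^+ 2 = a ^+ 2 + b ^+ 2.
Proof. by rewrite sqr_sqrtr// addr_ge0 ?sqr_ge0. Qed.

Lemma sqr2_eq0 a b : (a ^+ 2 + b ^+ 2 == 0) = (a == 0) && (b == 0).
Proof. by rewrite paddr_eq0 ?sqr_ge0// !sqrf_eq0. Qed.

Lemma nrm_eq0 a b : (nrm a b == 0) = (a == 0) && (b == 0).
Proof. by rewrite -sqr2_eq0 -sqr_nrm sqrf_eq0. Qed.

Lemma nrm_gt0 a b : (a != 0) || (b != 0) -> 0 < nrm a b.
Proof. by move=> h; rewrite lt_def nrm_ge0 nrm_eq0 negb_and h. Qed.

Lemma ler_norm_nrm a b : `|a| <= nrm a b /\ `|b| <= nrm a b.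
Proof.
split; rewrite -sqrtr_sqr ler_sqrt ?addr_ge0 ?sqr_ge0//.
  by rewrite lerDl sqr_ge0.
by rewrite lerDr sqr_ge0.
Qed.

Lemma nrm_le a b : nrm a b <= `|a| + `|b|.
Proof.
rewrite -(ler_pXn2r (n := 2))// ?nnegrE ?addr_ge0 ?nrm_ge0// sqr_nrm.
rewrite sqrrD !real_normK ?num_real//; have : 0 <= `|a| * `|b| by rewrite mulr_ge0.
lra.
Qed.

Lemma div_nrm_bound a b : -1 <= b / nrm a b <= 1.
Proof.
rewrite -ler_norml normrM normfV (ger0_norm (nrm_ge0 _ _)).
have [/eqP n0|n0] := boolP (nrm a b == 0).
  by rewrite n0 invr0 mulr0 ler01.
by rewrite ler_pdivrMr ?lt_def ?n0 ?nrm_ge0// mul1r; have [] := ler_norm_nrm a b.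
Qed.

Lemma sin_arg a b : nrm a b * sin (arg a b) = b.
Proof.
rewrite /arg asinK; last by rewrite in_itv/= div_nrm_bound.
have [/eqP n0|n0] := boolP (nrm a b == 0); last by rewrite mulrC divfK.
by have := nrm_eq0 a b; rewrite n0 eqxx mul0r => /esym/andP[_ /eqP->].
Qed.

Lemma cos_arg a b : 0 <= a -> nrm a b * cos (arg a b) = a.
Proof.
move=> a0; rewrite /arg cos_asin ?div_nrm_bound//.
have [/eqP n0|n0] := boolP (nrm a b == 0).
  by have := nrm_eq0 a b; rewrite n0 eqxx mul0r => /esym/andP[/eqP-> _].
rewrite -[X in X * _](ger0_norm (nrm_ge0 a b)) -sqrtr_sqr -sqrtrM ?sqr_ge0//.
rewrite mulrBr mulr1 exprMn exprVn mulrCA mulfV ?sqrf_eq0// mulr1 sqr_nrm.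
by rewrite addrK sqrtr_sqr ger0_norm.
Qed.

Lemma arg_bound a b : - (pi / 2) <= arg a b <= pi / 2.
Proof. by rewrite asin_geNpi2 ?asin_lepi2// div_nrm_bound. Qed.

Lemma arg_bound_lt a b : 0 < a -> - (pi / 2) < arg a b < pi / 2.
Proof.
move=> a0.
have n0 : 0 < nrm a b by apply: nrm_gt0; rewrite gt_eqF.
have ltb : `|b| < nrm a b.
  rewrite -(ltr_pXn2r (n := 2))// ?nnegrE ?nrm_ge0// sqr_nrm real_normK ?num_real//.
  by rewrite ltrDr exprn_gt0.
have /andP[h1 h2] : -1 < b / nrm a b < 1.
  by rewrite -ltr_norml normrM normfV (gtr0_norm n0) ltr_pdivrMr// mul1r.
by rewrite asin_gtNpi2 ?asin_ltpi2// ?h1 ?h2 ?ltW.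
Qed.

Lemma is_derive_nrm_a a b : 0 < nrm a b ->
  is_derive a 1 (fun t => nrm t b) (a / nrm a b).
Proof.
move=> n0; have n2 : 0 < a ^+ 2 + b ^+ 2 by rewrite -sqr_nrm exprn_gt0.
have h := is_derive1_sqrt n2.
have g : is_derive a 1 (fun t => t ^+ 2 + b ^+ 2) (2 * a).
  by apply: is_derive_eq; rewrite /GRing.scale/=; ring.
have := @is_derive1_comp _ Num.sqrt (fun t => t ^+ 2 + b ^+ 2) _ _ _ h g; rewrite /comp => /is_derive_eq; apply.
by rewrite -/(nrm a b); field; rewrite gt_eqF.
Qed.

Lemma nrmC a b : nrm a b = nrm b a. Proof. by rewrite /nrm addrC. Qed.

Lemma is_derive_nrm_b a b : 0 < nrm a b ->
  is_derive b 1 (fun t => nrm a t) (b / nrm a b).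
Proof.
move=> n0; rewrite nrmC.
under eq_fun do rewrite nrmC.
by apply: is_derive_nrm_a; rewrite nrmC.
Qed.

Lemma arg_aux a b : 0 < a ->
  [/\ 0 < nrm a b, -1 < b / nrm a b < 1 & Num.sqrt (1 - (b / nrm a b) ^+ 2) = a / nrm a b].
Proof.
move=> a0.
have n0 : 0 < nrm a b by apply: nrm_gt0; rewrite gt_eqF.
split => //.
  rewrite -ltr_norml normrM normfV (gtr0_norm n0) ltr_pdivrMr// mul1r.
  rewrite -(ltr_pXn2r (n := 2))// ?nnegrE ?nrm_ge0// sqr_nrm real_normK ?num_real//.
  by rewrite ltrDr exprn_gt0.
rewrite -cos_asin ?div_nrm_bound// -/(arg a b).
by rewrite -{2}(cos_arg b (ltW a0)) mulrC mulKf ?gt_eqF.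
Qed.

Lemma is_derive_arg_a a b : 0 < a ->
  is_derive a 1 (fun t => arg t b) (- b / nrm a b ^+ 2).
Proof.
move=> a0; have [n0 bd sq] := arg_aux b a0.
have h := is_derive1_asin bd.
have g : is_derive a 1 (fun t => b / nrm t b) (b * (- (nrm a b) ^- 2 * (a / nrm a b))).
  have d1 := is_derive_nrm_a n0.
  have nn : nrm a b != 0 by rewrite gt_eqF.
  by apply: is_derive_eq; rewrite /GRing.scale/=; field.
have := @is_derive1_comp _ asin (fun t => b / nrm t b) _ _ _ h g; rewrite /comp => /is_derive_eq; apply.
by rewrite sq; field; rewrite !gt_eqF.
Qed.

Lemma is_derive_arg_b a b : 0 < a ->
  is_derive b 1 (fun t => arg a t) (a / nrm a b ^+ 2).
Proof.
move=> a0; have [n0 bd sq] := arg_aux b a0.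
have h := is_derive1_asin bd.
have nn : nrm a b != 0 by rewrite gt_eqF.
have g : is_derive b 1 (fun t => t / nrm a t) ((nrm a b)^-1 - b * ((nrm a b) ^- 2 * (b / nrm a b))).
  have d1 := is_derive_nrm_b n0.
  by apply: is_derive_eq; rewrite /GRing.scale/=; field.
have := @is_derive1_comp _ asin (fun t => t / nrm a t) _ _ _ h g; rewrite /comp => /is_derive_eq; apply.
have e : b ^+ 2 = nrm a b ^+ 2 - a ^+ 2 by rewrite sqr_nrm; ring.
rewrite sq.
transitivity ((nrm a b ^+ 2 - b ^+ 2) / (a * nrm a b ^+ 2)).
  by field; rewrite !gt_eqF.
by rewrite e; field; rewrite !gt_eqF.
Qed.

(** The derivative m z^(m - 1), written as z^m times m / z, with 1 / z the conjugate of z over its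
    squared modulus. *)
Definition dcpow m a b : R * R := cm (cpow m a b) (m * a / nrm a b ^+ 2, - (m * b / nrm a b ^+ 2)).

Lemma holo_cpow m a b : 0 < a -> holo (cpow m) (dcpow m) a b.
Proof.
move=> a0; have [n0 _ _] := arg_aux b a0.
have nn : nrm a b != 0 by rewrite gt_eqF.
have pm : nrm a b `^ (m - 1) = nrm a b `^ m / nrm a b.
  by rewrite powRB ?powRr1 ?nrm_ge0// nn implybT.
have dna := is_derive_nrm_a n0.
have dnb := is_derive_nrm_b n0.
have daa := is_derive_arg_a b a0.
have dab := is_derive_arg_b b a0.
have dp := is_derive1_powR m n0.
have pa := @is_derive1_comp _ (fun x : R => x `^ m) (fun t => nrm t b) _ _ _ dp dna.
have pb := @is_derive1_comp _ (fun x : R => x `^ m) (fun t => nrm a t) _ _ _ dp dnb.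
have ca := @is_derive1_comp _ cos (fun t => m * arg t b) _ _ _ (is_derive_cos _) (is_deriveZ m daa).
have sa := @is_derive1_comp _ sin (fun t => m * arg t b) _ _ _ (is_derive_sin _) (is_deriveZ m daa).
have cb := @is_derive1_comp _ cos (fun t => m * arg a t) _ _ _ (is_derive_cos _) (is_deriveZ m dab).
have sb := @is_derive1_comp _ sin (fun t => m * arg a t) _ _ _ (is_derive_sin _) (is_deriveZ m dab).
split.
- have := is_deriveM pa ca => /is_derive_eq; apply.
  by rewrite /dcpow /cpow /cm /= /GRing.scale/= pm; field.
- have := is_deriveM pa sa => /is_derive_eq; apply.
  by rewrite /dcpow /cpow /cm /= /GRing.scale/= pm; field.
- have := is_deriveM pb cb => /is_derive_eq; apply.
  by rewrite /dcpow /cpow /cm /= /GRing.scale/= pm; field.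
- have := is_deriveM pb sb => /is_derive_eq; apply.
  by rewrite /dcpow /cpow /cm /= /GRing.scale/= pm; field.
Qed.

Lemma holo_mul (f f' g g' : R -> R -> R * R) a b : holo f f' a b -> holo g g' a b ->
  holo (fun a b => cm (f a b) (g a b))
       (fun a b => ((cm (f' a b) (g a b)).1 + (cm (f a b) (g' a b)).1,
                    (cm (f' a b) (g a b)).2 + (cm (f a b) (g' a b)).2)) a b.
Proof.
case=> f1 f2 f3 f4 [g1 g2 g3 g4]; rewrite /cm; split => /=.
- have := is_deriveB (is_deriveM f1 g1) (is_deriveM f2 g2) => /is_derive_eq; apply.
  by rewrite /GRing.scale/=; ring.
- have := is_deriveD (is_deriveM f1 g2) (is_deriveM f2 g1) => /is_derive_eq; apply.
  by rewrite /GRing.scale/=; ring.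
- have := is_deriveB (is_deriveM f3 g3) (is_deriveM f4 g4) => /is_derive_eq; apply.
  by rewrite /GRing.scale/=; ring.
- have := is_deriveD (is_deriveM f3 g4) (is_deriveM f4 g3) => /is_derive_eq; apply.
  by rewrite /GRing.scale/=; ring.
Qed.

End ComplexPower.

(** * The holomorphic model *)

Section Model.
Context {R : realType} (mu rho : R).
Hypothesis (mu_gt0 : 0 < mu) (mu_lt : mu < 1 / 8) (rho_gt0 : 0 < rho).
Implicit Types (a b : R).

(* With z = a + i b: EE = (z ^ 2 + rho ^ 2) ^ mu, ZZ = z + rho ^ 2 / z, and
   PP = EE * ZZ = A + i B has complex derivative dP = EE * WW = p + i q. *)
Definition kap : R := 1 + 2 * mu.
Definition EE a b : R * R := cm (cpow mu a (b + rho)) (cpow mu a (b - rho)).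
Definition NN a b : R := a ^+ 2 + b ^+ 2.
Definition ZZ a b : R * R :=
  (a * (1 + rho ^+ 2 / NN a b), b * (1 - rho ^+ 2 / NN a b)).
Definition WW a b : R * R :=
  (kap - rho ^+ 2 * (a ^+ 2 - b ^+ 2) / NN a b ^+ 2,
   rho ^+ 2 * (2 * a * b) / NN a b ^+ 2).
Definition PP a b : R * R := cm (EE a b) (ZZ a b).
Definition dP a b : R * R := cm (EE a b) (WW a b).
Definition A a b := (PP a b).1.
Definition B a b := (PP a b).2.
Definition p a b := (dP a b).1.
Definition q a b := (dP a b).2.

Lemma NN_gt0 a b : (a != 0) || (b != 0) -> 0 < NN a b.
Proof. by move=> h; rewrite /NN -sqr_nrm exprn_gt0// nrm_gt0. Qed.

Definition dZZ a b : R * R :=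
  (1 - rho ^+ 2 * (a ^+ 2 - b ^+ 2) / NN a b ^+ 2, rho ^+ 2 * (2 * a * b) / NN a b ^+ 2).

Lemma holo_ZZ a b : 0 < a -> holo ZZ dZZ a b.
Proof.
move=> a0; have N0 : NN a b != 0 by rewrite gt_eqF// NN_gt0// gt_eqF.
have N0' : a ^+ 2 + b ^+ 2 != 0 by [].
rewrite /ZZ /dZZ /NN; split => /=.
- by apply: is_derive_eq; rewrite /GRing.scale/=; field.
- by apply: is_derive_eq; rewrite /GRing.scale/=; field.
- by apply: is_derive_eq; rewrite /GRing.scale/=; field.
- by apply: is_derive_eq; rewrite /GRing.scale/=; field.
Qed.

Lemma holo_shift (f f' : R -> R -> R * R) a b s : holo f f' a (b + s) ->
  holo (fun a b => f a (b + s)) (fun a b => f' a (b + s)) a b.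
Proof.
case=> f1 f2 f3 f4; split => //.
  have g : is_derive b 1 (fun t => t + s) 1 by apply: is_derive_eq; rewrite addr0.
  have := @is_derive1_comp _ (fun t => (f a t).1) (fun t => t + s) _ _ _ f3 g.
  by rewrite mulr1.
have g : is_derive b 1 (fun t => t + s) 1 by apply: is_derive_eq; rewrite addr0.
have := @is_derive1_comp _ (fun t => (f a t).2) (fun t => t + s) _ _ _ f4 g.
by rewrite mulr1.
Qed.

Lemma holo_eq (f f' g' : R -> R -> R * R) a b : f' a b = g' a b ->
  holo f f' a b -> holo f g' a b.
Proof. by move=> e [f1 f2 f3 f4]; rewrite /holo -e. Qed.

(** The derivative of (z^2 + rho^2)^mu is 2 mu z / (z^2 + rho^2) times itself, and the factor [ZZ] =
    (z^2 + rho^2) / z cancels this quotient to the constant 2 mu. Added to the derivative of [ZZ] it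
    gives [WW], whence [kap] = 1 + 2 mu. *)
Lemma holo_PP a b : 0 < a -> holo PP dP a b.
Proof.
move=> a0.
have hp := holo_shift (holo_cpow mu (b + rho) a0).
have hm := holo_shift (holo_cpow mu (b - rho) a0).
have := holo_mul (holo_mul hp hm) (holo_ZZ b a0); apply: holo_eq.
have N0 : NN a b != 0 by rewrite gt_eqF// NN_gt0// gt_eqF.
have Np : NN a (b + rho) != 0 by rewrite gt_eqF// NN_gt0// gt_eqF.
have Nm : NN a (b - rho) != 0 by rewrite gt_eqF// NN_gt0// gt_eqF.
have N0' : a ^+ 2 + b ^+ 2 != 0 by [].
have Np' : a ^+ 2 + (b + rho) ^+ 2 != 0 by [].
have Nm' : a ^+ 2 + (b - rho) ^+ 2 != 0 by [].
rewrite /dP /EE /dcpow !sqr_nrm.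
case: (cpow mu a (b + rho)) => x1 y1; case: (cpow mu a (b - rho)) => x2 y2.
rewrite /ZZ /dZZ /WW /cm /NN /kap /=.
by congr pair; field; rewrite ?N0' ?Np' ?Nm'.
Qed.

(* modulus and argument of z ^ 2 + rho ^ 2 *)
Definition sS a b : R := nrm a (b + rho) * nrm a (b - rho).
Definition psi a b : R := arg a (b + rho) + arg a (b - rho).

Lemma EE_polar a b : EE a b =
  (sS a b `^ mu * cos (mu * psi a b), sS a b `^ mu * sin (mu * psi a b)).
Proof.
rewrite /EE /cm /cpow /sS /psi /= powRM ?nrm_ge0// mulrDr cosD sinD.
by move: (_ `^ _) (_ `^ _) (cos _) (cos _) (sin _) (sin _) => *; congr pair; ring.
Qed.

Lemma cos_psi a b : 0 <= a -> sS a b * cos (psi a b) = rho ^+ 2 + a ^+ 2 - b ^+ 2.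
Proof.
move=> a0; rewrite /psi cosD /sS.
have c1 := cos_arg (b + rho) a0. have c2 := cos_arg (b - rho) a0.
have s1 := sin_arg a (b + rho). have s2 := sin_arg a (b - rho).
transitivity ((nrm a (b + rho) * cos (arg a (b + rho))) * (nrm a (b - rho) * cos (arg a (b - rho)))
  - (nrm a (b + rho) * sin (arg a (b + rho))) * (nrm a (b - rho) * sin (arg a (b - rho)))).
  by ring.
by rewrite c1 c2 s1 s2; ring.
Qed.

Lemma sin_psi a b : 0 <= a -> sS a b * sin (psi a b) = 2 * a * b.
Proof.
move=> a0; rewrite /psi sinD /sS.
have c1 := cos_arg (b + rho) a0. have c2 := cos_arg (b - rho) a0.
have s1 := sin_arg a (b + rho). have s2 := sin_arg a (b - rho).
transitivity ((nrm a (b + rho) * sin (arg a (b + rho))) * (nrm a (b - rho) * cos (arg a (b - rho)))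
  + (nrm a (b + rho) * cos (arg a (b + rho))) * (nrm a (b - rho) * sin (arg a (b - rho)))).
  by ring.
by rewrite c1 c2 s1 s2; ring.
Qed.

Lemma sS_gt0 a b : 0 < a -> 0 < sS a b.
Proof. by move=> a0; rewrite /sS mulr_gt0// nrm_gt0// gt_eqF. Qed.

(** In the open first quadrant z^2 + rho^2 has imaginary part 2 a b > 0. *)
Lemma psi_bound a b : 0 < a -> 0 < b -> 0 < psi a b < pi.
Proof.
move=> a0 b0.
have [/andP[l1 u1] /andP[l2 u2]] := (arg_bound_lt (b + rho) a0, arg_bound_lt (b - rho) a0).
have pu : psi a b < pi by rewrite /psi; lra.
have pl : - pi < psi a b by rewrite /psi; lra.
rewrite pu andbT ltNge; apply/negP => h.
have : 0 <= sin (- psi a b) by rewrite sin_ge0_pi//; apply/andP; split; lra.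
have : 0 < sS a b * sin (psi a b) by rewrite sin_psi ?mulr_gt0 ?ltW//.
by rewrite pmulr_rgt0 ?sS_gt0// sinN; lra.
Qed.

Lemma sqr_sS a b : sS a b ^+ 2 = (NN a b - rho ^+ 2) ^+ 2 + 4 * rho ^+ 2 * a ^+ 2.
Proof. by rewrite /sS exprMn !sqr_nrm /NN; ring. Qed.

End Model.

(** * Elementary inequalities and Hoelder continuity of complex powers *)

Section Calculus.
Context {R : realType}.
Implicit Types x y m : R.

Lemma MVT_ex (f df : R -> R) (x y : R) : x < y ->
  (forall t, x < t < y -> is_derive t 1 f (df t)) ->
  {within `[x, y], continuous f} ->
  exists2 t, x < t < y & f y - f x = df t * (y - x).
Proof.
move=> xy df_ cf.
have h t : t \in `]x, y[ -> is_derive t 1 f (df t) by rewrite in_itv/= => /df_.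
have [t] := @MVT R f df x y xy h cf.
by rewrite in_itv/= => tt e; exists t.
Qed.

(** Since cos decreases on [0, pi], the mean slope of sin on [x, y] is below its mean slope on
    [0, x]. *)
Lemma sin_chord x y : 0 < x -> x < y -> y <= pi -> x * sin y < y * sin x.
Proof.
move=> x0 xy yp.
have cs (u v : R) : {within `[u, v], continuous (@sin R)}.
  by apply: continuous_subspaceT => ?; exact: continuous_sin.
have [t /andP[t0 tx] e1] := @MVT_ex sin cos 0 x x0 (fun t _ => is_derive_sin t) (cs _ _).
have [u /andP[xu uy] e2] := @MVT_ex sin cos x y xy (fun t _ => is_derive_sin t) (cs _ _).
have : cos u < cos t.
  by rewrite ltr_cos ?in_itv/=; [lra|apply/andP; split; lra|apply/andP; split; lra].
rewrite sin0 !subr0 in e1.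
move=> h.
have : x * (y - x) * cos u < x * (y - x) * cos t.
  by rewrite ltr_pM2l// mulr_gt0// subr_gt0.
have -> : x * (y - x) * cos u = x * (sin y - sin x) by rewrite e2; ring.
have -> : x * (y - x) * cos t = (y - x) * sin x by rewrite e1; ring.
lra.
Qed.

Lemma jordan x : 0 <= x <= pi / 2 -> x <= pi / 2 * sin x.
Proof.
move=> /andP[x0 xp]; have p0 := pi_gt0 R.
have [->|xn] := eqVneq x 0; first by rewrite sin0 mulr0.
have [->|xn'] := eqVneq x (pi / 2); first by rewrite sin_pihalf mulr1.
have := @sin_chord x (pi / 2); rewrite sin_pihalf mulr1 => h; apply/ltW/h.
- by rewrite lt_def xn.
- by rewrite lt_def eq_sym xn'.
- lra.
Qed.

Lemma cos_lip x y : `|cos x - cos y| <= `|x - y|.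
Proof.
wlog xy : x y / x < y.
  move=> h; have [//|yx|->] := ltgtP x y; last by rewrite !subrr.
  - exact: h.
  - by rewrite distrC (distrC x); exact: h.
have cc : {within `[x, y], continuous (@cos R)}.
  by apply: continuous_subspaceT => ?; exact: continuous_cos.
have [t _ e] := @MVT_ex cos (fun t => - sin t) x y xy (fun t _ => is_derive_cos t) cc.
rewrite distrC e (distrC x) normrM ler_piMl// normrN.
by rewrite ler_norml sin_geN1 sin_le1.
Qed.

Lemma sin_lip x y : `|sin x - sin y| <= `|x - y|.
Proof.
have := cos_lip (x - pi / 2) (y - pi / 2); rewrite !cosBpihalf.
by rewrite opprB addrA subrK.
Qed.

Lemma powR_subadd m x y : 0 < m -> m <= 1 -> 0 <= x -> 0 <= y ->
  (x + y) `^ m <= x `^ m + y `^ m.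
Proof.
move=> m0 m1 x0 y0.
have [e|xy] := eqVneq (x + y) 0.
  by rewrite e powR0 ?gt_eqF// addr_ge0// powR_ge0.
have s0 : 0 < x + y by rewrite lt_def xy addr_ge0.
have aux t : 0 <= t -> t <= x + y -> t / (x + y) <= t `^ m / (x + y) `^ m.
  move=> t0 ts.
  have [->|tn] := eqVneq t 0; first by rewrite mul0r divr_ge0// powR_ge0.
  have tp : 0 < t by rewrite lt_def tn.
  have : t / (x + y) <= (t / (x + y)) `^ m.
    by apply: ger1_powR => //; rewrite divr_gt0//= ler_pdivrMr// mul1r.
  have e : (x + y)^-1 `^ m = ((x + y) `^ m)^-1.
    by rewrite -powR_inv1 ?ltW// powRAC powR_inv1// powR_ge0.
  by rewrite powRM ?invr_ge0 ?(ltW s0)// e.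
have := lerD (aux x x0 _) (aux y y0 _).
rewrite -!mulrDl mulfV// => h.
rewrite -[leLHS]mul1r -ler_pdivlMr ?powR_gt0//.
by apply: h; lra.
Qed.

Lemma powR_dist m x y : 0 < m -> m <= 1 -> 0 <= x -> 0 <= y ->
  `|x `^ m - y `^ m| <= `|x - y| `^ m.
Proof.
move=> m0 m1; wlog xy : x y / x <= y.
  move=> h x0 y0; have [xy|/ltW yx] := leP x y; first exact: h.
  by rewrite distrC (distrC x); exact: h.
move=> x0 y0.
rewrite distrC ger0_norm; last by rewrite subr_ge0 ge0_ler_powR ?nnegrE// ltW.
rewrite distrC ger0_norm ?subr_ge0// lerBlDl.
have := @powR_subadd m x (y - x) m0 m1 x0.
by rewrite subr_ge0 xy addrC subrK => /(_ isT).
Qed.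

Lemma dist_polar (a b c d : R) : 0 <= a -> 0 <= c ->
  (a - c) ^+ 2 + (b - d) ^+ 2 = nrm a b ^+ 2 + nrm c d ^+ 2
     - 2 * nrm a b * nrm c d * cos (arg a b - arg c d).
Proof.
move=> a0 c0; rewrite cosB.
have c1 := cos_arg b a0. have c2 := cos_arg d c0.
have s1 := sin_arg a b. have s2 := sin_arg c d.
transitivity (nrm a b ^+ 2 + nrm c d ^+ 2 - 2 * ((nrm a b * cos (arg a b)) * (nrm c d * cos (arg c d)) +
  (nrm a b * sin (arg a b)) * (nrm c d * sin (arg c d)))); last by ring.
by rewrite c1 c2 s1 s2 !sqr_nrm; ring.
Qed.

(** By the law of cosines the squared distance is (r - s)^2 + 4 r s sin(e / 2)^2, and Jordan's
    inequality turns the sine into the angle. Weighting the angle by the smaller modulus keeps the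
    estimate valid down to the origin. *)
Lemma dist_nrm_arg (a b c d : R) : 0 <= a -> 0 <= c -> nrm c d <= nrm a b ->
  nrm a b - nrm c d <= nrm (a - c) (b - d) /\
  nrm c d * `|arg a b - arg c d| <= pi * nrm (a - c) (b - d).
Proof.
move=> a0 c0 sr.
set r := nrm a b in sr *; set s := nrm c d in sr *; set D := nrm _ _.
set e := arg a b - arg c d.
have s0 : 0 <= s := nrm_ge0 _ _. have r0 : 0 <= r := nrm_ge0 _ _.
have D0 : 0 <= D := nrm_ge0 _ _.
have eD : D ^+ 2 = (r - s) ^+ 2 + 2 * r * s * (1 - cos e).
  by rewrite sqr_nrm dist_polar// -/r -/s -/e; ring.
have ce : 0 <= 1 - cos e by rewrite subr_ge0 cos_le1.
have rs0 : 0 <= r * s by rewrite mulr_ge0.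
split.
  rewrite -(ler_pXn2r (n := 2))// ?nnegrE ?subr_ge0// eD lerDl.
  by rewrite !mulr_ge0.
have p0 := pi_gt0 R.
have eb : `|e| <= pi.
  have [/andP[l1 u1] /andP[l2 u2]] := (arg_bound a b, arg_bound c d).
  by rewrite ler_norml /e; lra.
have ee : cos e = cos `|e| by have [e0|e0] := ger0P e; rewrite ?cosN.
have h : `|e| / 2 <= pi / 2 * sin (`|e| / 2).
  by apply: jordan; rewrite divr_ge0//= ler_pM2r// invr_gt0.
have sd : s * sin (`|e| / 2) * 2 <= D.
  have sn : 0 <= sin (`|e| / 2) by rewrite sin_ge0_pi// divr_ge0//=; lra.
  rewrite -(ler_pXn2r (n := 2))// ?nnegrE ?mulr_ge0// eD.
  have -> : 1 - cos e = 2 * sin (`|e| / 2) ^+ 2.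
    rewrite ee; have -> : `|e| = `|e| / 2 + `|e| / 2 by lra.
    rewrite cosD; set t := `|e| / 2 + `|e| / 2.
    have -> : t / 2 = `|e| / 2 by rewrite /t; lra.
    have := cos2Dsin2 (`|e| / 2); set u := cos _; set v := sin _; nra.
  apply: (@le_trans _ _ (2 * r * s * (2 * sin (`|e| / 2) ^+ 2))); last first.
    by rewrite lerDr sqr_ge0.
  set v := sin _ in sn *.
  have : s * s * (4 * v ^+ 2) <= r * s * (4 * v ^+ 2).
    by rewrite ler_wpM2r ?mulr_ge0 ?sqr_ge0// ler_wpM2r.
  lra.
apply: (@le_trans _ _ (s * (pi * sin (`|e| / 2)))).
  by rewrite ler_wpM2l//; lra.
have : pi * (s * sin (`|e| / 2) * 2) <= pi * D by rewrite ler_pM2l.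
have : 0 <= pi * D by rewrite mulr_ge0// ltW.
lra.
Qed.

(** Moduli are handled by the subadditivity of t^m. For the angle e, write |e| = |e|^m |e|^(1 - m),
    absorb |e|^m into the smaller modulus and bound the remaining factor by pi^(1 - m). *)
Lemma cpow_dist m (a b c d : R) : 0 < m -> m <= 1 -> 0 <= a -> 0 <= c ->
  `|(cpow m a b).1 - (cpow m c d).1| <= (1 + pi) * nrm (a - c) (b - d) `^ m /\
  `|(cpow m a b).2 - (cpow m c d).2| <= (1 + pi) * nrm (a - c) (b - d) `^ m.
Proof.
move=> m0 m1; wlog sr : a b c d / nrm c d <= nrm a b.
  move=> h a0 c0; have [sr|/ltW sr] := leP (nrm c d) (nrm a b); first exact: h.
  have -> : nrm (a - c) (b - d) = nrm (c - a) (d - b) by rewrite /nrm -sqrrN -[X in _ + X]sqrrN !opprB.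
  by rewrite distrC [X in _ /\ X <= _]distrC; exact: h.
move=> a0 c0; have [h1 h2] := dist_nrm_arg a0 c0 sr.
have p0 := pi_gt0 R.
set D := nrm (a - c) (b - d) in h1 h2 *.
have D0 : 0 <= D := nrm_ge0 _ _.
have rm : `|nrm a b `^ m - nrm c d `^ m| <= D `^ m.
  apply: le_trans (powR_dist m0 m1 (nrm_ge0 _ _) (nrm_ge0 _ _)) _.
  by rewrite ge0_ler_powR ?nnegrE ?ger0_norm ?subr_ge0// ltW.
have pim : pi `^ m * pi `^ (1 - m) = pi :> R.
  rewrite -powRD; last by rewrite (gt_eqF p0) implybT.
  by rewrite addrC subrK powRr1// ltW.
have sm : nrm c d `^ m * `|arg a b - arg c d| <= pi * D `^ m.
  set e := `|_|; have e0 : 0 <= e by exact: normr_ge0.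
  have eb : e <= pi.
    have [/andP[l1 u1] /andP[l2 u2]] := (arg_bound a b, arg_bound c d).
    by rewrite ler_norml; lra.
  have {1}-> : e = e `^ m * e `^ (1 - m).
    have [->|e1] := eqVneq e 0; first by rewrite powR0 ?gt_eqF// mul0r.
    by rewrite -powRD ?e1 ?implybT// addrC subrK powRr1.
  rewrite mulrA -powRM ?nrm_ge0//.
  rewrite -pim mulrAC -powRM ?(ltW p0)//.
  apply: ler_pM; rewrite ?powR_ge0//.
    by apply: ge0_ler_powR; rewrite ?nnegrE ?mulr_ge0 ?nrm_ge0 ?(ltW m0) ?(ltW p0).
  by apply: ge0_ler_powR; rewrite ?nnegrE ?subr_ge0// ltW.
have me : `|m * arg a b - m * arg c d| <= `|arg a b - arg c d|.
  by rewrite -mulrBr normrM ler_piMl// gtr0_norm.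
have key (F : R -> R) : (forall x, `|F x| <= 1) -> (forall x y, `|F x - F y| <= `|x - y|) ->
  `|nrm a b `^ m * F (m * arg a b) - nrm c d `^ m * F (m * arg c d)| <= (1 + pi) * D `^ m.
  move=> F1 F2.
  have -> : nrm a b `^ m * F (m * arg a b) - nrm c d `^ m * F (m * arg c d) =
    (nrm a b `^ m - nrm c d `^ m) * F (m * arg a b) + nrm c d `^ m * (F (m * arg a b) - F (m * arg c d)).
    by ring.
  rewrite [leRHS]mulrDl mul1r; apply: le_trans (ler_normD _ _) _; apply: lerD.
    by rewrite normrM (le_trans _ rm)// ler_piMr.
  rewrite normrM (ger0_norm (powR_ge0 _ _)) (le_trans _ sm)// ler_wpM2l ?powR_ge0//.
  exact: le_trans (F2 _ _) me.
split; apply: key => //.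
- by move=> x; rewrite ler_norml cos_geN1 cos_le1.
- exact: cos_lip.
- by move=> x; rewrite ler_norml sin_geN1 sin_le1.
- exact: sin_lip.
Qed.

End Calculus.

(** * Hoelder estimates for the model *)

Section Hoelder.
Context {R : realType}.
Implicit Types (S : set (R * R)) (f g : R * R -> R) (be : R).

(** Sup bound and Hoelder bound share one constant, so that the class is closed under products as
    well as sums. *)
Definition hold be S f := exists2 C : R, 0 <= C &
  forall v w, S v -> S w -> `|f v| <= C /\ `|f v - f w| <= C * `|v - w| `^ be.

Lemma norm_pair (v : R * R) : `|v.1| <= `|v| /\ `|v.2| <= `|v|.
Proof. by rewrite prod_normE !le_max !lexx orbT. Qed.

Lemma norm_pair_le (v : R * R) e : (`|v| <= e) = (`|v.1| <= e) && (`|v.2| <= e).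
Proof. by rewrite prod_normE ge_max. Qed.

Lemma holdS be S S' f : S' `<=` S -> hold be S f -> hold be S' f.
Proof. by move=> h [C C0 fC]; exists C => // v w /h Sv /h Sw; exact: fC. Qed.

Lemma hold_eq be S f g : (forall v, S v -> f v = g v) -> hold be S f -> hold be S g.
Proof. by move=> h [C C0 fC]; exists C => // v w Sv Sw; rewrite -!h//; exact: fC. Qed.

Lemma hold_cst be S (c : R) : hold be S (fun=> c).
Proof.
by exists `|c| => // v w _ _; rewrite subrr normr0 lexx mulr_ge0// powR_ge0.
Qed.

Lemma holdD be S f g : hold be S f -> hold be S g -> hold be S (fun v => f v + g v).
Proof.
move=> [C C0 fC] [D D0 gD]; exists (C + D); first exact: addr_ge0.
move=> v w Sv Sw; have [[f1 f2] [g1 g2]] := (fC _ _ Sv Sw, gD _ _ Sv Sw).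
split; first by rewrite (le_trans (ler_normD _ _))// lerD.
rewrite mulrDl opprD addrACA (le_trans (ler_normD _ _))//.
by rewrite lerD.
Qed.

Lemma holdN be S f : hold be S f -> hold be S (fun v => - f v).
Proof.
by move=> [C C0 fC]; exists C => // v w Sv Sw; rewrite -opprD !normrN; exact: fC.
Qed.

Lemma holdB be S f g : hold be S f -> hold be S g -> hold be S (fun v => f v - g v).
Proof. by move=> hf /holdN; exact: holdD. Qed.

Lemma holdM be S f g : hold be S f -> hold be S g -> hold be S (fun v => f v * g v).
Proof.
move=> [C C0 fC] [D D0 gD]; exists (2 * C * D); first by rewrite !mulr_ge0.
move=> v w Sv Sw; have [[f1 f2] [g1 g2]] := (fC _ _ Sv Sw, gD _ _ Sv Sw).
have [fw _] := fC _ _ Sw Sv.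
have CD : 0 <= C * D by rewrite mulr_ge0.
split.
  rewrite normrM; apply: (@le_trans _ _ (C * D)); first by rewrite ler_pM.
  lra.
have -> : f v * g v - f w * g w = (f v - f w) * g v + f w * (g v - g w) by ring.
rewrite (le_trans (ler_normD _ _))// !normrM.
have -> : 2 * C * D * `|v - w| `^ be = (C * `|v - w| `^ be) * D + C * (D * `|v - w| `^ be) by ring.
by rewrite lerD// ler_pM.
Qed.

Lemma hold_inv be S f c : 0 < c -> (forall v, S v -> c <= f v) -> hold be S f ->
  hold be S (fun v => (f v)^-1).
Proof.
move=> c0 fc [C C0 fC]; exists (c^-1 + C / c ^+ 2).
  by rewrite addr_ge0 ?divr_ge0 ?invr_ge0 ?sqr_ge0// ltW.
move=> v w Sv Sw; have [f1 f2] := fC _ _ Sv Sw.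
have fv : 0 < f v by apply: lt_le_trans (fc _ Sv).
have fw : 0 < f w by apply: lt_le_trans (fc _ Sw).
have fvc : (f v)^-1 <= c^-1 by rewrite lef_pV2 ?posrE ?fc.
have fwc : (f w)^-1 <= c^-1 by rewrite lef_pV2 ?posrE ?fc.
have Cc : 0 <= C / c ^+ 2 by rewrite divr_ge0 ?sqr_ge0.
split; first by rewrite gtr0_norm ?invr_gt0// (le_trans fvc)// lerDl.
have -> : (f v)^-1 - (f w)^-1 = (f w - f v) * ((f v)^-1 * (f w)^-1).
  by field; rewrite !gt_eqF.
rewrite normrM distrC.
apply: (@le_trans _ _ ((C * `|v - w| `^ be) * (c^-1 * c^-1))).
  apply: ler_pM => //.
  rewrite gtr0_norm ?mulr_gt0 ?invr_gt0//.
  by apply: ler_pM => //; rewrite invr_ge0 ltW.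
rewrite -invfM -expr2 mulrAC.
by rewrite ler_wpM2r ?powR_ge0// lerDr invr_ge0 ltW.
Qed.

(** At distance at least 1 the sup bound is used, below 1 the Lipschitz bound. *)
Lemma hold_lip be S f (C L : R) : 0 < be <= 1 -> 0 <= C -> 0 <= L ->
  (forall v, S v -> `|f v| <= C) ->
  (forall v w, S v -> S w -> `|f v - f w| <= L * `|v - w|) -> hold be S f.
Proof.
move=> /andP[b0 b1] C0 L0 fC fL; exists (2 * C + L); first by rewrite addr_ge0 ?mulr_ge0.
move=> v w Sv Sw; split; first by apply: le_trans (fC _ Sv) _; lra.
have [t1|t1] := leP 1 `|v - w|.
  have : 1 <= `|v - w| `^ be.
    have e : 1 `^ be = 1 :> R by rewrite powR1.
    by rewrite -[leLHS]e ge0_ler_powR ?nnegrE// ltW.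
  have := ler_normB (f v) (f w); have := fC _ Sv; have := fC _ Sw.
  set T := _ `^ be => h1 h2 h3 h4.
  apply: (@le_trans _ _ (2 * C)); first lra.
  by apply: (@le_trans _ _ (2 * C * T)); [rewrite ler_peMr ?mulr_ge0|rewrite ler_wpM2r//; lra].
apply: le_trans (fL _ _ Sv Sw) _.
have [->|t0] := eqVneq `|v - w| 0.
  by rewrite mulr0 mulr_ge0 ?powR_ge0// addr_ge0 ?mulr_ge0.
apply: ler_pM => //; first lra.
by apply: ger1_powR => //; rewrite (ltW t1) andbT lt_def t0/=.
Qed.

Lemma hold_comp be S S' f (g : R * R -> R * R) L : 0 <= be -> 0 <= L ->
  (forall v, S' v -> S (g v)) ->
  (forall v w, S' v -> S' w -> `|g v - g w| <= L * `|v - w|) ->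
  hold be S f -> hold be S' (f \o g).
Proof.
move=> b0 L0 gS gL [C C0 fC]; exists (C + C * L `^ be).
  by rewrite addr_ge0 ?mulr_ge0 ?powR_ge0.
move=> v w Sv Sw /=; have [f1 f2] := fC _ _ (gS _ Sv) (gS _ Sw).
split; first by rewrite (le_trans f1)// lerDl mulr_ge0 ?powR_ge0.
apply: le_trans f2 _.
apply: (@le_trans _ _ (C * (L * `|v - w|) `^ be)).
  by rewrite ler_wpM2l// ge0_ler_powR ?nnegrE ?mulr_ge0// gL.
rewrite powRM// mulrA ler_wpM2r ?powR_ge0//.
by rewrite lerDr.
Qed.


Lemma pow_small be (C e : R) : 0 < be -> 0 <= C -> 0 < e ->
  exists2 d : R, 0 < d & forall t, 0 <= t -> t < d -> C * t `^ be < e.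
Proof.
move=> b0 C0 e0; have C1 : 0 < C + 1 by lra.
have ec : 0 < e / (C + 1) by rewrite divr_gt0.
exists ((e / (C + 1)) `^ be^-1); first by rewrite powR_gt0.
move=> t t0 td.
have h : t `^ be < e / (C + 1).
  have -> : e / (C + 1) = ((e / (C + 1)) `^ be^-1) `^ be.
    by rewrite -powRrM mulVf ?gt_eqF// powRr1// ltW.
  by apply: gt0_ltr_powR; rewrite ?nnegrE ?powR_ge0.
apply: (@le_lt_trans _ _ (C * (e / (C + 1)))); first by rewrite ler_wpM2l// ltW.
by rewrite mulrCA -[ltRHS]mulr1 ltr_pM2l// ltr_pdivrMr// mul1r; lra.
Qed.

Lemma within_contP (V W : normedModType R) (I : set V) (f : V -> W) :
  {within I, continuous f} <->
  forall x, I x -> forall e : R, 0 < e ->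
    exists2 d : R, 0 < d & forall y, I y -> `|x - y| < d -> `|f x - f y| < e.
Proof.
split.
  move=> /subspace_continuousP h x Ix e e0.
  have /cvgrPdist_lt /(_ _ e0) := h x Ix.
  rewrite near_withinE => /nbhs_ballP[d /= d0 hd]; exists d => // y Iy xy.
  by apply: (hd y _ Iy); rewrite -ball_normE.
move=> h; apply/subspace_continuousP => x Ix; apply/cvgrPdist_lt => e e0.
have [d d0 hd] := h x Ix e e0.
rewrite near_withinE; apply/nbhs_ballP; exists d => //= y xy Iy.
by apply: hd => //; move: xy; rewrite -ball_normE.
Qed.

Lemma hold_cont be S f (I : set R) (g : R -> R * R) L : 0 < be -> 0 <= L -> hold be S f ->
  (forall t, I t -> S (g t)) -> (forall t u, I t -> I u -> `|g t - g u| <= L * `|t - u|) ->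
  {within I, continuous (f \o g)}.
Proof.
move=> b0 L0 [C C0 fC] gS gL; apply/within_contP => x Ix e e0.
have CL : 0 <= C * L `^ be by rewrite mulr_ge0 ?powR_ge0.
have [d d0 hd] := pow_small b0 CL e0; exists d => // y Iy xy /=.
have [_ h] := fC _ _ (gS _ Ix) (gS _ Iy).
apply: le_lt_trans h _; apply: le_lt_trans (hd _ (normr_ge0 (x - y)) xy).
rewrite -mulrA -powRM// ler_wpM2l// ge0_ler_powR ?nnegrE ?mulr_ge0// ?(ltW b0)//.
exact: gL.
Qed.

End Hoelder.

Section ModelHoelder.
Context {R : realType} (mu rho : R).
Hypothesis (mu_gt0 : 0 < mu) (mu_lt : mu < 1 / 8) (rho_gt0 : 0 < rho).
Implicit Types (a b c M : R).

(** Coordinates are ordered (b, a). The set avoids the pole but includes part of the imaginary axis,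
    possibly with the zeros of z^2 + rho^2, where [EE] is only mu-Hoelder. *)
Definition SM c M : set (R * R) :=
  [set v | [/\ 0 <= v.2, c <= nrm v.2 v.1, `|v.1| <= M & `|v.2| <= M]].

Let be01 : 0 < mu <= 1. Proof. by have := mu_gt0; have := mu_lt => h1 h2; apply/andP; split; lra. Qed.

Lemma hold_fst c M : 0 <= M -> hold mu (SM c M) (fun v => v.1).
Proof.
move=> M0; apply: (@hold_lip _ mu _ _ M 1) => //.
  by move=> v [].
by move=> v w _ _; rewrite mul1r; have [] := norm_pair (v - w).
Qed.

Lemma hold_snd c M : 0 <= M -> hold mu (SM c M) (fun v => v.2).
Proof.
move=> M0; apply: (@hold_lip _ mu _ _ M 1) => //.
  by move=> v [].
by move=> v w _ _; rewrite mul1r; have [] := norm_pair (v - w).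
Qed.

Lemma hold_cpow s c M : 0 <= M ->
  hold mu (SM c M) (fun v => (cpow mu v.2 (v.1 + s)).1) /\
  hold mu (SM c M) (fun v => (cpow mu v.2 (v.1 + s)).2).
Proof.
move=> M0; have p0 := pi_gt0 R; have [b0 b1] := andP be01.
pose K := (2 * M + `|s|) `^ mu + (1 + pi) * 2 `^ mu.
have K1 : (2 * M + `|s|) `^ mu <= K by rewrite lerDl mulr_ge0 ?powR_ge0//; lra.
have K2 : (1 + pi) * 2 `^ mu <= K by rewrite lerDr powR_ge0.
have K0 : 0 <= K by rewrite addr_ge0 ?mulr_ge0 ?powR_ge0//; lra.
have bd v : SM c M v -> nrm v.2 (v.1 + s) `^ mu <= K.
  move=> [_ _ v1 v2]; apply: le_trans K1.
  apply: ge0_ler_powR; rewrite ?nnegrE ?nrm_ge0 ?addr_ge0 ?mulr_ge0 ?(ltW b0)//.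
  apply: le_trans (nrm_le _ _) _; have := ler_normD v.1 s; lra.
have dist v w : nrm (v.2 - w.2) (v.1 + s - (w.1 + s)) `^ mu <= 2 `^ mu * `|v - w| `^ mu.
  rewrite -powRM//; apply: ge0_ler_powR; rewrite ?nnegrE ?nrm_ge0 ?mulr_ge0 ?(ltW b0)//.
  apply: le_trans (nrm_le _ _) _; have [h1 h2] := norm_pair (v - w).
  have -> : v.1 + s - (w.1 + s) = v.1 - w.1 by ring.
  by move: h1 h2 => /=; lra.
have pp v w : (1 + pi) * nrm (v.2 - w.2) (v.1 + s - (w.1 + s)) `^ mu <= K * `|v - w| `^ mu.
  apply: le_trans (ler_wpM2r (powR_ge0 _ _) K2).
  by rewrite -mulrA ler_wpM2l//; lra.
split; exists K => // v w Sv Sw.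
- split.
    rewrite /cpow /= normrM (ger0_norm (powR_ge0 _ _)) (le_trans _ (bd _ Sv))//.
    by rewrite ler_piMr ?powR_ge0// ler_norml cos_geN1 cos_le1.
  have [v2 _ _ _] := Sv; have [w2 _ _ _] := Sw.
  by have [h _] := cpow_dist (v.1 + s) (w.1 + s) b0 b1 v2 w2; apply: le_trans h (pp _ _).
- split.
    rewrite /cpow /= normrM (ger0_norm (powR_ge0 _ _)) (le_trans _ (bd _ Sv))//.
    by rewrite ler_piMr ?powR_ge0// ler_norml sin_geN1 sin_le1.
  have [v2 _ _ _] := Sv; have [w2 _ _ _] := Sw.
  by have [_ h] := cpow_dist (v.1 + s) (w.1 + s) b0 b1 v2 w2; apply: le_trans h (pp _ _).
Qed.

Lemma hold_cm S (f g : R * R -> R * R) :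
  hold mu S (fun v => (f v).1) -> hold mu S (fun v => (f v).2) ->
  hold mu S (fun v => (g v).1) -> hold mu S (fun v => (g v).2) ->
  hold mu S (fun v => (cm (f v) (g v)).1) /\ hold mu S (fun v => (cm (f v) (g v)).2).
Proof.
by move=> f1 f2 g1 g2; split; [apply: holdB|apply: holdD]; apply: holdM.
Qed.

Lemma hold_NNV c M : 0 < c -> 0 <= M -> hold mu (SM c M) (fun v => (NN v.2 v.1)^-1).
Proof.
move=> c0 M0; apply: (@hold_inv _ _ _ _ (c ^+ 2)); first by rewrite exprn_gt0.
  move=> v [_ h _ _]; rewrite /NN -sqr_nrm ler_pXn2r// ?nnegrE ?nrm_ge0//.
  exact: ltW.
by apply: holdD; apply: holdM; do ?[exact: hold_fst|exact: hold_snd].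
Qed.

Lemma hold_model c M : 0 < c -> 0 <= M ->
  [/\ hold mu (SM c M) (fun v => A mu rho v.2 v.1),
      hold mu (SM c M) (fun v => B mu rho v.2 v.1),
      hold mu (SM c M) (fun v => p mu rho v.2 v.1) &
      hold mu (SM c M) (fun v => q mu rho v.2 v.1)].
Proof.
move=> c0 M0.
have [p1 p2] := hold_cpow rho c M0.
have [m1 m2] := hold_cpow (- rho) c M0.
have h1 := hold_fst c M0; have h2 := hold_snd c M0; have hV := hold_NNV c0 M0.
have hc (x : R) := hold_cst mu (SM c M) x.
have [E1 E2] := hold_cm p1 p2 m1 m2.
have Z1 : hold mu (SM c M) (fun v => (ZZ rho v.2 v.1).1).
  by apply: holdM => //; apply: holdD => //; apply: holdM.
have Z2 : hold mu (SM c M) (fun v => (ZZ rho v.2 v.1).2).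
  by apply: holdM => //; apply: holdB => //; apply: holdM.
have VV : hold mu (SM c M) (fun v => (NN v.2 v.1 ^+ 2)^-1).
  by apply: hold_eq (holdM hV hV) => v _; rewrite -invfM expr2.
have sq2 : hold mu (SM c M) (fun v => v.2 ^+ 2) by exact: holdM.
have sq1 : hold mu (SM c M) (fun v => v.1 ^+ 2) by exact: holdM.
have W1 : hold mu (SM c M) (fun v => (WW mu rho v.2 v.1).1).
  by apply: holdB => //; apply: holdM => //; apply: holdM => //; apply: holdB.
have W2 : hold mu (SM c M) (fun v => (WW mu rho v.2 v.1).2).
  by apply: holdM => //; apply: holdM => //; apply: holdM => //; apply: holdM.
have [A1 B1] := hold_cm E1 E2 Z1 Z2.
by have [P1 Q1] := hold_cm E1 E2 W1 W2.
Qed.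

End ModelHoelder.

(** * Signs of B and of its derivatives in the first quadrant *)

Section Signs.
Context {R : realType} (mu rho : R).
Hypothesis (mu_gt0 : 0 < mu) (mu_lt : mu < 1 / 8) (rho_gt0 : 0 < rho).
Implicit Types (a b : R).
Notation A := (A mu rho).
Notation B := (B mu rho).
Notation p := (p mu rho).
Notation q := (q mu rho).
Notation psi := (psi rho).
Notation sS := (sS rho).
Notation ZZ := (ZZ rho).
Notation WW := (WW mu rho).
Notation kap := (kap mu).

Lemma B_polar a b : B a b = sS a b `^ mu *
  (cos (mu * psi a b) * (ZZ a b).2 + sin (mu * psi a b) * (ZZ a b).1).
Proof. by rewrite /B /PP EE_polar /cm /=; ring. Qed.

Lemma A_polar a b : A a b = sS a b `^ mu *
  (cos (mu * psi a b) * (ZZ a b).1 - sin (mu * psi a b) * (ZZ a b).2).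
Proof. by rewrite /A /PP EE_polar /cm /=; ring. Qed.

Lemma p_polar a b : p a b = sS a b `^ mu *
  (cos (mu * psi a b) * (WW a b).1 - sin (mu * psi a b) * (WW a b).2).
Proof. by rewrite /p /dP EE_polar /cm /=; ring. Qed.

Lemma q_polar a b : q a b = sS a b `^ mu *
  (cos (mu * psi a b) * (WW a b).2 + sin (mu * psi a b) * (WW a b).1).
Proof. by rewrite /q /dP EE_polar /cm /=; ring. Qed.

Lemma sSmu_gt0 a b : 0 < a -> 0 < sS a b `^ mu.
Proof. by move=> a0; rewrite powR_gt0// sS_gt0. Qed.

Lemma NN_pos a b : 0 < a -> 0 < NN a b.
Proof. by move=> a0; rewrite NN_gt0// gt_eqF. Qed.

Lemma mupsi_bound a b : 0 < a -> 0 < b -> 0 < mu * psi a b < pi / 8.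
Proof.
have m0 := mu_gt0; have m1 := mu_lt.
move=> a0 b0; have /andP[p0 p1] := psi_bound rho a0 b0.
rewrite mulr_gt0//=.
have : mu * psi a b < 1 / 8 * psi a b by rewrite ltr_pM2r.
lra.
Qed.

(** If kap |z|^2 <= rho^2, then [ZZ] has argument - x with x in (0, pi / 2), and B >= 0 forces x <=
    mu psi. Then y = psi + 2 x satisfies psi < y <= kap psi, while sin y >= kap sin psi, against the
    decrease of sin t / t. *)
Lemma B_pos_reg a b : 0 < a -> 0 < b -> 0 <= B a b -> rho ^+ 2 < kap * NN a b.
Proof.
have m0 := mu_gt0; have m1 := mu_lt; have r0 := rho_gt0.
move=> a0 b0 Bge; rewrite ltNge; apply/negP => h.
have N0 := NN_pos b a0.
have k1 : 1 < kap by rewrite /kap; lra.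
have Nr : NN a b < rho ^+ 2.
  apply: lt_le_trans h; rewrite -[ltLHS]mul1r ltr_pM2r//.
have /andP[s0 s1] := psi_bound rho a0 b0.
have /andP[ms0 ms1] := mupsi_bound a0 b0.
have p0 := pi_gt0 R.
set z1 := (ZZ a b).1; set z2 := - (ZZ a b).2.
have z10 : 0 < z1 by rewrite /z1 mulr_gt0// addr_gt0// divr_gt0// exprn_gt0.
have z20 : 0 < z2.
  rewrite /z2 /= -mulrN mulr_gt0// opprB subr_gt0 ltr_pdivlMr// mul1r//.
set x := arg z1 z2.
have /andP[xl xu] := arg_bound_lt z2 z10; rewrite -/x in xl xu.
have cx := cos_arg z2 (ltW z10); have sx := sin_arg z1 z2; rewrite -/x in cx sx.
clearbody x.
have n0 : 0 < nrm z1 z2 by rewrite nrm_gt0// gt_eqF.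
have x0 : 0 < x.
  rewrite ltNge; apply/negP => xle.
  have : 0 <= sin (- x) by rewrite sin_ge0_pi//; apply/andP; split; lra.
  have : 0 < nrm z1 z2 * sin x by rewrite sx.
  by rewrite pmulr_rgt0// sinN; lra.
have Be : B a b = sS a b `^ mu * (nrm z1 z2 * sin (mu * psi a b - x)).
  rewrite B_polar sinB; congr (_ * _).
  rewrite -/z1 -[(ZZ a b).2]opprK -/z2.
  transitivity (sin (mu * psi a b) * (nrm z1 z2 * cos x) - cos (mu * psi a b) * (nrm z1 z2 * sin x)).
    by rewrite cx sx; ring.
  by ring.
have xm : x <= mu * psi a b.
  rewrite leNgt; apply/negP => hx.
  have : 0 < sin (x - mu * psi a b) by rewrite sin_gt0_pi//; apply/andP; split; lra.
  rewrite -[X in sin X]opprB sinN => hs.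
  by move: Bge; rewrite Be pmulr_rge0 ?sSmu_gt0// pmulr_rge0//; lra.
have snp : 0 < sin (psi a b) by rewrite sin_gt0_pi// s0.
(* Here z^2 + rho^2 = S e^(i psi) and arg z = psi + x. The imaginary part of z^2 e^(- i psi) = S -
   rho^2 e^(- i psi) reads N sin y = rho^2 sin psi. *)
pose y := psi a b + 2 * x.
have sy : NN a b * sin y = rho ^+ 2 * sin (psi a b).
  have Nz : nrm z1 z2 ^+ 2 * NN a b = sS a b ^+ 2.
    rewrite sqr_nrm sqr_sS /z1 /z2 /ZZ /NN /=; field.
    by rewrite -/(NN a b) gt_eqF.
  have t0 : sS a b * nrm z1 z2 ^+ 2 != 0 by rewrite mulf_neq0// ?expf_neq0// gt_eqF// sS_gt0.
  apply: (mulfI t0).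
  rewrite /y sinD.
  have -> : sin (2 * x) = 2 * sin x * cos x by rewrite mulr_natl mulr2n sinD; ring.
  have -> : cos (2 * x) = cos x ^+ 2 - sin x ^+ 2 by rewrite mulr_natl mulr2n cosD; ring.
  transitivity (NN a b * ((sS a b * sin (psi a b)) * ((nrm z1 z2 * cos x) ^+ 2 - (nrm z1 z2 * sin x) ^+ 2)
     + (sS a b * cos (psi a b)) * (2 * (nrm z1 z2 * sin x) * (nrm z1 z2 * cos x)))); first by ring.
  transitivity (rho ^+ 2 * (sS a b * sin (psi a b)) * nrm z1 z2 ^+ 2); last by ring.
  rewrite cx sx sqr_nrm sin_psi ?cos_psi ?ltW// /z1 /z2 /ZZ /NN /=; field.
  by rewrite -/(NN a b) gt_eqF.
have syk : kap * sin (psi a b) <= sin y.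
  have : kap * NN a b * sin (psi a b) <= rho ^+ 2 * sin (psi a b) by rewrite ler_pM2r.
  rewrite -sy [kap * _]mulrC -mulrA ler_pM2l//.
have ysp : psi a b < y by rewrite /y; lra.
have yk : y <= kap * psi a b by rewrite /y /kap; lra.
have yp : y <= pi.
  rewrite leNgt; apply/negP => hy.
  have : 0 <= sin (y - pi) by rewrite sin_ge0_pi//; apply/andP; split; rewrite /y in hy *; lra.
  rewrite sinB sinpi cospi => hs.
  have : 0 < kap * sin (psi a b) by rewrite mulr_gt0//; lra.
  lra.
have := sin_chord s0 ysp yp.
have : y * sin (psi a b) <= kap * psi a b * sin (psi a b) by rewrite ler_pM2r.
have : psi a b * (kap * sin (psi a b)) <= psi a b * sin y by rewrite ler_pM2l.
lra.
Qed.

(** Adding rho^2 > 0 to z^2 lowers its argument, so psi / 2 is at most arg z. *)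
Lemma tan_half a b : 0 < a -> 0 < b ->
  a * sin (psi a b / 2) <= b * cos (psi a b / 2).
Proof.
move=> a0 b0; have /andP[s0 s1] := psi_bound rho a0 b0.
set t := psi a b / 2.
have ct : 0 < cos t by rewrite cos_gt0_pihalf//; apply/andP; split; rewrite /t; lra.
have S0 := sS_gt0 rho b a0.
rewrite -(ler_pM2r (mulr_gt0 (mulr_gt0 S0 ct) (ltr0n R 2))).
have e2 : psi a b = t + t by rewrite /t; lra.
have es : sin (psi a b) = 2 * sin t * cos t by rewrite e2 sinD; ring.
have ec : cos (psi a b) = 2 * cos t ^+ 2 - 1.
  by rewrite e2 cosD; have := cos2Dsin2 t => h; rewrite -!expr2; lra.
have -> : a * sin t * (sS a b * cos t * 2) = a * (sS a b * sin (psi a b)) by rewrite es; ring.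
have -> : b * cos t * (sS a b * cos t * 2) = b * (sS a b * cos (psi a b) + sS a b) by rewrite ec; ring.
rewrite sin_psi ?cos_psi ?(ltW a0)//.
have : NN a b - rho ^+ 2 <= sS a b.
  have [h|h] := leP (NN a b - rho ^+ 2) 0; first by apply: le_trans h (ltW _).
  rewrite -(ler_pXn2r (n := 2))// ?nnegrE ?(ltW h) ?(ltW S0)// sqr_sS lerDl.
  have -> : 4 * rho ^+ 2 * a ^+ 2 = (2 * rho * a) ^+ 2 by ring.
  exact: sqr_ge0.
move=> h; have : b * (NN a b - rho ^+ 2) <= b * sS a b by rewrite ler_pM2l.
rewrite /NN; lra.
Qed.

Lemma W_pos a b : 0 < a -> 0 < b -> rho ^+ 2 <= kap * NN a b -> 0 < (WW a b).1 /\ 0 < (WW a b).2.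
Proof.
have r0 := rho_gt0; move=> a0 b0 h; have N0 := NN_pos b a0.
split; last by rewrite /= divr_gt0 ?mulr_gt0 ?exprn_gt0.
have -> : (WW a b).1 = (kap * NN a b - rho ^+ 2) / NN a b + 2 * rho ^+ 2 * b ^+ 2 / NN a b ^+ 2.
  by rewrite /WW /= /NN; field; rewrite -/(NN a b) gt_eqF.
rewrite ltr_wpDl// ?divr_ge0 ?subr_ge0 ?(ltW N0)//.
by rewrite divr_gt0 ?mulr_gt0 ?exprn_gt0.
Qed.

(** [WW] is a nonnegative real number plus a positive multiple of b + i a. Rotating b + i a by mu
    psi keeps its real part positive because mu psi < psi / 2 <= arg z. *)
Lemma p_gt0 a b : 0 < a -> 0 < b -> rho ^+ 2 <= kap * NN a b -> 0 < p a b.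
Proof.
have m0 := mu_gt0; have m1 := mu_lt; have r0 := rho_gt0.
move=> a0 b0 h; have N0 := NN_pos b a0.
have /andP[s0 s1] := psi_bound rho a0 b0.
have /andP[ms0 ms1] := mupsi_bound a0 b0.
have p0 := pi_gt0 R.
rewrite p_polar pmulr_rgt0 ?sSmu_gt0//.
have -> : (WW a b).1 = (kap * NN a b - rho ^+ 2) / NN a b + 2 * rho ^+ 2 * b / NN a b ^+ 2 * b.
  by rewrite /WW /= /NN; field; rewrite -/(NN a b) gt_eqF.
have -> : (WW a b).2 = 2 * rho ^+ 2 * b / NN a b ^+ 2 * a.
  by rewrite /WW /= /NN; field; rewrite -/(NN a b) gt_eqF.
have c0 : 0 < cos (mu * psi a b) by rewrite cos_gt0_pihalf//; apply/andP; split; lra.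
have t1 : 0 <= (kap * NN a b - rho ^+ 2) / NN a b by rewrite divr_ge0 ?subr_ge0// ltW.
have t2 : 0 < 2 * rho ^+ 2 * b / NN a b ^+ 2 by rewrite divr_gt0 ?mulr_gt0 ?exprn_gt0.
have m2 : mu * psi a b < psi a b / 2.
  by rewrite mulrC ltr_pM2l//; lra.
have sl : sin (mu * psi a b) < sin (psi a b / 2).
  by rewrite ltr_sin// in_itv/=; apply/andP; split; lra.
have cl : cos (psi a b / 2) < cos (mu * psi a b).
  by rewrite ltr_cos// in_itv/=; apply/andP; split; lra.
have := tan_half a0 b0 => th.
have main : a * sin (mu * psi a b) < b * cos (mu * psi a b).
  apply: lt_trans (_ : a * sin (psi a b / 2) < _); first by rewrite ltr_pM2l.
  by apply: le_lt_trans th _; rewrite ltr_pM2l.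
set X := (kap * _ - _) / _ in t1 *; set Y := 2 * _ * _ / _ in t2 *.
have := mulr_ge0 (ltW c0) t1.
have : Y * (a * sin (mu * psi a b)) < Y * (b * cos (mu * psi a b)) by rewrite ltr_pM2l.
lra.
Qed.

Lemma q_gt0 a b : 0 < a -> 0 < b -> rho ^+ 2 <= kap * NN a b -> 0 < q a b.
Proof.
move=> a0 b0 h; have p0 := pi_gt0 R.
have /andP[ms0 ms1] := mupsi_bound a0 b0.
have [w1 w2] := W_pos a0 b0 h.
rewrite q_polar pmulr_rgt0 ?sSmu_gt0//.
rewrite addr_gt0// mulr_gt0//.
  by rewrite cos_gt0_pihalf//; apply/andP; split; lra.
by rewrite sin_gt0_pi//; apply/andP; split; lra.
Qed.

Lemma argN a b : arg a (- b) = - arg a b.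
Proof.
rewrite /arg; have -> : nrm a (- b) = nrm a b by rewrite /nrm sqrrN.
have bd := div_nrm_bound a b; set x := b / nrm a b in bd *; rewrite mulNr -/x.
have bd' : -1 <= - x <= 1 by move: bd => /andP[? ?]; apply/andP; split; lra.
have h1 : asin (- x) \in `[(- (pi / 2)), pi / 2] by rewrite in_itv/= asin_geNpi2 ?asin_lepi2.
have h2 : - asin x \in `[(- (pi / 2)), pi / 2].
  rewrite in_itv/=; have := asin_geNpi2 bd; have := asin_lepi2 bd.
  by move=> ? ?; apply/andP; split; lra.
by apply: (sin_inj h1 h2); rewrite sinN !asinK// in_itv.
Qed.

Lemma B_b0 a : B a 0 = 0.
Proof.
rewrite B_polar /psi add0r sub0r argN subrr mulr0 sin0 mul0r addr0 /ZZ /= mul0r.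
by rewrite !mulr0.
Qed.

Lemma arg0 b : 0 < b -> arg 0 b = pi / 2.
Proof.
move=> b0; rewrite /arg /nrm expr0n/= add0r sqrtr_sqr gtr0_norm// divff ?gt_eqF//.
have p0 := pi_gt0 R.
have h : (pi / 2 : R) \in `[(- (pi / 2)), pi / 2] by rewrite in_itv/=; apply/andP; split; lra.
by have := sinK h; rewrite sin_pihalf.
Qed.

Lemma psi0_gt b : rho < b -> psi 0 b = pi.
Proof. by move=> h; rewrite /psi !arg0; have := rho_gt0; lra. Qed.

Lemma psi0_lt b : 0 < b -> b < rho -> psi 0 b = 0.
Proof.
by move=> b0 h; rewrite /psi -[b - rho]opprB argN !arg0; have := rho_gt0; lra.
Qed.

Lemma NN0 b : NN 0 b = b ^+ 2. Proof. by rewrite /NN expr0n/= add0r. Qed.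

Lemma sS0 b : 0 < b -> b != rho -> 0 < sS 0 b.
Proof.
move=> b0 h; have r0 := rho_gt0.
have b1 : b + rho != 0 by rewrite gt_eqF// addr_gt0.
by rewrite /sS mulr_gt0// nrm_gt0// ?b1 ?subr_eq0 ?h orbT.
Qed.

Lemma sSr : sS 0 rho = 0.
Proof. by rewrite /sS subrr /nrm expr0n/= addr0 sqrtr0 mulr0. Qed.

Lemma B0_lt b : 0 < b -> b < rho -> B 0 b < 0.
Proof.
move=> b0 h; have r0 := rho_gt0.
rewrite B_polar psi0_lt// mulr0 cos0 sin0 mul1r mul0r addr0 /ZZ/= NN0.
rewrite pmulr_rlt0; last by rewrite powR_gt0// sS0// lt_eqF.
have h2 : b ^+ 2 < rho ^+ 2 by rewrite ltr_pXn2r// nnegrE ltW.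
by rewrite pmulr_rlt0// subr_lt0 ltr_pdivlMr ?exprn_gt0// mul1r.
Qed.

Lemma cs_mupi : 0 < cos (mu * pi) /\ 0 < sin (mu * pi).
Proof.
have m0 := mu_gt0; have m1 := mu_lt; have p0 := pi_gt0 R.
have : mu * pi < 1 / 8 * pi by rewrite ltr_pM2r.
have : 0 < mu * pi by rewrite mulr_gt0.
move=> h1 h2.
rewrite cos_gt0_pihalf ?sin_gt0_pi//; apply/andP; split; lra.
Qed.

Lemma B0_gt b : rho < b -> 0 < B 0 b.
Proof.
move=> h; have r0 := rho_gt0; have b0 : 0 < b by apply: lt_trans h.
have [c0 s0] := cs_mupi.
rewrite B_polar psi0_gt// /ZZ/= mul0r mulr0 addr0 NN0.
rewrite mulr_gt0 ?powR_gt0 ?sS0 ?gt_eqF// mulr_gt0// mulr_gt0//.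
have h2 : rho ^+ 2 < b ^+ 2 by rewrite ltr_pXn2r// nnegrE ltW.
by rewrite subr_gt0 ltr_pdivrMr ?exprn_gt0// mul1r.
Qed.

Lemma A0_gt b : rho < b -> A 0 b = - (sS 0 b `^ mu * sin (mu * pi) * (b - rho ^+ 2 / b)).
Proof.
move=> h; have r0 := rho_gt0; have b0 : 0 < b by apply: lt_trans h.
by rewrite A_polar psi0_gt// /ZZ/= NN0; field; rewrite gt_eqF.
Qed.

Lemma PPr : A 0 rho = 0 /\ B 0 rho = 0 /\ p 0 rho = 0 /\ q 0 rho = 0.
Proof.
have m0 := mu_gt0.
by rewrite A_polar B_polar p_polar q_polar sSr powR0 ?gt_eqF// !mul0r.
Qed.

Lemma p0_gt b : rho < b -> 0 < p 0 b /\ 0 < q 0 b /\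
  q 0 b = sS 0 b `^ mu * sin (mu * pi) * (kap + rho ^+ 2 / b ^+ 2).
Proof.
move=> h; have r0 := rho_gt0; have b0 : 0 < b by apply: lt_trans h.
have m0 := mu_gt0.
have [c0 s0] := cs_mupi.
have qe : q 0 b = sS 0 b `^ mu * sin (mu * pi) * (kap + rho ^+ 2 / b ^+ 2).
  by rewrite q_polar psi0_gt// /WW/= NN0; field; rewrite gt_eqF.
have w0 : 0 < kap + rho ^+ 2 / b ^+ 2.
  by rewrite addr_gt0 ?divr_gt0 ?exprn_gt0// /kap; lra.
have S0 : 0 < sS 0 b `^ mu by rewrite powR_gt0// sS0// gt_eqF.
split; last by split => //; rewrite qe !mulr_gt0.
have -> : p 0 b = sS 0 b `^ mu * cos (mu * pi) * (kap + rho ^+ 2 / b ^+ 2).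
  by rewrite p_polar psi0_gt// /WW/= NN0; field; rewrite gt_eqF.
by rewrite !mulr_gt0.
Qed.

End Signs.

(** * The curve on which B vanishes *)

Section Gamma.
Context {R : realType} (mu rho : R).
Hypothesis (mu_gt0 : 0 < mu) (mu_lt : mu < 1 / 8) (rho_gt0 : 0 < rho).
Implicit Types (a b : R).
Notation A := (A mu rho).
Notation B := (B mu rho).
Notation p := (p mu rho).
Notation q := (q mu rho).
Notation psi := (psi rho).
Notation sS := (sS rho).
Notation ZZ := (ZZ rho).
Notation WW := (WW mu rho).
Notation kap := (kap mu).

Definition hgood (F : R -> R -> R) := forall c M, 0 < c -> 0 <= M ->
  hold mu (SM c M) (fun v => F v.2 v.1).

Lemma hgoodP : [/\ hgood A, hgood B, hgood p & hgood q].
Proof.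
by split=> c M c0 M0; have [] := hold_model rho mu_gt0 mu_lt c0 M0.
Qed.

Lemma cont_in_a (F : R -> R -> R) a1 a2 b : hgood F -> 0 <= a1 -> b != 0 ->
  {within `[a1, a2], continuous (fun t => F t b)}.
Proof.
move=> hF a10 b0.
have c0 : 0 < `|b| by rewrite normr_gt0.
have M0 : 0 <= `|b| + `|a2| by rewrite addr_ge0.
apply: (@hold_cont _ mu _ (fun v => F v.2 v.1) `[a1, a2] (fun t => (b, t)) 1 mu_gt0 ler01 (hF _ _ c0 M0)).
  move=> t /=; rewrite in_itv/= => /andP[t1 t2]; split => /=.
  - exact: le_trans t1.
  - by have [] := ler_norm_nrm t b.
  - by rewrite lerDl.
  - rewrite ger0_norm ?(le_trans a10)//; apply: le_trans t2 _.
    by apply: le_trans (ler_norm _) _; rewrite lerDr.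
move=> t u _ _; rewrite mul1r prod_normE /= subrr normr0 ge_max normr_ge0/=.
exact: lexx.
Qed.

Lemma cont_in_b (F : R -> R -> R) a b1 b2 c : hgood F -> 0 <= a -> 0 < c ->
  (forall t, b1 <= t <= b2 -> c <= nrm a t) ->
  {within `[b1, b2], continuous (F a)}.
Proof.
move=> hF a0 c0 hc.
have M0 : 0 <= `|a| + (`|b1| + `|b2|) by rewrite !addr_ge0.
apply: (@hold_cont _ mu _ (fun v => F v.2 v.1) `[b1, b2] (fun t => (t, a)) 1 mu_gt0 ler01 (hF _ _ c0 M0)).
  move=> t /=; rewrite in_itv/= => tt; split => //=.
  - exact: hc.
  - rewrite ler_norml; case/andP: tt => t1 t2.
    have := ler_norm b2; have := lerNnormlW (lexx `|b1|); have := normr_ge0 a.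
    have := normr_ge0 b1; have := normr_ge0 b2.
    by move=> h1 h2 h3 h4 h5; apply/andP; split; lra.
  - by rewrite lerDl addr_ge0.
move=> t u _ _; rewrite mul1r prod_normE /= subrr normr0 ge_max normr_ge0 andbT.
exact: lexx.
Qed.

Lemma cont_in_b_pos (F : R -> R -> R) a b1 b2 : hgood F -> 0 < a ->
  {within `[b1, b2], continuous (F a)}.
Proof.
move=> hF a0; apply: (@cont_in_b F a b1 b2 a) => //; first exact: ltW.
by move=> t _; have [h _] := ler_norm_nrm a t; apply: le_trans h; exact: ler_norm.
Qed.

Lemma cont2 (F : R -> R -> R) a b : hgood F -> 0 < a -> forall e, 0 < e ->
  exists2 d, 0 < d & forall a' b', `|a' - a| < d -> `|b' - b| < d -> `|F a' b' - F a b| < e.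
Proof.
move=> hF a0 e e0.
have c0 : 0 < a / 2 by lra.
have M0 : 0 <= 2 * a + (`|b| + 1) by rewrite !addr_ge0// mulr_ge0// ltW.
have [C C0 hC] := hF _ _ c0 M0.
have [d d0 hd] := pow_small mu_gt0 C0 e0.
exists (Num.min d (Num.min (a / 2) 1)); first by rewrite !lt_min d0 ltr01 c0.
move=> a' b'; rewrite !lt_min => /and3P[h1 h2 h3] /and3P[g1 g2 g3].
have Sab : SM (a / 2) (2 * a + (`|b| + 1)) (b, a).
  split => /=.
  - exact: ltW.
  - have [h _] := ler_norm_nrm a b; apply: le_trans h; rewrite gtr0_norm//; lra.
  - have := normr_ge0 b; lra.
  - by rewrite gtr0_norm//; have := normr_ge0 b; lra.
have aa : a / 2 < a' by move: h2; rewrite ltr_norml => /andP[? ?]; lra.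
have au : a' < 2 * a by move: h2; rewrite ltr_norml => /andP[? ?]; lra.
have Sab' : SM (a / 2) (2 * a + (`|b| + 1)) (b', a').
  split => /=.
  - lra.
  - have [h _] := ler_norm_nrm a' b'; apply: le_trans h; rewrite gtr0_norm//; lra.
  - by have := ler_normD (b' - b) b; rewrite subrK; lra.
  - by rewrite gtr0_norm//; have := normr_ge0 b; lra.
have [_ h] := hC _ _ Sab' Sab; apply: le_lt_trans h _; apply: hd => //.
by rewrite prod_normE/= gt_max h1 g1.
Qed.

Lemma derA_a a b : 0 < a -> is_derive a 1 (fun t => A t b) (p a b).
Proof. by move=> a0; have [] := holo_PP mu rho b a0. Qed.
Lemma derB_a a b : 0 < a -> is_derive a 1 (fun t => B t b) (q a b).
Proof. by move=> a0; have [] := holo_PP mu rho b a0. Qed.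
Lemma derA_b a b : 0 < a -> is_derive b 1 (fun t => A a t) (- q a b).
Proof. by move=> a0; have [] := holo_PP mu rho b a0. Qed.
Lemma derB_b a b : 0 < a -> is_derive b 1 (fun t => B a t) (p a b).
Proof. by move=> a0; have [] := holo_PP mu rho b a0. Qed.

Lemma kap_gt1 : 1 < kap. Proof. by have := mu_gt0; rewrite /kap => ?; lra. Qed.

(** The region in which p and q are known to be positive is closed under increasing a and b, so the
    mean value points on such segments stay in it. *)
Lemma reg_mono a b a' b' : 0 <= a -> 0 <= b -> a <= a' -> b <= b' ->
  rho ^+ 2 <= kap * NN a b -> rho ^+ 2 <= kap * NN a' b'.
Proof.
move=> a0 b0 aa bb h; apply: le_trans h _; have k1 := kap_gt1.
rewrite ler_pM2l; last by lra.
by rewrite lerD// ler_pXn2r// ?nnegrE// (le_trans _ aa, le_trans _ bb).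
Qed.

Lemma B_incr_b a b1 b2 : 0 < a -> 0 < b1 -> b1 < b2 ->
  rho ^+ 2 <= kap * NN a b1 -> B a b1 < B a b2.
Proof.
move=> a0 b0 bb h; have [_ hB _ _] := hgoodP.
have [t /andP[t1 t2] e] := MVT_ex bb (fun t _ => derB_b t a0) (@cont_in_b_pos _ a b1 b2 hB a0).
rewrite -subr_gt0 e; apply: mulr_gt0; last by rewrite subr_gt0.
apply: p_gt0 => //; first exact: lt_trans t1.
by apply: reg_mono h => //; exact: ltW.
Qed.

Lemma AB_incr_a a1 a2 b : 0 <= a1 -> a1 < a2 -> 0 < b ->
  rho ^+ 2 <= kap * NN a1 b -> A a1 b < A a2 b /\ B a1 b < B a2 b.
Proof.
move=> a0 aa b0 h; have [hA hB _ _] := hgoodP.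
have bn : b != 0 by rewrite gt_eqF.
have dA t : a1 < t < a2 -> is_derive t 1 (fun t => A t b) (p t b).
  by move=> /andP[t1 _]; apply: derA_a; exact: le_lt_trans t1.
have dB t : a1 < t < a2 -> is_derive t 1 (fun t => B t b) (q t b).
  by move=> /andP[t1 _]; apply: derB_a; exact: le_lt_trans t1.
have [t /andP[t1 t2] e] := MVT_ex aa dA (cont_in_a hA a0 bn).
have [u /andP[u1 u2] e'] := MVT_ex aa dB (cont_in_a hB a0 bn).
split; rewrite -subr_gt0 ?e ?e'; (apply: mulr_gt0; last by rewrite subr_gt0).
  by apply: p_gt0 => //; [exact: le_lt_trans t1|apply: reg_mono h => //; exact: ltW].
by apply: q_gt0 => //; [exact: le_lt_trans u1|apply: reg_mono h => //; exact: ltW].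
Qed.

Lemma B_incr_a a1 a2 b : 0 < a1 -> a1 <= a2 -> 0 < b -> 0 <= B a1 b -> B a1 b <= B a2 b.
Proof.
move=> a0; rewrite le_eqVlt => /orP[/eqP->//|aa] b0 h; apply/ltW.
by have [] := AB_incr_a (ltW a0) aa b0 (ltW (B_pos_reg mu_gt0 mu_lt rho_gt0 a0 b0 h)).
Qed.

Lemma B_large a b : 0 < a -> 0 < b -> rho <= a -> 0 < B a b.
Proof.
have r0 := rho_gt0; move=> a0 b0 ra; have N0 := NN_pos b a0; have p0 := pi_gt0 R.
have /andP[s0 s1] := mupsi_bound rho mu_gt0 mu_lt a0 b0.
rewrite B_polar mulr_gt0 ?sSmu_gt0//.
have c0 : 0 < cos (mu * psi a b) by rewrite cos_gt0_pihalf//; apply/andP; split; lra.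
have sn0 : 0 < sin (mu * psi a b) by rewrite sin_gt0_pi//; apply/andP; split; lra.
rewrite /ZZ/= ltr_wpDl// ?mulr_gt0//; last by rewrite addr_gt0// divr_gt0// exprn_gt0.
rewrite mulr_ge0 ?(ltW c0)// mulr_ge0 ?(ltW b0)// subr_ge0 ler_pdivrMr// mul1r /NN.
have : rho ^+ 2 <= a ^+ 2 by rewrite ler_pXn2r// nnegrE// ltW.
have := sqr_ge0 b; lra.
Qed.

Lemma alpha_ex b : 0 < b -> b < rho -> exists2 a, 0 < a & B a b = 0.
Proof.
have r0 := rho_gt0; move=> b0 br; have [_ hB _ _] := hgoodP.
have bn : b != 0 by rewrite gt_eqF.
have l := B0_lt mu rho_gt0 b0 br.
have u := B_large r0 b0 (lexx _).
have [|a] := @IVT _ (fun t => B t b) 0 rho 0 (ltW r0) (cont_in_a hB (lexx _) bn).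
  by rewrite ge_min le_max (ltW l) (ltW u) orbT.
rewrite in_itv/= => /andP[a0 ar] e; exists a => //.
rewrite lt_def a0 andbT; apply/negP => /eqP a00.
by rewrite a00 in e; move: l; rewrite e ltxx.
Qed.

(* The curve B = 0 for 0 < b < rho, with its limit at b = 0, and a = 0 beyond rho. *)
Definition alpha b : R :=
  if b == 0 then Num.sqrt (rho ^+ 2 / kap)
  else if b < rho then xget 0 [set a | 0 < a /\ B a b = 0] else 0.

Lemma alphaP b : 0 < b -> b < rho -> 0 < alpha b /\ B (alpha b) b = 0.
Proof.
move=> b0 br; rewrite /alpha gt_eqF// br.
have [a a0 e] := alpha_ex b0 br.
by case: xgetP => [y _ [y0 ye]//|/(_ a) []].
Qed.

Lemma alpha_reg b : 0 < b -> b < rho -> rho ^+ 2 < kap * NN (alpha b) b.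
Proof.
by move=> b0 br; have [a0 e] := alphaP b0 br; apply: B_pos_reg => //; rewrite e.
Qed.

Lemma alpha_ge b : rho <= b -> alpha b = 0.
Proof.
by move=> h; rewrite /alpha ltNge h gt_eqF// (lt_le_trans rho_gt0 h).
Qed.

Lemma alpha_ge0 b : 0 < b -> 0 <= alpha b.
Proof.
move=> b0; have [h|h] := leP rho b; first by rewrite alpha_ge.
by have [/ltW] := alphaP b0 h.
Qed.

Lemma reg_alpha b : 0 < b -> rho ^+ 2 <= kap * NN (alpha b) b.
Proof.
move=> b0; have [h|h] := leP rho b; last exact: ltW (alpha_reg b0 h).
rewrite alpha_ge// NN0; have k1 := kap_gt1; have r0 := rho_gt0.
have : rho ^+ 2 <= b ^+ 2 by rewrite ler_pXn2r// nnegrE ltW.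
have : 1 * b ^+ 2 <= kap * b ^+ 2 by rewrite ler_wpM2r ?sqr_ge0// ltW.
lra.
Qed.

Lemma B_alpha_ge0 b : 0 < b -> 0 <= B (alpha b) b.
Proof.
move=> b0; have [h|h] := leP rho b; last by have [_ ->] := alphaP b0 h.
rewrite alpha_ge//; move: h; rewrite le_eqVlt => /orP[/eqP<-|h].
  by have [_ [-> _]] := PPr rho mu_gt0.
by apply/ltW/B0_gt.
Qed.

(** Once B is nonnegative it increases with a, so on each line of constant b its sign changes only
    once. *)
Lemma B_alpha a b : 0 < a -> 0 < b -> (0 < B a b) = (alpha b < a).
Proof.
move=> a0 b0; have al0 := alpha_ge0 b0; apply/idP/idP => h.
  rewrite ltNge; apply/negP => ha.
  have ba : b < rho.
    by rewrite ltNge; apply/negP => /alpha_ge e; move: ha; rewrite e leNgt a0.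
  have := B_incr_a a0 ha b0 (ltW h).
  by have [_ ->] := alphaP b0 ba; rewrite leNgt h.
have [_] := AB_incr_a al0 h b0 (reg_alpha b0).
by apply: le_lt_trans; exact: B_alpha_ge0.
Qed.

Lemma gamma_eq b : 0 < b -> b < rho -> let a := alpha b in
  cos (mu * psi a b) * (b * (rho ^+ 2 - NN a b)) = sin (mu * psi a b) * (a * (rho ^+ 2 + NN a b)).
Proof.
move=> b0 br a; have [a0 e] := alphaP b0 br; rewrite -/a in a0 e.
have N0 := NN_pos b a0.
move: e; rewrite B_polar => /eqP; rewrite mulf_eq0 gt_eqF ?sSmu_gt0//= => /eqP e.
have : NN a b * (cos (mu * psi a b) * (ZZ a b).2 + sin (mu * psi a b) * (ZZ a b).1) = 0.
  by rewrite e mulr0.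
have -> : (ZZ a b).2 = b * (NN a b - rho ^+ 2) / NN a b by rewrite /=; field; rewrite gt_eqF.
have -> : (ZZ a b).1 = a * (NN a b + rho ^+ 2) / NN a b by rewrite /=; field; rewrite gt_eqF.
have -> : NN a b * (cos (mu * psi a b) * (b * (NN a b - rho ^+ 2) / NN a b) +
   sin (mu * psi a b) * (a * (NN a b + rho ^+ 2) / NN a b)) =
   sin (mu * psi a b) * (a * (rho ^+ 2 + NN a b)) - cos (mu * psi a b) * (b * (rho ^+ 2 - NN a b)).
  by field; rewrite gt_eqF.
by move/eqP; rewrite subr_eq0 => /eqP->.
Qed.

(** By [gamma_eq], tan(mu psi) = b (rho^2 - N) / (a (rho^2 + N)) on the curve; this and mu sin psi
    <= sin(mu psi) give the second to fourth bounds. The third one, combined with [alpha_reg], pins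
    the curve to the circle N = rho^2 / kap as b tends to 0. *)
Lemma gamma_facts b : 0 < b -> b < rho -> let a := alpha b in
  [/\ 0 < a, NN a b < rho ^+ 2, kap * NN a b - rho ^+ 2 <= 2 * mu * b ^+ 2,
      mu * sin (psi a b) * (a * (rho ^+ 2 + NN a b)) <= b * (rho ^+ 2 - NN a b) &
      sS a b <= rho ^+ 2 + NN a b].
Proof.
have m0 := mu_gt0; have m1 := mu_lt; have r0 := rho_gt0; have p0 := pi_gt0 R.
move=> b0 br a; have [a0 _] := alphaP b0 br; have := gamma_eq b0 br; rewrite -/a => e.
rewrite -/a in a0.
have N0 := NN_pos b a0.
have /andP[ms0 ms1] := mupsi_bound rho mu_gt0 mu_lt a0 b0.
have /andP[s0 s1] := psi_bound rho a0 b0.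
have c0 : 0 < cos (mu * psi a b) by rewrite cos_gt0_pihalf//; apply/andP; split; lra.
have sn0 : 0 < sin (mu * psi a b) by rewrite sin_gt0_pi//; apply/andP; split; lra.
have T0 : 0 < a * (rho ^+ 2 + NN a b) by rewrite mulr_gt0// addr_gt0// exprn_gt0.
have Nr : NN a b < rho ^+ 2.
  have : 0 < cos (mu * psi a b) * (b * (rho ^+ 2 - NN a b)) by rewrite e mulr_gt0.
  by rewrite !pmulr_rgt0// subr_gt0.
have sm : mu * sin (psi a b) <= sin (mu * psi a b).
  have mp : mu * psi a b < psi a b by rewrite gtr_pMl//; lra.
  have := sin_chord ms0 mp (ltW s1).
  by rewrite -mulrA [mu * (psi a b * _)]mulrCA ltr_pM2l// => /ltW.
have D0 : 0 <= b * (rho ^+ 2 - NN a b) by rewrite mulr_ge0 ?(ltW b0)// subr_ge0 ltW.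
have k : mu * sin (psi a b) * (a * (rho ^+ 2 + NN a b)) <= b * (rho ^+ 2 - NN a b).
  apply: le_trans (_ : sin (mu * psi a b) * (a * (rho ^+ 2 + NN a b)) <= _).
    by rewrite ler_pM2r.
  by rewrite -e ler_piMl// cos_le1.
have Sle : sS a b <= rho ^+ 2 + NN a b.
  have T1 : 0 <= rho ^+ 2 + NN a b by rewrite addr_ge0 ?sqr_ge0// ltW.
  rewrite -(ler_pXn2r (n := 2))// ?nnegrE ?(ltW (sS_gt0 rho b a0))// sqr_sS.
  have : 0 <= 4 * rho ^+ 2 * b ^+ 2.
    have -> : 4 * rho ^+ 2 * b ^+ 2 = (2 * rho * b) ^+ 2 by ring.
    exact: sqr_ge0.
  rewrite /NN; lra.
split => //.
have h : 2 * mu * a ^+ 2 * b <= b * (rho ^+ 2 - NN a b).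
  apply: le_trans k.
  have -> : 2 * mu * a ^+ 2 * b = mu * a * (sS a b * sin (psi a b)).
    by rewrite sin_psi ?(ltW a0)//; ring.
  have -> : mu * sin (psi a b) * (a * (rho ^+ 2 + NN a b)) =
            mu * a * ((rho ^+ 2 + NN a b) * sin (psi a b)) by ring.
  rewrite ler_pM2l ?mulr_gt0// ler_wpM2r// sin_ge0_pi// (ltW s0) ltW//.
have h2 : 2 * mu * a ^+ 2 <= rho ^+ 2 - NN a b.
  by rewrite -(ler_pM2l b0); move: h; rewrite [_ * b]mulrC.
by move: h2; rewrite /kap /NN; lra.
Qed.

(** Both p and q vanish as b tends to 0. The real part of [WW] is of order b^2 there while its
    imaginary part is of order b, which keeps p / q bounded. *)
Lemma gamma_W b : 0 < b -> b < rho ->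
  (WW (alpha b) b).1 <= 3 * rho ^+ 2 * b ^+ 2 / NN (alpha b) b ^+ 2.
Proof.
have m0 := mu_gt0; have m1 := mu_lt; have r0 := rho_gt0.
move=> b0 br; set a := alpha b; have := gamma_facts b0 br; rewrite -/a => -[a0 Nr h _ _].
have N0 := NN_pos b a0.
have -> : (WW a b).1 = ((kap * NN a b - rho ^+ 2) * NN a b + 2 * rho ^+ 2 * b ^+ 2) / NN a b ^+ 2.
  by rewrite /WW /= /NN; field; rewrite -/(NN a b) gt_eqF.
rewrite ler_pM2r ?invr_gt0 ?exprn_gt0//.
have : (kap * NN a b - rho ^+ 2) * NN a b <= (2 * mu * b ^+ 2) * NN a b by rewrite ler_pM2r.
have : (2 * mu * b ^+ 2) * NN a b <= (2 * mu * b ^+ 2) * rho ^+ 2.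
  by rewrite ler_wpM2l ?(ltW Nr)// !mulr_ge0 ?sqr_ge0// ltW.
have : 2 * mu * (b ^+ 2 * rho ^+ 2) <= 1 * (b ^+ 2 * rho ^+ 2).
  by rewrite ler_wpM2r ?mulr_ge0 ?sqr_ge0//; lra.
lra.
Qed.

(** On the curve e^(i mu psi) is a positive multiple of T + i D, so p and q are multiples of T W1 -
    D W2 and T W2 + D W1. If b <= a, [gamma_W] gives W1 <= 2 W2; if b > a, the factor 1 / mu is lost
    through mu T <= 3 D. Up to sign p / q is the slope of [alpha], so the curve is Lipschitz up to
    both of its endpoints. *)
Lemma cone b : 0 < b -> b < rho -> let a := alpha b in
  [/\ 0 < p a b, 0 < q a b & p a b <= 3 / mu * q a b].
Proof.
have m0 := mu_gt0; have m1 := mu_lt; have r0 := rho_gt0; have p0 := pi_gt0 R.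
move=> b0 br a; have := gamma_facts b0 br; rewrite -/a => -[a0 Nr h k Sle].
have := gamma_W b0 br; rewrite -/a => w1.
have /= e := gamma_eq b0 br; rewrite -/a in e.
have := alpha_reg b0 br; rewrite -/a => reg.
have N0 := NN_pos b a0.
have pg := p_gt0 mu_gt0 mu_lt rho_gt0 a0 b0 (ltW reg).
have qg := q_gt0 mu_gt0 mu_lt rho_gt0 a0 b0 (ltW reg).
split => //.
have [W1 W2] := W_pos rho_gt0 a0 b0 (ltW reg).
have /andP[ms0 ms1] := mupsi_bound rho mu_gt0 mu_lt a0 b0.
have /andP[s0 s1] := psi_bound rho a0 b0.
have c0 : 0 < cos (mu * psi a b) by rewrite cos_gt0_pihalf//; apply/andP; split; lra.
have sn0 : 0 < sin (mu * psi a b) by rewrite sin_gt0_pi//; apply/andP; split; lra.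
have T0 : 0 < a * (rho ^+ 2 + NN a b) by rewrite mulr_gt0// addr_gt0// exprn_gt0.
have D0 : 0 < b * (rho ^+ 2 - NN a b) by rewrite mulr_gt0// subr_gt0.
set T := a * (rho ^+ 2 + NN a b) in e k T0; set D := b * (rho ^+ 2 - NN a b) in e k D0.
have m3 : 0 < 3 / mu by rewrite divr_gt0.
suff : T * (WW a b).1 <= 3 / mu * (T * (WW a b).2 + D * (WW a b).1).
  move=> H; rewrite p_polar q_polar; set X := _ - _; set Y := _ + _.
  suff XY : X <= 3 / mu * Y by rewrite mulrCA ler_pM2l// sSmu_gt0.
  rewrite -(ler_pM2l T0) /X /Y.
  have -> : T * (cos (mu * psi a b) * (WW a b).1 - sin (mu * psi a b) * (WW a b).2) =
    cos (mu * psi a b) * (T * (WW a b).1 - D * (WW a b).2).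
    transitivity (T * cos (mu * psi a b) * (WW a b).1 - (sin (mu * psi a b) * T) * (WW a b).2); first by ring.
    by rewrite -e; ring.
  have -> : T * (3 / mu * (cos (mu * psi a b) * (WW a b).2 + sin (mu * psi a b) * (WW a b).1)) =
    cos (mu * psi a b) * (3 / mu * (T * (WW a b).2 + D * (WW a b).1)).
    transitivity (3 / mu * (T * cos (mu * psi a b) * (WW a b).2 + (sin (mu * psi a b) * T) * (WW a b).1)); first by ring.
    by rewrite -e; ring.
  rewrite ler_pM2l//; apply: le_trans H.
  by rewrite gerBl mulr_ge0// ltW.
have m3' : 2 <= 3 / mu by rewrite ler_pdivlMr//; lra.
have [ba|ab] := leP b a.
  have : (WW a b).1 <= 2 * (WW a b).2.
    apply: le_trans w1 _; rewrite /WW /= mulrA ler_pM2r ?invr_gt0 ?exprn_gt0//.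
    have : rho ^+ 2 * b * b <= rho ^+ 2 * b * a by rewrite ler_pM2l// mulr_gt0// exprn_gt0.
    have : 0 <= rho ^+ 2 * b * a by rewrite !mulr_ge0 ?sqr_ge0// ltW.
    lra.
  move=> w; apply: (@le_trans _ _ (T * (2 * (WW a b).2))); first by rewrite ler_pM2l.
  have TW := mulr_gt0 T0 W2; have DW := mulr_gt0 m3 (mulr_gt0 D0 W1).
  have : 2 * (T * (WW a b).2) <= 3 / mu * (T * (WW a b).2) by rewrite ler_pM2r.
  by rewrite mulrDr [T * (2 * _)]mulrCA; move: DW; lra.
suff DT : mu * T <= 3 * D.
  apply: (@le_trans _ _ (3 / mu * (D * (WW a b).1))); last first.
    by rewrite ler_pM2l// lerDr mulr_ge0// ltW.
  rewrite mulrA ler_pM2r// -(ler_pM2l m0); apply: le_trans DT _.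
  by rewrite le_eqVlt; apply/orP; left; apply/eqP; field; rewrite gt_eqF.
clear pg qg W1 W2 w1 ms0 ms1 c0 sn0 e m3 m3'.
have br2 : rho <= 2 * b.
  rewrite -(ler_pXn2r (n := 2))// ?nnegrE ?mulr_ge0// ?ltW//.
  have aa : a ^+ 2 <= b ^+ 2 by rewrite ler_pXn2r// ?nnegrE ltW.
  have k2 : kap <= 2 by rewrite /kap; lra.
  have : kap * NN a b <= 2 * NN a b by rewrite ler_pM2r.
  rewrite exprMn; move: reg aa; rewrite /NN; lra.
(* If N is far from rho^2, D is large outright. Otherwise |z^2 + rho^2| <= 3 rho a, and sin psi,
   which is 2 a b divided by that modulus, is at least 1 / 3. *)
have [big|small] := leP (2 * a * rho) (rho ^+ 2 - NN a b).
  have : b * (2 * a * rho) <= D by rewrite ler_pM2l.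
  have : rho * (a * rho) <= 2 * b * (a * rho) by rewrite ler_pM2r// mulr_gt0.
  have : T <= a * (rho ^+ 2 + rho ^+ 2) by rewrite ler_pM2l// lerD2l ltW.
  have : mu * T <= 1 * T by rewrite ler_pM2r//; lra.
  move: D0 T0; rewrite expr2; lra.
have S3 : sS a b <= 3 * (rho * a).
  have ra := mulr_gt0 r0 a0.
  have nn : 0 <= 3 * (rho * a) := mulr_ge0 (ler0n _ 3) (ltW ra).
  rewrite -(ler_pXn2r (n := 2))// ?nnegrE ?nn ?(ltW (sS_gt0 rho b a0))// sqr_sS.
  have : (NN a b - rho ^+ 2) ^+ 2 <= (2 * a * rho) ^+ 2.
    have n2 : 0 <= 2 * a * rho := mulr_ge0 (mulr_ge0 (ler0n _ 2) (ltW a0)) (ltW r0).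
    have n3 : 0 <= rho ^+ 2 - NN a b by rewrite subr_ge0 ltW.
    by rewrite -[X in X ^+ 2 <= _]opprB sqrrN ler_pXn2r// ltW.
  have := sqr_ge0 (rho * a); rewrite !exprMn; lra.
have sp3 : 1 / 3 <= sin (psi a b).
  have sn : 0 <= sin (psi a b) by rewrite sin_ge0_pi// (ltW s0) ltW.
  rewrite -(ler_pM2l (mulr_gt0 r0 a0)).
  have : sS a b * sin (psi a b) <= 3 * (rho * a) * sin (psi a b) by rewrite ler_wpM2r.
  rewrite sin_psi ?(ltW a0)//.
  have : rho * a <= 2 * b * a by rewrite ler_pM2r.
  lra.
have : mu * (1 / 3) * T <= mu * sin (psi a b) * T by rewrite ler_pM2r// ler_pM2l.
lra.
Qed.

End Gamma.

(** * Difference quotients of one variable *)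

Section OneVariable.
Context {R : realType}.
Implicit Types (f df : R -> R) (x y c l e : R).

Lemma dist_right c h x : c < x -> x < c + h -> `|x - c| < `|h|.
Proof.
by move=> cx xh; rewrite !gtr0_norm ?subr_gt0// ?ltrBlDl//; have := lt_trans cx xh; rewrite ltrDl.
Qed.

Lemma dist_left c h x : c + h < x -> x < c -> `|x - c| < `|h|.
Proof.
move=> hx xc; have := lt_trans hx xc; rewrite gtrDl => h0.
by rewrite !ltr0_norm ?subr_lt0// ltrN2 ltrBrDl.
Qed.

Lemma is_derive_eps f x l :
  (forall e, 0 < e -> exists2 d, 0 < d & forall h, h != 0 -> `|h| < d ->
     `|(f (x + h) - f x) / h - l| < e) -> is_derive x 1 f l.
Proof.
move=> H.
have cv : h^-1 *: (f (h *: 1 + x) - f x) @[h --> 0^'] --> l.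
  apply/cvgrPdist_lt => e e0; have [d d0 hd] := H _ e0.
  apply/nbhs_ballP; exists d => //= h; rewrite -ball_normE /= sub0r normrN => hd' h0.
  rewrite distrC /GRing.scale/= mulr1 (addrC h) mulrC.
  exact: hd.
apply: DeriveDef; first by apply/cvg_ex; exists l.
exact/cvg_lim.
Qed.

Lemma MVT_two f df x y : (forall t, Num.min x y <= t <= Num.max x y -> is_derive t 1 f (df t)) ->
  exists2 t, `|t - x| <= `|y - x| & f y - f x = df t * (y - x).
Proof.
wlog xy : f df x y / x < y.
  move=> H h; have [xy|yx|->] := ltgtP x y; first exact: H.
  - rewrite minC maxC in h; have [t tt e] := H f df y x yx h.
    pose g s := f (- s); pose dg s := - df (- s).
    have [||u uu eu] := H g dg (- x) (- y).
    + by rewrite ltrN2.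
    + move=> s; rewrite min_l ?max_r ?lerN2 ?(ltW yx)// => /andP[s1 s2].
      have : is_derive (- s) 1 f (df (- s)).
        by apply: h; rewrite min_l ?max_r ?(ltW yx)//; apply/andP; split; lra.
      move=> hd; have dn : is_derive s 1 (fun s : R => - s) (- 1) by apply: is_derive_eq.
      have := @is_derive1_comp _ f (fun s : R => - s) _ _ _ hd dn.
      by rewrite mulrN1.
    + exists (- u); first by move: uu; rewrite -!opprD !normrN opprK addrC.
      by move: eu; rewrite /g /dg !opprK => ->; ring.
  - exists y; first by rewrite !subrr.
    by rewrite !subrr mulr0.
rewrite min_l ?max_r ?(ltW xy)// => h.
have hc : {within `[x, y], continuous f}.
  apply: derivable_within_continuous => t; rewrite in_itv/= => /h ht.
  exact: ex_derive.
have [t /andP[t1 t2] e] := @MVT_ex _ f df x y xy (fun t tt => h t (let: conj a b := andP tt in introT andP (conj (ltW a) (ltW b)))) hc.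
exists t => //; rewrite !ger0_norm; lra.
Qed.

(** The mean value theorem turns a limit of the derivative at c into the derivative at c. This joins
    the branches of [gg] at rho and of [FF] at 0. *)
Lemma derive_ext f df c r : 0 < r ->
  (forall t, t != c -> `|t - c| < r -> is_derive t 1 f (df t)) ->
  (forall e, 0 < e -> exists2 d, 0 < d & forall t, `|t - c| < d -> `|f t - f c| < e) ->
  (forall e, 0 < e -> exists2 d, 0 < d & forall t, `|t - c| < d -> `|df t - df c| < e) ->
  is_derive c 1 f (df c).
Proof.
move=> r0 hd hf hdf; apply: is_derive_eps => e e0.
have [d d0 Hd] := hdf _ e0.
exists (Num.min d r); first by rewrite lt_min d0.
move=> h h0; rewrite lt_min => /andP[h1 h2].
have hcont t : `|t - c| < r -> {for t, continuous f}.
  move=> tr; have [->|tc] := eqVneq t c.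
    apply/cvgrPdist_lt => e' e'0; have [d' d'0 Hd'] := hf _ e'0.
    apply/nbhs_ballP; exists d' => //= s; rewrite -?ball_normE /= => sd.
    by rewrite distrC; apply: Hd'; rewrite distrC.
  have ht := hd _ tc tr.
  by apply: differentiable_continuous; apply/derivable1_diffP; exact: ex_derive.
have hw x y : `|x - c| < r -> `|y - c| < r -> {within `[x, y], continuous f}.
  rewrite !ltr_norml => /andP[x1 x2] /andP[y1 y2].
  apply: continuous_in_subspaceT => t; rewrite inE/= in_itv/= => /andP[t1 t2].
  by apply: hcont; rewrite ltr_norml (lt_le_trans x1) ?(le_lt_trans _ y2) ?lerB ?lerD2r.
have cr : `|c - c| < r by rewrite subrr normr0.
have chr : `|c + h - c| < r by rewrite addrC addKr.
have [hp|hn|hz] := ltgtP 0 h; last by rewrite -hz eqxx in h0.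
- have [|||t /andP[t1 t2] ->] := @MVT_ex _ f df c (c + h).
  + by rewrite ltrDl.
  + move=> t /andP[t1 t2]; apply: hd; first by rewrite gt_eqF.
    by apply: lt_trans h2; exact: dist_right.
  + exact: hw.
  rewrite [c + h - c]addrC addKr mulfK//; apply: Hd.
  by apply: lt_trans h1; exact: dist_right.
- have [|||t /andP[t1 t2] E] := @MVT_ex _ f df (c + h) c.
  + by rewrite gtrDl.
  + move=> t /andP[t1 t2]; apply: hd; first by rewrite lt_eqF.
    by apply: lt_trans h2; exact: dist_left.
  + exact: hw.
  have -> : (f (c + h) - f c) / h = df t.
    by rewrite -[f (c + h) - f c]opprB E; field.
  apply: Hd.
  by apply: lt_trans h1; exact: dist_left.
Qed.

Lemma div_eps (p0 q0 e : R) : 0 < q0 -> 0 < e -> exists2 d, 0 < d &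
  forall p1 q1, `|p1 - p0| < d -> `|q1 - q0| < d -> 0 < q1 /\ `|p1 / q1 - p0 / q0| < e.
Proof.
move=> q00 e0.
pose K := 2 * (q0 + `|p0|) / q0 ^+ 2.
have K0 : 0 < K.
  have P0 := normr_ge0 p0.
  have P1 : 0 < q0 + `|p0| by lra.
  by apply: divr_gt0; [lra|exact: exprn_gt0].
have k1 : 0 < q0 / 2 by lra.
have k2 : 0 < e / K by exact: divr_gt0.
exists (Num.min (q0 / 2) (e / K)); first by rewrite lt_min k1.
move=> p1 q1; rewrite !lt_min => /andP[h1 h2] /andP[h3 h4].
have q1h : q0 / 2 < q1 by move: h3; rewrite ltr_norml => /andP[? ?]; lra.
have q10 : 0 < q1 by apply: lt_trans q1h; lra.
split => //.
have -> : p1 / q1 - p0 / q0 = ((p1 - p0) * q0 - p0 * (q1 - q0)) / (q1 * q0).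
  by field; rewrite !gt_eqF.
rewrite normrM normfV (gtr0_norm (mulr_gt0 q10 q00)) ltr_pdivrMr ?mulr_gt0//.
apply: le_lt_trans (ler_normB _ _) _; rewrite !normrM (gtr0_norm q00).
have P0 := normr_ge0 p0.
have a1 : `|p1 - p0| * q0 < e / K * q0 by rewrite ltr_pM2r.
have a2 : `|p0| * `|q1 - q0| <= `|p0| * (e / K) by rewrite ler_wpM2l// ltW.
apply: (@lt_trans _ _ (e / K * (q0 + `|p0|))); first lra.
apply: (@le_lt_trans _ _ (e * (q0 / 2 * q0))).
  rewrite le_eqVlt; apply/orP; left; apply/eqP; rewrite /K; field.
  have P1 : 0 < q0 + `|p0| by lra.
  by rewrite !gt_eqF.
by rewrite ltr_pM2l// ltr_pM2r.
Qed.

(** Gives the limit q + p^2 / q of the difference quotients of [gg]. The approximations are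
    independent variables because each one comes from its own mean value point. *)
Lemma quad_div_eps (p0 q0 e : R) : 0 < q0 -> 0 < e -> exists2 d, 0 < d &
  forall p1 q1 p2 q2, `|p1 - p0| < d -> `|q1 - q0| < d -> `|p2 - p0| < d -> `|q2 - q0| < d ->
   0 < q1 /\ `|p2 * (p1 / q1) + q2 - (p0 * (p0 / q0) + q0)| < e.
Proof.
move=> q00 e0.
pose s0 := p0 / q0; have S0 := normr_ge0 s0; have P0 := normr_ge0 p0.
pose e1 := Num.min 1 (e / (3 * (`|p0| + 1))).
have p3 : 0 < 3 * (`|p0| + 1) by lra.
have e10 : 0 < e1 by rewrite lt_min ltr01; exact: divr_gt0.
have [d d0 Hd] := div_eps p0 q00 e10.
have s3 : 0 < 3 * (`|s0| + 1) by lra.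
exists (Num.min d (Num.min (e / 3) (e / (3 * (`|s0| + 1))))).
  have k1 : 0 < e / 3 by lra.
  have k2 : 0 < e / (3 * (`|s0| + 1)) by exact: divr_gt0.
  by rewrite !lt_min d0 k1.
move=> p1 q1 p2 q2; rewrite !lt_min => /and3P[a1 _ _] /and3P[b1 _ _] /and3P[_ _ c3] /and3P[_ d2 _].
have [q10 hs] := Hd _ _ a1 b1; split => //.
set s := p1 / q1 in hs *; rewrite -/s0 in hs *.
have hs1 : `|s - s0| < 1 by apply: lt_le_trans hs _; rewrite ge_min lexx.
have hs2 : `|s - s0| < e / (3 * (`|p0| + 1)) by apply: lt_le_trans hs _; rewrite ge_min lexx orbT.
have -> : p2 * s + q2 - (p0 * s0 + q0) = (p2 - p0) * s + p0 * (s - s0) + (q2 - q0) by ring.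
have sb : `|s| <= `|s0| + 1.
  by have := ler_normD (s - s0) s0; rewrite subrK; lra.
have t1 : `|(p2 - p0) * s| <= e / 3.
  rewrite normrM; apply: (@le_trans _ _ (e / (3 * (`|s0| + 1)) * (`|s0| + 1))).
    by apply: ler_pM => //; exact: ltW.
  by rewrite le_eqVlt; apply/orP; left; apply/eqP; field; rewrite gt_eqF//; lra.
have t2 : `|p0 * (s - s0)| <= e / 3.
  rewrite normrM; apply: (@le_trans _ _ ((`|p0| + 1) * (e / (3 * (`|p0| + 1))))).
    by apply: ler_pM => //; [lra|exact: ltW].
  by rewrite le_eqVlt; apply/orP; left; apply/eqP; field; rewrite gt_eqF//; lra.
have := ler_normD ((p2 - p0) * s + p0 * (s - s0)) (q2 - q0).
have := ler_normD ((p2 - p0) * s) (p0 * (s - s0)).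
lra.
Qed.

End OneVariable.

(** * Regularity of the curve and of the boundary function *)

Section Curve.
Context {R : realType} (mu rho : R).
Hypothesis (mu_gt0 : 0 < mu) (mu_lt : mu < 1 / 8) (rho_gt0 : 0 < rho).
Implicit Types (a b : R).
Notation A := (A mu rho).
Notation B := (B mu rho).
Notation p := (p mu rho).
Notation q := (q mu rho).
Notation kap := (kap mu).
Notation alpha := (alpha mu rho).

(** Implicit function theorem by signs: B is negative at alpha(b0) - e' and positive at alpha(b0) +
    e', this persists for nearby b, and [B_alpha] traps alpha(b) in between. *)
Lemma alpha_cont b0 : 0 < b0 -> b0 < rho -> forall e, 0 < e ->
  exists2 d, 0 < d & forall b, `|b - b0| < d -> `|alpha b - alpha b0| < e.
Proof.
move=> b00 b0r e e0; have [a0 ea] := alphaP mu_gt0 mu_lt rho_gt0 b00 b0r.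
have [_ hB _ _] := hgoodP rho mu_gt0 mu_lt.
set a := alpha b0 in a0 ea *.
pose e' := Num.min (a / 2) (e / 2).
have e'0 : 0 < e' by rewrite lt_min; apply/andP; split; lra.
have e'a : e' <= a / 2 by rewrite ge_min lexx.
have e'e : e' <= e / 2 by rewrite ge_min lexx orbT.
clearbody e'.
have al0 : 0 < a - e' by lra.
have ar0 : 0 < a + e' by lra.
have lB : B (a - e') b0 < 0.
  rewrite ltNge; apply/negP => h.
  have aa : a - e' < a by lra.
  have := AB_incr_a mu_gt0 mu_lt rho_gt0 (ltW al0) aa b00.
  move=> /(_ (ltW (B_pos_reg mu_gt0 mu_lt rho_gt0 al0 b00 h)))[_].
  by rewrite ea ltNge h.
have uB : 0 < B (a + e') b0 by rewrite B_alpha// -/a; lra.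
have nB : 0 < - B (a - e') b0 by lra.
have [d1 d10 h1] := cont2 mu_gt0 b0 hB al0 nB.
have [d2 d20 h2] := cont2 mu_gt0 b0 hB ar0 uB.
exists (Num.min (b0 / 2) (Num.min d1 d2)).
  by rewrite !lt_min d10 d20 andbT; lra.
move=> b; rewrite !lt_min => /and3P[g0 g1 g2].
have b'0 : 0 < b by move: g0; rewrite ltr_norml => /andP[? ?]; lra.
have := h1 (a - e') b; rewrite subrr normr0 => /(_ d10 g1).
rewrite ltr_norml => /andP[_ k1].
have := h2 (a + e') b; rewrite subrr normr0 => /(_ d20 g2).
rewrite ltr_norml => /andP[k2 _].
have u : alpha b < a + e' by rewrite -B_alpha//; lra.
have l : a - e' <= alpha b by rewrite leNgt -B_alpha// -leNgt; lra.
by rewrite ltr_norml; apply/andP; split; lra.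
Qed.

(** The increments are split along (a, b0), (a, b), (a', b), with one mean value theorem per leg.
    Since B vanishes at both ends, the increments of alpha and b are linearly related. *)
Lemma gamma_quot b0 : 0 < b0 -> b0 < rho -> forall e, 0 < e ->
  exists2 d, 0 < d & forall b, `|b - b0| < d ->
   exists p1 q1 p2 q2, [/\ [/\ `|p1 - p (alpha b0) b0| < e, `|q1 - q (alpha b0) b0| < e,
     `|p2 - p (alpha b0) b0| < e & `|q2 - q (alpha b0) b0| < e],
     q1 * (alpha b - alpha b0) + p1 * (b - b0) = 0 &
     A (alpha b) b - A (alpha b0) b0 = p2 * (alpha b - alpha b0) - q2 * (b - b0)].
Proof.
move=> b00 b0r e e0; have [a0 ea] := alphaP mu_gt0 mu_lt rho_gt0 b00 b0r.
have [_ _ hp hq] := hgoodP rho mu_gt0 mu_lt.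
set a := alpha b0 in a0 ea *.
have [d1 d10 h1] := cont2 mu_gt0 b0 hp a0 e0.
have [d2 d20 h2] := cont2 mu_gt0 b0 hq a0 e0.
pose d' := Num.min (a / 2) (Num.min d1 d2).
have d'0 : 0 < d' by rewrite !lt_min d10 d20 andbT; lra.
have [d3 d30 h3] := alpha_cont b00 b0r d'0.
exists (Num.min (Num.min (b0 / 2) (rho - b0)) (Num.min d3 (Num.min d1 d2))).
  by rewrite !lt_min d10 d20 d30 !andbT; apply/andP; split; lra.
move=> b; rewrite !lt_min => /andP[/andP[g0 g1] /and3P[g2 g3 g4]].
have b'0 : 0 < b by move: g0; rewrite ltr_norml => /andP[? ?]; lra.
have br : b < rho by move: g1; rewrite ltr_norml => /andP[? ?]; lra.
have [a'0 ea'] := alphaP mu_gt0 mu_lt rho_gt0 b'0 br.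
have := h3 _ g2; rewrite -/a; set a' := alpha b in a'0 ea' *.
rewrite !lt_min => /and3P[k0 k1 k2].
have pos t : Num.min a a' <= t <= Num.max a a' -> 0 < t.
  move=> /andP[t1 _]; apply: lt_le_trans t1; by rewrite lt_min a0.
have dB t : Num.min a a' <= t <= Num.max a a' -> is_derive t 1 (fun t => B t b) (q t b).
  by move/pos; exact: derB_a.
have dA t : Num.min a a' <= t <= Num.max a a' -> is_derive t 1 (fun t => A t b) (p t b).
  by move/pos; exact: derA_a.
have [x1 l1 e1] := @MVT_two _ (fun t => B t b) (fun t => q t b) a a' dB.
have [x2 l2 e2] := @MVT_two _ (fun t => A t b) (fun t => p t b) a a' dA.
have [x3 l3 e3] := @MVT_two _ (fun t => B a t) (fun t => p a t) b0 b (fun t _ => derB_b mu rho t a0).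
have [x4 l4 e4] := @MVT_two _ (fun t => A a t) (fun t => - q a t) b0 b (fun t _ => derA_b mu rho t a0).
exists (p a x3), (q x1 b), (p x2 b), (q a x4); split.
- split.
  + by apply: h1; [rewrite subrr normr0|apply: le_lt_trans g3].
  + by apply: h2 => //; apply: le_lt_trans k2.
  + by apply: h1 => //; apply: le_lt_trans k1.
  + by apply: h2; [rewrite subrr normr0|apply: le_lt_trans g4].
- by rewrite -e1 -e3 ea' ea; ring.
- have -> : A a' b - A a b0 = (A a' b - A a b) + (A a b - A a b0) by ring.
  by rewrite e2 e4; ring.
Qed.

Lemma der_alpha b0 : 0 < b0 -> b0 < rho ->
  is_derive b0 1 alpha (- (p (alpha b0) b0 / q (alpha b0) b0)).
Proof.
move=> b00 b0r; apply: is_derive_eps => e e0.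
have [p0 q0 _] := cone mu_gt0 mu_lt rho_gt0 b00 b0r.
have [d d0 hd] := div_eps (p (alpha b0) b0) q0 e0.
have [d' d'0 hd'] := gamma_quot b00 b0r d0.
exists d' => // h h0 hd'h.
have := hd' (b0 + h); rewrite addrC addKr => /(_ hd'h)[p1 [q1 [p2 [q2 [[t1 t2 _ _] E _]]]]].
have [q10 H] := hd _ _ t1 t2.
have -> : alpha (b0 + h) - alpha b0 = - (p1 * h) / q1.
  apply: (mulfI (lt0r_neq0 q10)); rewrite [RHS]mulrC divfK ?gt_eqF//.
  by apply/eqP; rewrite -addr_eq0 E.
move: H; rewrite -normrN; congr (is_true (`| _ | < e)).
by field; rewrite h0 !gt_eqF.
Qed.

Definition gg b : R := - A (alpha b) b.
(** Chain rule with alpha' = - p / q, A_a = p and A_b = - q. At b = 0 the quotient is 0 / 0 = 0,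
    which is the right limit. *)
Definition dgg b : R := if b < rho then q (alpha b) b + p (alpha b) b ^+ 2 / q (alpha b) b else q 0 b.

Lemma der_gg_lt b0 : 0 < b0 -> b0 < rho -> is_derive b0 1 gg (dgg b0).
Proof.
move=> b00 b0r; apply: is_derive_eps => e e0; rewrite /dgg b0r.
have [p0 q0 _] := cone mu_gt0 mu_lt rho_gt0 b00 b0r.
have [d d0 hd] := quad_div_eps (p (alpha b0) b0) q0 e0.
have [d' d'0 hd'] := gamma_quot b00 b0r d0.
exists d' => // h h0 hd'h.
have := hd' (b0 + h); rewrite addrC addKr => /(_ hd'h)[p1 [q1 [p2 [q2 [[t1 t2 t3 t4] E F]]]]].
have [q10 H] := hd _ _ _ _ t1 t2 t3 t4.
move: H; congr (is_true (`| _ | < e)).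
rewrite /gg.
have ea : alpha (b0 + h) - alpha b0 = - (p1 * h) / q1.
  apply: (mulfI (lt0r_neq0 q10)); rewrite [RHS]mulrC divfK ?gt_eqF//.
  by apply/eqP; rewrite -addr_eq0 E.
rewrite ea in F.
have -> : - A (alpha (b0 + h)) (b0 + h) - - A (alpha b0) b0 = - (A (alpha (b0 + h)) (b0 + h) - A (alpha b0) b0) by ring.
rewrite F; field; by rewrite h0 !gt_eqF.
Qed.

Lemma sS0E b : rho <= b -> sS rho 0 b = b ^+ 2 - rho ^+ 2.
Proof.
move=> h; have r0 := rho_gt0; rewrite /sS /nrm expr0n/= !add0r !sqrtr_sqr.
by rewrite !ger0_norm; [ring|lra|lra].
Qed.

Lemma der_gg_gt b0 : rho < b0 -> is_derive b0 1 gg (dgg b0).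
Proof.
move=> rb; have r0 := rho_gt0; have b00 : 0 < b0 by apply: lt_trans rb.
have S0 : 0 < b0 ^+ 2 - rho ^+ 2 by rewrite subr_gt0 ltr_pXn2r// nnegrE ltW.
pose G b := (b ^+ 2 - rho ^+ 2) `^ mu * sin (mu * pi) * (b - rho ^+ 2 / b).
have GE b : rho < b -> gg b = G b.
  move=> h; rewrite /gg alpha_ge ?(ltW h)// A0_gt// opprK sS0E ?(ltW h)//.
have dp := is_derive1_powR mu S0.
have ds : is_derive b0 1 (fun b : R => b ^+ 2 - rho ^+ 2) (2 * b0).
  by apply: is_derive_eq; rewrite /GRing.scale/=; ring.
have d1 := @is_derive1_comp _ (fun t : R => t `^ mu) (fun b : R => b ^+ 2 - rho ^+ 2) _ _ _ dp ds.
have bn : b0 != 0 by rewrite gt_eqF.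
have d2 : is_derive b0 1 (fun b : R => sin (mu * pi) * (b - rho ^+ 2 / b)) (sin (mu * pi) * (1 + rho ^+ 2 / b0 ^+ 2)).
  have di : is_derive b0 1 (fun b : R => b^-1) (- b0 ^- 2 *: 1).
    exact: (@is_deriveV _ id b0 1 1 bn (is_derive_id _ _)).
  have dj := is_deriveZ (sin (mu * pi)) (is_deriveB (is_derive_id b0 1) (is_deriveZ (rho ^+ 2) di)).
  by apply: (is_derive_eq dj); rewrite /GRing.scale/=; field.
have dG : is_derive b0 1 G (dgg b0).
  have -> : G = (fun b => (b ^+ 2 - rho ^+ 2) `^ mu * (sin (mu * pi) * (b - rho ^+ 2 / b))).
    by apply/funext => b; rewrite /G mulrA.
  have := is_deriveM d1 d2 => /is_derive_eq; apply.
  rewrite /dgg ltNge (ltW rb)/=.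
  have [_ [_ ->]] := p0_gt mu_gt0 mu_lt rho_gt0 rb.
  rewrite sS0E ?(ltW rb)// /GRing.scale/= /kap.
  have -> : (b0 ^+ 2 - rho ^+ 2) `^ (mu - 1) = (b0 ^+ 2 - rho ^+ 2) `^ mu / (b0 ^+ 2 - rho ^+ 2).
    have Sn : b0 ^+ 2 - rho ^+ 2 != 0 by rewrite gt_eqF.
    by rewrite powRB ?powRr1 ?(ltW S0)// Sn implybT.
  by field; rewrite bn gt_eqF.
apply: near_eq_is_derive dG => //.
have := @lt_nbhsr _ _ _ rb.
by apply: filterS => b hb; rewrite GE.
Qed.

Definition sig : R := Num.sqrt (rho ^+ 2 / kap).

Lemma sig_gt0 : 0 < sig.
Proof.
have k1 := kap_gt1 mu_gt0; have r0 := rho_gt0.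
by rewrite sqrtr_gt0 divr_gt0 ?exprn_gt0//; lra.
Qed.

Lemma sqr_sig : kap * sig ^+ 2 = rho ^+ 2.
Proof.
have k1 := kap_gt1 mu_gt0; have r0 := rho_gt0.
by rewrite sqr_sqrtr ?divr_ge0 ?sqr_ge0//; [rewrite mulrC divfK// gt_eqF//; lra|lra].
Qed.

Lemma alpha_cont0 e : 0 < e -> exists2 d, 0 < d & forall b, 0 <= b -> b < d ->
  `|alpha b - alpha 0| < e.
Proof.
move=> e0; have r0 := rho_gt0; have s0 := sig_gt0; have k1 := kap_gt1 mu_gt0.
have m0 := mu_gt0; have m1 := mu_lt.
have -> : alpha 0 = sig by rewrite /alpha eqxx.
exists (Num.min rho (Num.min 1 (e * sig))).
  by rewrite !lt_min r0 ltr01 mulr_gt0.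
move=> b; rewrite le_eqVlt => /orP[/eqP<-|b0].
  by rewrite /alpha eqxx subrr normr0.
rewrite !lt_min => /and3P[br b1 be].
have := gamma_facts mu_gt0 mu_lt rho_gt0 b0 br; set a := alpha b => -[a0 Nr h _ _].
have := alpha_reg mu_gt0 mu_lt rho_gt0 b0 br; rewrite -/a => reg.
have ss := sqr_sig.
have B2 : 0 < b ^+ 2 by rewrite exprn_gt0.
have D1 : kap * (a ^+ 2 - sig ^+ 2) <= kap * b ^+ 2.
  have : 2 * mu * b ^+ 2 <= kap * b ^+ 2 by rewrite ler_pM2r// /kap; lra.
  have : 0 < kap * b ^+ 2 by rewrite mulr_gt0//; lra.
  by move: h; rewrite /NN; lra.
have D2 : - (kap * b ^+ 2) <= kap * (a ^+ 2 - sig ^+ 2) by move: reg; rewrite /NN; lra.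
have kp : 0 < kap by lra.
have E1 : a ^+ 2 - sig ^+ 2 <= b ^+ 2 by rewrite -(ler_pM2l kp).
have E2 : - b ^+ 2 <= a ^+ 2 - sig ^+ 2 by rewrite -(ler_pM2l kp) mulrN.
have F : `|a - sig| * (a + sig) <= b ^+ 2.
  have -> : `|a - sig| * (a + sig) = `|a ^+ 2 - sig ^+ 2|.
    by rewrite -[a + sig]gtr0_norm ?addr_gt0// -normrM; congr `| _ |; ring.
  by rewrite ler_norml E2.
have : `|a - sig| * sig < e * sig.
  apply: le_lt_trans be; apply: (@le_trans _ _ (b ^+ 2)); last first.
    by rewrite expr2 ger_pMl// ltW.
  by apply: le_trans F; rewrite ler_wpM2l ?normr_ge0// lerDr ltW.
by rewrite ltr_pM2r.
Qed.

Lemma alpha_cont_rho e : 0 < e -> exists2 d, 0 < d & forall b, `|b - rho| < d -> `|alpha b - alpha rho| < e.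
Proof.
move=> e0; have r0 := rho_gt0.
rewrite [alpha rho]alpha_ge//.
exists (Num.min (rho / 2) (e ^+ 2 / (2 * rho))).
  by rewrite lt_min divr_gt0//= divr_gt0 ?exprn_gt0// mulr_gt0.
move=> b; rewrite lt_min => /andP[h1 h2].
have b0 : 0 < b by move: h1; rewrite ltr_norml => /andP[? ?]; lra.
have [rb|br] := leP rho b; first by rewrite alpha_ge// subrr normr0.
have := gamma_facts mu_gt0 mu_lt rho_gt0 b0 br; set a := alpha b => -[a0 Nr _ _ _].
rewrite subr0 gtr0_norm// -(ltr_pXn2r (n := 2))// ?nnegrE ?(ltW a0) ?(ltW e0)//.
have : a ^+ 2 < (rho - b) * (2 * rho).
  have : (rho - b) * (rho + b) <= (rho - b) * (2 * rho) by rewrite ler_pM2l; lra.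
  move: Nr; rewrite /NN; lra.
move: h2; rewrite ltr_pdivlMr ?mulr_gt0// ltr0_norm; lra.
Qed.

Lemma alpha_lip b1 b2 : 0 <= b1 -> 0 <= b2 -> `|alpha b1 - alpha b2| <= 3 / mu * `|b1 - b2|.
Proof.
have r0 := rho_gt0; have m0 := mu_gt0.
have m3 : 0 < 3 / mu by rewrite divr_gt0.
wlog bb : b1 b2 / b1 < b2.
  move=> h b10 b20; have [bb|bb|->] := ltgtP b1 b2; first exact: h.
  - by rewrite distrC (distrC b1); exact: h.
  - by rewrite !subrr normr0 mulr0.
move=> b10 b20.
have key x y : 0 <= x -> x < y -> y <= rho -> `|alpha x - alpha y| <= 3 / mu * (y - x).
  move=> x0 xy yr.
  have hc : {within `[x, y], continuous alpha}.
    apply/within_contP => t /=; rewrite in_itv/= => /andP[t1 t2] e e0.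
    have [t0|t0|t0] := ltgtP 0 t; last 1 first.
    - have [d d0 hd] := alpha_cont0 e0; exists d => // s; rewrite in_itv/= => /andP[s1 s2].
      rewrite -t0 sub0r normrN distrC => sd; apply: hd; first exact: le_trans s1.
      by apply: le_lt_trans sd; exact: ler_norm.
    - have [tr|tr|tr] := ltgtP t rho.
      + have [d d0 hd] := alpha_cont t0 tr e0; exists d => // s _; rewrite distrC => sd.
        by rewrite distrC; exact: hd.
      + by exfalso; lra.
      + have [d d0 hd] := alpha_cont_rho e0; exists d => // s _; rewrite distrC tr => sd.
        by rewrite distrC; exact: hd.
    - by exfalso; lra.
  have hd t : x < t < y -> is_derive t 1 alpha (- (p (alpha t) t / q (alpha t) t)).
    by move=> /andP[t1 t2]; apply: der_alpha; lra.
  have [t /andP[t1 t2] e] := MVT_ex xy hd hc.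
  have t0 : 0 < t by lra.
  have tr : t < rho by lra.
  have [pp qp pq] := cone mu_gt0 mu_lt rho_gt0 t0 tr.
  rewrite distrC e normrM normrN (gtr0_norm (divr_gt0 pp qp)) [ `|y - x| ]gtr0_norm ?subr_gt0//.
  by rewrite ler_pM2r ?subr_gt0// ler_pdivrMr.
rewrite [ `|b1 - b2| ]ltr0_norm ?subr_lt0// opprB.
have [b2r|b2r] := leP b2 rho; first exact: key.
have [b1r|b1r] := leP rho b1.
  by rewrite !alpha_ge ?(ltW b2r)// subrr normr0 mulr_ge0 ?subr_ge0 ?(ltW m3) ?(ltW bb).
have -> : alpha b2 = alpha rho by rewrite !alpha_ge ?(ltW b2r).
apply: le_trans (key b1 rho b10 b1r (lexx _)) _.
by rewrite ler_pM2l//; lra.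
Qed.

(** [sig], the limit of the curve at b = 0, is the critical point of PP on the positive real axis.
    Hence the slope of [gg] vanishes at 0 and its even extension is differentiable there. *)
Lemma p_sig0 : p sig 0 = 0 /\ q sig 0 = 0.
Proof.
have s0 := sig_gt0; have r0 := rho_gt0; have k1 := kap_gt1 mu_gt0.
have w1 : (WW mu rho sig 0).1 = 0.
  rewrite /WW /NN /= expr0n/= !addr0 subr0.
  have -> : rho ^+ 2 = kap * sig ^+ 2 by rewrite sqr_sig.
  by field; rewrite gt_eqF.
have w2 : (WW mu rho sig 0).2 = 0 by rewrite /WW/= mulr0 mulr0 mul0r.
by rewrite p_polar q_polar w1 w2 !mulr0 subr0 addr0 mulr0.
Qed.

Lemma cone' b : 0 <= b -> b <= rho ->
  [/\ 0 <= p (alpha b) b, 0 <= q (alpha b) b & p (alpha b) b <= 3 / mu * q (alpha b) b].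
Proof.
move=> b0 br; have [pz qz] := p_sig0; have [_ [_ [pr qr]]] := PPr rho mu_gt0.
have [b00|b00|b00] := ltgtP 0 b; last 1 first.
- have -> : alpha b = sig by rewrite -b00 /alpha eqxx.
  by rewrite -b00 pz qz mulr0.
- have [brr|brr|brr] := ltgtP b rho.
  + by have [/ltW p0 /ltW q0 pq] := cone mu_gt0 mu_lt rho_gt0 b00 brr.
  + by exfalso; lra.
  + by rewrite brr alpha_ge// pr qr mulr0.
- by exfalso; lra.
Qed.

Lemma dggE b : 0 <= b -> b <= rho ->
  dgg b = q (alpha b) b + p (alpha b) b ^+ 2 / q (alpha b) b.
Proof.
move=> b0; rewrite le_eqVlt /dgg => /orP[/eqP->|->//].
have [_ [_ [pr qr]]] := PPr rho mu_gt0.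
by rewrite ltxx alpha_ge// pr qr expr0n/= mul0r addr0.
Qed.

(** Along the curve N >= rho^2 / kap >= rho^2 / 2, so it avoids the disc of radius rho / 2 about the
    pole; the maximum keeps the points of the imaginary axis at height at least rho. *)
Lemma SM_curve M b : 0 <= b -> b <= M ->
  SM (rho / 2) (M + rho) (b, alpha b) /\ SM (rho / 2) (M + rho) (Num.max b rho, 0).
Proof.
have m0 := mu_gt0; have m1 := mu_lt.
move=> b0 bM; have r0 := rho_gt0; have s0 := sig_gt0; have k1 := kap_gt1 mu_gt0.
have k2 : kap <= 2 by rewrite /kap; lra.
have ss := sqr_sig.
split.
  have [reg al0 alr] : [/\ rho ^+ 2 <= kap * NN (alpha b) b, 0 <= alpha b & alpha b <= rho].
    move: b0; rewrite le_eqVlt => /orP[/eqP<-|b0].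
      have -> : alpha 0 = sig by rewrite /alpha eqxx.
      split; [by rewrite /NN expr0n/= addr0 ss|exact: ltW|].
      rewrite -(ler_pXn2r (n := 2))// ?nnegrE ?(ltW s0) ?(ltW r0)//.
      rewrite -ss; have : 0 <= (kap - 1) * sig ^+ 2 by rewrite mulr_ge0 ?sqr_ge0//; lra.
      lra.
    split; [exact: reg_alpha|exact: alpha_ge0|].
    have [rb|br] := leP rho b; first by rewrite alpha_ge// ltW.
    have := gamma_facts mu_gt0 mu_lt rho_gt0 b0 br; set a := alpha b => -[a0 Nr _ _ _].
    rewrite -(ler_pXn2r (n := 2))// ?nnegrE ?(ltW a0) ?(ltW r0)//.
    by have := sqr_ge0 b; move: Nr; rewrite /NN; lra.
  split => //=.
  - rewrite -(ler_pXn2r (n := 2))// ?nnegrE ?nrm_ge0//; last by lra.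
    rewrite sqr_nrm -/(NN _ _).
    have NN0 : 0 <= NN (alpha b) b by rewrite addr_ge0 ?sqr_ge0.
    have : kap * NN (alpha b) b <= 2 * NN (alpha b) b by rewrite ler_wpM2r.
    have -> : (rho / 2) ^+ 2 = rho ^+ 2 / 4 by field.
    have : 0 < rho ^+ 2 by rewrite exprn_gt0.
    lra.
  - by rewrite ger0_norm//; lra.
  - by rewrite ger0_norm//; lra.
have mr : rho <= Num.max b rho by rewrite le_max lexx orbT.
have mM : Num.max b rho <= M + rho by rewrite ge_max; apply/andP; split; lra.
split => //=.
- by have [_ h] := ler_norm_nrm 0 (Num.max b rho); apply: le_trans h; rewrite ger0_norm; lra.
- by rewrite ger0_norm; lra.
- by rewrite normr0; lra.
Qed.

(** As q vanishes at the ends of the curve, p^2 / q is not a product of Hoelder functions. With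
    slopes s and t at the two points, (1 + s^2) Q1 - (1 + t^2) Q2 = (1 - s t) (Q1 - Q2) + (s + t)
    (P1 - P2), so only the bound on the slopes enters and not their regularity. *)
Lemma gg_hold M : 0 <= M -> exists2 C, 0 <= C & forall b1 b2,
  0 <= b1 <= M -> 0 <= b2 <= M ->
  `|gg b1 - gg b2| <= C * `|b1 - b2| `^ mu /\ `|dgg b1 - dgg b2| <= C * `|b1 - b2| `^ mu.
Proof.
move=> M0; have r0 := rho_gt0; have m0 := mu_gt0; have m1 := mu_lt.
have c0 : 0 < rho / 2 by lra.
have M1 : 0 <= M + rho by lra.
have [hA _ hp hq] := hgoodP rho mu_gt0 mu_lt.
have [CA CA0 cA] := hA _ _ c0 M1.
have [Cp Cp0 cp] := hp _ _ c0 M1.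
have [Cq Cq0 cq] := hq _ _ c0 M1.
pose L := 3 / mu; have L0 : 0 < L by rewrite divr_gt0.
pose K := (L + 1) `^ mu; have K0 : 0 <= K by exact: powR_ge0.
have L20 := sqr_ge0 L.
pose C := CA * K + (2 * ((1 + L ^+ 2) * (Cq * K) + 2 * L * (Cp * K)) + Cq).
have dist b1 b2 : 0 <= b1 -> 0 <= b2 -> `|((b1, alpha b1) : R * R) - (b2, alpha b2)| `^ mu <= K * `|b1 - b2| `^ mu.
  move=> h1 h2; rewrite -powRM//; last by lra.
  apply: ge0_ler_powR; rewrite ?nnegrE ?mulr_ge0 ?(ltW m0)//; first by lra.
  have := alpha_lip h1 h2; rewrite -/L => h3.
  have ab := normr_ge0 (b1 - b2).
  have LL : 0 <= L * `|b1 - b2| by apply: mulr_ge0 => //; exact: ltW.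
  by rewrite norm_pair_le/=; apply/andP; split; lra.
have X0 : 0 <= (1 + L ^+ 2) * (Cq * K) by apply: mulr_ge0; [lra|exact: mulr_ge0].
have X1 : 0 <= 2 * L * (Cp * K) by apply: mulr_ge0; [lra|exact: mulr_ge0].
have X2 : 0 <= CA * K by rewrite mulr_ge0.
exists C; first by rewrite /C !addr_ge0// mulr_ge0// addr_ge0.
move=> b1 b2 /andP[b10 b1M] /andP[b20 b2M].
have D0 : 0 <= `|b1 - b2| `^ mu := powR_ge0 _ _.
split.
  have [[S1 _] [S2 _]] := (SM_curve b10 b1M, SM_curve b20 b2M).
  have [_ h] := cA _ _ S1 S2.
  have -> : gg b1 - gg b2 = - (A (alpha b1) b1 - A (alpha b2) b2) by rewrite /gg; ring.
  rewrite normrN.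
  apply: le_trans h _; apply: (@le_trans _ _ (CA * (K * `|b1 - b2| `^ mu))).
    by rewrite ler_wpM2l// dist.
  by rewrite mulrA ler_wpM2r// /C lerDl addr_ge0// mulr_ge0// addr_ge0.
pose C1 := (1 + L ^+ 2) * (Cq * K) + 2 * L * (Cp * K).
have low x y : 0 <= x -> x <= M -> x <= rho -> 0 <= y -> y <= M -> y <= rho ->
  `|dgg x - dgg y| <= C1 * `|x - y| `^ mu.
  move=> x0 xM xr y0 yM yr; rewrite !dggE//.
  have [p1 q1 pq1] := cone' x0 xr; have [p2 q2 pq2] := cone' y0 yr.
  have [[S1 _] [S2 _]] := (SM_curve x0 xM, SM_curve y0 yM).
  have [_ hp1] := cp _ _ S1 S2; have [_ hq1] := cq _ _ S1 S2.
  have dd := dist _ _ x0 y0.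
  have {}hp1 : `|p (alpha x) x - p (alpha y) y| <= Cp * K * `|x - y| `^ mu.
    by apply: le_trans hp1 _; rewrite -mulrA ler_wpM2l.
  have {}hq1 : `|q (alpha x) x - q (alpha y) y| <= Cq * K * `|x - y| `^ mu.
    by apply: le_trans hq1 _; rewrite -mulrA ler_wpM2l.
  move: p1 q1 pq1 p2 q2 pq2 hp1 hq1.
  set P1 := p (alpha x) x; set Q1 := q (alpha x) x; set P2 := p (alpha y) y; set Q2 := q (alpha y) y.
  rewrite -/L => p1 q1 pq1 p2 q2 pq2 hp1 hq1.
  (* If Q = 0 then P = 0, and s = 0 agrees with the convention that P^2 / 0 is 0. *)
  have slope P Q : 0 <= P -> 0 <= Q -> P <= L * Q -> exists s, [/\ 0 <= s, s <= L, P = s * Q & P ^+ 2 / Q = s ^+ 2 * Q].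
    move=> P0 Q0 PQ; have [Q00|Qn] := eqVneq Q 0.
      exists 0; split => //; [exact: ltW| |]; first by move: PQ; rewrite Q00 !mulr0 => ?; apply: le_anti; rewrite P0 andbT.
      by rewrite Q00 invr0 !mulr0.
    have Qp : 0 < Q by rewrite lt_def Qn.
    exists (P / Q); split; [by rewrite divr_ge0|by rewrite ler_pdivrMr|by rewrite divfK|].
    by field.
  have [s [s0 sL E1 F1]] := slope P1 Q1 p1 q1 pq1.
  have [t [t0 tL E2 F2]] := slope P2 Q2 p2 q2 pq2.
  rewrite F1 F2.
  have -> : Q1 + s ^+ 2 * Q1 - (Q2 + t ^+ 2 * Q2) = (1 - s * t) * (Q1 - Q2) + (s + t) * (P1 - P2).
    by rewrite E1 E2; ring.
  apply: le_trans (ler_normD _ _) _; rewrite !normrM /C1 mulrDl.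
  apply: lerD; rewrite -[leRHS]mulrA; apply: ler_pM => //.
    have st0 : 0 <= s * t by rewrite mulr_ge0.
    have stL : s * t <= L * L by rewrite ler_pM.
    by rewrite ler_norml expr2; clear -m0 r0 st0 stL; apply/andP; split; lra.
  by rewrite ger0_norm; clear -m0 r0 s0 sL t0 tL; lra.
have high x y : 0 <= x -> x <= M -> rho <= x -> 0 <= y -> y <= M -> rho <= y ->
  `|dgg x - dgg y| <= Cq * `|x - y| `^ mu.
  move=> x0 xM xr y0 yM yr.
  have [[_ S1] [_ S2]] := (SM_curve x0 xM, SM_curve y0 yM).
  have [_ h] := cq _ _ S1 S2; move: h => /=.
  rewrite !max_l// /dgg !ltNge xr yr/= => h; apply: le_trans h _.
  rewrite ler_wpM2l// ge0_ler_powR ?nnegrE ?(ltW m0)//.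
  by rewrite norm_pair_le/= subrr normr0 lexx normr_ge0.
have C10 : 0 <= C1 by rewrite /C1 addr_ge0.
have fin x y : 0 <= x -> x <= M -> 0 <= y -> y <= M -> x <= y -> `|dgg x - dgg y| <= C * `|x - y| `^ mu.
  move=> x0 xM y0 yM xy.
  have E0 : 0 <= `|x - y| `^ mu := powR_ge0 _ _.
  have CC1 : C1 <= C by rewrite /C -/C1; clear -m0 r0 X2 C10 Cq0; lra.
  have CCq : Cq <= C by rewrite /C -/C1; clear -m0 r0 X2 C10; lra.
  have [yr|yr] := leP y rho.
    apply: le_trans (low x y x0 xM (le_trans xy yr) y0 yM yr) _.
    by rewrite ler_wpM2r.
  have [xr|xr] := leP rho x.
    apply: le_trans (high x y x0 xM xr y0 yM (ltW yr)) _.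
    by rewrite ler_wpM2r.
  have rM : rho <= M := le_trans (ltW yr) yM.
  have h1 := low x rho x0 xM (ltW xr) (ltW r0) rM (lexx _).
  have h2 := high rho y (ltW r0) rM (lexx _) y0 yM (ltW yr).
  have m1' : `|x - rho| `^ mu <= `|x - y| `^ mu.
    by rewrite ge0_ler_powR ?nnegrE ?(ltW m0)// !ltr0_norm; clear -m0 r0 xr yr; lra.
  have m2' : `|rho - y| `^ mu <= `|x - y| `^ mu.
    by rewrite ge0_ler_powR ?nnegrE ?(ltW m0)// !ltr0_norm; clear -m0 r0 xr yr; lra.
  have k1 : C1 * `|x - rho| `^ mu <= C1 * `|x - y| `^ mu by rewrite ler_wpM2l.
  have k2 : Cq * `|rho - y| `^ mu <= Cq * `|x - y| `^ mu by rewrite ler_wpM2l.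
  have := ler_distD (dgg rho) (dgg x) (dgg y).
  have : (C1 + Cq) * `|x - y| `^ mu <= C * `|x - y| `^ mu.
    by rewrite ler_wpM2r// /C -/C1; clear -m0 r0 X2 C10; lra.
  by rewrite mulrDl; clear -m0 r0 k1 k2 h1 h2; lra.
have [xy|/ltW xy] := leP b1 b2; first exact: fin.
by rewrite distrC (distrC b1); exact: fin.
Qed.

End Curve.

(** * Even extension of the boundary function and its slope *)

Section EvenExtension.
Context {R : realType} (mu rho : R).
Hypothesis (mu_gt0 : 0 < mu) (mu_lt : mu < 1 / 8) (rho_gt0 : 0 < rho).
Implicit Types (a b : R).
Notation A := (A mu rho).
Notation B := (B mu rho).
Notation p := (p mu rho).
Notation q := (q mu rho).
Notation kap := (kap mu).
Notation alpha := (alpha mu rho).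
Notation gg := (gg mu rho).
Notation dgg := (dgg mu rho).

Lemma dgg0 : dgg 0 = 0.
Proof.
have [pz qz] := p_sig0 mu_gt0 rho_gt0.
rewrite dggE ?lexx ?(ltW rho_gt0)//.
have -> : alpha 0 = sig mu rho by rewrite /alpha eqxx.
by rewrite pz qz expr0n/= mul0r addr0.
Qed.

Lemma hold_eps (C e : R) : 0 <= C -> 0 < e ->
  exists2 d, 0 < d & forall x y : R, `|x - y| < d -> C * `|x - y| `^ mu < e.
Proof.
move=> C0 e0; have [d d0 hd] := pow_small mu_gt0 C0 e0.
by exists d => // x y xy; exact: hd.
Qed.

Lemma der_gg b0 : 0 < b0 -> is_derive b0 1 gg (dgg b0).
Proof.
move=> b00; have r0 := rho_gt0.
have [h|h|->] := ltgtP b0 rho; [exact: der_gg_lt|exact: der_gg_gt|].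
have M0 : 0 <= 2 * rho by lra.
have [C C0 hC] := gg_hold mu_gt0 mu_lt rho_gt0 M0.
have rr : 0 <= rho <= 2 * rho by apply/andP; split; lra.
apply: (@derive_ext _ gg dgg rho (rho / 2)); first by lra.
- move=> t tr; rewrite ltr_norml => /andP[t1 t2].
  have [h|h|h] := ltgtP t rho.
  + by apply: der_gg_lt => //; lra.
  + exact: der_gg_gt.
  + by rewrite h eqxx in tr.
- move=> e e0; have [d d0 hd] := hold_eps C0 e0.
  exists (Num.min d rho); first by rewrite lt_min d0.
  move=> t; rewrite lt_min => /andP[t1 t2]; apply: le_lt_trans (hd _ _ t1).
  have tt : 0 <= t <= 2 * rho by move: t2; rewrite ltr_norml => /andP[? ?]; apply/andP; split; lra.
  by have [] := hC _ _ tt rr.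
- move=> e e0; have [d d0 hd] := hold_eps C0 e0.
  exists (Num.min d rho); first by rewrite lt_min d0.
  move=> t; rewrite lt_min => /andP[t1 t2]; apply: le_lt_trans (hd _ _ t1).
  have tt : 0 <= t <= 2 * rho by move: t2; rewrite ltr_norml => /andP[? ?]; apply/andP; split; lra.
  by have [] := hC _ _ tt rr.
Qed.

(* The lower boundary of the perturbed domain is the graph of - FF. *)
Definition FF b : R := gg `|b|.
Definition dFF b : R := if 0 <= b then dgg b else - dgg (- b).

Lemma FF_even b : FF (- b) = FF b. Proof. by rewrite /FF normrN. Qed.

Lemma dFF_odd b : dFF (- b) = - dFF b.
Proof.
rewrite /dFF oppr_ge0 opprK; have [h|h|->] := ltgtP b 0 => //; first by rewrite opprK.
by rewrite oppr0 dgg0 oppr0.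
Qed.

Lemma norm_abs_le (x y : R) : `| `|x| - `|y| | <= `|x - y|.
Proof. exact: ler_dist_dist. Qed.

(** Points on opposite sides of 0 are compared through 0, where [dgg] vanishes; this costs the
    factor 2. *)
Lemma FF_hold M : 0 <= M -> exists2 C, 0 <= C & forall b1 b2, `|b1| <= M -> `|b2| <= M ->
  `|FF b1 - FF b2| <= C * `|b1 - b2| `^ mu /\ `|dFF b1 - dFF b2| <= C * `|b1 - b2| `^ mu.
Proof.
move=> M0; have [C C0 hC] := gg_hold mu_gt0 mu_lt rho_gt0 M0.
have mono (x y : R) : 0 <= x -> x <= y -> C * x `^ mu <= C * y `^ mu.
  move=> x0 xy; rewrite ler_wpM2l// ge0_ler_powR ?nnegrE ?(ltW mu_gt0)//.
  exact: le_trans xy.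
exists (2 * C); first by lra.
have key b1 b2 : `|b1| <= M -> `|b2| <= M -> b1 <= b2 ->
   `|dFF b1 - dFF b2| <= 2 * C * `|b1 - b2| `^ mu.
  move=> h1 h2 bb.
  have X0 : 0 <= C * `|b1 - b2| `^ mu by rewrite mulr_ge0 ?powR_ge0.
  have [b10|b10] := leP 0 b1.
    have b20 : 0 <= b2 by lra.
    rewrite /dFF b10 b20.
    have n1 : 0 <= b1 <= M by rewrite b10 -[b1]ger0_norm.
    have n2 : 0 <= b2 <= M by rewrite b20 -[b2]ger0_norm.
    have [_ h] := hC _ _ n1 n2.
    by move: X0 h; lra.
  have n1 : 0 <= - b1 <= M by move: h1; rewrite ltr0_norm// => ->; rewrite andbT; lra.
  have [b20|b20] := leP 0 b2.
    have n2 : 0 <= b2 <= M by rewrite b20; move: h2; rewrite ger0_norm.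
    have n0 : 0 <= (0 : R) <= M by rewrite lexx.
    have [_ k1] := hC _ _ n1 n0; have [_ k2] := hC _ _ n2 n0.
    rewrite dgg0 !subr0 in k1 k2.
    have e1 : C * `|- b1| `^ mu <= C * `|b1 - b2| `^ mu.
      by apply: mono => //; rewrite normrN ltr0_norm// ler0_norm; lra.
    have e2 : C * `|b2| `^ mu <= C * `|b1 - b2| `^ mu.
      by apply: mono => //; rewrite ger0_norm// ler0_norm; lra.
    rewrite /dFF (lt_geF b10) b20.
    have := ler_normB (- dgg (- b1)) (dgg b2); rewrite normrN.
    by move: k1 k2 e1 e2; lra.
  have n2 : 0 <= - b2 <= M by move: h2; rewrite ltr0_norm// => ->; rewrite andbT; lra.
  have [_ h] := hC _ _ n1 n2.
  rewrite /dFF (lt_geF b10) (lt_geF b20) -opprD normrN.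
  have e1 : - b1 - - b2 = - (b1 - b2) by ring.
  by rewrite e1 normrN in h; move: X0 h; lra.
move=> b1 b2 h1 h2; split.
  have n1 : 0 <= `|b1| <= M by rewrite normr_ge0.
  have n2 : 0 <= `|b2| <= M by rewrite normr_ge0.
  have [h _] := hC _ _ n1 n2; rewrite /FF; apply: le_trans h _.
  apply: le_trans (mono _ _ (normr_ge0 _) (norm_abs_le b1 b2)) _.
  have : 0 <= C * `|b1 - b2| `^ mu by rewrite mulr_ge0 ?powR_ge0.
  by rewrite -mulrA; lra.
have [bb|/ltW bb] := leP b1 b2; first exact: key.
by rewrite distrC (distrC b1); exact: key.
Qed.

Lemma der_FF b : is_derive b 1 FF (dFF b).
Proof.
have pos b0 : 0 < b0 -> is_derive b0 1 FF (dFF b0).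
  move=> b00; have := der_gg b00; rewrite /dFF (ltW b00).
  apply: near_eq_is_derive => //.
  by have := @lt_nbhsr _ _ _ b00; apply: filterS => t t0; rewrite /FF gtr0_norm.
have neg b0 : b0 < 0 -> is_derive b0 1 FF (dFF b0).
  move=> b00; have nb : 0 < - b0 by lra.
  have dn : is_derive b0 1 (fun s : R => - s) (- 1) by apply: is_derive_eq.
  have := @is_derive1_comp _ FF (fun s : R => - s) _ _ _ (pos _ nb) dn.
  rewrite dFF_odd mulrN1 opprK.
  by have -> : FF \o (fun s : R => - s) = FF by apply/funext => s /=; exact: FF_even.
have [h|h|->] := ltgtP b 0; [exact: neg|exact: pos|].
have [C C0 hC] := FF_hold ler01.
apply: (@derive_ext _ FF dFF 0 1 ltr01).
- by move=> t t0 _; have [h|h|h] := ltgtP t 0; [exact: neg|exact: pos|rewrite h eqxx in t0].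
- move=> e e0; have [d d0 hd] := hold_eps C0 e0.
  exists (Num.min d 1); first by rewrite lt_min d0/=.
  move=> t; rewrite lt_min subr0 => /andP[t1 t2].
  have [||h _] := hC t 0; [exact: ltW|by rewrite normr0|].
  by apply: le_lt_trans h _; apply: hd; rewrite subr0.
- move=> e e0; have [d d0 hd] := hold_eps C0 e0.
  exists (Num.min d 1); first by rewrite lt_min d0/=.
  move=> t; rewrite lt_min subr0 => /andP[t1 t2].
  have [||_ h] := hC t 0; [exact: ltW|by rewrite normr0|].
  by apply: le_lt_trans h _; apply: hd; rewrite subr0.
Qed.

(** The first term bounds the slope for rho <= b <= 1, where kap + rho^2 / b^2 <= 3. The second one
    is for b < rho: there |z^2 + rho^2| <= 2 rho^2 and the parts of [WW] are at most 6 and 2, so p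
    and q are at most 8 (2 rho^2)^mu, and p^2 / q <= (3 / mu) p by [cone]. *)
Definition slope_bd : R := 3 * (mu * pi) + 8 * (1 + 3 / mu) * (2 * rho ^+ 2) `^ mu.

Lemma slope_bd_ge0 : 0 <= slope_bd.
Proof.
have m0 := mu_gt0; have p0 := pi_gt0 R.
rewrite /slope_bd addr_ge0 ?mulr_ge0 ?powR_ge0 ?(ltW m0) ?(ltW p0)//.
by rewrite addr_ge0// divr_ge0// ltW.
Qed.

Lemma dgg_small b : 0 <= b -> b <= 1 -> `|dgg b| <= slope_bd.
Proof.
have m0 := mu_gt0; have m1 := mu_lt; have r0 := rho_gt0; have p0 := pi_gt0 R.
have k1 := kap_gt1 m0.
have k2 : kap <= 2 by rewrite /kap; lra.
have T1 : 0 <= 3 * (mu * pi) by rewrite !mulr_ge0 ?(ltW m0) ?(ltW p0).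
have T2 : 0 <= 8 * (1 + 3 / mu) * (2 * rho ^+ 2) `^ mu.
  by rewrite !mulr_ge0 ?powR_ge0// addr_ge0// divr_ge0// ltW.
rewrite le_eqVlt => /orP[/eqP<- _|b0 b1]; first by rewrite dgg0 normr0 slope_bd_ge0.
have [br|rb] := ltP b rho; last first.
  rewrite /dgg ltNge rb/=; move: rb; rewrite le_eqVlt => /orP[/eqP<-|rb].
    by have [_ [_ [_ ->]]] := PPr rho m0; rewrite normr0 slope_bd_ge0.
  have [_ [q0 ->]] := p0_gt m0 m1 r0 rb.
  have [_ sp] := cs_mupi m0 m1.
  have S1 : sS rho 0 b `^ mu <= 1.
    have -> : 1 = 1 `^ mu :> R by rewrite powR1.
    apply: ge0_ler_powR; rewrite ?nnegrE ?(ltW m0)//.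
      by rewrite mulr_ge0 ?nrm_ge0.
    rewrite sS0E ?(ltW rb)//.
    have : b ^+ 2 <= 1 by rewrite expr_le1// ltW.
    have := sqr_ge0 rho; lra.
  have sl : sin (mu * pi) <= mu * pi.
    have := sin_lip (mu * pi) 0; rewrite sin0 !subr0 => h.
    by apply: le_trans (ler_norm _) (le_trans h _); rewrite gtr0_norm// mulr_gt0.
  have r1 : rho ^+ 2 / b ^+ 2 <= 1.
    by rewrite ler_pdivrMr ?exprn_gt0// mul1r ler_pXn2r// ?nnegrE ltW.
  have r2 : 0 <= rho ^+ 2 / b ^+ 2 by rewrite divr_ge0 ?sqr_ge0.
  rewrite ger0_norm; last first.
    by rewrite !mulr_ge0 ?powR_ge0 ?(ltW sp)//; lra.
  apply: (@le_trans _ _ (3 * (mu * pi))); last by rewrite /slope_bd; lra.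
  rewrite [leRHS]mulrC; apply: ler_pM => //.
  - by rewrite mulr_ge0 ?powR_ge0 ?(ltW sp).
  - by lra.
  - by rewrite -[leRHS]mul1r; apply: ler_pM; rewrite ?powR_ge0 ?(ltW sp).
  - by lra.
have [pp qp pq] := cone m0 m1 r0 b0 br.
have := gamma_facts m0 m1 r0 b0 br; have := gamma_W m0 m1 r0 b0 br; have := alpha_reg m0 m1 r0 b0 br.
rewrite /dgg br; move: pp qp pq; set a := alpha b => pp qp pq reg W1b [a0 Nr _ _ Sle].
have N0 := NN_pos b a0.
have [w1 w2] := W_pos r0 a0 b0 (ltW reg).
have rN : rho ^+ 2 / NN a b <= 2.
  rewrite ler_pdivrMr//; apply: le_trans (ltW reg) _; by rewrite ler_pM2r.
have rN0 : 0 <= rho ^+ 2 / NN a b by rewrite divr_ge0 ?sqr_ge0// ltW.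
have b2N : b ^+ 2 / NN a b <= 1.
  by rewrite ler_pdivrMr// mul1r /NN lerDr sqr_ge0.
have W1u : (WW mu rho a b).1 <= 6.
  apply: le_trans W1b _.
  have -> : 3 * rho ^+ 2 * b ^+ 2 / NN a b ^+ 2 = 3 * ((rho ^+ 2 / NN a b) * (b ^+ 2 / NN a b)).
    by field; rewrite gt_eqF.
  have : (rho ^+ 2 / NN a b) * (b ^+ 2 / NN a b) <= 2 * 1.
    by apply: ler_pM => //; rewrite divr_ge0 ?sqr_ge0// ltW.
  lra.
have W2u : (WW mu rho a b).2 <= 2.
  have -> : (WW mu rho a b).2 = (rho ^+ 2 / NN a b) * (2 * a * b / NN a b).
    by rewrite /WW/=; field; rewrite gt_eqF.
  have h : 2 * a * b / NN a b <= 1.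
    by rewrite ler_pdivrMr// mul1r /NN; have := sqr_ge0 (a - b); lra.
  rewrite -[leRHS]mulr1; apply: ler_pM => //.
  by rewrite divr_ge0 ?(ltW N0)// !mulr_ge0// ltW.
have S0 := sS_gt0 rho b a0.
have SP : sS rho a b `^ mu <= (2 * rho ^+ 2) `^ mu.
  apply: ge0_ler_powR; rewrite ?nnegrE ?(ltW m0) ?(ltW S0)//.
    by rewrite mulr_ge0 ?sqr_ge0.
  by lra.
set T := (2 * rho ^+ 2) `^ mu in SP T2 *.
have Sm0 : 0 <= sS rho a b `^ mu := powR_ge0 _ _.
have bd x y (c s : R) : `|c| <= 1 -> `|s| <= 1 -> 0 <= x -> x <= 6 -> 0 <= y -> y <= 2 ->
    sS rho a b `^ mu * (c * x + s * y) <= 8 * T.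
  rewrite !ler_norml => /andP[c1 c2] /andP[s1 s2] x0 x6 y0 y2.
  rewrite mulrC.
  have h : c * x + s * y <= 8.
    have : c * x <= 1 * x by rewrite ler_wpM2r.
    have : s * y <= 1 * y by rewrite ler_wpM2r.
    lra.
  apply: (@le_trans _ _ (8 * sS rho a b `^ mu)); first by rewrite ler_wpM2r.
  by rewrite ler_wpM2l.
have cb (t : R) : `|cos t| <= 1 by rewrite ler_norml cos_geN1 cos_le1.
have sb (t : R) : `|sin t| <= 1 by rewrite ler_norml sin_geN1 sin_le1.
have pu : p a b <= 8 * T.
  rewrite p_polar -mulNr; apply: bd => //; rewrite ?normrN ?(ltW w1) ?(ltW w2)//.
have qu : q a b <= 8 * T.
  rewrite q_polar addrC; apply: bd => //; rewrite ?(ltW w1) ?(ltW w2)//.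
have pqu : p a b ^+ 2 / q a b <= 3 / mu * p a b.
  by rewrite ler_pdivrMr// expr2 mulrAC ler_pM2r.
have m3 : 0 < 3 / mu by rewrite divr_gt0.
have : 3 / mu * p a b <= 3 / mu * (8 * T) by rewrite ler_pM2l.
have q2 : 0 <= p a b ^+ 2 / q a b by rewrite divr_ge0 ?sqr_ge0// ltW.
move=> h; rewrite ger0_norm; last by rewrite addr_ge0// ltW.
rewrite /slope_bd -/T.
clear -h pqu qu T1; lra.
Qed.

(** FF vanishes at rho because PP vanishes at i rho; over an interval of length at most 1 the slope
    bound then bounds the values. *)
Lemma FF_small b : rho <= 1 -> `|b| <= 1 -> `|FF b| <= slope_bd /\ `|dFF b| <= slope_bd.
Proof.
move=> r1 b1; have r0 := rho_gt0.
have dsm t : `|t| <= 1 -> `|dFF t| <= slope_bd.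
  move=> t1; rewrite /dFF; have [t0|t0] := leP 0 t.
    by apply: dgg_small => //; rewrite -(ger0_norm t0).
  by rewrite normrN; apply: dgg_small; [lra|rewrite -(ltr0_norm t0)].
split; last exact: dsm.
rewrite /FF -[ `|b|]normr_id -/(FF `|b|).
have Fr : FF rho = 0.
  by rewrite /FF gtr0_norm// /gg alpha_ge//; have [-> _] := PPr rho mu_gt0; rewrite oppr0.
have b0 := normr_ge0 b.
have key x y : 0 <= x -> x < y -> y <= 1 -> `|FF y - FF x| <= slope_bd.
  move=> x0 xy y1.
  have hc : {within `[x, y], continuous FF}.
    by apply: derivable_within_continuous => t _; have h := der_FF t; exact: ex_derive.
  have [t /andP[t1 t2] ->] := MVT_ex xy (fun t _ => der_FF t) hc.
  rewrite normrM -[leRHS]mulr1; apply: ler_pM => //.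
    by apply: dsm; rewrite ler_norml; apply/andP; split; lra.
  by rewrite ler_norml; apply/andP; split; lra.
have [rb|br|eb] := ltgtP rho `|b|; last by rewrite -eb Fr normr0 slope_bd_ge0.
- by rewrite -[FF _]subr0 -Fr; apply: key => //; exact: ltW.
- by rewrite -normrN -[- FF _]add0r -Fr; apply: key.
Qed.

End EvenExtension.

(** * The model away from the pole *)

Section Outer.
Context {R : realType} (mu rho : R).
Hypothesis (mu_gt0 : 0 < mu) (mu_lt : mu < 1 / 320) (rho_gt0 : 0 < rho) (rho_lt : rho < 1 / 4).
Implicit Types (a b : R).
Notation A := (A mu rho).
Notation B := (B mu rho).
Notation p := (p mu rho).
Notation q := (q mu rho).
Notation kap := (kap mu).

Lemma nrm_opp a b : nrm a (- b) = nrm a b.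
Proof. by rewrite /nrm sqrrN. Qed.

Lemma psi_opp a b : psi rho a (- b) = - psi rho a b.
Proof.
rewrite /psi opprD -!argN addrC; congr (arg a _ + arg a _); ring.
Qed.

Lemma sS_opp a b : sS rho a (- b) = sS rho a b.
Proof.
rewrite /sS mulrC -[- b - rho]opprD nrm_opp; congr (_ * _).
by rewrite -[- b + rho]opprK nrm_opp; congr nrm; ring.
Qed.

Lemma model_sym a b : [/\ A a (- b) = A a b, B a (- b) = - B a b,
  p a (- b) = p a b & q a (- b) = - q a b].
Proof.
have e : NN a (- b) = NN a b by rewrite /NN sqrrN.
rewrite !A_polar !B_polar !p_polar !q_polar psi_opp sS_opp mulrN cosN sinN /ZZ /WW e sqrrN /=.
by split; ring.
Qed.

Lemma pi_lt4 : pi < 4 :> R.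
Proof. by have := pihalf_lt2 R; lra. Qed.

Lemma psi_le a b : `|mu * psi rho a b| <= 4 * mu.
Proof.
have m0 := mu_gt0; have p4 := pi_lt4.
have /andP[l1 u1] := arg_bound a (b + rho); have /andP[l2 u2] := arg_bound a (b - rho).
have : `|psi rho a b| <= 4 by rewrite ler_norml /psi; apply/andP; split; lra.
by rewrite normrM (gtr0_norm m0) [4 * _]mulrC ler_pM2l.
Qed.

(** From ln y <= y - 1 at s and at 1 / s, -15 <= ln s <= 99. As mu < 1 / 320, the exponent t = mu ln
    s is below 1 / 2, where exp t <= 1 / (1 - t) <= 2 gives a linear bound. *)
Lemma powR_near1 s : 1 / 16 <= s -> s <= 100 -> `|s `^ mu - 1| <= 200 * mu.
Proof.
have m0 := mu_gt0; have m1 := mu_lt.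
move=> s1 s2; have s0 : 0 < s by lra.
have l1 : ln s <= 99.
  have e : 1 + (s - 1) = s by ring.
  have := @le_ln1Dx R (s - 1); rewrite e => h.
  by apply: le_trans (h _) _; lra.
have l2 : - 15 <= ln s.
  have si : 0 < s^-1 by rewrite invr_gt0.
  have e : 1 + (s^-1 - 1) = s^-1 by ring.
  have := @le_ln1Dx R (s^-1 - 1); rewrite e lnV ?posrE// => h.
  have : s^-1 <= 16 by rewrite -[leLHS]div1r ler_pdivrMr//; lra.
  have : - ln s <= s^-1 - 1 by apply: h; lra.
  by lra.
have -> : s `^ mu = expR (mu * ln s) by rewrite /powR gt_eqF.
have t1 : mu * ln s <= mu * 99 by rewrite ler_pM2l.
have t2 : mu * - 15 <= mu * ln s by rewrite ler_pM2l.
set t := mu * ln s in t1 t2 *.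
have e1 := expR_ge1Dx t.
have e2 := expR_ge1Dx (- t).
rewrite expRN in e2.
have t3 : t <= 1 / 2 by lra.
have E0 := expR_gt0 t.
have e3 : expR t * (1 - t) <= 1.
  have : expR t * (1 - t) <= expR t * (expR t)^-1 by rewrite ler_pM2l.
  by rewrite mulfV// gt_eqF.
rewrite ler_norml; apply/andP; split; first by lra.
have [tn|tp] := leP t 0.
  have : expR t <= 1 by rewrite expR_le1.
  by lra.
have : expR t <= 2.
  have : expR t * (1 / 2) <= expR t * (1 - t) by rewrite ler_pM2l//; lra.
  by lra.
move=> E2.
have : expR t * t <= 2 * t by rewrite ler_pM2r.
by lra.
Qed.

Lemma cos_near1 (t : R) : `|cos t - 1| <= `|t| /\ `|sin t| <= `|t|.
Proof.
have := cos_lip t 0; rewrite cos0 subr0 => h.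
by have := sin_lip t 0; rewrite sin0 !subr0 => h'.
Qed.

(** At distance at least 1 / 2 from the pole the factor [EE] is within O(mu) of 1, and [ZZ] and [WW]
    are within O(rho^2) of z and O(mu + rho^2) of 1. The constant 4000 is a common upper bound. *)
Lemma outer a b : 0 <= a -> a <= 4 -> `|b| <= 4 -> 1 / 4 <= NN a b ->
  [/\ `|A a b - a| <= 4000 * (mu + rho ^+ 2), `|B a b - b| <= 4000 * (mu + rho ^+ 2),
      `|p a b - 1| <= 4000 * (mu + rho ^+ 2) & `|q a b| <= 4000 * (mu + rho ^+ 2)].
Proof.
have m0 := mu_gt0; have m1 := mu_lt; have r0 := rho_gt0; have r1 := rho_lt.
move=> a0 a4 b4 N4.
have N0 : 0 < NN a b by lra.
have [lb ub] : - 4 <= b /\ b <= 4 by move: b4; rewrite ler_norml => /andP[].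
have S2 := sqr_sS rho a b.
have R2 : rho ^+ 2 <= 1 / 16.
  have -> : 1 / 16 = (1 / 4) ^+ 2 :> R by field.
  by rewrite ler_pXn2r// ?nnegrE ?ltW.
have R0 : 0 < rho ^+ 2 by rewrite exprn_gt0.
have Sp : 0 <= sS rho a b by rewrite mulr_ge0 ?nrm_ge0.
have a2 : a ^+ 2 <= 16.
  have -> : 16 = 4 ^+ 2 :> R by field.
  by rewrite ler_pXn2r// nnegrE.
have b2 : b ^+ 2 <= 16.
  have -> : 16 = 4 ^+ 2 :> R by field.
  by rewrite -[b ^+ 2]real_normK ?num_real// ler_pXn2r// nnegrE ?normr_ge0.
have [a20 b20] := (sqr_ge0 a, sqr_ge0 b).
have S16 : 1 / 16 <= sS rho a b.
  have n16 : 0 <= 1 / 16 :> R by rewrite divr_ge0.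
  have D0 : 0 <= NN a b - rho ^+ 2 by clear -R2 N4; lra.
  have D1 : 1 / 16 <= NN a b - rho ^+ 2 by clear -R2 N4; lra.
  rewrite -(ler_pXn2r (n := 2))// S2; apply: (@le_trans _ _ ((NN a b - rho ^+ 2) ^+ 2)).
    by rewrite ler_pXn2r.
  rewrite lerDl; have -> : 4 * rho ^+ 2 * a ^+ 2 = (2 * rho * a) ^+ 2 by ring.
  exact: sqr_ge0.
have S100 : sS rho a b <= 100.
  have n100 : 0 <= (100 : R) := ler0n _ 100.
  have n32 : 0 <= (32 : R) := ler0n _ 32.
  have D0 : 0 <= NN a b - rho ^+ 2 by clear -R2 N4; lra.
  have D1 : NN a b - rho ^+ 2 <= 32 by rewrite /NN; clear -a2 b2 R0; lra.
  rewrite -(ler_pXn2r (n := 2))// S2.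
  have h1 : (NN a b - rho ^+ 2) ^+ 2 <= 32 ^+ 2 by rewrite ler_pXn2r.
  have h2 : rho ^+ 2 * a ^+ 2 <= 1 * 16 by apply: ler_pM => //; [exact: ltW|apply: (le_trans R2); lra].
  by rewrite -mulrA; clear -h1 h2; lra.
have E1 := powR_near1 S16 S100.
have Ps := psi_le a b.
have [c1 s1] := cos_near1 (mu * psi rho a b).
move: E1 c1 s1; set s := _ `^ mu; set c := cos _; set z := sin _ => E1 c1 s1.
have s2 : `|s| <= 2 by have := ler_normD (s - 1) 1; rewrite subrK normr1; clear -E1 m1; lra.
have X1 : `|s * c - 1| <= 300 * mu.
  have -> : s * c - 1 = s * (c - 1) + (s - 1) by ring.
  apply: le_trans (ler_normD _ _) _; rewrite normrM.
  have : `|s| * `|c - 1| <= 2 * (4 * mu) by apply: ler_pM => //; exact: le_trans Ps.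
  by clear -m0 E1; lra.
have X2 : `|s * z| <= 8 * mu.
  rewrite normrM; have : `|s| * `|z| <= 2 * (4 * mu) by apply: ler_pM => //; exact: le_trans Ps.
  by clear -m0 r0; lra.
have rN : 0 < rho ^+ 2 / NN a b <= 4 * rho ^+ 2.
  rewrite divr_gt0//= ler_pdivrMr//.
  have : 4 * rho ^+ 2 * (1 / 4) <= 4 * rho ^+ 2 * NN a b by rewrite ler_pM2l// mulr_gt0.
  by clear -m0 r0; lra.
have /andP[rN0 rN4] := rN; set d := rho ^+ 2 / NN a b in rN0 rN4 rN.
have d1 : d <= 1 / 4 by clear -m0 rN4 R2; lra.
have Z1 : `|(ZZ rho a b).1 - a| <= 16 * rho ^+ 2.
  rewrite /ZZ/= -/d mulrDr mulr1 addrAC subrr add0r normrM (ger0_norm a0) (gtr0_norm rN0).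
  have : a * d <= 4 * (4 * rho ^+ 2) by apply: ler_pM => //; exact: ltW.
  by clear -m0 r0; lra.
have Z2 : `|(ZZ rho a b).2 - b| <= 16 * rho ^+ 2.
  rewrite /ZZ/= -/d mulrBr mulr1 addrAC subrr add0r normrN normrM (gtr0_norm rN0).
  have : `|b| * d <= 4 * (4 * rho ^+ 2) by apply: ler_pM => //; exact: ltW.
  by clear -m0 r0; lra.
have W1 : `|(WW mu rho a b).1 - 1| <= 2 * mu + 4 * rho ^+ 2.
  rewrite /WW/=.
  have -> : kap - rho ^+ 2 * (a ^+ 2 - b ^+ 2) / NN a b ^+ 2 - 1 =
    2 * mu - d * ((a ^+ 2 - b ^+ 2) / NN a b) by rewrite /d /kap; field; rewrite gt_eqF.
  apply: le_trans (ler_normB _ _) _; rewrite [ `|2 * mu| ]gtr0_norm; last by rewrite mulr_gt0.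
  rewrite normrM (gtr0_norm rN0).
  have h : `|(a ^+ 2 - b ^+ 2) / NN a b| <= 1.
    rewrite normrM normfV (gtr0_norm N0) ler_pdivrMr// mul1r ler_norml /NN.
    by clear -m0 r0 a20 b20; apply/andP; split; lra.
  have : d * `|(a ^+ 2 - b ^+ 2) / NN a b| <= d * 1 by rewrite ler_pM2l.
  by clear -m0 rN4; lra.
have W2 : `|(WW mu rho a b).2| <= 4 * rho ^+ 2.
  have -> : (WW mu rho a b).2 = d * (2 * a * b / NN a b) by rewrite /WW/= /d; field; rewrite gt_eqF.
  rewrite normrM (gtr0_norm rN0).
  have h : `|2 * a * b / NN a b| <= 1.
    rewrite normrM normfV (gtr0_norm N0) ler_pdivrMr// mul1r ler_norml /NN.
    by have := sqr_ge0 (a - b); have := sqr_ge0 (a + b); clear -m0 r0 => h1 h2; apply/andP; split; lra.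
  have : d * `|2 * a * b / NN a b| <= d * 1 by rewrite ler_pM2l.
  by clear -m0 rN4; lra.
have comb (x y u v u0 v0 w : R) : `|x - 1| <= 300 * mu -> `|y| <= 8 * mu -> `|u - u0| <= w -> `|v - v0| <= w ->
   `|u0| <= 4 -> `|v0| <= 4 -> w <= 1 ->
   `|x * u + y * v - u0| <= w + 2000 * mu.
  clear -m0.
  move=> hx hy hu hv hu0 hv0 w1.
  have -> : x * u + y * v - u0 = (x - 1) * u + (u - u0) + y * v by ring.
  have u5 : `|u| <= 5 by have := ler_normD (u - u0) u0; rewrite subrK; lra.
  have v5 : `|v| <= 5 by have := ler_normD (v - v0) v0; rewrite subrK; lra.
  have k1 : `|(x - 1) * u| <= 300 * mu * 5 by rewrite normrM; apply: ler_pM.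
  have k2 : `|y * v| <= 8 * mu * 5 by rewrite normrM; apply: ler_pM.
  have := ler_normD ((x - 1) * u + (u - u0)) (y * v).
  have := ler_normD ((x - 1) * u) (u - u0).
  lra.
have X2n : `|- (s * z)| <= 8 * mu by rewrite normrN.
have an4 : `|a| <= 4 by rewrite ger0_norm.
have W1' : `|(WW mu rho a b).1 - 1| <= 2 * mu + 4 * rho ^+ 2 by [].
have W2' : `|(WW mu rho a b).2 - 0| <= 2 * mu + 4 * rho ^+ 2 by rewrite subr0; clear -W2 m0 r0; lra.
have n14 : `|1 : R| <= 4 by rewrite normr1 ler1n.
have n04 : `|0 : R| <= 4 by rewrite normr0.
split.
- have -> : A a b = s * c * (ZZ rho a b).1 + - (s * z) * (ZZ rho a b).2.
    by rewrite A_polar -/s -/c -/z; ring.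
  by have := comb _ _ _ _ _ _ _ X1 X2n Z1 Z2 an4 b4; clear -R2 m0 R0; lra.
- have -> : B a b = s * c * (ZZ rho a b).2 + s * z * (ZZ rho a b).1.
    by rewrite B_polar -/s -/c -/z; ring.
  by have := comb _ _ _ _ _ _ _ X1 X2 Z2 Z1 b4 an4; clear -R2 m0 R0; lra.
- have -> : p a b = s * c * (WW mu rho a b).1 + - (s * z) * (WW mu rho a b).2.
    by rewrite p_polar -/s -/c -/z; ring.
  by have := comb _ _ _ _ _ _ _ X1 X2n W1' W2' n14 n04; clear -R2 m0 R0 m1; lra.
- have -> : q a b = s * c * (WW mu rho a b).2 + s * z * (WW mu rho a b).1.
    by rewrite q_polar -/s -/c -/z; ring.
  by have := comb _ _ _ _ _ _ _ X1 X2 W2' W1' n04 n14; rewrite subr0; clear -R2 m0 R0 m1; lra.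
Qed.

End Outer.

(** * Regularity up to the boundary *)

Section Taylor.
Context {R : realType}.
Implicit Types (S : set (R * R)) (g w : R * R -> R) (be C : R).

(* Differentiability on a set that need not be open: g1 and g2 play the role of
   the partial derivatives through the Taylor estimate. *)
Definition tay be S (g g1 g2 : R * R -> R) := [/\ hold be S g, hold be S g1, hold be S g2 &
  exists2 C, 0 <= C & forall v u, S v -> S u ->
    `|g u - g v - g1 v * (u.1 - v.1) - g2 v * (u.2 - v.2)| <= C * (`|u - v| `^ be * `|u - v|)].

Lemma tayS be S S' g g1 g2 : S' `<=` S -> tay be S g g1 g2 -> tay be S' g g1 g2.
Proof.
move=> SS [h h1 h2 [C C0 hC]]; split; [exact: holdS h|exact: holdS h1|exact: holdS h2|].
by exists C => // v u /SS Sv /SS Su; exact: hC.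
Qed.

Lemma tay_add be S f f1 f2 g g1 g2 : tay be S f f1 f2 -> tay be S g g1 g2 ->
  tay be S (fun v => f v + g v) (fun v => f1 v + g1 v) (fun v => f2 v + g2 v).
Proof.
move=> [h h1 h2 [C C0 hC]] [k k1 k2 [D D0 kD]]; split; [exact: holdD|exact: holdD|exact: holdD|].
exists (C + D); first exact: addr_ge0.
move=> v u Sv Su /=; rewrite [leRHS]mulrDl.
have := hC _ _ Sv Su; have := kD _ _ Sv Su.
set x := g u - _ - _ - _; set y := f u - _ - _ - _ => hx hy.
have -> : f u + g u - (f v + g v) - (f1 v + g1 v) * (u.1 - v.1) - (f2 v + g2 v) * (u.2 - v.2) = y + x.
  by rewrite /x /y; ring.
by apply: le_trans (ler_normD _ _) _; exact: lerD.
Qed.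

Lemma tay_opp be S f f1 f2 : tay be S f f1 f2 ->
  tay be S (fun v => - f v) (fun v => - f1 v) (fun v => - f2 v).
Proof.
move=> [h h1 h2 [C C0 hC]]; split; [exact: holdN|exact: holdN|exact: holdN|].
exists C => // v u Sv Su /=; have := hC _ _ Sv Su.
set x := f u - _ - _ - _ => hx.
have -> : - f u - - f v - - f1 v * (u.1 - v.1) - - f2 v * (u.2 - v.2) = - x by rewrite /x; ring.
by rewrite normrN.
Qed.

Lemma tay_fst be S M : 0 < be <= 1 -> 0 <= M -> (forall v, S v -> `|v.1| <= M) ->
  tay be S (fun v => v.1) (fun=> 1) (fun=> 0).
Proof.
move=> b01 M0 SM; split; [|exact: hold_cst|exact: hold_cst|].
  apply: (@hold_lip _ be S _ M 1) => //.
  by move=> v u _ _; rewrite mul1r; have [] := norm_pair (v - u).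
exists 0 => // v u _ _; rewrite mul1r mul0r subr0 subrr normr0 mul0r//.
Qed.

Definition sw (v : R * R) : R * R := (v.2, v.1).

Lemma norm_sw (v u : R * R) : `|sw v - sw u| = `|v - u|.
Proof. by rewrite !prod_normE /= maxC. Qed.

Lemma hold_sw be S g : hold be S g -> hold be (sw @^-1` S) (g \o sw).
Proof.
by move=> [C C0 h]; exists C => // v u Sv Su; have := h _ _ Sv Su; rewrite norm_sw.
Qed.

Lemma tay_sw be S g g1 g2 : tay be S g g1 g2 -> tay be (sw @^-1` S) (g \o sw) (g2 \o sw) (g1 \o sw).
Proof.
move=> [h h1 h2 [C C0 hC]]; split; [exact: hold_sw|exact: hold_sw|exact: hold_sw|].
exists C => // v u Sv Su; have := hC _ _ Sv Su; rewrite norm_sw /=.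
set x := g _ - _ - _ - _ => hx.
have -> : g (sw u) - g (sw v) - g2 (sw v) * (u.1 - v.1) - g1 (sw v) * (u.2 - v.2) = x by rewrite /x; ring.
by [].
Qed.

Lemma tay_snd be S M : 0 < be <= 1 -> 0 <= M -> (forall v, S v -> `|v.2| <= M) ->
  tay be S (fun v => v.2) (fun=> 0) (fun=> 1).
Proof.
move=> b01 M0 SM.
have := @tay_fst be (sw @^-1` S) M b01 M0.
move=> /(_ (fun v Sv => SM _ Sv))/tay_sw; apply: tayS => v Sv /=.
by rewrite /sw/=; case: v Sv.
Qed.

Lemma MVT_btw (f df : R -> R) (l r x y : R) : l <= x <= r -> l <= y <= r ->
  (forall t, l <= t <= r -> is_derive t 1 f (df t)) ->
  exists t, [/\ l <= t <= r, `|t - x| <= `|y - x| & f y - f x = df t * (y - x)].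
Proof.
move=> /andP[lx xr] /andP[ly yr] hd.
have main a b : l <= a -> b <= r -> a < b ->
    exists t, [/\ l <= t <= r, a < t < b & f b - f a = df t * (b - a)].
  move=> la br ab.
  have hd' t : a <= t <= b -> is_derive t 1 f (df t).
    by move=> /andP[? ?]; apply: hd; apply/andP; split; lra.
  have hc : {within `[a, b], continuous f}.
    by apply: derivable_within_continuous => t; rewrite in_itv/= => /hd' h; exact: ex_derive.
  have [t /andP[t1 t2] e] := MVT_ex ab (fun t (tt : a < t < b) => hd' t (introT andP (conj (ltW (proj1 (andP tt))) (ltW (proj2 (andP tt)))))) hc.
  by exists t; split => //; apply/andP; split; lra.
have [xy|yx|<-] := ltgtP x y.
- have [t [tt /andP[t1 t2] e]] := main x y lx yr xy; exists t; split => //.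
  by rewrite !gtr0_norm; lra.
- have [t [tt /andP[t1 t2] e]] := main y x ly xr yx; exists t; split => //.
    by rewrite !ltr0_norm; lra.
  by rewrite -[f y - f x]opprB e; ring.
- by exists x; rewrite lx xr !subrr mulr0.
Qed.

Definition box (M : R) : set (R * R) := [set v | `|v.1| <= M /\ 0 <= v.2 <= M].

Lemma ler_eps (x y : R) : (forall e, 0 < e -> x <= y + e) -> x <= y.
Proof.
move=> h; rewrite leNgt; apply/negP => xy.
by have := h ((x - y) / 2); rewrite divr_gt0 ?subr_gt0// => /(_ isT); lra.
Qed.

Section BoxPartials.
Context (be M : R) (g g1 g2 : R * R -> R).
Hypothesis (be01 : 0 < be <= 1) (M0 : 0 < M).
Hypothesis hg : hold be (box M) g.
Hypothesis hg1 : hold be (box M) g1.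
Hypothesis hg2 : hold be (box M) g2.
Hypothesis d1 : forall v, box M v -> 0 < v.2 -> is_derive v.1 1 (fun t => g (t, v.2)) (g1 v).
Hypothesis d2 : forall v, box M v -> 0 < v.2 -> is_derive v.2 1 (fun t => g (v.1, t)) (g2 v).

(** Lifts a point off the line v.2 = 0, where no partial derivatives are given; estimates on the
    closed box follow as t tends to 0. *)
Let up (t : R) (v : R * R) : R * R := (v.1, Num.max v.2 t).

Lemma up_box t v : 0 < t -> t <= M -> box M v ->
  [/\ box M (up t v), 0 < (up t v).2 & `|up t v - v| <= t].
Proof.
move=> t0 tM [v1 /andP[v2 v3]]; split.
- by split => //=; rewrite le_max v2/= ge_max v3 tM.
- by rewrite /= lt_max t0 orbT.
- rewrite norm_pair_le/= subrr normr0 (ltW t0)/=.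
  have [h|h] := leP v.2 t; last by rewrite subrr normr0 ltW.
  by rewrite ger0_norm; lra.
Qed.

Lemma up_dist t v u : `|up t v - up t u| <= `|v - u|.
Proof.
have [h1 h2] := norm_pair (v - u).
rewrite norm_pair_le /= h1/=; apply: le_trans h2 => /=.
have [k1|k1] := leP v.2 t; have [k2|k2] := leP u.2 t; rewrite ler_norml; apply/andP.
- by rewrite subrr oppr_le0 normr_ge0.
- have := ler_norm (u.2 - v.2); rewrite (distrC u.2); split; have := normr_ge0 (v.2 - u.2); lra.
- have := ler_norm (v.2 - u.2); split; have := normr_ge0 (v.2 - u.2); lra.
- by have := ler_norm (v.2 - u.2); have := ler_norm (u.2 - v.2); rewrite (distrC u.2); split; lra.
Qed.

(** A horizontal leg at the height of v followed by a vertical leg above u.1; both stay at positive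
    height, and the mean value theorem applies to each. *)
Lemma box_path v u : box M v -> box M u -> 0 < v.2 -> 0 < u.2 ->
  exists v1 v2, [/\ box M v1, box M v2, `|v1 - v| <= `|u - v|, `|v2 - v| <= `|u - v| &
    g u - g v = g1 v1 * (u.1 - v.1) + g2 v2 * (u.2 - v.2)].
Proof.
move=> Bv Bu v20 u20; have [v1 /andP[v2 v3]] := Bv; have [u1 /andP[u2 u3]] := Bu.
have hv : - M <= v.1 <= M by rewrite -ler_norml.
have hu : - M <= u.1 <= M by rewrite -ler_norml.
have [n1 n2] := norm_pair (u - v).
have D1 t : - M <= t <= M -> is_derive t 1 (fun t => g (t, v.2)) (g1 (t, v.2)).
  by move=> tt; apply: (d1 (v := (t, v.2))) => //=; split => //=; rewrite ?ler_norml// v2.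
pose m := Num.min v.2 u.2.
have m0 : 0 < m by rewrite lt_min v20.
have hv2 : m <= v.2 <= M by rewrite ge_min lexx v3.
have hu2 : m <= u.2 <= M by rewrite ge_min lexx orbT u3.
have D2 t : m <= t <= M -> is_derive t 1 (fun t => g (u.1, t)) (g2 (u.1, t)).
  move=> /andP[t1 t2]; have t0 : 0 < t by exact: lt_le_trans t1.
  by apply: (d2 (v := (u.1, t))) => //=; split => //=; rewrite t2 (ltW t0).
have [x [xx x1 e1]] := MVT_btw hv hu D1.
have [y [yy y1 e2]] := MVT_btw hv2 hu2 D2.
exists (x, v.2), (u.1, y); split.
- by split => //=; rewrite ?ler_norml// v2.
- by split => //=; case/andP: yy => ? ->; rewrite andbT; lra.
- rewrite norm_pair_le /= subrr normr0 normr_ge0 andbT.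
  exact: le_trans x1 n1.
- rewrite norm_pair_le /=; apply/andP; split; [exact: n1|exact: le_trans y1 n2].
- rewrite -e1 -e2; have -> : g u = g (u.1, u.2) by case: (u).
  have -> : g v = g (v.1, v.2) by case: (v).
  ring.
Qed.

Lemma box_lip L : (forall v, box M v -> `|g1 v| <= L /\ `|g2 v| <= L) ->
  forall v u, box M v -> box M u -> `|g u - g v| <= 2 * L * `|u - v|.
Proof.
move=> hL v u Bv Bu; have [C C0 hC] := hg; have [b0 _] := andP be01.
have n0 := normr_ge0 (u - v).
have core v' u' : box M v' -> box M u' -> 0 < v'.2 -> 0 < u'.2 -> `|g u' - g v'| <= 2 * L * `|u' - v'|.
  move=> Bv' Bu' v0 u0; have [w1 [w2 [Bw1 Bw2 _ _ ->]]] := box_path Bv' Bu' v0 u0.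
  have [l1 _] := hL _ Bw1; have [_ l2] := hL _ Bw2.
  have [n1 n2] := norm_pair (u' - v').
  apply: le_trans (ler_normD _ _) _; rewrite !normrM.
  have : `|g1 w1| * `|u'.1 - v'.1| <= L * `|u' - v'| by apply: ler_pM.
  have : `|g2 w2| * `|u'.2 - v'.2| <= L * `|u' - v'| by apply: ler_pM.
  lra.
have L0 : 0 <= L by have [h _] := hL _ Bv; apply: le_trans h.
apply: ler_eps => e e0.
have e2 : 0 < e / 2 by lra.
have [d d0 hd] := pow_small b0 C0 e2.
pose t := Num.min (d / 2) M.
have t0 : 0 < t by rewrite lt_min M0 andbT; lra.
have tM : t <= M by rewrite ge_min lexx orbT.
have td : t < d by apply: (@le_lt_trans _ _ (d / 2)); [rewrite ge_min lexx|lra].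
have [Bvt vt0 vt] := up_box t0 tM Bv; have [But ut0 ut] := up_box t0 tM Bu.
have [_ c1] := hC _ _ Bvt Bv; have [_ c2] := hC _ _ But Bu.
have := hd _ (normr_ge0 _) (le_lt_trans vt td); have := hd _ (normr_ge0 _) (le_lt_trans ut td).
have k := core _ _ Bvt But vt0 ut0.
have k2 : 2 * L * `|up t u - up t v| <= 2 * L * `|u - v|.
  by rewrite ler_wpM2l ?up_dist// mulr_ge0.
have -> : g u - g v = (g (up t u) - g (up t v)) - (g (up t u) - g u) + (g (up t v) - g v) by ring.
have := ler_normD ((g (up t u) - g (up t v)) - (g (up t u) - g u)) (g (up t v) - g v).
have := ler_normB (g (up t u) - g (up t v)) (g (up t u) - g u).
lra.
Qed.

(** [box_path] evaluates the partial derivatives within |u - v| of v, and their Hoelder continuity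
    turns the error into |u - v|^(1 + be). Boundary points are reached through [up]. *)
Lemma tay_box : tay be (box M) g g1 g2.
Proof.
split => //; have [b0 b1] := andP be01.
have [C C0 hC] := hg; have [C1 C10 hC1] := hg1; have [C2 C20 hC2] := hg2.
exists (C1 + C2); first exact: addr_ge0.
have core v u : box M v -> box M u -> 0 < v.2 -> 0 < u.2 ->
    `|g u - g v - g1 v * (u.1 - v.1) - g2 v * (u.2 - v.2)| <= (C1 + C2) * (`|u - v| `^ be * `|u - v|).
  move=> Bv Bu v0 u0; have [w1 [w2 [Bw1 Bw2 e1 e2 ->]]] := box_path Bv Bu v0 u0.
  have [n1 n2] := norm_pair (u - v).
  have -> : g1 w1 * (u.1 - v.1) + g2 w2 * (u.2 - v.2) - g1 v * (u.1 - v.1) - g2 v * (u.2 - v.2) =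
    (g1 w1 - g1 v) * (u.1 - v.1) + (g2 w2 - g2 v) * (u.2 - v.2) by ring.
  apply: le_trans (ler_normD _ _) _; rewrite !normrM mulrDl !mulrA.
  have mono x : 0 <= x -> x <= `|u - v| -> x `^ be <= `|u - v| `^ be.
    by move=> x0 xy; rewrite ge0_ler_powR ?nnegrE// ltW.
  apply: lerD; apply: ler_pM => //.
    have [_ h] := hC1 _ _ Bw1 Bv; apply: le_trans h _.
    by rewrite ler_wpM2l// mono.
  have [_ h] := hC2 _ _ Bw2 Bv; apply: le_trans h _.
  by rewrite ler_wpM2l// mono.
move=> v u Bv Bu; apply: ler_eps => e e0.
pose K := 2 * C + C1 * `|u - v| + C2 * `|u - v| + 2 * (C1 + C2).
have n0 := normr_ge0 (u - v).
have K0 : 0 <= K.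
  have := mulr_ge0 C10 n0; have := mulr_ge0 C20 n0; rewrite /K; lra.
have [d d0 hd] := pow_small b0 K0 e0.
pose t := Num.min (Num.min 1 (d / 2)) M.
have t0 : 0 < t by rewrite !lt_min M0 ltr01 andbT; lra.
have tM : t <= M by rewrite ge_min lexx orbT.
have t1 : t <= 1 by rewrite !ge_min lexx.
have td : t < d by apply: (@le_lt_trans _ _ (d / 2)); [rewrite !ge_min lexx orbT|lra].
have [Bvt vt0 vt] := up_box t0 tM Bv; have [But ut0 ut] := up_box t0 tM Bu.
have [[_ c1] [_ c2]] := (hC _ _ Bvt Bv, hC _ _ But Bu).
have [_ c3] := hC1 _ _ Bvt Bv; have [G2b c4] := hC2 _ _ Bvt Bv.
have mono x : 0 <= x -> x <= t -> x `^ be <= t `^ be.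
  by move=> x0 xy; rewrite ge0_ler_powR ?nnegrE// ltW// (lt_le_trans t0).
have tt : t <= t `^ be by apply: ger1_powR => //; rewrite t0.
set T := t `^ be in mono tt.
have kT : K * T < e by apply: hd => //; exact: ltW.
have {}c1 : `|g (up t v) - g v| <= C * T by apply: le_trans c1 _; rewrite ler_wpM2l ?mono.
have {}c2 : `|g (up t u) - g u| <= C * T by apply: le_trans c2 _; rewrite ler_wpM2l ?mono.
have {}c3 : `|g1 (up t v) - g1 v| <= C1 * T by apply: le_trans c3 _; rewrite ler_wpM2l ?mono.
have {}c4 : `|g2 (up t v) - g2 v| <= C2 * T by apply: le_trans c4 _; rewrite ler_wpM2l ?mono.
have k := core _ _ Bvt But vt0 ut0.
have ud := up_dist t u v.
have k2 : (C1 + C2) * (`|up t u - up t v| `^ be * `|up t u - up t v|) <= (C1 + C2) * (`|u - v| `^ be * `|u - v|).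
  rewrite ler_wpM2l ?addr_ge0//; apply: ler_pM; rewrite ?powR_ge0//.
  by rewrite ge0_ler_powR ?nnegrE// ltW.
have [n1 n2] := norm_pair (u - v).
set X := g (up t u) - _ - _ - _ in k.
have E : g u - g v - g1 v * (u.1 - v.1) - g2 v * (u.2 - v.2) =
  X - (g (up t u) - g u) + (g (up t v) - g v) + (g1 (up t v) - g1 v) * (u.1 - v.1)
  + (g2 (up t v) - g2 v) * (u.2 - v.2)
  + g2 (up t v) * (((up t u).2 - u.2) - ((up t v).2 - v.2)).
  by rewrite /X /=; ring.
rewrite E.
have f1 : `|(g1 (up t v) - g1 v) * (u.1 - v.1)| <= C1 * T * `|u - v| by rewrite normrM; apply: ler_pM.
have f2 : `|(g2 (up t v) - g2 v) * (u.2 - v.2)| <= C2 * T * `|u - v| by rewrite normrM; apply: ler_pM.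
have f3 : `|g2 (up t v) * (((up t u).2 - u.2) - ((up t v).2 - v.2))| <= C2 * (2 * T).
  rewrite normrM; apply: ler_pM => //.
  apply: le_trans (ler_normB _ _) _.
  have [_ a1] := norm_pair (up t u - u); have [_ a2] := norm_pair (up t v - v).
  apply: le_trans (lerD (le_trans a1 ut) (le_trans a2 vt)) _.
  by rewrite mulr_natl mulr2n lerD.
apply: le_trans (ler_normD _ _) _.
have h1 := ler_normD (X - (g (up t u) - g u) + (g (up t v) - g v) + (g1 (up t v) - g1 v) * (u.1 - v.1)) ((g2 (up t v) - g2 v) * (u.2 - v.2)).
have h2 := ler_normD (X - (g (up t u) - g u) + (g (up t v) - g v)) ((g1 (up t v) - g1 v) * (u.1 - v.1)).
have h3 := ler_normD (X - (g (up t u) - g u)) (g (up t v) - g v).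
have h4 := ler_normB X (g (up t u) - g u).
have kE : K * T = 2 * (C * T) + C1 * T * `|u - v| + C2 * T * `|u - v| + 2 * (C1 * T) + C2 * (2 * T) by rewrite /K; ring.
have CT : 0 <= C1 * T by rewrite mulr_ge0// powR_ge0.
clear -k k2 c1 c2 f1 f2 f3 h1 h2 h3 h4 kE CT kT; lra.
Qed.

End BoxPartials.

Section Shear.
Context (be L : R) (S S' : set (R * R)) (w w1 w2 : R * R -> R) (i : R * R -> R * R).
Hypothesis (be01 : 0 < be <= 1).
Hypothesis tw : tay be S w w1 w2.
Hypothesis w1_small : forall v, S v -> `|w1 v| <= 1 / 2.
Hypothesis iS : forall x, S' x -> S (i x).
Hypothesis iK : forall x, S' x -> ((i x).1 + w (i x), (i x).2) = x.
Hypothesis L0 : 0 <= L.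
Hypothesis i_lip : forall x y, S' x -> S' y -> `|i x - i y| <= L * `|x - y|.

(** The map i inverts the shear v -> (v.1 + w v, v.2), and the coefficients come from the chain
    rule. When both g and w are expanded, only their two Taylor remainders survive. *)
Lemma tay_shear g g1 g2 : tay be S g g1 g2 ->
  tay be S' (g \o i) (fun x => g1 (i x) / (1 + w1 (i x)))
    (fun x => g2 (i x) - g1 (i x) * w2 (i x) / (1 + w1 (i x))).
Proof.
move=> [h h1 h2 [C C0 hC]]; have [hw hw1 hw2 [D D0 hD]] := tw.
have [b0 b1] := andP be01.
have w1h v : S v -> 1 / 2 <= 1 + w1 v by move=> /w1_small; rewrite ler_norml => /andP[? ?]; lra.
have hinv : hold be S (fun v => (1 + w1 v)^-1).
  apply: (@hold_inv _ be S (fun v => 1 + w1 v) (1 / 2)) => //; apply: holdD => //.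
  exact: hold_cst.
have cmp f : hold be S f -> hold be S' (f \o i).
  by move=> hf; apply: (hold_comp _ L0 iS i_lip hf); exact: ltW.
split.
- exact: cmp.
- by apply: (cmp (fun v => g1 v / (1 + w1 v))); exact: holdM.
- apply: (cmp (fun v => g2 v - g1 v * w2 v / (1 + w1 v))); apply: holdB => //.
  by apply: holdM => //; exact: holdM.
have [E E0 hE] := h1.
pose K := C + 2 * E * D.
have K0 : 0 <= K by have := mulr_ge0 E0 D0; rewrite /K; lra.
have Lb0 : 0 <= L `^ be by exact: powR_ge0.
exists (K * (L `^ be * L)); first by rewrite mulr_ge0 ?mulr_ge0.
move=> x y Sx Sy /=.
have [Sv Su] := (iS Sx, iS Sy).
have ex := iK Sx; have ey := iK Sy.
have hi := i_lip Sy Sx.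
move: Sv Su ex ey hi; set v := i x; set u := i y => Sv Su ex ey hi.
have ex1 : x.1 = v.1 + w v by rewrite -ex.
have ex2 : x.2 = v.2 by rewrite -ex.
have ey1 : y.1 = u.1 + w u by rewrite -ey.
have ey2 : y.2 = u.2 by rewrite -ey.
have hg := hC _ _ Sv Su; have hr := hD _ _ Sv Su.
set r := w u - w v - _ - _ in hr; set rg := g u - g v - _ - _ in hg.
have p0 : 0 < 1 + w1 v by have := w1h _ Sv; lra.
have -> : g u - g v - g1 v / (1 + w1 v) * (y.1 - x.1) - (g2 v - g1 v * w2 v / (1 + w1 v)) * (y.2 - x.2)
   = rg - g1 v / (1 + w1 v) * r.
  by rewrite /rg /r ex1 ex2 ey1 ey2; field; rewrite gt_eqF.
apply: le_trans (ler_normB _ _) _.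
have q : `|g1 v / (1 + w1 v)| <= 2 * E.
  have [ge _] := hE _ _ Sv Su.
  rewrite normrM normfV (gtr0_norm p0) ler_pdivrMr//.
  apply: le_trans ge _.
  have : E * 1 <= E * (2 * (1 + w1 v)) by rewrite ler_wpM2l//; have := w1h _ Sv; lra.
  lra.
set T := `|u - v| `^ be * `|u - v| in hg hr.
have hT : T <= L `^ be * L * (`|y - x| `^ be * `|y - x|).
  have -> : L `^ be * L * (`|y - x| `^ be * `|y - x|) = (L `^ be * `|y - x| `^ be) * (L * `|y - x|) by ring.
  rewrite -powRM//; apply: ler_pM; rewrite ?powR_ge0//.
  by rewrite ge0_ler_powR ?nnegrE ?mulr_ge0// ltW.
have k : `|g1 v / (1 + w1 v) * r| <= 2 * E * (D * T) by rewrite normrM; apply: ler_pM.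
apply: (@le_trans _ _ (K * T)); last by rewrite -[leRHS]mulrA; apply: ler_wpM2l.
rewrite /K; lra.
Qed.

End Shear.

End Taylor.

(** * Smooth functions and the convex domain *)

Section Smooth.
Context {R : realType}.
Implicit Types (f g : R -> R) (t : R).

Lemma is_derive_near f g x l r : 0 < r -> (forall t, `|t - x| < r -> f t = g t) ->
  is_derive x 1 g l -> is_derive x 1 f l.
Proof.
move=> r0 fg; apply: near_eq_is_derive.
apply/nbhs_ballP; exists r => //= t; rewrite -ball_normE /= distrC => /fg ->//.
Qed.

(** The functions t^(- n) exp(- 1 / t): the linear span of this family is closed under
    differentiation. *)
Definition flat (n : nat) t : R := if 0 < t then t^-1 ^+ n * expR (- t^-1) else 0.

Lemma flat_le0 n t : t <= 0 -> flat n t = 0.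
Proof. by rewrite /flat leNgt => /negbTE ->. Qed.

Lemma flat_gt0 n t : 0 < t -> 0 < flat n t.
Proof. by move=> t0; rewrite /flat t0 mulr_gt0 ?expR_gt0// exprn_gt0 ?invr_gt0. Qed.

Lemma flat_ge0 n t : 0 <= flat n t.
Proof. by have [/flat_le0 ->//|/flat_gt0 h] := leP t 0; apply: ltW. Qed.

(** From exp s >= s^(n + 1) / (n + 1)! at s = 1 / t. It yields the derivative 0 at the origin. *)
Lemma flat_le n t : 0 < t -> flat n t <= n.+1`!%:R * t.
Proof.
move=> t0; rewrite /flat t0.
have s0 : 0 < t^-1 by rewrite invr_gt0.
have F0 : 0 < n.+1`!%:R :> R by rewrite ltr0n fact_gt0.
have := expR_ge1Dxn n (ltW s0); set s := t^-1 in s0 *.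
move=> h; have {}h : s ^+ n.+1 / n.+1`!%:R <= expR s by lra.
rewrite expRN ler_pdivrMr ?expR_gt0//.
apply: (@le_trans _ _ (n.+1`!%:R * t * (s ^+ n.+1 / n.+1`!%:R))); last first.
  by rewrite ler_wpM2l// ltW// mulr_gt0.
have -> : n.+1`!%:R * t * (s ^+ n.+1 / n.+1`!%:R) = (t * s) * s ^+ n * (n.+1`!%:R / n.+1`!%:R).
  by rewrite exprS; ring.
by rewrite /s !divff ?gt_eqF// mul1r mulr1.
Qed.

Lemma der_flat n t : is_derive t 1 (flat n) (flat n.+2 t - n%:R * flat n.+1 t).
Proof.
have [t0|t0|->] := ltgtP t 0.
- rewrite !flat_le0 ?(ltW t0)// mulr0 subr0.
  apply: (@is_derive_near (flat n) (cst 0) _ _ (- t)); first lra.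
    move=> s st; rewrite flat_le0//; have := ler_norm (s - t); lra.
- apply: (@is_derive_near (flat n) (fun s => (s^-1) ^+ n * expR (- s^-1)) _ _ t) => //.
    move=> s st; rewrite /flat ifT//; have := ler_norm (t - s); rewrite (distrC t); lra.
  have t1 : t != 0 by rewrite gt_eqF.
  have dV : is_derive t 1 (fun s : R => s^-1) (- t ^- 2).
    by have /is_derive_eq := @is_deriveV _ (@id R) t 1 1 t1 (is_derive_id _ _); apply; rewrite /GRing.scale /= mulr1.
  have dX : is_derive t 1 (fun s : R => s^-1 ^+ n) (n%:R * t^-1 ^+ n.-1 * (- t ^- 2)).
    have := @is_derive1_comp _ (fun x => x ^+ n) (fun s => s^-1) t _ _ _ dV.
    move=> /(_ (n%:R * t^-1 ^+ n.-1)) h; apply: h.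
    by apply: DeriveDef; [exact: exprn_derivable|rewrite exp_derive /GRing.scale /= mulr1].
  have dE : is_derive t 1 (fun s : R => expR (- s^-1)) (expR (- t^-1) * (t ^- 2)).
    have := @is_derive1_comp _ expR (fun s => - s^-1) t _ _ (is_derive_expR _) (is_deriveN dV).
    by move=> /is_derive_eq; apply; rewrite opprK.
  have /is_derive_eq := is_deriveM dX dE; apply; rewrite /flat t0 /= -[t ^- 2]exprVn.
  set s := t^-1; set e := expR (- s); rewrite /GRing.scale /=.
  case: (n) => [|m] /=; first by rewrite !mul0r mulr0 addr0 subr0 expr0; ring.
  by rewrite !exprS -natr1; ring.
- rewrite !flat_le0// mulr0 subr0; apply: is_derive_eps => e e0.
  have F0 : 0 < n.+2`!%:R :> R by rewrite ltr0n fact_gt0.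
  exists (e / n.+2`!%:R); first by rewrite divr_gt0.
  move=> h h0 hd; rewrite !add0r [flat n 0]flat_le0// !subr0.
  have [hn|hp] := leP h 0; first by rewrite flat_le0// mul0r normr0.
  have -> : flat n h / h = flat n.+1 h by rewrite /flat hp exprS; ring.
  rewrite ger0_norm ?flat_ge0//; apply: le_lt_trans (flat_le _ hp) _.
  by move: hd; rewrite gtr0_norm// ltr_pdivlMr// mulrC.
Qed.

(** A syntactic class closed under differentiation: smoothness follows by induction on the order,
    with no formula for higher derivatives of products or compositions. [ST_inv] and [ST_ln] ask for
    positivity on the whole line, which [smooth_trunc] arranges. *)
Inductive smooth_term : (R -> R) -> Prop :=
| ST_smooth f : smooth_function f -> smooth_term f
| ST_cst c : smooth_term (fun=> c)
| ST_id : smooth_term (fun t => t)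
| ST_flat n : smooth_term (flat n)
| ST_exp : smooth_term expR
| ST_add f g : smooth_term f -> smooth_term g -> smooth_term (fun t => f t + g t)
| ST_mul f g : smooth_term f -> smooth_term g -> smooth_term (fun t => f t * g t)
| ST_comp f g : smooth_term f -> smooth_term g -> smooth_term (fun t => f (g t))
| ST_inv f : (forall t, 0 < f t) -> smooth_term f -> smooth_term (fun t => (f t)^-1)
| ST_ln f : (forall t, 0 < f t) -> smooth_term f -> smooth_term (fun t => ln (f t)).

Lemma smooth_term_derive f : smooth_term f ->
  exists2 f', smooth_term f' & forall t, is_derive t 1 f (f' t).
Proof.
elim=> {f} [f sf|c||n||f g _ [f' sf' df] _ [g' sg' dg]|f g sf [f' sf' df] sg [g' sg' dg]
  |f g sf [f' sf' df] sg [g' sg' dg]|f f0 sf [f' sf' df]|f f0 sf [f' sf' df]].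
- exists (derive1 f).
    by apply: ST_smooth => k t; rewrite -derive1Sn; exact: sf.
  move=> t; apply: DeriveDef; [exact: (sf 0%N)|by rewrite derive1E].
- by exists (fun=> 0); [exact: ST_cst|move=> t; exact: is_derive_cst].
- by exists (fun=> 1); [exact: ST_cst|move=> t; exact: is_derive_id].
- exists (fun t => flat n.+2 t + (- n%:R) * flat n.+1 t).
    by apply: ST_add; [exact: ST_flat|apply: ST_mul; [exact: ST_cst|exact: ST_flat]].
  by move=> t; have /is_derive_eq := der_flat n t; apply; rewrite mulNr.
- by exists expR; [exact: ST_exp|move=> t; exact: is_derive_expR].
- by exists (fun t => f' t + g' t); [exact: ST_add|move=> t; exact: is_deriveD].
- exists (fun t => f t * g' t + g t * f' t); first by apply: ST_add; exact: ST_mul.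
  by move=> t; exact: is_deriveM.
- exists (fun t => f' (g t) * g' t); first by apply: ST_mul => //; exact: ST_comp.
  by move=> t; exact: (@is_derive1_comp _ f g).
- exists (fun t => (-1) * ((f t)^-1 * (f t)^-1) * f' t).
    by apply: ST_mul => //; apply: ST_mul; [exact: ST_cst|apply: ST_mul; exact: ST_inv].
  move=> t; have ft : f t != 0 by rewrite gt_eqF.
  have /is_derive_eq := is_deriveV ft (df t); apply.
  by rewrite /GRing.scale /= expr2 invfM mulN1r.
- exists (fun t => (f t)^-1 * f' t); first by apply: ST_mul => //; exact: ST_inv.
  by move=> t; have h := @is_derive1_comp _ (@ln R) f t _ _ (is_derive1_ln (f0 t)) (df t).
Qed.

Lemma smooth_termP f : smooth_term f -> smooth_function f.
Proof.
move=> sf k; elim: k f sf => [|k IH] f sf t.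
  by have [f' _ /(_ t) d] := smooth_term_derive sf; exact: ex_derive.
have [f' sf' d] := smooth_term_derive sf; rewrite derive1Sn.
have -> : derive1 f = f'; last exact: IH.
by apply/funext => s; rewrite derive1E; exact: derive_val.
Qed.

Lemma smooth_lip f M : smooth_function f -> exists2 C, 0 <= C & forall x y,
  `|x| <= M -> `|y| <= M -> [/\ `|f x| <= C, `|derive1 f x| <= C & `|f x - f y| <= C * `|x - y|].
Proof.
move=> sf.
have cb g : (forall t, derivable g t 1) -> exists2 C, 0 <= C & forall x, `|x| <= M -> `|g x| <= C.
  move=> dg; have [M0|M0] := ltP M 0.
    by exists 0 => // x xM; have := normr_ge0 x; lra.
  have cg : {within `[- M, M], continuous (fun x => `|g x|)}.
    apply: continuous_subspaceT => x; apply: cvg_norm.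
    by apply: differentiable_continuous; apply/derivable1_diffP.
  have [|c _ h] := EVT_max _ cg; first lra.
  by exists `|g c| => // x; rewrite ler_norml => xM; apply: h; rewrite in_itv.
have d0 t : derivable f t 1 by exact: (sf 0%N).
have [C1 C10 h1] := cb _ d0.
have [C2 C20 h2] := cb _ (fun t => sf 1%N t).
exists (C1 + C2); first exact: addr_ge0.
move=> x y xM yM; split.
- by apply: le_trans (h1 _ xM) _; rewrite lerDl.
- by apply: le_trans (h2 _ xM) _; rewrite lerDr.
have ix : - M <= x <= M by rewrite -ler_norml.
have iy : - M <= y <= M by rewrite -ler_norml.
have D t : - M <= t <= M -> is_derive t 1 f (derive1 f t).
  by move=> _; apply: DeriveDef => //; rewrite derive1E.
have [t [tt _ ->]] := MVT_btw iy ix D.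
rewrite normrM ler_wpM2r//; apply: (@le_trans _ _ C2); last by rewrite lerDr.
by apply: h2; rewrite ler_norml.
Qed.

(** A smooth transition from 0 on t <= 0 to 1 on t >= 1 / 2. *)
Definition step t : R := flat 0 t / (flat 0 t + flat 0 (1 / 2 - t)).

Lemma step_den t : 0 < flat 0 t + flat 0 (1 / 2 - t).
Proof.
have [t0|t0] := leP t 0.
  by apply: ltr_wpDl; [exact: flat_ge0|apply: flat_gt0; lra].
by apply: ltr_wpDr; [exact: flat_ge0|apply: flat_gt0; lra].
Qed.

Definition bump t : R := step (1 - t) * step (1 + t).

Lemma ST_sub f g : smooth_term f -> smooth_term g -> smooth_term (fun t => f t - g t).
Proof.
move=> sf sg; have := ST_add sf (ST_mul (ST_cst (-1)) sg).
by congr smooth_term; apply/funext => t; rewrite mulN1r.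
Qed.

Lemma ST_bump : smooth_term bump.
Proof.
have st : smooth_term step.
  apply: ST_mul; [exact: ST_flat|apply: ST_inv; first exact: step_den].
  apply: ST_add; [exact: ST_flat|apply: ST_comp; [exact: ST_flat|]].
  by apply: ST_sub; [exact: ST_cst|exact: ST_id].
apply: ST_mul; apply: (ST_comp st); [apply: ST_sub|apply: ST_add]; by [exact: ST_cst|exact: ST_id].
Qed.

Lemma bump_smooth : smooth_function bump.
Proof. exact/smooth_termP/ST_bump. Qed.

Lemma step01 t : 0 <= step t <= 1.
Proof.
have d := step_den t; have d' := ltW d; apply/andP; split.
  by apply: divr_ge0 => //; exact: flat_ge0.
by rewrite /step ler_pdivrMr//; have := flat_ge0 0 (1 / 2 - t); lra.
Qed.

Lemma bump01 t : 0 <= bump t <= 1.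
Proof.
have /andP[a b] := step01 (1 - t); have /andP[c d] := step01 (1 + t).
by rewrite mulr_ge0//= mulr_ile1.
Qed.

Lemma bump_even t : bump (- t) = bump t.
Proof. by rewrite /bump opprK mulrC. Qed.

Lemma bump_eq1 t : `|t| <= 1 / 2 -> bump t = 1.
Proof.
have s1 s : 1 / 2 <= s -> step s = 1.
  move=> h; rewrite /step [flat 0 (_ - _)]flat_le0; last lra.
  by rewrite addr0 divff// gt_eqF// flat_gt0//; lra.
by rewrite ler_norml => /andP[? ?]; rewrite /bump !s1 ?mulr1//; lra.
Qed.

Lemma bump_eq0 t : 1 <= `|t| -> bump t = 0.
Proof.
have s1 s : s <= 0 -> step s = 0 by move=> h; rewrite /step flat_le0 ?mul0r.
by rewrite ler_normr => /orP[h|h]; rewrite /bump; 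
  [rewrite s1 ?mul0r//|rewrite [step (1 + t)]s1 ?mulr0//]; lra.
Qed.

(** Composing with s makes a function that is positive near p positive everywhere, without changing
    it close to p. *)
Lemma smooth_trunc p d : 0 < d -> exists s : R -> R,
  [/\ smooth_term s, forall t, `|s t - p| < d & forall t, `|t - p| <= d / 2 -> s t = t].
Proof.
move=> d0; exists (fun t => p + (t - p) * bump ((t - p) * d^-1)); split.
- apply: ST_add; first exact: ST_cst.
  have sp : smooth_term (fun t => t - p) by apply: ST_sub; [exact: ST_id|exact: ST_cst].
  apply: (ST_mul sp); apply: (ST_comp ST_bump (ST_mul sp (ST_cst _))).
- move=> t; have -> : p + (t - p) * bump ((t - p) * d^-1) - p = (t - p) * bump ((t - p) * d^-1) by ring.
  have /andP[b0 b1] := bump01 ((t - p) * d^-1).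
  have [h|h] := leP d `|t - p|.
    by rewrite bump_eq0 ?mulr0 ?normr0// normrM normfV (gtr0_norm d0) ler_pdivlMr// mul1r.
  rewrite normrM (ger0_norm b0); apply: le_lt_trans h.
  by rewrite ler_piMr.
- move=> t h; rewrite bump_eq1 ?mulr1; first by ring.
  by rewrite normrM normfV (gtr0_norm d0) ler_pdivrMr//; lra.
Qed.

End Smooth.

Section Convexity.
Context {R : realType}.

Lemma incr_derive_convex (f df : R -> R) (c x y l : R) :
  (forall t : R, is_derive t 1 f (df t)) -> (forall s t, s <= t -> t <= c -> df s <= df t) ->
  x <= c -> y <= c -> 0 <= l <= 1 -> f (l * x + (1 - l) * y) <= l * f x + (1 - l) * f y.
Proof.
move=> hd hi; wlog xy : x y l / x <= y => [W xc yc l01|].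
  have [xy|yx] := leP x y; first exact: W.
  have := W y x (1 - l) (ltW yx) yc xc.
  have -> : (1 - l) * y + (1 - (1 - l)) * x = l * x + (1 - l) * y by ring.
  have -> : (1 - l) * f y + (1 - (1 - l)) * f x = l * f x + (1 - l) * f y by ring.
  by apply; case/andP: l01 => ? ?; apply/andP; split; lra.
move=> xc yc /andP[l0 l1]; set z := l * x + (1 - l) * y.
have k0 : 0 <= l * (y - x) by rewrite mulr_ge0//; lra.
have k1 : 0 <= (1 - l) * (y - x) by rewrite mulr_ge0//; lra.
have xz : x <= z by rewrite /z; lra.
have zy : z <= y by rewrite /z; lra.
have [t1 [/andP[_ t1z] _ e1]] : exists t, [/\ x <= t <= z, `|t - z| <= `|x - z| & f x - f z = df t * (x - z)].
  by apply: MVT_btw => //; rewrite ?lexx xz.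
have [t2 [/andP[t2z t2y] _ e2]] : exists t, [/\ z <= t <= y, `|t - z| <= `|y - z| & f y - f z = df t * (y - z)].
  by apply: MVT_btw => //; rewrite ?lexx zy.
have h : df t1 <= df t2 by apply: hi; lra.
have -> : l * f x + (1 - l) * f y = f z + (l * (f x - f z) + (1 - l) * (f y - f z)) by ring.
rewrite e1 e2.
have -> : l * (df t1 * (x - z)) + (1 - l) * (df t2 * (y - z)) = l * ((1 - l) * (y - x)) * (df t2 - df t1).
  by rewrite /z; ring.
by rewrite lerDl; apply: mulr_ge0; [exact: mulr_ge0|lra].
Qed.

(** The second derivative of exp(- 1 / u) is [flat 4] - 2 [flat 3] = (1 / u - 2) [flat 3],
    nonnegative up to u = 1 / 2. *)
Lemma flat_convex (x y l : R) : x <= 1 / 2 -> y <= 1 / 2 -> 0 <= l <= 1 ->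
  flat 0 (l * x + (1 - l) * y) <= l * flat 0 x + (1 - l) * flat 0 y.
Proof.
move=> x2 y2; apply: (@incr_derive_convex _ _ (1 / 2) _ _ _ (der_flat 0)) => // s t st t2.
rewrite !mul0r !subr0.
have ss : s <= s <= t by rewrite lexx.
have tt : s <= t <= t by rewrite lexx st.
have [u [/andP[_ ut] _ e]] := MVT_btw ss tt (fun t _ => der_flat 2 t).
suff : 0 <= flat 2 t - flat 2 s by lra.
rewrite e; apply: mulr_ge0; last lra.
have [u0|u0] := leP u 0; first by rewrite !flat_le0// mulr0 subrr.
have -> : flat 4 u = u^-1 * flat 3 u by rewrite /flat u0 !exprS; ring.
rewrite -mulrBl mulr_ge0 ?flat_ge0//.
have : (1 / 2)^-1 <= u^-1 by rewrite lef_pV2 ?posrE//; lra.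
lra.
Qed.

End Convexity.

(** * The stadium: a smooth convex domain with a flat edge *)

Section Domain.
Context {R : realType}.
Implicit Types (t : R) (x : R * R).

(** The factor exp 3 makes the wall reach height 1 at |t| = 7 / 3, inside the range |t| - 2 <= 1 / 2
    on which [flat 0] is convex. *)
Definition wall t : R := expR 3 * (flat 0 (t - 2) + flat 0 (- t - 2)).

(** The flat bottom edge, |x.1| <= 2 and x.2 = 0, is where the model has a = 0. *)
Definition stadium : set (R * R) := [set x | (x.2 - 1) ^+ 2 + wall x.1 < 1].

Lemma ST_wall : smooth_term wall.
Proof.
apply: ST_mul; first exact: ST_cst.
apply: ST_add; apply: (ST_comp (ST_flat 0)); apply: ST_sub; try exact: ST_cst; first exact: ST_id.
have := ST_mul (ST_cst (-1)) (@ST_id R).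
by congr smooth_term; apply/funext => t; rewrite mulN1r.
Qed.

Lemma wall_cont : continuous wall.
Proof.
move=> t; apply: differentiable_continuous; apply/derivable1_diffP.
by have := smooth_termP ST_wall; move=> /(_ 0%N t).
Qed.

Lemma wall_even t : wall (- t) = wall t.
Proof. by rewrite /wall opprK addrC. Qed.

Lemma wall_ge0 t : 0 <= wall t.
Proof. by rewrite mulr_ge0 ?expR_ge0// addr_ge0 ?flat_ge0. Qed.

Lemma wall_eq0 t : `|t| <= 2 -> wall t = 0.
Proof.
by rewrite ler_norml => /andP[? ?]; rewrite /wall !flat_le0 ?addr0 ?mulr0//; lra.
Qed.

Lemma wallE t : 2 < t -> wall t = expR (3 - (t - 2)^-1).
Proof.
move=> t2; rewrite /wall [flat 0 (- _ - _)]flat_le0; last lra.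
by rewrite addr0 /flat ifT ?expr0 ?mul1r -?expRD//; lra.
Qed.

Lemma wall_lt1 t : wall t <= 1 -> `|t| <= 7 / 3.
Proof.
have main s : 7 / 3 < s -> 1 < wall s.
  move=> h; rewrite wallE ?expR_gt1; last lra.
  have : (s - 2)^-1 < (1 / 3)^-1 by rewrite ltf_pV2 ?posrE; lra.
  lra.
move=> h; rewrite leNgt; apply/negP; rewrite lter_normr => /orP[/main|/main]; rewrite ?wall_even; lra.
Qed.

Lemma stadium_cont : continuous (fun x : R * R => (x.2 - 1) ^+ 2 + wall x.1).
Proof.
move=> x; apply: cvgD; last by apply: cvg_comp; [exact: cvg_fst|exact: wall_cont].
have h : {for x, continuous (fun y : R * R => y.2 - 1)}.
  by apply: cvgB; [exact: cvg_snd|exact: cvg_cst].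
by rewrite expr2; under eq_fun do rewrite expr2; exact: cvgM.
Qed.

Lemma stadium_open : open stadium.
Proof.
by apply: (@open_comp _ _ (fun x : R * R => (x.2 - 1) ^+ 2 + wall x.1) [set y | y < 1]);
  [move=> x _; exact: stadium_cont|exact: open_lt].
Qed.

Lemma stadium_closure x : closure stadium x -> (x.2 - 1) ^+ 2 + wall x.1 <= 1.
Proof.
pose D : set (R * R) := [set x | (x.2 - 1) ^+ 2 + wall x.1 <= 1].
have cD : closed D by apply: (@closed_comp _ _ (fun x : R * R => (x.2 - 1) ^+ 2 + wall x.1) [set y | y <= 1]);
    [move=> ? _; exact: stadium_cont|exact: closed_le].
have sD : stadium `<=` D by move=> y /= /ltW.
by move=> /(closure_subset sD); rewrite -(proj1 (closure_id _) cD).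
Qed.

Lemma stadium_bounds x : (x.2 - 1) ^+ 2 + wall x.1 <= 1 -> `|x.1| <= 7 / 3 /\ 0 <= x.2 <= 2.
Proof.
move=> h; have := wall_ge0 x.1 => w0; have s0 := sqr_ge0 (x.2 - 1); split.
  by apply: wall_lt1; lra.
by apply/andP; split; rewrite leNgt; apply/negP => h2; nra.
Qed.

Lemma stadium_pos x : stadium x -> 0 < x.2 < 2.
Proof.
rewrite /stadium /= => h; have := wall_ge0 x.1 => w0.
have e : (x.2 - 1) ^+ 2 = 1 + x.2 * (x.2 - 2) by ring.
apply/andP; split; rewrite ltNge; apply/negP => h2.
  by have : 0 <= x.2 * (x.2 - 2) by [apply: mulr_le0; lra]; lra.
by have : 0 <= x.2 * (x.2 - 2) by [apply: mulr_ge0; lra]; lra.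
Qed.

Lemma stadium_strip x : `|x.1| <= 2 -> 0 < x.2 -> x.2 < 2 -> stadium x.
Proof. by move=> h a b; rewrite /stadium/= wall_eq0// addr0; nra. Qed.

Lemma stadium_sym x : stadium x -> stadium (- x.1, x.2).
Proof. by rewrite /stadium/= wall_even. Qed.

Lemma stadium_conv x y (l : R) : stadium x -> stadium y -> 0 <= l <= 1 ->
  stadium (l * x.1 + (1 - l) * y.1, l * x.2 + (1 - l) * y.2).
Proof.
move=> Sx Sy l01; have [l0 l1] := andP l01.
have [/ler_normlP[x1 x2] _] := stadium_bounds (ltW Sx).
have [/ler_normlP[y1 y2] _] := stadium_bounds (ltW Sy).
move: Sx Sy; rewrite /stadium /= => Sx Sy.
have k1 : flat 0 (l * (x.1 - 2) + (1 - l) * (y.1 - 2)) <=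
   l * flat 0 (x.1 - 2) + (1 - l) * flat 0 (y.1 - 2) by apply: flat_convex => //; lra.
have k2 : flat 0 (l * (- x.1 - 2) + (1 - l) * (- y.1 - 2)) <=
   l * flat 0 (- x.1 - 2) + (1 - l) * flat 0 (- y.1 - 2) by apply: flat_convex => //; lra.
have E1 : l * (x.1 - 2) + (1 - l) * (y.1 - 2) = l * x.1 + (1 - l) * y.1 - 2 by ring.
have E2 : l * (- x.1 - 2) + (1 - l) * (- y.1 - 2) = - (l * x.1 + (1 - l) * y.1) - 2 by ring.
rewrite E1 in k1; rewrite E2 in k2.
have k3 : wall (l * x.1 + (1 - l) * y.1) <= l * wall x.1 + (1 - l) * wall y.1.
  have -> : l * wall x.1 + (1 - l) * wall y.1 = expR 3 * (l * flat 0 (x.1 - 2) + (1 - l) * flat 0 (y.1 - 2)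
    + (l * flat 0 (- x.1 - 2) + (1 - l) * flat 0 (- y.1 - 2))) by rewrite /wall; ring.
  by rewrite /wall ler_wpM2l ?expR_ge0// lerD.
have k4 : (l * x.2 + (1 - l) * y.2 - 1) ^+ 2 <= l * (x.2 - 1) ^+ 2 + (1 - l) * (y.2 - 1) ^+ 2.
  rewrite -subr_ge0.
  have -> : l * (x.2 - 1) ^+ 2 + (1 - l) * (y.2 - 1) ^+ 2 - (l * x.2 + (1 - l) * y.2 - 1) ^+ 2 =
    l * (1 - l) * (x.2 - y.2) ^+ 2 by ring.
  by apply: mulr_ge0; [apply: mulr_ge0; rewrite ?subr_ge0|exact: sqr_ge0].
have [->|lp] := eqVneq l 0; first by rewrite !mul0r !add0r subr0 !mul1r.
have {}lp : 0 < l by rewrite lt_neqAle eq_sym lp.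
set X := (x.2 - 1) ^+ 2 + wall x.1 in Sx; set Y := (y.2 - 1) ^+ 2 + wall y.1 in Sy.
have : l * X + (1 - l) * Y < 1.
  have : l * X < l * 1 by rewrite ltr_pM2l.
  have : (1 - l) * Y <= (1 - l) * 1 by apply: ler_wpM2l; [rewrite subr_ge0|exact: ltW].
  lra.
rewrite /X /Y; clear -k3 k4; lra.
Qed.

Lemma stadium_convex : convex_set (stadium : set (convex_lmodType (R * R)%type)).
Proof.
move=> x y l; rewrite !inE => Sx Sy; have := stadium_conv Sx Sy; apply.
by have := ge0 l => /= ->; exact: le1.
Qed.

Lemma stadium_connected : connected stadium.
Proof.
have S0 : stadium (0, 1) by apply: stadium_strip => /=; rewrite ?normr0; lra.
pose seg (x : R * R) := [set (l * x.1, l * x.2 + (1 - l) * 1) | l in `[0 : R, 1]].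
have -> : stadium = \bigcup_(x in stadium) seg x.
  apply/seteqP; split => [x Sx|_ [x Sx [l l01 <-]]].
    exists x => //; exists 1; first by rewrite /= in_itv/= lexx ler01.
    by rewrite subrr !mul1r mul0r addr0 -surjective_pairing.
  have := stadium_conv Sx S0 l01; by rewrite mulr0 addr0.
apply: bigcup_connected.
  exists (0, 1) => x _; exists 0; first by rewrite /= in_itv/= lexx ler01.
  by rewrite !mul0r subr0 mulr1 add0r.
move=> x _; apply: connected_continuous_connected; first exact: segment_connected.
apply/within_contP => l _ e e0.
have K0 : 0 < 1 + `|x.1| + `|x.2 - 1| by have := normr_ge0 x.1; have := normr_ge0 (x.2 - 1); lra.
exists (e / (1 + `|x.1| + `|x.2 - 1|)); first exact: divr_gt0.
move=> k _; rewrite ltr_pdivlMr// => h; apply: le_lt_trans h.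
have n0 := normr_ge0 (l - k); have n1 := normr_ge0 x.1; have n2 := normr_ge0 (x.2 - 1).
rewrite norm_pair_le /=.
have -> : l * x.1 - k * x.1 = (l - k) * x.1 by ring.
have -> : l * x.2 + (1 - l) * 1 - (k * x.2 + (1 - k) * 1) = (l - k) * (x.2 - 1) by ring.
rewrite !normrM; apply/andP; split; apply: ler_wpM2l => //; lra.
Qed.

Lemma stadium_bounded_domain : bounded_domain stadium.
Proof.
split; [exact: stadium_open|exact: stadium_connected| |].
  by exists (0, 1); apply: stadium_strip => /=; rewrite ?normr0; lra.
exists 3; split; [exact: num_real|move=> M M3 x /ltW/stadium_bounds[h1 /andP[h2 h3]]].
rewrite /= norm_pair_le (ger0_norm h2); apply/andP; split; lra.
Qed.

Lemma coord_enorm x p : `|x.1 - p.1| <= enorm (x - p) /\ `|x.2 - p.2| <= enorm (x - p).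
Proof.
rewrite /enorm /dotp /= -!expr2; split; rewrite -sqrtr_sqr; apply: ler_wsqrtr; first by rewrite lerDl sqr_ge0.
by rewrite lerDr sqr_ge0.
Qed.

Lemma sqr_lt_sqr (a b : R) : 0 <= a -> 0 < b -> (a ^+ 2 < b ^+ 2) = (a < b).
Proof. by move=> a0 b0; rewrite ltr_pXn2r// nnegrE// ltW. Qed.

(** Where the wall is below 1 the boundary is a graph over x.1, namely x.2 = 1 - sqrt(1 - wall) or 1
    + sqrt(1 - wall), with the root written as exp(ln / 2) to stay among the smooth terms. At the
    two tips, where the wall is 1 and x.2 = 1, the equation is solved for x.1: up to sign, x.1 = 2 +
    1 / (3 - ln(1 - (x.2 - 1)^2)). *)
Lemma stadium_smooth : smooth_domain stadium.
Proof.
move=> p cp; rewrite (proj1 (interior_id _) stadium_open) /stadium /= => np.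
have {cp np} fp : (p.2 - 1) ^+ 2 + wall p.1 = 1.
  by apply/eqP; rewrite eq_le stadium_closure//= leNgt; apply/negP.
have w0 := wall_ge0 p.1.
have [w1|w1] := ltP (wall p.1) 1.
  have [d d0 hd] : exists2 d, 0 < d & forall t, `|t - p.1| < d -> wall t < 1.
    have /cvgrPdist_lt := @wall_cont p.1; move=> /(_ (1 - wall p.1)).
    rewrite subr_gt0 => /(_ w1) /nbhs_ballP[d /= d0 hd]; exists d => // t td.
    have := hd t; rewrite -ball_normE /= distrC => /(_ td).
    have := ler_norm (wall t - wall p.1); rewrite (distrC (wall t)); lra.
  have [s [sS sd sid]] := smooth_trunc p.1 d0.
  have y0 t : 0 < 1 - wall (s t) by rewrite subr_gt0 hd.
  pose G t := expR (1 / 2 * ln (1 - wall (s t))).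
  have G0 t : 0 < G t by exact: expR_gt0.
  have G2 t : G t ^+ 2 = 1 - wall (s t).
    by rewrite -expRM_natl mulrA -[2%:R * _]/(2 * (1 / 2)) mulrCA mulfV// mulr1 mul1r lnK// posrE.
  have SG : smooth_term G.
    apply: (ST_comp ST_exp); apply: (ST_mul (ST_cst _)); apply: ST_ln => //.
    by apply: ST_sub; [exact: ST_cst|exact: ST_comp ST_wall sS].
  have SN : smooth_term (fun t : R => - t).
    have := ST_mul (ST_cst (-1)) (@ST_id R).
    by congr smooth_term; apply/funext => t; rewrite mulN1r.
  have p21 : p.2 != 1 by apply/eqP => e; rewrite e subrr expr0n/= add0r in fp; lra.
  have [p2|p2] : p.2 < 1 \/ 1 < p.2 by apply/orP; rewrite -neq_lt.
    exists (0, 1), (fun t => 1 - G t), (Num.min (d / 2) (1 - p.2)); split.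
    - by rewrite /enorm /dotp /= mulr0 add0r mulr1 sqrtr1.
    - by apply: smooth_termP; apply: ST_sub; [exact: ST_cst|exact: SG].
    - by rewrite lt_min; apply/andP; split; lra.
    move=> x; rewrite lt_min => /andP[x1 x2]; have [c1 c2] := coord_enorm x p.
    rewrite /dotp /= oppr0 mulr0 addr0 !mulr1 mulr0 add0r.
    have G2x : G x.1 ^+ 2 = 1 - wall x.1 by rewrite G2 sid//; lra.
    have := ler_norm (x.2 - p.2) => c3.
    have k : (1 - x.2) ^+ 2 < G x.1 ^+ 2 <-> 1 - x.2 < G x.1 by rewrite sqr_lt_sqr//; lra.
    rewrite G2x in k.
    have -> : (x.2 - 1) ^+ 2 = (1 - x.2) ^+ 2 by ring.
    by split=> h; [have /k : (1 - x.2) ^+ 2 < 1 - wall x.1 by lra|have /k : 1 - x.2 < G x.1 by lra]; clear -h; move=> ?; lra.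
  exists (0, -1), (fun t => -1 - G (- t)), (Num.min (d / 2) (p.2 - 1)); split.
  - by rewrite /enorm /dotp /= mulr0 add0r mulrNN mulr1 sqrtr1.
  - by apply: smooth_termP; apply: ST_sub; [exact: ST_cst|exact: ST_comp SG SN].
  - by rewrite lt_min; apply/andP; split; lra.
  move=> x; rewrite lt_min => /andP[x1 x2]; have [c1 c2] := coord_enorm x p.
  rewrite /dotp /= oppr0 !mulr0 addr0 add0r !mulrN1 opprK.
  have G2x : G x.1 ^+ 2 = 1 - wall x.1 by rewrite G2 sid//; lra.
  have := ler_norm (p.2 - x.2); rewrite distrC => c3.
  have k : (x.2 - 1) ^+ 2 < G x.1 ^+ 2 <-> x.2 - 1 < G x.1 by rewrite sqr_lt_sqr//; lra.
  rewrite G2x in k.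
  by split=> h; [have /k : (x.2 - 1) ^+ 2 < 1 - wall x.1 by lra|have /k : x.2 - 1 < G x.1 by lra]; clear -h; move=> ?; lra.
have e2 : p.2 = 1.
  have : (p.2 - 1) ^+ 2 <= 0 by lra.
  by rewrite -[_ <= 0]orbF => /orP[|//]; rewrite le_eqVlt ltNge sqr_ge0 orbF sqrf_eq0 subr_eq0 => /eqP.
have [s [sS sd sid]] := @smooth_trunc R p.2 (1 / 2) ltac:(lra).
pose Y t := 1 - (s t - 1) ^+ 2.
have Yh t : 0 < Y t <= 1.
  have := sd t; rewrite e2 ltr_norml => /andP[? ?]; rewrite /Y.
  by have := sqr_ge0 (s t - 1) => ?; apply/andP; split; nra.
have Y0 t : 0 < Y t by case/andP: (Yh t).
have lY t : 0 < 3 - ln (Y t).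
  by have : ln (Y t) <= 0 by [rewrite ln_le0//; case/andP: (Yh t)]; lra.
pose m t := 2 + (3 - ln (Y t))^-1.
have Sm : smooth_term m.
  apply: ST_add; first exact: ST_cst.
  apply: ST_inv => //; apply: ST_sub; first exact: ST_cst.
  apply: ST_ln => //; apply: ST_sub; first exact: ST_cst.
  have h : smooth_term (fun t => s t - 1) by apply: ST_sub => //; exact: ST_cst.
  by have := ST_mul h h; congr smooth_term; apply/funext => t; rewrite expr2.
have key t u : 2 < t -> `|u - p.2| < 1 / 4 -> (u - 1) ^+ 2 + wall t < 1 <-> t < m u.
  move=> t2 up; have su : s u = u by apply: sid; lra.
  have -> : ((u - 1) ^+ 2 + wall t < 1) = (wall t < Y u) by rewrite /Y su; apply/idP/idP; lra.
  rewrite wallE// -[Y u]lnK ?posrE// ltr_expR.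
  have -> : (3 - (t - 2)^-1 < ln (Y u)) = (3 - ln (Y u) < (t - 2)^-1) by apply/idP/idP; lra.
  have -> : (t < m u) = (t - 2 < (3 - ln (Y u))^-1) by rewrite /m; apply/idP/idP; lra.
  by rewrite -{2}[t - 2]invrK ltf_pV2// posrE ?invr_gt0//; lra.
have p12 : 2 < `|p.1|.
  by rewrite ltNge; apply/negP => h; move: w1; rewrite wall_eq0//; lra.
have SN : smooth_term (fun t : R => - t).
  have := ST_mul (ST_cst (-1)) (@ST_id R).
  by congr smooth_term; apply/funext => t; rewrite mulN1r.
have SNm : smooth_term (fun t : R => - m t) by exact: ST_comp SN Sm.
move: p12; rewrite ltr_normr => /orP[p12|p12].
  exists (-1, 0), (fun t => - m t), (Num.min (p.1 - 2) (1 / 4)); split.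
  - by rewrite /enorm /dotp /= mulr0 addr0 mulrNN mulr1 sqrtr1.
  - exact: smooth_termP.
  - by rewrite lt_min; apply/andP; split; lra.
  move=> x; rewrite lt_min => /andP[x1 x2]; have [c1 c2] := coord_enorm x p.
  rewrite /dotp /= opprK !mulr0 add0r addr0 mulr1 mulrN1.
  have := ler_norm (p.1 - x.1); rewrite distrC => c3.
  have k : (x.2 - 1) ^+ 2 + wall x.1 < 1 <-> x.1 < m x.2 by apply: key; lra.
  by rewrite k; clear; split; lra.
exists (1, 0), (fun t => - m (- t)), (Num.min (- p.1 - 2) (1 / 4)); split.
- by rewrite /enorm /dotp /= mulr0 addr0 mulr1 sqrtr1.
- apply: smooth_termP; exact: ST_comp SNm SN.
- by rewrite lt_min; apply/andP; split; lra.
move=> x; rewrite lt_min => /andP[x1 x2]; have [c1 c2] := coord_enorm x p.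
rewrite /dotp /= !mulr0 add0r addr0 mulr1 mulrN1 opprK.
have := ler_norm (x.1 - p.1) => c3.
have k : (x.2 - 1) ^+ 2 + wall x.1 < 1 <-> - x.1 < m x.2.
  by rewrite -(wall_even x.1); apply: key; lra.
by rewrite k; clear; split; lra.
Qed.

End Domain.

(** * From Taylor estimates to the norms of the statement *)

Section Bridge.
Context {R : realType}.
Implicit Types (X S : set (R * R)) (be al : R).

Definition lin2 (J : (R * R) * (R * R)) (v : R * R) : R * R :=
  (J.1.1 * v.1 + J.2.1 * v.2, J.1.2 * v.1 + J.2.2 * v.2).

Lemma lin2_is_linear J : linear (lin2 J).
Proof.
have e (c a b d e : R) : c *: (a, b) + (d, e) = (c * a + d, c * b + e) :> R * R by [].
by move=> k [u1 u2] [v1 v2]; rewrite /lin2 !e /=; congr pair; ring.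
Qed.

HB.instance Definition _ J := GRing.isLinear.Build R (R * R)%type (R * R)%type _ (lin2 J) (lin2_is_linear J).

Definition jac (a1 a2 b1 b2 : R * R -> R) (v : R * R) : (R * R) * (R * R) :=
  ((a1 v, b1 v), (a2 v, b2 v)).

Lemma within_cont_pair (V W1 W2 : normedModType R) (I : set V) (f : V -> W1) (g : V -> W2) :
  {within I, continuous f} -> {within I, continuous g} ->
  {within I, continuous (fun v => (f v, g v))}.
Proof.
move=> /within_contP hf /within_contP hg; apply/within_contP => x Ix e e0.
have [d1 d10 h1] := hf x Ix e e0; have [d2 d20 h2] := hg x Ix e e0.
exists (Num.min d1 d2); first by rewrite lt_min d10.
move=> y Iy; rewrite lt_min => /andP[/h1 k1 /h2 k2].
by rewrite prod_normE /= gt_max k1// k2.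
Qed.

Lemma hold_within be S g : 0 < be -> hold be S g -> {within S, continuous g}.
Proof.
move=> b0 [C C0 hC]; apply/within_contP => x Sx e e0.
have [d d0 hd] := pow_small b0 C0 e0.
exists d => // y Sy xy; have [_ h] := hC _ _ Sx Sy.
by apply: le_lt_trans h _; exact: hd.
Qed.

Lemma lin2_cont J : continuous (lin2 J).
Proof.
suff h : {within setT, continuous (lin2 J)} by move=> x; have := h x; rewrite /continuous_at nbhs_subspaceT.
apply/within_contP => x _ e e0.
pose K := `|J.1.1| + `|J.1.2| + `|J.2.1| + `|J.2.2| + 1.
have n11 := normr_ge0 J.1.1; have n12 := normr_ge0 J.1.2.
have n21 := normr_ge0 J.2.1; have n22 := normr_ge0 J.2.2.
have K0 : 0 < K by rewrite /K; lra.
exists (e / K); first exact: divr_gt0.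
move=> y _; rewrite ltr_pdivlMr// => h; apply: le_lt_trans h.
have [h1 h2] := norm_pair (x - y); have n0 := normr_ge0 (x - y).
have main a b : `|a| + `|b| <= K -> `|a * x.1 + b * x.2 - (a * y.1 + b * y.2)| <= `|x - y| * K.
  move=> abK; have -> : a * x.1 + b * x.2 - (a * y.1 + b * y.2) = a * (x - y).1 + b * (x - y).2 by rewrite /=; ring.
  apply: le_trans (ler_normD _ _) _; rewrite !normrM.
  have : `|a| * `|(x - y).1| <= `|a| * `|x - y| by rewrite ler_wpM2l.
  have : `|b| * `|(x - y).2| <= `|b| * `|x - y| by rewrite ler_wpM2l.
  have : `|x - y| * (`|a| + `|b|) <= `|x - y| * K by rewrite ler_wpM2l.
  lra.
by rewrite norm_pair_le /lin2 /=; apply/andP; split; apply: main; rewrite /K; lra.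
Qed.

Lemma tay_differentiable be X S f1 a1 a2 f2 b1 b2 : 0 < be -> open X -> X `<=` S ->
  tay be S f1 a1 a2 -> tay be S f2 b1 b2 -> forall x, X x ->
  differentiable (fun v => (f1 v, f2 v)) x /\
  gradient (fun v => (f1 v, f2 v)) x = jac a1 a2 b1 b2 x.
Proof.
move=> b0 oX XS [_ _ _ [C C0 hC]] [_ _ _ [D D0 hD]] x Xx.
set f := fun v => (f1 v, f2 v).
pose J := jac a1 a2 b1 b2 x.
have ho : f \o shift x = cst (f x) + lin2 J +o_ (0 : (R * R)%type) id.
  apply/eqaddoP => e e0.
  have CD0 : 0 <= C + D by exact: addr_ge0.
  have [d d0 hd] := pow_small b0 CD0 e0.
  have /nbhs_ballP[r /= r0 hr] : nbhs x X by exact: open_nbhs_nbhs.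
  apply/nbhs_ballP; exists (Num.min d r); first by rewrite /= lt_min d0.
  move=> h; rewrite -ball_normE /= sub0r normrN lt_min => /andP[hh1 hh2].
  have Sx : S x by exact: XS.
  have Sh : S (h + x).
    by apply: XS; apply: hr; rewrite -ball_normE /= opprD addrCA subrr addr0 normrN.
  have k1 := hC _ _ Sx Sh; have k2 := hD _ _ Sx Sh.
  have ex : h + x - x = h by rewrite addrK.
  rewrite ex in k1 k2.
  have hk := hd _ (normr_ge0 h) hh1.
  have P0 : 0 <= `|h| `^ be by exact: powR_ge0.
  have main c : 0 <= c -> c <= C + D -> c * (`|h| `^ be * `|h|) <= e * `|h|.
    move=> c0 cCD; rewrite mulrA ler_wpM2r//; apply: le_trans (ltW hk).
    by rewrite ler_wpM2r.
  rewrite norm_pair_le; apply/andP; split.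
    apply: le_trans (main C C0 _); last by rewrite lerDl.
    apply: le_trans k1; rewrite le_eqVlt; apply/orP; left; apply/eqP; congr (`| _ |).
    by rewrite /lin2 /J /jac /=; ring.
  apply: le_trans (main D D0 _); last by rewrite lerDr.
  apply: le_trans k2; rewrite le_eqVlt; apply/orP; left; apply/eqP; congr (`| _ |).
  by rewrite /lin2 /J /jac /=; ring.
have dE := diff_unique (@lin2_cont J) ho.
have df : differentiable f x.
  by apply/diff_locallyP; rewrite dE; split; [exact: lin2_cont|exact: ho].
split => //; rewrite /gradient !deriveE// dE /J /jac /=.
by rewrite /lin2 /= !mulr0 !mulr1 !addr0 !add0r.
Qed.

Lemma tay_C1 be X S f1 a1 a2 f2 b1 b2 : 0 < be -> open X -> closure X `<=` S ->
  tay be S f1 a1 a2 -> tay be S f2 b1 b2 ->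
  C1_upto_boundary X (fun v => (f1 v, f2 v)) (jac a1 a2 b1 b2).
Proof.
move=> b0 oX XS t1 t2; have [h1 ha1 ha2 _] := t1; have [h2 hb1 hb2 _] := t2.
have hw g : hold be S g -> {within closure X, continuous g}.
  by move=> /(holdS XS); exact: hold_within.
split.
- by apply: within_cont_pair; exact: hw.
- by apply: within_cont_pair; apply: within_cont_pair; exact: hw.
- move=> x Xx; apply: (tay_differentiable b0 oX _ t1 t2) => //.
  by move=> y Xy; apply: XS; exact: subset_closure.
Qed.

Lemma enorm_le (v : R * R) : enorm v <= `|v.1| + `|v.2|.
Proof.
have h : 0 <= `|v.1| + `|v.2| by exact: addr_ge0.
rewrite /enorm /dotp -!expr2 -(ger0_norm h) -sqrtr_sqr.
apply: ler_wsqrtr; rewrite sqrrD !real_normK ?num_real//.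
have := mulr_ge0 (normr_ge0 v.1) (normr_ge0 v.2); lra.
Qed.

Lemma enorm_ge0 (v : R * R) : 0 <= enorm v. Proof. exact: sqrtr_ge0. Qed.

Lemma gnorm_le (J : (R * R) * (R * R)) d : `|J.1.1| <= d -> `|J.1.2| <= d -> `|J.2.1| <= d -> `|J.2.2| <= d ->
  Defs.gnorm J <= 4 * d.
Proof.
move=> h1 h2 h3 h4; have := enorm_le (enorm J.1, enorm J.2).
rewrite /Defs.gnorm {1}/enorm /dotp /= -!expr2 => h; apply: le_trans h _.
rewrite !ger0_norm ?enorm_ge0//; have := enorm_le J.1; have := enorm_le J.2; lra.
Qed.

Lemma norm_le_enorm (v : R * R) : `|v| <= enorm v.
Proof.
by rewrite norm_pair_le; have := coord_enorm v 0; rewrite !subr0 => -[-> ->].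
Qed.

(** Interpolation between the Hoelder constant C and the C^1 bound d1. At distance r <= s the spare
    power r^(be - al) <= s^(be / 2) absorbs C; at larger distances the difference of gradients, at
    most 8 d1, is divided by r^al >= s^al >= 1 / 2. So the seminorm is at most 16 d1 however large C
    is, at the price of an al that depends on C. The sup norms contribute 2 d0 and 4 d1. *)
Lemma C1alpha_bound be (C d0 d1 : R) : 0 < be -> 0 <= C -> 0 <= d0 -> 0 < d1 ->
  exists2 a0, 0 < a0 & forall al X (f J : _), 0 < al -> al <= a0 ->
    (forall v, closure X v -> `|(f v).1| <= d0 /\ `|(f v).2| <= d0) ->
    (forall v, closure X v -> [/\ `|(J v).1.1| <= d1, `|(J v).1.2| <= d1, `|(J v).2.1| <= d1 & `|(J v).2.2| <= d1]) ->
    (forall v w, closure X v -> closure X w -> let D := J v - J w in let K := C * `|v - w| `^ be in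
      [/\ `|D.1.1| <= K, `|D.1.2| <= K, `|D.2.1| <= K & `|D.2.2| <= K]) ->
    (C1alpha_norm al X f J <= (2 * d0 + 20 * d1)%:E)%E.
Proof.
move=> b0 C0 d00 d10.
have b20 : 0 < be / 2 by lra.
have C40 : 0 <= 4 * C by lra.
have [t t0 ht] := pow_small b20 C40 d10.
pose s := Num.min 1 (t / 2).
have s0 : 0 < s by rewrite lt_min ltr01/=; lra.
have s1 : s <= 1 by rewrite ge_min lexx.
have st : s < t by rewrite gt_min; apply/orP; right; lra.
have ls : ln s <= 0 by exact: ln_le0.
have q0 : 0 < 2 * (1 - ln s) by lra.
(* Chosen for s^al >= 1 + al ln s >= 1 / 2; the term 1 - ln s in place of - ln s keeps the
   denominator positive when s = 1. *)
exists (Num.min (be / 2) (1 / (2 * (1 - ln s)))).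
  by rewrite lt_min b20/= divr_gt0.
move=> al X f J al0; rewrite le_min => /andP[alb als] hf hJ hD.
have sal : 1 / 2 <= s `^ al.
  rewrite /powR gt_eqF//; apply: le_trans (expR_ge1Dx _).
  by move: als; rewrite ler_pdivlMr//; clear -al0; nra.
have e3 z : [/\ closure X z.1, closure X z.2 & z.1 <> z.2] ->
   Defs.gnorm (J z.1 - J z.2) / enorm (z.1 - z.2) `^ al <= 16 * d1.
  move=> [z1 z2 zz]; set r := `|z.1 - z.2|.
  have r0 : 0 < r by rewrite normr_gt0 subr_eq0; apply/eqP.
  have re : r <= enorm (z.1 - z.2) by exact: norm_le_enorm.
  have ra : r `^ al <= enorm (z.1 - z.2) `^ al.
    by apply: ge0_ler_powR => //; rewrite ?nnegrE; clear -al0 r0 re; lra.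
  rewrite ler_pdivrMr; last by apply: powR_gt0; exact: lt_le_trans re.
  apply: (@le_trans _ _ (16 * d1 * r `^ al)); last by rewrite ler_wpM2l//; clear -d10; lra.
  have [rs|sr] := leP r s.
    have [k1 k2 k3 k4] := hD _ _ z1 z2.
    apply: le_trans (gnorm_le k1 k2 k3 k4) _; rewrite -/r.
    have -> : be = (be - al) + al by ring.
    rewrite powRD ?(gt_eqF r0) ?implybT//.
    have m : r `^ (be - al) <= s `^ (be / 2).
      have r1 : r <= 1 by exact: le_trans rs s1.
      apply: (@le_trans _ _ (r `^ (be / 2))).
        by apply: ger_powR; [rewrite r0 r1|clear -alb; lra].
      by apply: ge0_ler_powR; rewrite ?nnegrE; clear -b20 r0 s0 rs; lra.
    have := ht s (ltW s0) st => hs.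
    have p1 : 0 <= r `^ al by exact: powR_ge0.
    have : 4 * C * r `^ (be - al) <= 4 * C * s `^ (be / 2) by rewrite ler_wpM2l.
    move=> h; have h' : 4 * C * r `^ (be - al) <= 16 * d1 by clear -h hs d10; lra.
    by have := ler_wpM2r p1 h'; rewrite !mulrA.
  have [a1 a2 a3 a4] := hJ _ z1; have [c1 c2 c3 c4] := hJ _ z2.
  have g : Defs.gnorm (J z.1 - J z.2) <= 4 * (2 * d1).
    apply: gnorm_le => /=; apply: le_trans (ler_normB _ _) _; clear -a1 a2 a3 a4 c1 c2 c3 c4; lra.
  apply: le_trans g _.
  have : s `^ al <= r `^ al by apply: ge0_ler_powR; rewrite ?nnegrE; clear -al0 s0 sr; lra.
  by clear -d10 sal; move=> h; nra.
rewrite /C1alpha_norm.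
have -> : (2 * d0 + 20 * d1)%:E = ((2 * d0)%:E + (4 * d1)%:E + (16 * d1)%:E)%E.
  by rewrite -!EFinD; congr EFin; ring.
apply: leeD; first apply: leeD.
- apply: ge_ereal_sup => _ [x /hf [h1 h2] <-]; rewrite lee_fin.
  by apply: le_trans (enorm_le _) _; lra.
- by apply: ge_ereal_sup => _ [x /hJ [h1 h2 h3 h4] <-]; rewrite lee_fin; exact: gnorm_le.
- by apply: ge_ereal_sup => _ [z hz <-]; rewrite lee_fin; exact: e3.
Qed.

Lemma tay_C1alpha_norm_le be X S f1 a1 a2 f2 b1 b2 d0 d1 : 0 < be -> open X -> closure X `<=` S ->
  0 <= d0 -> 0 < d1 -> tay be S f1 a1 a2 -> tay be S f2 b1 b2 ->
  (forall v, closure X v -> `|f1 v| <= d0 /\ `|f2 v| <= d0) ->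
  (forall v, closure X v -> [/\ `|a1 v| <= d1, `|b1 v| <= d1, `|a2 v| <= d1 & `|b2 v| <= d1]) ->
  exists2 a0, 0 < a0 & forall al, 0 < al -> al <= a0 ->
    C1alpha_norm_le al X (fun v => (f1 v, f2 v)) (2 * d0 + 20 * d1).
Proof.
move=> b0 oX XS d00 d10 t1 t2 hf hJ.
have [h1 [A1 A10 ha1] [A2 A20 ha2] _] := t1; have [h2 [B1 B10 hb1] [B2 B20 hb2] _] := t2.
have C0 : 0 <= A1 + A2 + B1 + B2 by lra.
have [a0 a00 h] := C1alpha_bound b0 C0 d00 d10.
exists a0 => // al al0 ala; exists (jac a1 a2 b1 b2); first exact: tay_C1 t1 t2.
apply: h => // v w /XS Sv /XS Sw D K.
have p0 : 0 <= `|v - w| `^ be by exact: powR_ge0.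
have [_ k1] := ha1 _ _ Sv Sw; have [_ k2] := ha2 _ _ Sv Sw.
have [_ k3] := hb1 _ _ Sv Sw; have [_ k4] := hb2 _ _ Sv Sw.
by split; [apply: le_trans k1 _|apply: le_trans k3 _|apply: le_trans k2 _|apply: le_trans k4 _];
  rewrite ler_wpM2r//; clear -A10 A20 B10 B20; lra.
Qed.

Lemma tay_C1alpha be X S f1 a1 a2 f2 b1 b2 : 0 < be -> open X -> closure X `<=` S ->
  tay be S f1 a1 a2 -> tay be S f2 b1 b2 ->
  exists2 a0, 0 < a0 & forall al, 0 < al -> al <= a0 -> C1alpha al X (fun v => (f1 v, f2 v)).
Proof.
move=> b0 oX XS t1 t2.
have [[F1 F10 h1] [A1 A10 ha1] [A2 A20 ha2] _] := t1; have [[F2 F20 h2] [B1 B10 hb1] [B2 B20 hb2] _] := t2.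
have d00 : 0 <= F1 + F2 by lra.
have d10 : 0 < 1 + A1 + A2 + B1 + B2 by lra.
have [] := tay_C1alpha_norm_le b0 oX XS d00 d10 t1 t2.
- move=> v /XS Sv; have [k1 _] := h1 _ _ Sv Sv; have [k2 _] := h2 _ _ Sv Sv; clear -k1 k2 F10 F20; split; lra.
- move=> v /XS Sv; have [k1 _] := ha1 _ _ Sv Sv; have [k2 _] := ha2 _ _ Sv Sv.
  have [k3 _] := hb1 _ _ Sv Sv; have [k4 _] := hb2 _ _ Sv Sv; clear -k1 k2 k3 k4 A10 A20 B10 B20; split; lra.
move=> a0 a00 h; exists a0 => // al al0 ala; have [J hJ n] := h al al0 ala.
by exists J => //; apply: le_lt_trans n _; rewrite ltry.
Qed.

End Bridge.

(** * The perturbed domain *)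

Section Cutoff.
Context {R : realType}.

(** If w lies outside S1 then eta w = 0, and |eta v f v| is at most |eta v - eta w| times the bound
    on f; no value of f outside S1 enters. *)
Lemma hold_cut be (S S1 : set (R * R)) (eta f : R * R -> R) :
  hold be S eta -> hold be (S `&` S1) f -> (forall v, S v -> ~ S1 v -> eta v = 0) ->
  hold be S (fun v => eta v * f v).
Proof.
move=> [C C0 hC] [D D0 hD] h0; exists (2 * (C * D)); first by have := mulr_ge0 C0 D0; lra.
have CD := mulr_ge0 C0 D0.
move=> v w Sv Sw; have [e1 e2] := hC _ _ Sv Sw; have [e3 _] := hC _ _ Sw Sw.
have P0 := powR_ge0 `|v - w| be; have CP := mulr_ge0 CD P0.
have [kv|kv] := pselect (S1 v); last first.
  rewrite (h0 _ Sv kv) mul0r normr0; split; first lra.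
  rewrite sub0r normrN; have [kw|kw] := pselect (S1 w); last first.
    by rewrite (h0 _ Sw kw) mul0r normr0; lra.
  have [d1 _] := hD _ _ (conj Sw kw) (conj Sw kw).
  rewrite (h0 _ Sv kv) sub0r normrN in e2.
  have : `|eta w * f w| <= C * `|v - w| `^ be * D by rewrite normrM; exact: ler_pM.
  lra.
have [d1 _] := hD _ _ (conj Sv kv) (conj Sv kv).
have hb : `|eta v * f v| <= C * D by rewrite normrM; exact: ler_pM.
split; first lra.
have [kw|kw] := pselect (S1 w).
  have [_ d2] := hD _ _ (conj Sv kv) (conj Sw kw).
  have -> : eta v * f v - eta w * f w = (eta v - eta w) * f v + eta w * (f v - f w) by ring.
  apply: le_trans (ler_normD _ _) _; rewrite !normrM.
  have : `|eta v - eta w| * `|f v| <= C * `|v - w| `^ be * D by exact: ler_pM.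
  have : `|eta w| * `|f v - f w| <= C * (D * `|v - w| `^ be) by exact: ler_pM.
  lra.
rewrite (h0 _ Sw kw) subr0 in e2; rewrite (h0 _ Sw kw) mul0r subr0.
have : `|eta v * f v| <= C * `|v - w| `^ be * D by rewrite normrM; exact: ler_pM.
lra.
Qed.

Definition dbump : R -> R := derive1 bump.

Lemma der_bump (t : R) : is_derive t 1 bump (dbump t).
Proof. by apply: DeriveDef; [have := @bump_smooth R; move=> /(_ 0%N t)|rewrite /dbump derive1E]. Qed.

Lemma der_unique (f : R -> R) (x a b : R) : is_derive x 1 f a -> is_derive x 1 f b -> a = b.
Proof. by move=> h1 h2; rewrite -(@derive_val _ _ _ _ _ _ _ h1) (@derive_val _ _ _ _ _ _ _ h2). Qed.

Lemma dbump_eq0 (t : R) : `|t| < 1 / 2 \/ 1 < `|t| -> dbump t = 0.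
Proof.
case=> h; apply: (der_unique (der_bump t)).
  apply: (@is_derive_near _ _ (cst 1) _ _ (1 / 2 - `|t|)); first by rewrite subr_gt0.
  move=> s st; apply: bump_eq1; have := ler_normB s (s - t); rewrite opprB addrCA subrr addr0.
  have := ler_normD (s - t) t; rewrite subrK; lra.
apply: (@is_derive_near _ _ (cst 0) _ _ (`|t| - 1)); first by rewrite subr_gt0.
move=> s st; apply: bump_eq0; have := ler_normD s (t - s); rewrite addrCA subrr addr0 (distrC t); lra.
Qed.

Lemma bump_bounds : exists2 K : R, 0 <= K & forall t, `|dbump t| <= K.
Proof.
have [K K0 h] := smooth_lip 1 (@bump_smooth R).
exists K => // t; have [t1|t1] := leP `|t| 1; first by have [] := h t t t1 t1.
by rewrite dbump_eq0 ?normr0//; right.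
Qed.

Lemma hold_bump be M : 0 < be <= 1 -> 
  [/\ hold be (box M) (fun v => bump v.1), hold be (box M) (fun v => bump v.2),
      hold be (box M) (fun v => dbump v.1) & hold be (box M) (fun v => dbump v.2) :> Prop].
Proof.
move=> b01.
have main (f : R -> R) : smooth_function f ->
    hold be (box M) (fun v => f v.1) /\ hold be (box M) (fun v => f v.2).
  move=> sf; have [C C0 h] := smooth_lip M sf; split.
    apply: (@hold_lip _ be (box M) (fun v => f v.1) C C) => //.
      by move=> v [v1 _]; have [] := h _ _ v1 v1.
    move=> v w [v1 _] [w1 _]; have [_ _ k] := h _ _ v1 w1; apply: le_trans k _.
    by rewrite ler_wpM2l//; have [] := norm_pair (v - w).
  have n2 (v : R * R) : box M v -> `|v.2| <= M by case=> _ /andP[? ?]; rewrite ger0_norm.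
  apply: (@hold_lip _ be (box M) (fun v => f v.2) C C) => //.
    by move=> v /n2 v1; have [] := h _ _ v1 v1.
  move=> v w /n2 v1 /n2 w1; have [_ _ k] := h _ _ v1 w1; apply: le_trans k _.
  by rewrite ler_wpM2l//; have [] := norm_pair (v - w).
have [h1 h2] := main bump bump_smooth.
have sd : smooth_function (dbump : R -> R) by move=> k t; rewrite -derive1Sn; exact: bump_smooth.
have [h3 h4] := main _ sd.
by split.
Qed.

End Cutoff.

Section Corrections.
Context {R : realType} (mu rho : R).
Hypothesis (mu_gt0 : 0 < mu) (mu_lt : mu < 1 / 320) (rho_gt0 : 0 < rho) (rho_lt : rho < 1 / 4).
Notation A := (A mu rho).
Notation B := (B mu rho).
Notation p := (p mu rho).
Notation q := (q mu rho).
Notation FF := (FF mu rho).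
Notation dFF := (dFF mu rho).
Implicit Types (v : R * R).

Definition chi v : R := bump v.1 * bump v.2.
Definition chi1 v : R := dbump v.1 * bump v.2.
Definition chi2 v : R := bump v.1 * dbump v.2.
(* With v = (b, a), the perturbation maps (v.1 + w0 v, v.2) to (v.1, v.2 + z0 v).
   Off the support of chi these points are (B, a) and (b, A); near the pole the
   map is replaced by a vertical shift that only matches the boundary. *)
Definition w0 v := (1 - chi v) * (B v.2 v.1 - v.1).
Definition w01 v := (- chi1 v) * (B v.2 v.1 - v.1) + (1 - chi v) * (p v.2 v.1 - 1).
Definition w02 v := (- chi2 v) * (B v.2 v.1 - v.1) + (1 - chi v) * q v.2 v.1.
Definition z0 v := (1 - chi v) * (A v.2 v.1 - v.2) - chi v * FF v.1.
Definition z01 v := (- chi1 v) * (A v.2 v.1 - v.2) + (1 - chi v) * - q v.2 v.1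
  - (chi1 v * FF v.1 + chi v * dFF v.1).
Definition z02 v := (- chi2 v) * (A v.2 v.1 - v.2) + (1 - chi v) * (p v.2 v.1 - 1)
  - chi2 v * FF v.1.

Let mu8 : mu < 1 / 8. Proof. by have := mu_lt => ?; lra. Qed.
Let mu01 : 0 < mu <= 1. Proof. by have := mu_gt0; have := mu_lt => ? ?; apply/andP; split; lra. Qed.

Let near0 v : box 4 v -> ~ SM (1 / 2) 4 v -> `|v.1| < 1 / 2 /\ `|v.2| < 1 / 2.
Proof.
move=> [v1 /andP[v2 v3]] nS; have [n1 n2] := ler_norm_nrm v.2 v.1.
have : nrm v.2 v.1 < 1 / 2.
  by rewrite ltNge; apply/negP => h; apply: nS; split => //; rewrite ger0_norm.
by move=> h; split; [apply: le_lt_trans n2 h|apply: le_lt_trans n1 h].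
Qed.

Let cut0 v : box 4 v -> ~ SM (1 / 2) 4 v -> [/\ 1 - chi v = 0, - chi1 v = 0 & - chi2 v = 0].
Proof.
move=> Bv nS; have [h1 h2] := near0 Bv nS; rewrite /chi /chi1 /chi2.
by rewrite !bump_eq1 ?ltW// !dbump_eq0 ?mul0r ?mulr0 ?oppr0 ?mulr1 ?subrr//; left.
Qed.

Lemma corrections_derive :
  (forall v, 0 < v.2 -> is_derive v.1 1 (fun t => w0 (t, v.2)) (w01 v) /\
     is_derive v.2 1 (fun t => w0 (v.1, t)) (w02 v)) /\
  (forall v, 0 < v.2 -> is_derive v.1 1 (fun t => z0 (t, v.2)) (z01 v) /\
     is_derive v.2 1 (fun t => z0 (v.1, t)) (z02 v)).
Proof.
have dchi1 v : is_derive v.1 1 (fun t => 1 - chi (t, v.2)) (- chi1 v).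
  have h := is_deriveB (is_derive_cst (1 : R) v.1 1) (is_deriveM (der_bump v.1) (is_derive_cst (bump v.2) v.1 1)).
  by have /is_derive_eq := h; apply; rewrite /chi1 /GRing.scale /=; ring.
have dchi2 v : is_derive v.2 1 (fun t => 1 - chi (v.1, t)) (- chi2 v).
  have h := is_deriveB (is_derive_cst (1 : R) v.2 1) (is_deriveM (is_derive_cst (bump v.1) v.2 1) (der_bump v.2)).
  by have /is_derive_eq := h; apply; rewrite /chi2 /GRing.scale /=; ring.
have dchi1' v : is_derive v.1 1 (fun t => chi (t, v.2)) (chi1 v).
  have h := is_deriveM (der_bump v.1) (is_derive_cst (bump v.2) v.1 1).
  by have /is_derive_eq := h; apply; rewrite /chi1 /GRing.scale /=; ring.
have dchi2' v : is_derive v.2 1 (fun t => chi (v.1, t)) (chi2 v).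
  have h := is_deriveM (is_derive_cst (bump v.1) v.2 1) (der_bump v.2).
  by have /is_derive_eq := h; apply; rewrite /chi2 /GRing.scale /=; ring.
have id1 (x : R) : is_derive x 1 (fun t : R => t) 1 by exact: is_derive_id.
split.
  move=> v v0; split.
    have h := is_deriveM (dchi1 v) (is_deriveB (derB_b mu rho v.1 v0) (id1 v.1)).
    by have /is_derive_eq := h; apply; rewrite /w01 /GRing.scale /=; case: (v) => b a /=; rewrite ?fctE /=; ring.
  have h := is_deriveM (dchi2 v) (is_deriveB (derB_a mu rho v.1 v0) (is_derive_cst v.1 v.2 1)).
  by have /is_derive_eq := h; apply; rewrite /w02 /GRing.scale /=; case: (v) => b a /=; rewrite ?fctE /=; ring.
move=> v v0; split.
  have h1 := is_deriveM (dchi1 v) (is_deriveB (derA_b mu rho v.1 v0) (is_derive_cst v.2 v.1 1)).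
  have h2 := is_deriveM (dchi1' v) (der_FF mu_gt0 mu8 rho_gt0 v.1).
  by have /is_derive_eq := is_deriveB h1 h2; apply; rewrite /z01 /GRing.scale /=; case: (v) => b a /=; rewrite ?fctE /=; ring.
have h1 := is_deriveM (dchi2 v) (is_deriveB (derA_a mu rho v.1 v0) (id1 v.2)).
have h2 := is_deriveM (dchi2' v) (is_derive_cst (FF v.1) v.2 1).
by have /is_derive_eq := is_deriveB h1 h2; apply; rewrite /z02 /GRing.scale /=; case: (v) => b a /=; rewrite ?fctE /=; ring.
Qed.

Lemma tay_corrections : tay mu (box 4) w0 w01 w02 /\ tay mu (box 4) z0 z01 z02.
Proof.
have [hb1 hb2 hd1 hd2] := @hold_bump R mu 4 mu01.
have [hA hB hp hq] := hgoodP rho mu_gt0 mu8.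
have c2 : 0 < 1 / 2 :> R by lra.
have c4 : 0 <= 4 :> R by lra.
have m0 := mu_gt0.
have {}hA := hA _ _ c2 c4; have {}hB := hB _ _ c2 c4; have {}hp := hp _ _ c2 c4; have {}hq := hq _ _ c2 c4.
have sub : (box 4 `&` SM (1 / 2) 4 : set (R * R)) `<=` SM (1 / 2) 4 by move=> v [].
have h1 := hold_fst mu_gt0 mu8 (1 / 2) c4; have h2 := hold_snd mu_gt0 mu8 (1 / 2) c4.
have hc := @hold_cst R mu.
have E0 : hold mu (box 4) (fun v => 1 - chi v) by apply: holdB => //; exact: holdM.
have E1 : hold mu (box 4) (fun v => - chi1 v) by apply: holdN; exact: holdM.
have E2 : hold mu (box 4) (fun v => - chi2 v) by apply: holdN; exact: holdM.
have cut (f : R * R -> R) : hold mu (SM (1 / 2) 4) f ->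
   [/\ hold mu (box 4) (fun v => (1 - chi v) * f v), hold mu (box 4) (fun v => (- chi1 v) * f v)
     & hold mu (box 4) (fun v => (- chi2 v) * f v)].
  move=> /(holdS sub) hf; split; apply: (hold_cut _ hf) => // v Bv nS;
    by have [? ? ?] := cut0 Bv nS.
have [C C0 hF] := FF_hold mu_gt0 mu8 rho_gt0 c4.
have HF : hold mu (box 4) (fun v => FF v.1) /\ hold mu (box 4) (fun v => dFF v.1).
  have main (f : R -> R) : (forall b1 b2, `|b1| <= 4 -> `|b2| <= 4 -> `|f b1 - f b2| <= C * `|b1 - b2| `^ mu) ->
      hold mu (box 4) (fun v => f v.1).
    move=> hf; exists (`|f 0| + C * 4 `^ mu + C).
      by rewrite !addr_ge0// mulr_ge0// powR_ge0.
    have n4 : `|0 : R| <= 4 by rewrite normr0.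
    have Cp : 0 <= C * 4 `^ mu by rewrite mulr_ge0// powR_ge0.
    move=> v w [v1 _] [w1 _]; split.
      have k := hf _ _ v1 n4; rewrite subr0 in k.
      have : C * `|v.1| `^ mu <= C * 4 `^ mu by apply: ler_wpM2l => //; apply: ge0_ler_powR; rewrite ?nnegrE//; exact: ltW.
      have := ler_normD (f v.1 - f 0) (f 0); rewrite subrK; lra.
    apply: le_trans (hf _ _ v1 w1) _; have [n1 _] := norm_pair (v - w).
    apply: ler_pM; rewrite ?powR_ge0//.
      by have := normr_ge0 (f 0); lra.
    by apply: ge0_ler_powR; rewrite ?nnegrE//; exact: ltW.
  by split; apply: main => b1 b2 k1 k2; have [] := hF _ _ k1 k2.
have [HF0 HF1] := HF.
have [B1 B2 B3] := cut (fun v => B v.2 v.1 - v.1) (holdB hB h1).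
have [A1 A2 A3] := cut (fun v => A v.2 v.1 - v.2) (holdB hA h2).
have [p1 _ _] := cut (fun v => p v.2 v.1 - 1) (holdB hp (hc _ 1)).
have [q1 _ _] := cut _ hq.
have [q2 _ _] := cut _ (holdN hq).
have X0 : hold mu (box 4) chi by exact: holdM.
have X1 : hold mu (box 4) chi1 by exact: holdM.
have X2 : hold mu (box 4) chi2 by exact: holdM.
have c40 : 0 < 4 :> R by lra.
have hw01 : hold mu (box 4) w01 by exact: (holdD B2 p1).
have hw02 : hold mu (box 4) w02 by exact: (holdD B3 q1).
have hz0 : hold mu (box 4) z0 by exact: (holdB A1 (holdM X0 HF0)).
have hz01 : hold mu (box 4) z01.
  by exact: (holdB (holdD A2 q2) (holdD (holdM X1 HF0) (holdM X0 HF1))).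
have hz02 : hold mu (box 4) z02 by exact: (holdB (holdD A3 p1) (holdM X2 HF0)).
have [dw dz] := corrections_derive.
split.
  by apply: (tay_box mu01 c40 B1 hw01 hw02) => v _ /dw[].
by apply: (tay_box mu01 c40 hz0 hz01 hz02) => v _ /dz[].
Qed.

(** K bounds the derivative of [bump]. The summands bound the boundary function and the deviation of
    the model from the identity; 2 + 2 K accounts for the product rule with the cut-off. *)
Definition small_bd K : R := (2 + 2 * K) * (slope_bd mu rho + 4000 * (mu + rho ^+ 2)).

(** Where 1 - chi or a derivative of chi is nonzero, N >= 1 / 4 and [outer] applies; where chi or
    one of its derivatives is nonzero, |b| <= 1 and [FF_small] applies. *)
Lemma small_corrections K v : 0 <= K -> (forall t, `|dbump t| <= K) -> box 4 v ->
  let D := small_bd K in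
  [/\ `|w0 v| <= D, `|w01 v| <= D & `|w02 v| <= D] /\
  [/\ `|z0 v| <= D, `|z01 v| <= D & `|z02 v| <= D].
Proof.
have r1 : rho <= 1 by have := rho_lt => ?; lra.
move=> K0 hK Bv D; have [v1 /andP[v2 v3]] := Bv.
set d := 4000 * (mu + rho ^+ 2); have d0 : 0 <= d.
  by have := mu_gt0; have := sqr_ge0 rho => ? ?; rewrite /d; lra.
set s := slope_bd mu rho; have s0 : 0 <= s by exact: slope_bd_ge0.
have ch : 0 <= chi v <= 1.
  have /andP[x0 x1] := bump01 v.1; have /andP[y0 y1] := bump01 v.2.
  by rewrite /chi mulr_ge0//= mulr_ile1.
have n1c : `|1 - chi v| <= 1 by case/andP: ch => h0 h1; rewrite ger0_norm ?subr_ge0// lerBlDr lerDl.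
have nch : `|chi v| <= 1 by case/andP: ch => h0 h1; rewrite ger0_norm.
have c1 : `|chi1 v| <= K.
  have /andP[y0 y1] := bump01 v.2; rewrite /chi1 normrM (ger0_norm y0).
  by apply: le_trans (hK v.1); rewrite ler_piMr.
have c2 : `|chi2 v| <= K.
  have /andP[y0 y1] := bump01 v.1; rewrite /chi2 normrM (ger0_norm y0).
  by apply: le_trans (hK v.2); rewrite ler_piMl.
have Kd := mulr_ge0 K0 d0; have Ks := mulr_ge0 K0 s0.
have DE : D = 2 * s + 2 * d + 2 * (K * s) + 2 * (K * d) by rewrite /D /small_bd -/s -/d; ring.
have cutb (f : R) : (SM (1 / 2) 4 v -> `|f| <= d) ->
    [/\ `|(1 - chi v) * f| <= d, `|(- chi1 v) * f| <= K * d & `|(- chi2 v) * f| <= K * d].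
  move=> hf; have [/hf fd|nS] := pselect (SM (1 / 2) 4 v); last first.
    by have [-> -> ->] := cut0 Bv nS; rewrite mul0r normr0.
  rewrite !normrM !normrN; split; [|exact: ler_pM|exact: ler_pM].
  by rewrite -[d]mul1r; exact: ler_pM.
have out : SM (1 / 2) 4 v -> [/\ `|A v.2 v.1 - v.2| <= d, `|B v.2 v.1 - v.1| <= d,
      `|p v.2 v.1 - 1| <= d & `|q v.2 v.1| <= d].
  move=> [_ n _ _]; apply: outer => //.
  rewrite /NN -sqr_nrm; have -> : 1 / 4 = (1 / 2) ^+ 2 :> R by field.
  by rewrite ler_pXn2r// nnegrE ?nrm_ge0//; lra.
have [B1 B2 B3] := cutb (B v.2 v.1 - v.1) (fun h => let: And4 _ x _ _ := out h in x).
have [A1 A2 A3] := cutb (A v.2 v.1 - v.2) (fun h => let: And4 x _ _ _ := out h in x).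
have [p1 _ _] := cutb (p v.2 v.1 - 1) (fun h => let: And4 _ _ x _ := out h in x).
have [q1 _ _] := cutb (q v.2 v.1) (fun h => let: And4 _ _ _ x := out h in x).
have Fb : [/\ `|chi v * FF v.1| <= s, `|chi v * dFF v.1| <= s,
    `|chi1 v * FF v.1| <= K * s & `|chi2 v * FF v.1| <= K * s].
  have [b1|b1] := leP `|v.1| 1; last first.
    have e1 : bump v.1 = 0 by apply: bump_eq0; exact: ltW.
    have e2 : dbump v.1 = 0 by apply: dbump_eq0; right.
    by rewrite /chi /chi1 /chi2 e1 e2 !mul0r normr0; have := mulr_ge0 K0 s0; split.
  have [f1 f2] := FF_small mu_gt0 mu8 rho_gt0 r1 b1.
  have k (x y c : R) : `|x| <= c -> `|y| <= s -> `|x * y| <= c * s by move=> *; rewrite normrM ler_pM.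
  by split; [rewrite -[s]mul1r; apply: k|rewrite -[s]mul1r; apply: k|apply: k|apply: k].
have [F1 F2 F3 F4] := Fb.
rewrite /w0 /w01 /w02 /z0 /z01 /z02.
have tri (x y a b : R) : `|x| <= a -> `|y| <= b -> `|x + y| <= a + b.
  by move=> h1 h2; apply: le_trans (ler_normD _ _) _; exact: lerD.
have trib (x y a b : R) : `|x| <= a -> `|y| <= b -> `|x - y| <= a + b.
  by move=> h1 h2; apply: le_trans (ler_normB _ _) _; exact: lerD.
have q2 : `|(1 - chi v) * - q v.2 v.1| <= d by rewrite mulrN normrN.
have {Kd Ks s0 d0 DE} [] : [/\ d <= D, K * d + d <= D, d + s <= D, K * d + d + (K * s + s) <= D & K * d + d + K * s <= D].
  by rewrite DE; clear -Kd Ks s0 d0; split; lra.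
move=> D1 D2 D3 D4 D5.
split; split.
- exact: le_trans D1.
- by apply: le_trans (tri _ _ _ _ B2 p1) _.
- by apply: le_trans (tri _ _ _ _ B3 q1) _.
- by apply: le_trans (trib _ _ _ _ A1 F1) _.
- by apply: le_trans (trib _ _ _ _ (tri _ _ _ _ A2 q2) (tri _ _ _ _ F3 F2)) _.
- by apply: le_trans (trib _ _ _ _ (tri _ _ _ _ A3 p1) F4) _.
Qed.

End Corrections.

(** The condition 8 (1 + 3 / mu) (2 rho^2)^mu < e / 4 can be met by rho only after mu is fixed. *)
Lemma small_parameters (R : realType) (K d : R) : 0 <= K -> 0 < d ->
  exists mu rho : R, [/\ 0 < mu, mu < 1 / 320, 0 < rho, rho < 1 / 4 & small_bd mu rho K <= d].
Proof.
move=> K0 d0; have K2 : 0 < 2 + 2 * K by lra.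
have [e e0 ed] : exists2 e, 0 < e & (2 + 2 * K) * e <= d.
  by exists (d / (2 + 2 * K)); [exact: divr_gt0|rewrite mulrC divfK// gt_eqF].
have [c c0 cE] : exists2 c : R, 0 < c & c = 8000 * 10 by exists (8000 * 10); [rewrite mulr_gt0 ?ltr0n|reflexivity].
have ec : 0 < e / c by exact: divr_gt0.
have [mu [m0 m1 m2]] : exists mu : R, [/\ 0 < mu, mu < 1 / 320 & mu * c <= e].
  exists (Num.min (1 / 640) (e / c)); rewrite lt_min gt_min; split.
  - by rewrite ec andbT; clear; lra.
  - by apply/orP; left; clear; lra.
  - by rewrite -ler_pdivlMr// ge_min lexx orbT.
have C0 : 0 <= 8 * (1 + 3 / mu).
  by have := divr_ge0 (ler0n R 3) (ltW m0); clear; lra.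
have e4 : 0 < e / 4 by clear -e0; lra.
have [t t0 ht] := pow_small m0 C0 e4.
have [r [r0 r1 r2 r3]] : exists r : R, [/\ 0 < r, r < 1 / 4, 2 * r < t & r * c <= e].
  exists (Num.min (Num.min (1 / 8) (t / 4)) (e / c)); split.
  - by rewrite !lt_min ec andbT; apply/andP; split; clear -t0; lra.
  - by rewrite !gt_min; apply/orP; left; apply/orP; left; clear; lra.
  - rewrite -ltr_pdivlMl; last by clear; lra.
    by rewrite !gt_min; apply/orP; left; apply/orP; right; clear -t0; lra.
  - by rewrite -ler_pdivlMr// ge_min lexx orbT.
have rr : r ^+ 2 <= r.
  by rewrite expr2; apply: ler_piMr; [exact: ltW|clear -r1; lra].
exists mu, r; split => //.
have h : 8 * (1 + 3 / mu) * (2 * r ^+ 2) `^ mu < e / 4.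
  by apply: ht; have := sqr_ge0 r; clear -rr r2; lra.
have mp : mu * pi <= mu * 4 by rewrite ler_wpM2l// ltW// pi_lt4.
apply: le_trans ed; apply: ler_wpM2l; first exact: ltW.
by rewrite /slope_bd; subst c; clear -h mp rr r3 m2 e0; lra.
Qed.

(** * Inversion of shears *)

Section Homeomorphism.
Context {R : realType}.
Implicit Types (v x y : R * R).

Lemma lip_continuous (f : R * R -> R * R) (L : R) :
  (forall x y, `|f x - f y| <= L * `|x - y|) -> continuous f.
Proof.
move=> hf; suff h : {within setT, continuous f}.
  by move=> x; have := h x; rewrite /continuous_at nbhs_subspaceT.
apply/within_contP => x _ e e0.
have K0 : 0 < `|L| + 1 by have := normr_ge0 L; lra.
exists (e / (`|L| + 1)); first exact: divr_gt0.
move=> y _; rewrite ltr_pdivlMr// => h; apply: le_lt_trans (hf x y) _; apply: le_lt_trans h.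
rewrite mulrC; apply: ler_wpM2l => //; have := ler_norm L; lra.
Qed.

Lemma closure_image (f : R * R -> R * R) (S : set (R * R)) x : continuous f ->
  closure S x -> closure (f @` S) (f x).
Proof.
move=> cf cS V /cf Vf; have [y [Sy Vy]] := cS _ Vf.
by exists (f y); split => //; exists y.
Qed.

(** Existence by the intermediate value theorem within 2 |w x| of x.1, where w varies by at most |w
    x|; uniqueness and the Lipschitz constant 3 come from d <= 1 / 2. *)
Lemma shear_inverse (w : R * R -> R) (d : R) : 0 <= d <= 1 / 2 ->
  (forall v u, `|w v - w u| <= d * `|v - u|) ->
  exists i : R * R -> R * R, forall x y,
    [/\ (i x).2 = x.2, (i x).1 + w (i x) = x.1, i (x.1 + w x, x.2) = x &
        `|i x - i y| <= 3 * `|x - y|].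
Proof.
move=> /andP[d0 d1] hw.
have ex x : exists t, t + w (t, x.2) = x.1.
  pose K := 2 * `|w x|; have K0 : 0 <= K by have := normr_ge0 (w x); rewrite /K; lra.
  pose f t := t + w (t, x.2).
  have cf : {within `[x.1 - K, x.1 + K], continuous f}.
    apply/within_contP => t _ e e0; exists (e / 2); first lra.
    move=> s _ ts; have := hw (t, x.2) (s, x.2).
    have -> : `|(t, x.2) - (s, x.2)| = `|t - s|.
      by rewrite prod_normE /= subrr normr0; apply/max_idPl.
    have : d * `|t - s| <= 1 / 2 * `|t - s| by rewrite ler_wpM2r.
    have := ler_normD (t - s) (w (t, x.2) - w (s, x.2)).
    have -> : t - s + (w (t, x.2) - w (s, x.2)) = f t - f s by rewrite /f; ring.
    lra.
  have near t : `|t - x.1| <= K -> `|w (t, x.2) - w x| <= K / 2.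
    move=> tK; apply: le_trans (hw _ _) _.
    have -> : `|(t, x.2) - x| = `|t - x.1|.
      by rewrite prod_normE /= subrr normr0; apply/max_idPl.
    have : d * `|t - x.1| <= 1 / 2 * K by apply: ler_pM.
    lra.
  have h1 := ler_norm (w x); have h2 := ler_norm (- w x); rewrite normrN in h2.
  have n1 := near (x.1 - K); rewrite addrAC subrr add0r normrN ger0_norm// lexx in n1.
  have n2 := near (x.1 + K); rewrite addrAC subrr add0r ger0_norm// lexx in n2.
  move: (n1 isT) (n2 isT); rewrite !ler_norml => /andP[a1 a2] /andP[a3 a4].
  have KE : K / 2 = `|w x| by rewrite /K; field.
  have xK : x.1 - K <= x.1 + K by lra.
  have [|t _ ft] := @IVT R f (x.1 - K) (x.1 + K) x.1 xK cf; last by exists t.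
  by rewrite ge_min le_max; apply/andP; split; apply/orP; [left|right]; rewrite /f; lra.
pose i x := (xget 0 [set t | t + w (t, x.2) = x.1], x.2).
have i1 x : (i x).1 + w (i x) = x.1.
  have [t ht] := ex x.
  by rewrite /i; have := xgetPex 0 (ex x).
have i2 x : (i x).2 = x.2 by [].
clearbody i.
have lip x y : `|i x - i y| <= 3 * `|x - y|.
  have [n1 n2] := norm_pair (x - y).
  have n0 := normr_ge0 (x - y).
  have h := hw (i x) (i y).
  have hn : `|i x - i y| <= `|(i x).1 - (i y).1| + `|x - y|.
    rewrite norm_pair_le /= lerDl normr_ge0/= !i2; apply: le_trans n2 _; rewrite lerDr//.
  have e : (i x).1 - (i y).1 = (x.1 - y.1) - (w (i x) - w (i y)) by rewrite -(i1 x) -(i1 y); ring.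
  have k1 : `|(i x).1 - (i y).1| <= `|x - y| + `|w (i x) - w (i y)|.
    by rewrite e; apply: le_trans (ler_normB _ _) _; rewrite lerD2r.
  have k2 : d * `|i x - i y| <= 1 / 2 * (`|(i x).1 - (i y).1| + `|x - y|).
    by apply: ler_pM.
  rewrite norm_pair_le; apply/andP; split; first by clear -k1 k2 h n0 => /=; lra.
  by rewrite /= !i2; apply: le_trans n2 _; lra.
exists i => x y; split => //.
have [] := norm_pair (i (x.1 + w x, x.2) - x) => _ _.
set u := i _; have u1 := i1 (x.1 + w x, x.2); rewrite -/u /= in u1.
have u2 : u.2 = x.2 by rewrite /u i2.
have e : u.1 = x.1.
  have h := hw u x.
  have hn : `|u - x| = `|u.1 - x.1|.
    by rewrite prod_normE /= u2 subrr normr0; apply/max_idPl.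
  rewrite hn in h.
  have k : u.1 - x.1 = - (w u - w x) by lra.
  rewrite k normrN in h.
  have n0 := normr_ge0 (w u - w x).
  have : d * `|w u - w x| <= 1 / 2 * `|w u - w x| by rewrite ler_wpM2r.
  move=> h'; have : `|w u - w x| <= 0 by lra.
  by rewrite normr_le0 => /eqP w0; lra.
by rewrite [LHS]surjective_pairing e u2 -surjective_pairing.
Qed.

Definition clip (lo hi t : R) : R := Num.max lo (Num.min t hi).

Lemma clip_in lo hi t : lo <= hi -> lo <= clip lo hi t <= hi.
Proof. by move=> h; rewrite /clip le_max lexx/= ge_max h/= ge_min lexx orbT. Qed.

Lemma clip_id lo hi t : lo <= t <= hi -> clip lo hi t = t.
Proof. by move=> /andP[a b]; rewrite /clip min_l// max_r. Qed.

Lemma clip_lip lo hi t s : lo <= hi -> `|clip lo hi t - clip lo hi s| <= `|t - s|.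
Proof.
move=> h; wlog ts : t s / t <= s => [W|].
  by have [/W//|/ltW/W] := leP t s; rewrite distrC (distrC s).
rewrite [leRHS]distrC [leRHS]ger0_norm ?subr_ge0// ler_norml /clip.
have [h1|h1] := leP t hi; have [h2|h2] := leP s hi; rewrite ?(max_r h);
  try (have [h3|h3] := leP lo t); try (have [h4|h4] := leP lo s); apply/andP; split; lra.
Qed.

(** Composition with this 1-Lipschitz retraction extends the corrections from the box to the plane,
    so that the shears become bijections of the plane. *)
Definition clamp v : R * R := (clip (-4) 4 v.1, clip 0 4 v.2).

Lemma clamp_box v : box 4 (clamp v).
Proof.
have a : -4 <= 4 :> R by lra.
have b : 0 <= 4 :> R by lra.
by split; [rewrite ler_norml; exact: clip_in|exact: clip_in].
Qed.

Lemma clamp_id v : box 4 v -> clamp v = v.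
Proof.
by move=> [v1 v2]; rewrite /clamp !clip_id// -?ler_norml// -surjective_pairing.
Qed.

Lemma clamp_lip v u : `|clamp v - clamp u| <= `|v - u|.
Proof.
have a : -4 <= 4 :> R by lra.
have b : 0 <= 4 :> R by lra.
have [n1 n2] := norm_pair (v - u).
rewrite norm_pair_le /=; apply/andP; split.
  by apply: le_trans n1; exact: clip_lip.
by apply: le_trans n2; exact: clip_lip.
Qed.

Lemma tay_eq be (S : set (R * R)) g g' g1 g2 : (forall v, S v -> g v = g' v) ->
  tay be S g g1 g2 -> tay be S g' g1 g2.
Proof.
move=> e [h h1 h2 [C C0 hC]]; split => //; first exact: hold_eq h.
by exists C => // v u Sv Su; rewrite -!e//; exact: hC.
Qed.

End Homeomorphism.

(** * The diffeomorphism from the stadium to the perturbed domain *)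

Section Perturbation.
Context {R : realType} (mu rho K eps : R).
Hypothesis (mu_gt0 : 0 < mu) (mu_lt : mu < 1 / 320) (rho_gt0 : 0 < rho) (rho_lt : rho < 1 / 4).
Hypothesis (K0 : 0 <= K) (hK : forall t : R, `|dbump t| <= K).
Notation D := (small_bd mu rho K).
Hypothesis (D_small : D <= 1 / 8) (D_eps : 42 * D <= eps).
Notation w0 := (w0 mu rho).
Notation z0 := (z0 mu rho).
Notation w01 := (w01 mu rho).
Notation w02 := (w02 mu rho).
Notation z01 := (z01 mu rho).
Notation z02 := (z02 mu rho).

Definition wc (v : R * R) : R := w0 (clamp v).
Definition zc (v : R * R) : R := z0 (clamp v).

Lemma small_bd_gt0 : 0 < D.
Proof.
have s0 := slope_bd_ge0 rho mu_gt0; have r2 := sqr_ge0 rho.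
have m0 := mu_gt0; have k0 := K0; rewrite /small_bd; apply: mulr_gt0; lra.
Qed.

Lemma tay_wz : tay mu (box 4) wc w01 w02 /\ tay mu (box 4) zc z01 z02.
Proof.
have [tw tz] := tay_corrections mu_gt0 mu_lt rho_gt0.
by split; [apply: tay_eq tw|apply: tay_eq tz] => v Bv; rewrite /wc /zc clamp_id.
Qed.

Lemma wz_small v : [/\ `|wc v| <= D, `|zc v| <= D &
  box 4 v -> [/\ `|w01 v| <= D, `|w02 v| <= D, `|z01 v| <= D & `|z02 v| <= D]].
Proof.
have s u := @small_corrections R mu rho mu_gt0 mu_lt rho_gt0 rho_lt K u K0 hK.
have [[a _ _] [b _ _]] := s _ (clamp_box v).
by split => // Bv; have [[? ? ?] [? ? ?]] := s _ Bv.
Qed.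

Lemma wz_lip v u : `|wc v - wc u| <= 1 / 4 * `|v - u| /\ `|zc v - zc u| <= 1 / 4 * `|v - u|.
Proof.
have m01 : 0 < mu <= 1 by have := mu_gt0; have := mu_lt => ? ?; apply/andP; split; lra.
have [tw tz] := tay_wz; have c4 : 0 < 4 :> R by lra.
have l (f f1 f2 : R * R -> R) : hold mu (box 4) f -> (forall v, box 4 v -> `|f1 v| <= D /\ `|f2 v| <= D) ->
   (forall v, box 4 v -> 0 < v.2 -> is_derive v.1 1 (fun t => f (t, v.2)) (f1 v)) ->
   (forall v, box 4 v -> 0 < v.2 -> is_derive v.2 1 (fun t => f (v.1, t)) (f2 v)) ->
   forall v u, `|f (clamp v) - f (clamp u)| <= 1 / 4 * `|v - u|.
  move=> hf hb d1 d2 {}v {}u.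
  have h := box_lip m01 c4 hf d1 d2 hb (clamp_box u) (clamp_box v).
  apply: le_trans h _; apply: ler_pM => //; last exact: clamp_lip.
    by have := small_bd_gt0 => ?; lra.
  by have := D_small => ?; lra.
have [dw dz] := corrections_derive mu_gt0 mu_lt rho_gt0.
have [[hw _ _ _] [hz _ _ _]] := tay_corrections mu_gt0 mu_lt rho_gt0.
split.
- apply: (l _ _ _ hw _ (fun v Bv v0 => (dw v v0).1) (fun v Bv v0 => (dw v v0).2)) => x Bx.
  by have [_ _ /(_ Bx)[]] := wz_small x.
- apply: (l _ _ _ hz _ (fun v Bv v0 => (dz v v0).1) (fun v Bv v0 => (dz v v0).2)) => x Bx.
  by have [_ _ /(_ Bx)[]] := wz_small x.
Qed.

Lemma jac_small (x y y' t : R) : `|x| <= D -> `|y| <= D -> `|y'| <= D -> `|t| <= D ->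
  `|x / (1 + t)| <= 2 * D /\ `|y - x * y' / (1 + t)| <= 2 * D.
Proof.
move=> hx hy hy' ht; have D0 := small_bd_gt0; have D8 := D_small.
have t0 : 7 / 8 <= 1 + t by move: ht; rewrite ler_norml => /andP[? ?]; lra.
have tp : 0 < 1 + t by lra.
have e : `|x / (1 + t)| <= 2 * D.
  rewrite normrM normfV (gtr0_norm tp) ler_pdivrMr//.
  by have : D * (2 * (7 / 8)) <= D * (2 * (1 + t)) by [apply: ler_wpM2l; lra]; lra.
split => //; apply: le_trans (ler_normB _ _) _.
have -> : x * y' / (1 + t) = x / (1 + t) * y' by ring.
rewrite normrM; have : `|x / (1 + t)| * `|y'| <= 2 * D * (1 / 8) by apply: ler_pM => //; lra.
lra.
Qed.

(** [Phi] undoes the horizontal shear v -> (v.1 + wc v, v.2) and then applies the vertical shear v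
    -> (v.1, v.2 + zc v). Hence Phi - Id is (- wc, zc) evaluated at the intermediate point [i1 x],
    and its regularity comes from [tay_shear]; the inverse [Psi] has the same form with the shears
    exchanged. *)
Lemma perturbation_exists : exists (Y : set (R * R)) (a0 : R),
  [/\ 0 < a0, bounded_domain Y,
      forall al, 0 < al -> al <= a0 -> C1alpha_perturbation eps al stadium Y &
      forall y, Y y <-> exists v,
        [/\ box 4 v, stadium (v.1 + w0 v, v.2) & y = (v.1, v.2 + z0 v)]].
Proof.
have m01 : 0 < mu <= 1 by have := mu_gt0; have := mu_lt => ? ?; apply/andP; split; lra.
have D0 := small_bd_gt0; have D8 := D_small; have De := D_eps; have m0 := mu_gt0.
have d4 : ((0 : R) <= 1 / 4) && ((1 / 4 : R) <= 1 / 2) by apply/andP; split; lra.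
have [i1 h1] := shear_inverse d4 (fun v u => (wz_lip v u).1).
have zl v u : `|(zc \o sw) v - (zc \o sw) u| <= 1 / 4 * `|v - u|.
  by rewrite -norm_sw; have [] := wz_lip (sw v) (sw u).
have [j2 h2] := shear_inverse d4 zl.
(* The vertical shear becomes a horizontal one after the coordinates are exchanged. *)
pose i2 := sw \o j2 \o sw.
have swK (v : R * R) : sw (sw v) = v by rewrite /sw/= -surjective_pairing.
have i1a x : (i1 x).2 = x.2 by have [] := h1 x x.
have i1b x : (i1 x).1 + wc (i1 x) = x.1 by have [] := h1 x x.
have i1c v : i1 (v.1 + wc v, v.2) = v by have [] := h1 v v.
have i1d x y : `|i1 x - i1 y| <= 3 * `|x - y| by have [] := h1 x y.
have i2a y : (i2 y).1 = y.1 by have [] := h2 (sw y) (sw y).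
have i2b y : (i2 y).2 + zc (i2 y) = y.2 by have [] := h2 (sw y) (sw y).
have i2c v : i2 (v.1, v.2 + zc v) = v.
  have [_ _ e _] := h2 (sw v) (sw v).
  by rewrite /i2 /= -[in RHS](swK v) -e /= swK.
have j2d x y : `|j2 x - j2 y| <= 3 * `|x - y| by have [] := h2 x y.
have i2d x y : `|i2 x - i2 y| <= 3 * `|x - y|.
  by rewrite /i2 /= norm_sw -(norm_sw x y).
clear h1 h2.
pose Phi x := (x.1 - wc (i1 x), x.2 + zc (i1 x)).
pose Psi y := (y.1 + wc (i2 y), y.2 - zc (i2 y)).
have PhiE x : Phi x = ((i1 x).1, (i1 x).2 + zc (i1 x)).
  by rewrite /Phi -{1}(i1b x) -{1}(i1a x); congr pair; ring.
have PsiE y : Psi y = ((i2 y).1 + wc (i2 y), (i2 y).2).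
  by rewrite /Psi -{1}(i2b y) -{1}(i2a y); congr pair; ring.
have i2P x : i2 (Phi x) = i1 x by rewrite PhiE i2c.
have i1P y : i1 (Psi y) = i2 y by rewrite PsiE i1c.
have PK x : Psi (Phi x) = x by rewrite PsiE i2P i1b i1a -surjective_pairing.
have KP y : Phi (Psi y) = y by rewrite PhiE i1P i2b i2a -surjective_pairing.
have lipP (f g : R * R -> R) (i : R * R -> R * R) :
   (forall x y, `|i x - i y| <= 3 * `|x - y|) ->
   (forall v u, `|f v - f u| <= 1 / 4 * `|v - u|) -> (forall v u, `|g v - g u| <= 1 / 4 * `|v - u|) ->
   continuous (fun x => (x.1 + f (i x), x.2 + g (i x))).
  move=> hi hf hg; apply: (@lip_continuous _ _ 2) => x y.
  have [n1 n2] := norm_pair (x - y); have n0 := normr_ge0 (x - y).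
  have k := hi x y; have kf := hf (i x) (i y); have kg := hg (i x) (i y).
  rewrite norm_pair_le /=; apply/andP; split.
    have -> : x.1 + f (i x) - (y.1 + f (i y)) = (x - y).1 + (f (i x) - f (i y)) by rewrite /=; ring.
    by apply: le_trans (ler_normD _ _) _; lra.
  have -> : x.2 + g (i x) - (y.2 + g (i y)) = (x - y).2 + (g (i x) - g (i y)) by rewrite /=; ring.
  by apply: le_trans (ler_normD _ _) _; lra.
have cPhi : continuous Phi.
  apply: (lipP (fun v => - wc v) zc) => // v u; last by have [] := wz_lip v u.
  by rewrite -opprD normrN; have [] := wz_lip v u.
have cPsi : continuous Psi.
  apply: (lipP wc (fun v => - zc v)) => // v u; first by have [] := wz_lip v u.
  by rewrite -opprD normrN; have [] := wz_lip v u.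
pose Y := Phi @` stadium.
have YE y : Y y <-> stadium (Psi y).
  by split=> [[x Sx <-]|S]; [rewrite PK|exists (Psi y)].
have bX x : closure stadium x -> box 4 (i1 x) /\ `|(i1 x).1| <= 3.
  move=> /stadium_closure/stadium_bounds[x1 x2].
  have [a _ _] := wz_small (i1 x); have e := i1b x.
  have k : `|(i1 x).1| <= 3.
    have -> : (i1 x).1 = x.1 - wc (i1 x) by rewrite -e; ring.
    by apply: le_trans (ler_normB _ _) _; clear -D0 De D8 x1 a; lra.
  split => //; split; [clear -m01 m0 D8 D0 De mu_lt rho_lt hK k; lra|rewrite i1a; case/andP: x2 => x2 x3].
  by clear -m01 m0 D8 D0 De mu_lt rho_lt hK x2 x3; apply/andP; split; lra.
have clY y : closure Y y -> closure stadium (Psi y).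
  move=> /(closure_image cPsi); have -> // : Psi @` Y = stadium.
  apply/seteqP; split => [_ [_ [x Sx <-] <-]|x Sx]; first by rewrite PK.
  by exists (Phi x) => //; exists x.
have bY y : closure Y y -> box 4 (i2 y) by move=> /clY/bX[]; rewrite i1P.
have [tw tz] := tay_wz.
have half v : box 4 v -> `|w01 v| <= 1 / 2 by move=> Bv; have [_ _ /(_ Bv)[? _ _ _]] := wz_small v; lra.
have halfz v : (sw @^-1` box 4) v -> `|(z02 \o sw) v| <= 1 / 2.
  by move=> Bv; have [_ _ /(_ Bv)[_ _ _ ?]] := wz_small (sw v); rewrite /=; lra.
have c3 : 0 <= 3 :> R := ler0n _ 3.
have e1 x : closure stadium x -> ((i1 x).1 + wc (i1 x), (i1 x).2) = x.
  by rewrite i1b i1a -surjective_pairing.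
have shX := tay_shear m01 tw half (fun x (Sx : closure stadium x) => (bX x Sx).1) e1 c3 (fun x y _ _ => i1d x y).
have twX := shX _ _ _ tw; have tzX := shX _ _ _ tz; clear shX.
have e2 x : (sw @^-1` closure Y) x -> ((j2 x).1 + (zc \o sw) (j2 x), (j2 x).2) = x.
  move=> _; have := i2b (sw x); have := i2a (sw x); rewrite /i2 /= swK => -> ->.
  by rewrite -surjective_pairing.
have b2 x : (sw @^-1` closure Y) x -> (sw @^-1` box 4) (j2 x).
  by move=> /bY; rewrite /i2 /= swK.
have shY := tay_shear m01 (tay_sw tz) halfz b2 e2 c3 (fun x y _ _ => j2d x y).
have twY := tay_sw (shY _ _ _ (tay_sw tw)); have tzY := tay_sw (shY _ _ _ (tay_sw tz)); clear shY.
have fixY : (sw @^-1` (sw @^-1` closure Y)) = closure Y by apply/seteqP; split => x /=; rewrite swK.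
rewrite fixY in twY tzY.
have c4 : 0 <= 4 :> R := ler0n _ 4.
have XS : closure stadium `<=` [set v : R * R | `|v.1| <= 4 /\ `|v.2| <= 4].
  move=> v /stadium_closure/stadium_bounds[v1 /andP[v2 v3]].
  by clear -m01 m0 D8 D0 De mu_lt rho_lt hK v1 v2 v3; split; [lra|rewrite ger0_norm//; lra].
have YS : closure Y `<=` [set v : R * R | `|v.1| <= 5 /\ `|v.2| <= 5].
  move=> v /bY [v1 /andP[v2 v3]]; rewrite i2a in v1; split; first by rewrite (le_trans v1)// ler_nat.
  have := i2b v => <-; have [_ k _] := wz_small (i2 v).
  by apply: le_trans (ler_normD _ _) _; rewrite ger0_norm//; clear -D0 De D8 v3 k; lra.
have c5 : 0 <= 5 :> R := ler0n _ 5.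
have f1X := tay_fst m01 c4 (fun v Sv => (XS v Sv).1); have f2X := tay_snd m01 c4 (fun v Sv => (XS v Sv).2).
have f1Y := tay_fst m01 c5 (fun v Sv => (YS v Sv).1); have f2Y := tay_snd m01 c5 (fun v Sv => (YS v Sv).2).
have oY : open Y.
  have -> : Y = Psi @^-1` stadium by apply/seteqP; split => y /YE.
  by apply: open_comp => [y _|]; [exact: cPsi|exact: stadium_open].
have [a1 a10 A1] := tay_C1alpha m0 (@stadium_open R) (@subset_refl _ _) (tay_add f1X (tay_opp twX)) (tay_add f2X tzX).
have [a2 a20 A2] := tay_C1alpha m0 oY (@subset_refl _ _) (tay_add f1Y twY) (tay_add f2Y (tay_opp tzY)).
have D2 : 0 < 2 * D by rewrite mulr_gt0.
(* Here d0 = D and d1 = 2 D, the factor 2 being the cost of the chain rule in [jac_small]; the bound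
   2 d0 + 20 d1 is 42 D. *)
have [||a3 a30 A3] := tay_C1alpha_norm_le m0 (@stadium_open R) (@subset_refl _ _) (ltW D0) D2 (tay_opp twX) tzX.
- by move=> v _; rewrite normrN; have [] := wz_small (i1 v).
- move=> v Sv; have [_ _ /(_ (bX v Sv).1) [q1 q2 q3 q4]] := wz_small (i1 v).
  by rewrite !normrN; have [? ?] := jac_small q1 q2 q2 q1; have [? ?] := jac_small q3 q4 q2 q1; split.
exists Y, (Num.min a1 (Num.min a2 a3)); split.
- by rewrite !lt_min a10 a20.
- split => //.
  + apply: connected_continuous_connected; first exact: stadium_connected.
    exact: continuous_subspaceT.
  + by have [x Sx] : (@stadium R) !=set0 := let: And4 _ _ h _ := @stadium_bounded_domain R in h; exists (Phi x), x.
  + exists 5; split; [exact: num_real|move=> M M5 y Yy /=].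
    by have [y1 y2] := YS _ (subset_closure Yy); rewrite norm_pair_le (le_trans y1 (ltW M5)) (le_trans y2 (ltW M5)).
- move=> al al0; rewrite !le_min => /andP[l1 /andP[l2 l3]]; exists Phi; split => //.
  + split; last 2 first.
    * exact: A1.
    * by exists Psi => //; exact: A2.
    split.
    * by move=> x /(closure_image cPhi).
    * by move=> x y _ _ /(congr1 Psi); rewrite !PK.
    * by move=> y /clY cy; exists (Psi y).
  + have [J hJ n] := A3 al al0 l3; exists J.
      have -> : (fun x => Phi x - x) = (fun v => (- (wc \o i1) v, (zc \o i1) v)); last exact: hJ.
      by apply/funext => x; rewrite [X in _ - X]surjective_pairing /Phi; congr pair => /=; ring.
    have -> : (fun x => Phi x - x) = (fun v => (- (wc \o i1) v, (zc \o i1) v)).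
      by apply/funext => x; rewrite [X in _ - X]surjective_pairing /Phi; congr pair => /=; ring.
    by apply: le_trans n _; rewrite lee_fin; clear -m01 m0 D8 D0 De mu_lt rho_lt hK; lra.
- move=> y; split=> [[x Sx <-]|[v [Bv Sv ->]]].
    have [Bx _] := bX x (subset_closure Sx).
    exists (i1 x); split => //; last by rewrite PhiE /zc clamp_id.
    by have := i1b x; rewrite /wc clamp_id// i1a => ->; rewrite -surjective_pairing.
  exists (v.1 + w0 v, v.2) => //; rewrite PhiE.
  have -> : w0 v = wc v by rewrite /wc clamp_id.
  by rewrite i1c /zc clamp_id.
Qed.

End Perturbation.

(** * The transport map and its potential *)

Section Helpers.
Context {R : realType}.

Lemma ltr_dist_add (y z s : R) : `|y - z| < s -> z - s < y /\ y < z + s.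
Proof. by rewrite ltr_norml => /andP[? ?]; split; lra. Qed.

Lemma dist_lt_add (y z s : R) : z - s < y -> y < z + s -> `|y - z| < s.
Proof. by move=> ? ?; rewrite ltr_norml; apply/andP; split; lra. Qed.

Lemma midpoint_lt (s v x y : R) : s - (s - v) / 2 < x -> y < v + (s - v) / 2 -> y < x.
Proof. by move=> ? ?; lra. Qed.

End Helpers.

Section TransportMap.
Context {R : realType} (mu rho K : R).
Hypothesis (mu_gt0 : 0 < mu) (mu_lt : mu < 1 / 320) (rho_gt0 : 0 < rho) (rho_lt : rho < 1 / 4).
Hypothesis (K0 : 0 <= K) (hK : forall t : R, `|dbump t| <= K).
Hypothesis (D_small : small_bd mu rho K <= 1 / 8).
Notation A := (A mu rho).
Notation B := (B mu rho).
Notation p := (p mu rho).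
Notation q := (q mu rho).
Notation alpha := (alpha mu rho).
Notation FF := (FF mu rho).
Notation gg := (gg mu rho).
Notation w0 := (w0 mu rho).
Notation z0 := (z0 mu rho).
Notation kap := (kap mu).
Implicit Types (a b : R) (x y : R * R).

Let mu8 : mu < 1 / 8. Proof. by have := mu_lt => ?; lra. Qed.

Lemma B_near a b : 0 <= a -> a <= 4 -> `|b| <= 4 -> 1 / 4 <= NN a b -> `|B a b - b| <= 1 / 8 /\ `|A a b - a| <= 1 / 8.
Proof.
move=> a0 a4 b4 n; have [h1 h2 _ _] := outer mu_gt0 mu_lt rho_gt0 rho_lt a0 a4 b4 n.
have h : 4000 * (mu + rho ^+ 2) <= 1 / 8.
  apply: le_trans D_small; rewrite /small_bd.
  have d0 : 0 <= 4000 * (mu + rho ^+ 2) by have m0 := mu_gt0; have r2 := sqr_ge0 rho; lra.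
  move: (4000 * _) (slope_bd _ _) d0 (slope_bd_ge0 rho mu_gt0) => d s d0 s0.
  rewrite -[leLHS]mul1r; apply: ler_pM => //; last by rewrite lerDr.
  by apply: (@le_trans _ _ 2); [rewrite ler1n|rewrite lerDl mulr_ge0 ?ler0n].
by split; [exact: le_trans h2 h|exact: le_trans h1 h].
Qed.

Lemma B_at4 a : 0 <= a -> a <= 4 -> 7 / 3 < B a 4.
Proof.
move=> a0 a4; have [||h _] := B_near a0 a4 (b := 4).
- by rewrite ger0_norm.
- by rewrite /NN; have := sqr_ge0 a; lra.
by move: h; rewrite ler_norml => /andP[? ?]; lra.
Qed.

Lemma B_inj_lt a b1 b2 : 0 < a -> 0 < b1 -> b1 < b2 -> 0 <= B a b1 -> B a b1 < B a b2.
Proof.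
move=> a0 b10 bb h; apply: B_incr_b => //.
by apply: ltW; apply: B_pos_reg.
Qed.

(** For 0 < x.1 there is at most one such b, because B increases in b once it is nonnegative. *)
Definition bb x : R := xget 0 [set b | 0 < b /\ B x.2 b = x.1].

Lemma bbE a b : 0 < a -> 0 < b -> 0 < B a b -> bb (B a b, a) = b.
Proof.
move=> a0 b0 h; rewrite /bb; case: xgetP => [y _ [y0 /= e]|/(_ b)]; last by case.
have [yb|yb|//] := ltgtP y b.
  by have := B_inj_lt a0 y0 yb; rewrite e => /(_ (ltW h)); rewrite ltxx.
by have := B_inj_lt a0 b0 yb (ltW h); rewrite e ltxx.
Qed.

(** The constant 7 / 3 bounds |x.1| on the stadium, and B(a, 4) exceeds it because B is within 1 / 8
    of b there; at b = 0 the value of B is 0. *)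
Lemma bbP x : 0 < x.1 -> x.1 <= 7 / 3 -> 0 < x.2 -> x.2 <= 4 ->
  [/\ 0 < bb x, bb x < 4 & B x.2 (bb x) = x.1].
Proof.
move=> x0 x1 a0 a4; have h4 := B_at4 (ltW a0) a4.
have [_ hB _ _] := hgoodP rho mu_gt0 mu8.
have cB : {within `[0, 4], continuous (B x.2)} by exact: (cont_in_b_pos mu_gt0 hB).
have [||b] := @IVT R (B x.2) 0 4 x.1 _ cB; first lra.
  rewrite B_b0 ge_min le_max (ltW x0)/=; apply/orP; right; lra.
rewrite in_itv /= => /andP[b0 b4] e.
have {}b0 : 0 < b.
  rewrite lt_neqAle b0 andbT; apply/eqP => bz; rewrite -bz B_b0 in e; lra.
have hb : 0 < B x.2 b by rewrite e.
have eb : bb x = b by have := bbE a0 b0 hb; rewrite e -surjective_pairing.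
rewrite eb; split => //; rewrite lt_neqAle b4 andbT; apply/eqP => bz; rewrite bz in e; lra.
Qed.

Lemma bb_cont x0 e : 0 < x0.1 -> x0.1 <= 7 / 3 -> 0 < x0.2 -> x0.2 <= 4 -> 0 < e ->
  exists2 d, 0 < d & forall x, `|x - x0| < d -> x.1 <= 7 / 3 -> x.2 <= 4 ->
    [/\ 0 < x.1, 0 < x.2 & `|bb x - bb x0| < e].
Proof.
move=> x00 x01 a0 a4 e0; have [b0 b4 eB] := bbP x00 x01 a0 a4.
have [_ hB _ _] := hgoodP rho mu_gt0 mu8.
have [b1 [b10 b1x b1e]] : exists b1, [/\ 0 < b1, b1 < bb x0 & bb x0 - e < b1].
  exists (Num.max (bb x0 / 2) (bb x0 - e / 2)); rewrite !lt_max gt_max.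
  by split; [apply/orP; left|apply/andP; split|apply/orP; right]; lra.
have [b2 b2x b2e] : exists2 b2, bb x0 < b2 & b2 < bb x0 + e by exists (bb x0 + e / 2); lra.
have b20 : 0 < b2 by exact: lt_trans b2x.
have l1 : B x0.2 b1 < x0.1.
  rewrite ltNge; apply/negP => h.
  have := B_inj_lt a0 b10 b1x (le_trans (ltW x00) h); rewrite eB.
  by rewrite ltNge h.
have l2 : x0.1 < B x0.2 b2 by rewrite -{1}eB; apply: B_inj_lt => //; rewrite eB ltW.
have g1 : 0 < (x0.1 - B x0.2 b1) / 2 by rewrite divr_gt0// subr_gt0.
have g2 : 0 < (B x0.2 b2 - x0.1) / 2 by rewrite divr_gt0// subr_gt0.
have [d1 d10 h1] := cont2 mu_gt0 b1 hB a0 g1.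
have [d2 d20 h2] := cont2 mu_gt0 b2 hB a0 g2.
exists (Num.min (Num.min d1 d2) (Num.min (Num.min ((x0.1 - B x0.2 b1) / 2) ((B x0.2 b2 - x0.1) / 2)) (Num.min x0.1 x0.2))).
  by rewrite !lt_min d10 d20 g1 g2 x00 a0.
move=> x; rewrite !lt_min => /andP[/andP[xd1 xd2] /andP[/andP[xg1 xg2] /andP[xx xa]]] x1 x4.
have [n1 n2] := norm_pair (x - x0).
have n1' : `|x.1 - x0.1| <= `|x - x0| by [].
have n2' : `|x.2 - x0.2| <= `|x - x0| by [].
have [r1 _] := ltr_dist_add (le_lt_trans n1' xx); have [r2 _] := ltr_dist_add (le_lt_trans n2' xa).
have [r3 _] := ltr_dist_add (le_lt_trans n1' xg1); have [_ r4] := ltr_dist_add (le_lt_trans n1' xg2).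
rewrite subrr in r1; rewrite subrr in r2.
have z1 : `|b1 - b1| < d1 by rewrite subrr normr0.
have z2 : `|b2 - b2| < d2 by rewrite subrr normr0.
have [_ r5] := ltr_dist_add (h1 x.2 b1 (le_lt_trans n2' xd1) z1).
have [r6 _] := ltr_dist_add (h2 x.2 b2 (le_lt_trans n2' xd2) z2).
have m1 : B x.2 b1 < x.1 := midpoint_lt r3 r5.
have m2 : x.1 < B x.2 b2 := midpoint_lt r6 r4.
have [c0 c4 eC] := bbP r1 x1 r2 x4.
have q1 : b1 < bb x.
  rewrite ltNge le_eqVlt; apply/negP => /orP[/eqP h|h]; first by move: m1; rewrite -h eC ltxx.
  by have := B_inj_lt r2 c0 h; rewrite eC => /(_ (ltW r1)); rewrite ltNge (ltW m1).
have q2 : bb x < b2.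
  rewrite ltNge le_eqVlt; apply/negP => /orP[/eqP h|h]; first by move: m2; rewrite h eC ltxx.
  by have := B_inj_lt r2 b20 h (ltW (lt_trans r1 m2)); rewrite eC ltNge (ltW m2).
split; [exact: r1|exact: r2|].
by apply: dist_lt_add; [exact: lt_trans q1|exact: lt_trans b2e].
Qed.

(** The value on the axis x.1 = 0 is arbitrary, as the axis is a null set. *)
Definition TT x : R * R :=
  if 0 < x.1 then (bb x, A x.2 (bb x))
  else if x.1 < 0 then (- bb (- x.1, x.2), A x.2 (bb (- x.1, x.2)))
  else 0.

Lemma TT_pos x : 0 < x.1 -> TT x = (bb x, A x.2 (bb x)).
Proof. by rewrite /TT => ->. Qed.

Lemma TT_refl x : x.1 != 0 -> TT (- x.1, x.2) = (- (TT x).1, (TT x).2).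
Proof.
rewrite /TT /= oppr_gt0 oppr_lt0 opprK neq_lt => /orP[h|h].
  by rewrite h ltNge (ltW h) /= opprK.
by rewrite ltNge (ltW h) /= h -surjective_pairing.
Qed.

(** For b < rho < 1 / 4 the cut-off is 1 on the edge. For b >= rho the curve is a = 0, so the model
    and - FF agree there and every value of the cut-off gives the same height. *)
Lemma z0_at0 b : 0 < b -> z0 (b, 0) = A (alpha b) b.
Proof.
move=> b0; rewrite /z0 /chi /= [bump 0]bump_eq1; last by rewrite normr0; lra.
have -> : FF b = - A (alpha b) b by rewrite /FF gtr0_norm.
have [br|br] := leP rho b; first by rewrite alpha_ge//; ring.
rewrite bump_eq1; first by ring.
by rewrite gtr0_norm//; have := rho_lt => ?; lra.
Qed.

Lemma chi_eq0 v : 1 <= v.1 \/ 1 <= v.2 -> chi v = 0 :> R.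
Proof.
by case=> h; rewrite /chi; [rewrite bump_eq0 ?mul0r//|rewrite [bump v.2]bump_eq0 ?mulr0//];
  rewrite ger0_norm; lra.
Qed.

Lemma z0_lip b s t : 0 < b -> b <= 4 -> 0 <= s <= 4 -> 0 <= t <= 4 -> `|z0 (b, s) - z0 (b, t)| <= 1 / 4 * `|s - t|.
Proof.
move=> b0 b4 s4 t4.
have [_] := wz_lip mu_gt0 mu_lt rho_gt0 rho_lt K0 hK D_small (b, s) (b, t).
rewrite /zc !clamp_id; try by split => //=; rewrite ger0_norm// ltW.
by rewrite prod_normE /= subrr normr0 (max_idPr _)//; exact: normr_ge0.
Qed.

Section Image.
Variable Y : set (R * R).
Hypothesis YP : forall y, Y y <-> exists v,
  [/\ box 4 v, stadium (v.1 + w0 v, v.2) & y = (v.1, v.2 + z0 v)].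

(** Y is built from the cut-off corrections, which differ from T near the pole, so the two sides are
    compared on each vertical line. If b >= 1 or the height is at least 1, the cut-off vanishes and
    the formulas coincide. In the unit square membership in the stadium is automatic, and only the
    range of heights matters; its lower end is A(alpha b, b) on both sides by [z0_at0]. *)
Lemma image_iff a b : 0 < b -> b <= 4 -> 0 < a -> a <= 4 -> 0 < B a b ->
  stadium (B a b, a) <-> Y (b, A a b).
Proof.
move=> b0 b4 a0 a4 h; have al : alpha b < a by rewrite -(B_alpha mu_gt0 mu8 rho_gt0 a0 b0).
have al0 := alpha_ge0 mu_gt0 mu8 rho_gt0 b0; have reg := reg_alpha mu_gt0 mu8 rho_gt0 b0.
have r1 : rho <= 1 by have := rho_lt => ?; lra.
have Bv s : 0 <= s -> s <= 4 -> box 4 (b, s).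
  by move=> s0 s4; split => /=; [rewrite gtr0_norm|rewrite s0].
have incr s t : alpha b <= s -> s < t -> A s b < A t b /\ B s b < B t b.
  move=> s0 st; apply: (AB_incr_a mu_gt0 mu8 rho_gt0 (le_trans al0 s0) st b0).
  exact: (reg_mono mu_gt0 al0 (ltW b0) s0 (lexx b) reg).
have wsm v : `|w0 v| <= 1 / 8 \/ ~ box 4 v.
  have [Bx|] := pselect (box 4 v); [left|by right].
  have [k _ _] := wz_small mu_gt0 mu_lt rho_gt0 rho_lt K0 hK v.
  by move: k; rewrite /wc clamp_id// => k; exact: le_trans k D_small.
have B1 : b <= 1 -> B 1 b < 2.
  move=> b1; have c1 : 0 <= 1 :> R by []. have c4 : 1 <= 4 :> R by lra.
  have [||k _] := @B_near 1 b c1 c4; [by rewrite gtr0_norm|by rewrite /NN; have := sqr_ge0 b; lra|].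
  by move: k; rewrite ler_norml => /andP[? ?]; lra.
have in4 (u : R) : 0 <= u -> u <= 1 -> 0 <= u <= 4 by move=> u0 u1; rewrite u0 (le_trans u1)// ler1n.
have phi1 : 1 + z0 (b, 1) = A 1 b by rewrite /z0 chi_eq0 /=; [ring|right].
rewrite YP; split=> [S|[v [Bxv S e]]].
  have [ab|ab] := pselect (1 <= b \/ 1 <= a).
    have c0 : chi (b, a) = 0 :> R by exact: chi_eq0.
    have e1 : b + w0 (b, a) = B a b by rewrite /w0 c0 /=; ring.
    have e2 : a + z0 (b, a) = A a b by rewrite /z0 c0 /=; ring.
    exists (b, a); rewrite [(_, _).1]/= [(_, _).2]/= e1 e2.
    by split => //; apply: Bv => //; exact: ltW.
  have [b1 a1] : b < 1 /\ a < 1.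
    by split; rewrite ltNge; apply/negP => k; apply: ab; [left|right].
  (* A height s with phi s = A a b is wanted: phi runs from A (alpha b) b to A 1 b, and A is
     increasing in between. *)
  pose phi s := s + z0 (b, s).
  have cphi : {within `[0, 1], continuous phi}.
    apply/within_contP => s; rewrite /= in_itv /= => /andP[s0 s1] e e0; exists (e / 2); first lra.
    move=> t; rewrite in_itv /= => /andP[t0 t1] st.
    have k := @z0_lip b s t b0 b4 (in4 _ s0 s1) (in4 _ t0 t1).
    have := ler_normD (s - t) (z0 (b, s) - z0 (b, t)).
    have -> : s - t + (z0 (b, s) - z0 (b, t)) = phi s - phi t by rewrite /phi; ring.
    lra.
  have p0 : phi 0 < A a b by rewrite /phi add0r z0_at0//; have [] := incr (alpha b) a (lexx _) al.
  have p1 : A a b < phi 1 by rewrite /phi phi1; have [] := incr a 1 (ltW al) a1.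
  have [|s] := @IVT R phi 0 1 (A a b) ler01 cphi.
    by rewrite ge_min le_max (ltW p0) (ltW p1) orbT.
  rewrite in_itv /= => /andP[s0 s1] es.
  have s0' : 0 < s by rewrite lt_neqAle s0 andbT; apply/eqP => z; rewrite -z in es; lra.
  have Bs : box 4 (b, s) by case/andP: (in4 _ s0 s1) => *; exact: Bv.
  exists (b, s); split => //=; last by rewrite -es.
  have [k|//] := wsm (b, s); move: k; rewrite ler_norml => /andP[k1 k2].
  by apply: stadium_strip => /=; clear -mu_gt0 mu_lt rho_gt0 rho_lt K0 hK D_small YP k1 k2 b0 b1 s0' s1; [rewrite ler_norml; apply/andP; split|..]; lra.
have [vb vA] : v.1 = b /\ v.2 + z0 v = A a b by case: e => -> ->.
have ev : v = (b, v.2) by rewrite -vb -surjective_pairing.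
move: S vA Bxv; rewrite ev; move: (v.2) => s /= S vA [_ /= /andP[s0 s4]].
have /= /andP[sp s2] := stadium_pos S.
have [bs|bs] := pselect (1 <= b \/ 1 <= s).
  have c0 : chi (b, s) = 0 :> R by exact: chi_eq0.
  have e1 : b + w0 (b, s) = B s b by rewrite /w0 c0 /=; ring.
  have e2 : s + z0 (b, s) = A s b by rewrite /z0 c0 /=; ring.
  rewrite e1 in S; rewrite e2 in vA.
  have sal : alpha b < s.
    case: bs => k; last by rewrite -(B_alpha mu_gt0 mu8 rho_gt0 sp b0); apply: B_large => //; lra.
    by rewrite alpha_ge//; lra.
  have [ts|ts|->] := ltgtP a s; last exact: S.
    by have [k _] := incr a s (ltW al) ts; move: k; rewrite vA ltxx.
  by have [k _] := incr s a (ltW sal) ts; move: k; rewrite vA ltxx.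
have [b1 s1] : b < 1 /\ s < 1.
  by split; rewrite ltNge; apply/negP => k; apply: bs; [left|right].
have k := @z0_lip b 1 s b0 b4 (in4 _ ler01 (lexx 1)) (in4 _ s0 (ltW s1)).
have a1 : a < 1.
  rewrite ltNge le_eqVlt; apply/negP => ha.
  have : A 1 b <= A a b.
    case/orP: ha => [/eqP ->//|ha]; apply: ltW.
    have al1 : alpha b <= 1.
      have b1' := B_large mu_gt0 mu8 rho_gt0 ltr01 b0 r1.
      by rewrite (B_alpha mu_gt0 mu8 rho_gt0 ltr01 b0) in b1'; exact: ltW.
    by have [] := incr 1 a al1 ha.
  have n1 : `|1 - s| = 1 - s by rewrite ger0_norm// subr_ge0 ltW.
  rewrite n1 in k; move: k; rewrite ler_norml => /andP[? ?]; rewrite -phi1 -vA; lra.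
have Ble : B a b <= B 1 b by apply: (B_incr_a mu_gt0 mu8 rho_gt0 a0 (ltW a1) b0); exact: ltW.
have := B1 (ltW b1) => B12.
by apply: stadium_strip => /=; [rewrite gtr0_norm// (le_trans Ble (ltW B12))|exact: a0|clear -mu_gt0 mu_lt rho_gt0 rho_lt K0 hK D_small YP al0 a0 a1; lra].
Qed.

Lemma Y_bounds y : Y y -> `|y.1| <= 3 /\ `|y.2| <= 5.
Proof.
move=> /YP[v [Bx S ->]] /=; have [x1 /andP[x2 x3]] := stadium_bounds (ltW S).
have [k1 k2 _] := wz_small mu_gt0 mu_lt rho_gt0 rho_lt K0 hK v.
move: k1 k2; rewrite /wc /zc clamp_id// => k1 k2; have := D_small => D8.
have := ler_normB (v.1 + w0 v) (w0 v); rewrite addrK => j1.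
have := ler_normD v.2 (z0 v) => j2.
have [_ /andP[v0 v4]] := Bx; rewrite (ger0_norm v0) in j2.
by move: x1 x2 x3 => /= x1 x2 x3; split; lra.
Qed.

Lemma Y_sym y : Y y -> Y (- y.1, y.2).
Proof.
move=> /YP[v [Bx S ->]] /=; apply/YP; exists (- v.1, v.2).
have [sA sB _ _] := model_sym mu rho v.2 v.1.
have ch : chi (- v.1, v.2) = chi v by rewrite /chi /= bump_even.
have ew : w0 (- v.1, v.2) = - w0 v by rewrite /w0 ch /= sB; ring.
have ez : z0 (- v.1, v.2) = z0 v by rewrite /z0 ch /= sA FF_even.
split; [by case: Bx => h1 h2; split => //=; rewrite normrN| |by rewrite ez].
by rewrite ew /= -opprD; exact: stadium_sym S.
Qed.

End Image.

Lemma TT_in_Y Y x : (forall y, Y y <-> exists v,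
    [/\ box 4 v, stadium (v.1 + w0 v, v.2) & y = (v.1, v.2 + z0 v)]) ->
  stadium x -> x.1 != 0 -> Y (TT x).
Proof.
move=> YP; have pos z : stadium z -> 0 < z.1 -> Y (TT z).
  move=> Sz z0; have [z1 _] := stadium_bounds (ltW Sz); have /andP[z2 z3] := stadium_pos Sz.
  rewrite gtr0_norm// in z1; have z4 : z.2 <= 4 by lra.
  have [b0 b4 e] := bbP z0 z1 z2 z4; rewrite TT_pos//.
  have h : 0 < B z.2 (bb z) by rewrite e.
  by apply/(image_iff YP b0 (ltW b4) z2 z4 h); rewrite e -surjective_pairing.
move=> Sx; rewrite neq_lt => /orP[x0|x0]; last exact: pos.
have := pos _ (stadium_sym Sx); rewrite /= oppr_gt0 => /(_ x0) /(Y_sym YP).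
by rewrite TT_refl ?lt_eqF//= opprK -surjective_pairing.
Qed.

End TransportMap.

(** * One-dimensional integration and convexity *)

Section OneDimension.
Context {R : realType}.
Implicit Types (f df g tau : R -> R).
Local Notation leb := (@lebesgue_measure R).

Lemma ftc2 f df (a b : R) : a < b ->
  {within `[a, b], continuous df} -> {within `[a, b], continuous f} ->
  (forall t : R, a < t < b -> is_derive t 1 f (df t)) ->
  (\int[leb]_(t in `[a, b]) (df t)%:E = (f b - f a)%:E)%E.
Proof.
move=> ab cdf cf hd; rewrite EFinB; apply: continuous_FTC2 => //.
  have /(continuous_within_itvP _ ab)[_ h1 h2] := cf; split => // t; rewrite in_itv/= => /hd h.
  exact: ex_derive.
by move=> t; rewrite in_itv/= => /hd h; rewrite derive1E; exact: derive_val.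
Qed.

Lemma is_derive_continuous f (df x : R) : is_derive x 1 f df -> {for x, continuous f}.
Proof.
move=> h; apply: differentiable_continuous; apply/derivable1_diffP; exact: ex_derive.
Qed.

Lemma support_1d f df (l r x y : R) : l <= x <= r -> l <= y <= r ->
  (forall t : R, l <= t <= r -> is_derive t 1 f (df t)) ->
  (forall s t, l <= s -> s <= t -> t <= r -> df s <= df t) ->
  f x + df x * (y - x) <= f y.
Proof.
move=> /andP[lx xr] /andP[ly yr] hd hi.
have main s t : l <= s -> t <= r -> s <= t -> exists2 u, s <= u <= t & f t - f s = df u * (t - s).
  move=> ls tr st; have ss : s <= s <= t by rewrite lexx.
  have tt : s <= t <= t by rewrite lexx st.
  have hd' u : s <= u <= t -> is_derive u 1 f (df u).
    by move=> /andP[? ?]; apply: hd; apply/andP; split; [exact: le_trans ls _|exact: le_trans tr].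
  by have [u [u1 _ e]] := MVT_btw ss tt hd'; exists u.
have [xy|/ltW yx] := leP x y.
  have [u /andP[u1 u2] e] := main x y lx yr xy.
  have h := hi x u lx u1 (le_trans u2 yr).
  have : df x * (y - x) <= df u * (y - x) by rewrite ler_wpM2r// subr_ge0.
  lra.
have [u /andP[u1 u2] e] := main y x ly xr yx.
have h := hi u x (le_trans ly u1) u2 xr.
have : df u * (x - y) <= df x * (x - y) by rewrite ler_wpM2r// subr_ge0.
lra.
Qed.

(* The local inequality also makes [tau] nondecreasing, so it can be chained
   up to the supremum of the times it has reached. *)
Lemma local_support_global g tau :
  (forall t0, 0 <= t0 <= 1 -> exists2 d, 0 < d & forall s t, 0 <= s <= 1 -> 0 <= t <= 1 ->
     `|s - t0| < d -> `|t - t0| < d -> g s + tau s * (t - s) <= g t) ->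
  g 0 + tau 0 <= g 1.
Proof.
move=> h; pose E := [set t : R | [/\ 0 <= t, t <= 1, tau 0 <= tau t & g 0 + tau 0 * t <= g t]].
have E0 : E 0 by split => //; rewrite mulr0 addr0.
have supE : has_sup E by split; [exists 0|exists 1 => t []].
pose c := sup E.
have c0 : 0 <= c by apply: (ub_le_sup supE.2).
have c1 : c <= 1 by apply: ge_sup => //; [exists 0|move=> t []].
have [d d0 hd] := h c (introT andP (conj c0 c1)).
have [t Et tc] := sup_adherent d0 supE.
have tle : t <= c by apply: (ub_le_sup supE.2).
have [t0 t1 tt gt] := Et.
have step r : t < r -> r < c + d -> r <= 1 -> E r.
  move=> tr rc r1; have rt : 0 < r - t by rewrite subr_gt0.
  have r0 : 0 <= r by apply: ltW; apply: le_lt_trans tr.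
  have a1 : `|t - c| < d by rewrite ltr_norml; apply/andP; split; rewrite -/c in tc; lra.
  have a2 : `|r - c| < d by rewrite ltr_norml; apply/andP; split; rewrite -/c in tc; lra.
  have t01 : 0 <= t <= 1 by rewrite t0.
  have r01 : 0 <= r <= 1 by rewrite r0.
  have k1 := hd t r t01 r01 a1 a2; have k2 := hd r t r01 t01 a2 a1.
  have m : tau t <= tau r.
    have : 0 <= (tau r - tau t) * (r - t) by lra.
    by rewrite pmulr_lge0// subr_ge0.
  split => //; first exact: le_trans m.
  have : tau 0 * (r - t) <= tau t * (r - t) by rewrite ler_wpM2r// ltW.
  lra.
have [t1'|t1'] := eqVneq t 1; first by move: gt; rewrite t1' mulr1.
have {}t1' : t < 1 by rewrite lt_neqAle t1'.
have rt : t < Num.min 1 (c + d / 2).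
  by rewrite lt_min t1'/=; apply: (le_lt_trans tle); rewrite ltrDl divr_gt0.
have rcd : Num.min 1 (c + d / 2) < c + d.
  by rewrite gt_min; apply/orP; right; rewrite ltrD2l; lra.
have r1 : Num.min 1 (c + d / 2) <= 1 by rewrite ge_min lexx.
have Er := step _ rt rcd r1; have := ub_le_sup supE.2 Er; rewrite -/c => rc.
have r1E : Num.min 1 (c + d / 2) = 1.
  have [//|cd] := leP 1 (c + d / 2); exfalso; move: rc; rewrite (min_r (ltW cd)) gerDl leNgt divr_gt0//.
by move: Er; rewrite r1E => -[_ _ _]; rewrite mulr1.
Qed.

Lemma support_combine (b b' P P' P3 x x' a a' c : R) :
  P' + x' * (b - b') <= P3 -> - P + c * (a' - a) <= - P3 ->
  x * b - P + (b * (x' - x) + c * (a' - a)) <= x' * b' - P'.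
Proof. by move=> h1 h2; lra. Qed.

End OneDimension.

(** * The convex potential of the transport map *)

Section Potential.
Context {R : realType} (mu rho K : R).
Hypothesis (mu_gt0 : 0 < mu) (mu_lt : mu < 1 / 320) (rho_gt0 : 0 < rho) (rho_lt : rho < 1 / 4).
Hypothesis (K0 : 0 <= K) (hK : forall t : R, `|dbump t| <= K).
Hypothesis (D_small : small_bd mu rho K <= 1 / 8).
Notation A := (A mu rho).
Notation B := (B mu rho).
Notation p := (p mu rho).
Notation q := (q mu rho).
Notation kap := (kap mu).
Notation bb := (bb mu rho).
Notation TT := (TT mu rho).
Local Notation leb := (@lebesgue_measure R).
Implicit Types (a b : R) (x y : R * R).

Let mu8 : mu < 1 / 8. Proof. by have := mu_lt => ?; lra. Qed.

(* The gradient of prim in (a, b) is (- A, B). *)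
Definition prim_b a b : R := (\int[leb]_(t in `[(-1)%R, b]) B a t)%R.
Definition prim_a a : R := (\int[leb]_(s in `[0%R, a]) A s 1)%R.
Definition prim a b : R := prim_b a b - prim_a a.

Lemma prim_b_derb a b : 0 < a -> -1 < b -> is_derive b 1 (prim_b a) (B a b).
Proof.
move=> a0 b1; have [_ hB _ _] := hgoodP rho mu_gt0 mu8.
have bu : b < b + 1 by rewrite ltrDl.
have int : leb.-integrable `[-1, b + 1] (EFin \o B a).
  apply: continuous_compact_integrable; first exact: segment_compact.
  exact: (cont_in_b_pos mu_gt0 hB).
have cb : {for b, continuous (B a)} := is_derive_continuous (derB_b mu rho b a0).
have [h1 h2] := continuous_FTC1_closed bu int b1 cb.
by apply: DeriveDef; [exact: h1|rewrite -derive1E; exact: h2].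
Qed.

Lemma prim_a_der a : 0 < a -> is_derive a 1 prim_a (A a 1).
Proof.
move=> a0; have [hA _ _ _] := hgoodP rho mu_gt0 mu8.
have au : a < a + 1 by rewrite ltrDl.
have int : leb.-integrable `[0, a + 1] (EFin \o (fun s => A s 1)).
  apply: continuous_compact_integrable; first exact: segment_compact.
  by apply: (cont_in_a mu_gt0 hA) => //; exact: oner_neq0.
have cb : {for a, continuous (fun s => A s 1)} := is_derive_continuous (derA_a mu rho 1 a0).
have [h1 h2] := continuous_FTC1_closed au int a0 cb.
by apply: DeriveDef; [exact: h1|rewrite -derive1E; exact: h2].
Qed.

(** Under the integral B_a = q = - A_b, which integrates to A(a, -1) - A(a, b), and A is even in b.
    The boundary term A(a, 1) is what [prim_a] cancels; the base lines b = 1 and b = -1 keep that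
    term continuous down to a = 0, away from the pole. *)
Lemma prim_b_dera a b : 0 < a -> -1 < b -> b <= 4 ->
  is_derive a 1 (fun s => prim_b s b) (A a 1 - A a b).
Proof.
move=> a0 b1 b4; have [hA hB hp hq] := hgoodP rho mu_gt0 mu8.
have a20 : 0 < a / 2 by rewrite divr_gt0.
have M0 : 0 <= 4 + 2 * a by rewrite addr_ge0// mulr_ge0// ltW.
have [C C0 hC] := hq (a / 2) (4 + 2 * a) a20 M0.
have Ia : `]a / 2, 2 * a[%classic a by rewrite /= in_itv/=; apply/andP; split; lra.
have mI : measurable (`[-1, b]%classic : set R) by [].
have intf s : `]a / 2, 2 * a[%classic s -> leb.-integrable `[-1, b] (EFin \o B s).
  rewrite /= in_itv/= => /andP[s0 _]; apply: continuous_compact_integrable; first exact: segment_compact.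
  by apply: (cont_in_b_pos mu_gt0 hB); exact: lt_trans s0.
have dq s t : `]a / 2, 2 * a[%classic s -> is_derive s 1 (fun s => B s t) (q s t).
  by rewrite /= in_itv/= => /andP[s0 _]; apply: derB_a; exact: lt_trans s0.
have derf s t : `]a / 2, 2 * a[%classic s -> `[-1, b]%classic t -> derivable (B ^~ t) s 1.
  by move=> /(dq s t) h _; exact: ex_derive.
have intC : leb.-integrable `[-1, b] (EFin \o (fun=> C)).
  by apply: continuous_compact_integrable; [exact: segment_compact|apply: continuous_subspaceT; exact: cst_continuous].
have pE s t : `]a / 2, 2 * a[%classic s -> partial1of2 B s t = q s t.
  by move=> /(dq s t) h; rewrite partial1of2E; exact: derive_val.
have ub s t : `]a / 2, 2 * a[%classic s -> `[-1, b]%classic t -> `|partial1of2 B s t| <= C.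
  move=> Is; rewrite pE//; move: Is; rewrite /= !in_itv/= => /andP[s1 s2] /andP[t1 t2].
  have S : SM (a / 2) (4 + 2 * a) (t, s).
    have [n1 n2] := ler_norm_nrm s t; have s0 : 0 <= s by lra.
    rewrite (ger0_norm s0) in n1; split => /=; [lra|lra| |].
      by rewrite ler_norml; apply/andP; split; lra.
    by rewrite ger0_norm//; lra.
  by have [] := hC _ _ S S.
have h1 := @derivable_under_integral R _ (measurableTypeR R) leb B `[-1, b]%classic mI a (a / 2) (2 * a) Ia intf derf (fun=> C) (fun=> C0) intC ub.
have h2 := @differentiation_under_integral R _ (measurableTypeR R) leb B `[-1, b]%classic mI a (a / 2) (2 * a) Ia intf derf (fun=> C) (fun=> C0) intC ub.
apply: DeriveDef; first exact: h1.
rewrite -derive1E h2.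
have := @ftc2 R (fun t => - A a t) (q a) (-1) b b1.
have -> : A a 1 - A a b = - A a b - - A a (-1).
  by have [-> _ _ _] := model_sym mu rho a 1; ring.
move=> ft; rewrite /Rintegral.
under eq_integral do rewrite pE//.
have cq : {within `[-1, b], continuous (q a)} by exact: (cont_in_b_pos mu_gt0 hq).
have cA : {within `[-1, b], continuous (fun t => - A a t)}.
  have h : {within `[-1, b], continuous (A a)} by exact: (cont_in_b_pos mu_gt0 hA).
  by move=> t; apply: continuousN; exact: h.
have hd t : -1 < t < b -> is_derive t 1 (fun t => - A a t) (q a t).
  by move=> _; have /is_derive_eq := is_deriveN (derA_b mu rho t a0); apply; exact: opprK.
by rewrite (ft cq cA hd).
Qed.

Lemma prim_derb a b : 0 < a -> -1 < b -> is_derive b 1 (prim a) (B a b).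
Proof.
move=> a0 b1; have /is_derive_eq := is_deriveB (prim_b_derb a0 b1) (is_derive_cst (prim_a a) b 1).
by apply; rewrite subr0.
Qed.

Lemma prim_dera a b : 0 < a -> -1 < b -> b <= 4 -> is_derive a 1 (fun s => prim s b) (- A a b).
Proof.
move=> a0 b1 b4; have /is_derive_eq := is_deriveB (prim_b_dera a0 b1 b4) (prim_a_der a0).
by apply; ring.
Qed.

(** The Legendre transform of [prim] in b, evaluated at the critical point [bb] and extended evenly.
    Its formal gradient is (b, - prim_a) = (b, A), that is [TT]. *)
Definition pot x : R := `|x.1| * bb (`|x.1|, x.2) - prim x.2 (bb (`|x.1|, x.2)).

Lemma pot_sym x : pot (- x.1, x.2) = pot x.
Proof. by rewrite /pot /= normrN. Qed.

Lemma pot_pos x : 0 < x.1 -> pot x = x.1 * bb x - prim x.2 (bb x).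
Proof. by move=> x0; rewrite /pot gtr0_norm// -surjective_pairing. Qed.

(** Where kap N >= rho^2, [prim] is convex in b and concave in a. The tangent inequality in b at
    height x'.2 and the one in a at [bb x] add up to the claim. It is local because both legs have
    to stay in that region. *)
Lemma pot_local x0 : stadium x0 -> 0 < x0.1 -> exists2 d, 0 < d & forall x x',
  stadium x -> stadium x' -> `|x - x0| < d -> `|x' - x0| < d ->
  pot x + dotp (TT x) (x' - x) <= pot x'.
Proof.
move=> S0 x00; have st x : stadium x -> [/\ x.1 <= 7 / 3, 0 < x.2 & x.2 <= 4].
  move=> S; have [x1 _] := stadium_bounds (ltW S); have /andP[x2 x3] := stadium_pos S.
  by split => //; [exact: le_trans (ler_norm _) x1|apply: (le_trans (ltW x3)); rewrite ler_nat].
have [x01 a0 a4] := st _ S0; have [b0 b4 eB] := bbP mu_gt0 mu_lt rho_gt0 rho_lt K0 D_small x00 x01 a0 a4.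
have [hA hB _ _] := hgoodP rho mu_gt0 mu8.
have [d1 d10 h1] := cont2 mu_gt0 (bb x0) hB a0 x00.
have e0 : 0 < Num.min d1 (bb x0) by rewrite lt_min d10 b0.
have [d2 d20 h2] := bb_cont mu_gt0 mu_lt rho_gt0 rho_lt K0 D_small x00 x01 a0 a4 e0.
exists (Num.min d2 (Num.min d1 x0.2)); first by rewrite !lt_min d20 d10 a0.
have reg a b : `|a - x0.2| < d1 -> `|b - bb x0| < d1 -> 0 < a -> 0 < b -> rho ^+ 2 <= kap * NN a b.
  move=> ha hb pa pb; apply: ltW; apply: B_pos_reg => //.
  have := h1 a b ha hb; rewrite eB => /ltr_dist_add[]; rewrite subrr => k _; exact: ltW.
move=> x x' Sx Sx'; rewrite !lt_min => /andP[x2 /andP[x1 xa]] /andP[x2' /andP[x1' xa']].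
have [y1 y2 y4] := st _ Sx; have [y1' y2' y4'] := st _ Sx'.
have [z1 _ zb] := h2 x x2 y1 y4; have [z1' _ zb'] := h2 x' x2' y1' y4'.
have [c0 c4 eC] := bbP mu_gt0 mu_lt rho_gt0 rho_lt K0 D_small z1 y1 y2 y4.
have [c0' c4' eC'] := bbP mu_gt0 mu_lt rho_gt0 rho_lt K0 D_small z1' y1' y2' y4'.
move: zb zb'; rewrite !lt_min => /andP[zb _] /andP[zb' _].
have n2 : `|x.2 - x0.2| < d1 by apply: le_lt_trans x1; have [] := norm_pair (x - x0).
have n2' : `|x'.2 - x0.2| < d1 by apply: le_lt_trans x1'; have [] := norm_pair (x' - x0).
have conv (u v c d s : R) : `|u - c| < d -> `|v - c| < d -> Num.min u v <= s -> s <= Num.max u v -> `|s - c| < d.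
  move=> /ltr_dist_add[k1 k2] /ltr_dist_add[k3 k4] k5 k6; apply: dist_lt_add.
    by apply: lt_le_trans k5; rewrite lt_min k1.
  by apply: le_lt_trans k6 _; rewrite gt_max k2.
rewrite !pot_pos// TT_pos//.
have s1 : prim x'.2 (bb x') + B x'.2 (bb x') * (bb x - bb x') <= prim x'.2 (bb x).
  apply: (@support_1d _ (prim x'.2) (B x'.2) (Num.min (bb x') (bb x)) (Num.max (bb x') (bb x))).
  - by rewrite ge_min le_max !lexx.
  - by rewrite ge_min le_max !lexx !orbT.
  - move=> t /andP[t1 _]; apply: prim_derb => //.
    by apply: (@lt_trans _ _ 0); [rewrite ltrN10|apply: lt_le_trans t1; rewrite lt_min c0' c0].
  - move=> s t s1 st' t2; have s0 : 0 < s by apply: lt_le_trans s1; rewrite lt_min c0' c0.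
    have [->//|nst] := eqVneq s t; apply: ltW; apply: B_incr_b => //; first by rewrite lt_neqAle nst.
    by apply: reg => //; apply: (conv _ _ _ _ _ zb' zb s1); exact: le_trans t2.
have s2 : - prim x.2 (bb x) + A x.2 (bb x) * (x'.2 - x.2) <= - prim x'.2 (bb x).
  apply: (@support_1d _ (fun s => - prim s (bb x)) (fun s => A s (bb x)) (Num.min x.2 x'.2) (Num.max x.2 x'.2)).
  - by rewrite ge_min le_max !lexx.
  - by rewrite ge_min le_max !lexx !orbT.
  - move=> t /andP[t1 _]; have t0 : 0 < t by apply: lt_le_trans t1; rewrite lt_min y2 y2'.
    have b1 : -1 < bb x by apply: lt_trans c0; rewrite ltrN10.
    have /is_derive_eq := is_deriveN (prim_dera t0 b1 (ltW c4)); apply; exact: opprK.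
  - move=> s t r1 st' t2; have s0 : 0 < s by apply: lt_le_trans r1; rewrite lt_min y2 y2'.
    have [->//|nst] := eqVneq s t; apply: ltW.
    have sl : s < t by rewrite lt_neqAle nst.
    have r : rho ^+ 2 <= kap * NN s (bb x).
      by apply: reg => //; apply: (conv _ _ _ _ _ n2 n2' r1); exact: le_trans t2.
    by have [] := AB_incr_a mu_gt0 mu8 rho_gt0 (ltW s0) sl c0 r.
rewrite eC' in s1; rewrite /dotp /=.
exact: support_combine s1 s2.
Qed.

(** In the right half the segment stays in the convex stadium and [local_support_global] chains the
    local inequalities. If x' is across the axis, reflecting it preserves [pot] and only increases
    the pairing, since the first component of TT x is positive. *)
Lemma pot_support x x' : stadium x -> stadium x' -> x.1 != 0 -> x'.1 != 0 ->
  pot x + dotp (TT x) (x' - x) <= pot x'.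
Proof.
have pos y y' : stadium y -> stadium y' -> 0 < y.1 -> 0 < y'.1 -> pot y + dotp (TT y) (y' - y) <= pot y'.
  move=> Sy Sy' y0 y0'.
  pose z (t : R) : R * R := (t * y'.1 + (1 - t) * y.1, t * y'.2 + (1 - t) * y.2).
  have z0E : z 0 = y by rewrite /z !mul0r !add0r subr0 !mul1r -surjective_pairing.
  have z1E : z 1 = y' by rewrite /z subrr !mul0r !addr0 !mul1r -surjective_pairing.
  have Sz t : 0 <= t <= 1 -> stadium (z t) by exact: stadium_conv.
  have zp t : 0 <= t <= 1 -> 0 < (z t).1.
    move=> /andP[t0 t1]; rewrite /z /=; have [->|tn] := eqVneq t 0; first by rewrite mul0r add0r subr0 mul1r.
    by apply: ltr_wpDr; [rewrite mulr_ge0 ?subr_ge0// ltW|rewrite mulr_gt0// lt_neqAle eq_sym tn].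
  have := @local_support_global R (fun t => pot (z t)) (fun t => dotp (TT (z t)) (y' - y)).
  rewrite z0E z1E; apply => t0 t01.
  have [d d0 hd] := pot_local (Sz _ t01) (zp _ t01).
  have L0 : 0 < `|y' - y| + 1 by rewrite ltr_wpDl.
  exists (d / (`|y' - y| + 1)); first exact: divr_gt0.
  move=> s t s01 t01' hs ht.
  have zd (r r' : R) : z r - z r' = ((r - r') * (y' - y).1, (r - r') * (y' - y).2).
    by rewrite [LHS]surjective_pairing /z; congr pair => /=; ring.
  have near r : `|r - t0| < d / (`|y' - y| + 1) -> `|z r - z t0| < d.
    rewrite ltr_pdivlMr// => k; apply: le_lt_trans k; have [n1 n2] := norm_pair (y' - y).
    have m u : `|u| <= `|y' - y| -> `|(r - t0) * u| <= `|r - t0| * (`|y' - y| + 1).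
      by move=> hu; rewrite normrM ler_wpM2l// (le_trans hu)// lerDl.
    by rewrite zd norm_pair_le !m.
  have := hd _ _ (Sz _ s01) (Sz _ t01') (near _ hs) (near _ ht).
  rewrite zd; have -> : dotp (TT (z s)) ((t - s) * (y' - y).1, (t - s) * (y' - y).2) = dotp (TT (z s)) (y' - y) * (t - s).
    by rewrite /dotp [(_, _).1]/= [(_, _).2]/=; ring.
  by [].
have half y y' : stadium y -> stadium y' -> 0 < y.1 -> y'.1 != 0 -> pot y + dotp (TT y) (y' - y) <= pot y'.
  move=> Sy Sy' y0; rewrite neq_lt => /orP[y0'|y0']; last exact: pos.
  have ny : 0 < (- y'.1, y'.2).1 by rewrite /= oppr_gt0.
  have := pos y (- y'.1, y'.2) Sy (stadium_sym Sy') y0 ny; rewrite pot_sym => h.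
  apply: le_trans h; rewrite lerD2l TT_pos// /dotp /= lerD2r; apply: ler_wpM2l.
    have [y1 _] := stadium_bounds (ltW Sy); have /andP[y2 y3] := stadium_pos Sy.
    rewrite gtr0_norm// in y1; have y4 : y.2 <= 4 by apply: (le_trans (ltW y3)); rewrite ler_nat.
    by have [/ltW] := bbP mu_gt0 mu_lt rho_gt0 rho_lt K0 D_small y0 y1 y2 y4.
  by rewrite lerD2r; apply: ltW; apply: lt_trans y0' ny.
move=> Sx Sx'; rewrite neq_lt => /orP[x0|x0]; last exact: half.
move=> x0'; have nx : 0 < (- x.1, x.2).1 by rewrite /= oppr_gt0.
have nx' : (- x'.1, x'.2).1 != 0 by rewrite /= oppr_eq0.
have := half _ _ (stadium_sym Sx) (stadium_sym Sx') nx nx'.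
rewrite !pot_sym TT_refl ?lt_eqF// => h; apply: le_trans h.
by rewrite lerD2l /dotp /= lerD2r; rewrite le_eqVlt; apply/orP; left; apply/eqP; ring.
Qed.

End Potential.

(** * The image of the area measure *)

Section PlaneMeasure.
Context {R : realType}.
Local Notation leb := (@lebesgue_measure R).

(** Measurability refers to the product sigma-algebra, so the open set is written as a countable
    union of rational boxes. *)
Lemma open_measurable2 (O : set (R * R)) : open O -> measurable O.
Proof.
move=> oO.
pose Bx (q1 q2 : rat) (n : nat) : set (R * R) :=
  ball (ratr q1 : R) n.+1%:R^-1 `*` ball (ratr q2 : R) n.+1%:R^-1.
pose F q1 q2 n : set (R * R) := if `[< Bx q1 q2 n `<=` O >] then Bx q1 q2 n else set0.
have -> : O = \bigcup_q1 \bigcup_q2 \bigcup_n F q1 q2 n.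
  apply/seteqP; split => [x Ox|x [q1 _ [q2 _ [n _]]]]; last first.
    by rewrite /F; case: ifPn => // /asboolP; apply.
  have /nbhs_ballP[r /= r0 hr] : nbhs x O by exact: open_nbhs_nbhs.
  pose n := Num.bound (2 / r).
  have e0 : 0 < n.+1%:R^-1 :> R by rewrite invr_gt0 ltr0n.
  have er : 2 * n.+1%:R^-1 < r.
    have h : 2 / r < n.+1%:R.
      apply: (@lt_trans _ _ n%:R); last by rewrite ltr_nat.
      by apply: archi_boundP; rewrite divr_ge0// ltW.
    rewrite -ltr_pdivlMl// mulrC -[ltRHS]invrK ltf_pV2 ?posrE ?invr_gt0 ?ltr0n//; last first.
      by rewrite mulr_gt0// invr_gt0.
    by rewrite invfM invrK mulrC.
  have rat1 (u : R) : exists q : rat, `|ratr q - u| < n.+1%:R^-1.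
    have [q] := @rat_in_itvoo R u (u + n.+1%:R^-1) ltac:(by rewrite ltrDl).
    rewrite in_itv/= => /andP[q1 q2]; exists q.
    by rewrite gtr0_norm ?subr_gt0// ltrBlDr addrC.
  have [q1 hq1] := rat1 x.1; have [q2 hq2] := rat1 x.2.
  exists q1 => //; exists q2 => //; exists n => //; rewrite /F ifT.
    by split; rewrite /= -ball_normE.
  apply/asboolP => y [y1 y2]; apply: hr; rewrite -ball_normE /=.
  move: y1 y2; rewrite -!ball_normE /= => y1 y2.
  have tri (a b c : R) : `|a - b| < n.+1%:R^-1 -> `|a - c| < n.+1%:R^-1 -> `|b - c| < r.
    move=> h1 h2; apply: lt_trans er; rewrite distrC in h1.
    have := ler_normD (b - a) (a - c); rewrite addrA subrK => h.
    by apply: le_lt_trans h _; rewrite [ltRHS]mulr_natl mulr2n ltrD.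
  by rewrite prod_normE /= gt_max; apply/andP; split; [exact: tri hq1 y1|exact: tri hq2 y2].
apply: bigcupT_measurable_rat => q1; apply: bigcupT_measurable_rat => q2.
apply: bigcupT_measurable => n; rewrite /F; case: ifP => _; last exact: measurable0.
by apply: measurableX; exact: measurable_ball.
Qed.

Lemma cont_measurable (O : set (R * R)) (f : R * R -> R) : open O ->
  (forall x, O x -> forall e, 0 < e -> exists2 d, 0 < d & forall y, `|y - x| < d -> `|f y - f x| < e) ->
  measurable_fun O f.
Proof.
move=> oO hf; apply: (measurability _ (RGenOInfty.measurableE R)) => _ [_ [a ->] <-].
apply: open_measurable2; rewrite openE => x [Ox]; rewrite /= in_itv/= andbT => ax.
have /nbhs_ballP[r /= r0 hr] : nbhs x O by exact: open_nbhs_nbhs.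
have e0 : 0 < f x - a by rewrite subr_gt0.
have [d d0 hd] := hf x Ox _ e0.
apply/nbhs_ballP; exists (Num.min r d); first by rewrite /= lt_min r0.
move=> y; rewrite -ball_normE /= lt_min => /andP[yr yd].
split; first by apply: hr; rewrite -ball_normE.
rewrite distrC in yd; have := hd y yd; rewrite /= in_itv/= andbT ltr_norml => /andP[h _]; lra.
Qed.

Lemma area_ysection (S : set (R * R)) : measurable S ->
  area S = (\int[leb]_y leb (ysection S y))%E.
Proof.
move=> mS; rewrite /area.
have -> : (leb \x leb)%E S = (leb \x^ leb)%E S.
  by apply: product_measure_unique => //= *; rewrite product_measure2E.
by [].
Qed.

Lemma area_xsection (S : set (R * R)) : area S = (\int[leb]_x leb (xsection S x))%E.
Proof. by []. Qed.

Lemma area_reflect (S : set (R * R)) : measurable S ->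
  area [set x | S (- x.1, x.2)] = area S.
Proof.
move=> mS.
have mf : measurable_fun setT (fun x : R * R => (- x.1, x.2)).
  apply: measurable_fun_pair; last exact: measurable_snd.
  by apply: (@measurableT_comp _ _ _ _ _ _ (-%R : R -> R)) => //; exact: measurable_fst.
have mS' : measurable [set x | S (- x.1, x.2)].
  by have := mf measurableT _ mS; rewrite setTI.
rewrite !area_ysection//; apply: eq_integral => y _.
rewrite -[RHS]lebesgue_measureN; last exact: measurable_ysection.
by rewrite /pushforward; congr (leb _); apply/seteqP; split => x /=; rewrite /ysection /= !inE.
Qed.

Lemma area_axis : area [set x : R * R | x.1 = 0] = 0%E.
Proof.
have -> : [set x : R * R | x.1 = 0] = [set 0] `*` setT by apply/seteqP; split => x //= [].
by rewrite /area product_measure1E//= lebesgue_measure_set1 mul0e.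
Qed.

Lemma axis_measurable : measurable [set x : R * R | x.1 = 0].
Proof.
have -> : [set x : R * R | x.1 = 0] = [set 0] `*` setT by apply/seteqP; split => x //= [].
exact: measurableX.
Qed.

End PlaneMeasure.

(** * Change of variables on the line *)

Section Substitution.
Context {R : realType} (G g : R -> R) (l r : R).
Local Notation leb := (@lebesgue_measure R).
Hypothesis lr : l < r.
Hypothesis cg : {within `[l, r], continuous g}.
Hypothesis cG : {within `[l, r], continuous G}.
Hypothesis dG : forall t : R, l < t < r -> is_derive t 1 G (g t).
Hypothesis g0 : forall t, l < t <= r -> 0 <= g t.
Hypothesis G_lt : forall s t, l <= s -> s < t -> t <= r -> G s < G t.

Let I : set R := `]l, r].
Let J : set R := `]G l, G r].
Let Gh t := G (clip l r t).
Let gh t := `|g (clip l r t)|.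

Let clip_cont (f : R -> R) : {within `[l, r], continuous f} -> continuous (fun t => f (clip l r t)).
Proof.
move=> /within_contP cf; suff : {within setT, continuous (fun t => f (clip l r t))}.
  by move=> h x; have := h x; rewrite /continuous_at nbhs_subspaceT.
apply/within_contP => x _ e e0.
have cl t : `[l, r]%classic (clip l r t) by rewrite /= in_itv; apply: clip_in; exact: ltW.
have [d d0 hd] := cf _ (cl x) e e0; exists d => // y _ xy; apply: hd => //.
by apply: le_lt_trans xy; apply: clip_lip; exact: ltW.
Qed.

Let mGh : measurable_fun setT (Gh : R -> measurableTypeR R).
Proof. by apply: continuous_measurable_fun; exact: clip_cont. Qed.

Let mgh : measurable_fun setT gh.
Proof.
by apply: measurableT_comp => //; apply: continuous_measurable_fun; exact: clip_cont.
Qed.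

Let mI : measurable I. Proof. exact: measurable_itv. Qed.
Let mJ : measurable J. Proof. exact: measurable_itv. Qed.

Definition dens (A : set (measurableTypeR R)) : \bar R := (\int[leb]_(t in A `&` I) (gh t)%:E)%E.

Let dens0 : dens set0 = 0%E. Proof. by rewrite /dens set0I integral_set0. Qed.
Let dens_ge0 A : (0 <= dens A)%E.
Proof. by apply: integral_ge0 => t _; rewrite lee_fin normr_ge0. Qed.
Let dens_sigma_additive : semi_sigma_additive dens.
Proof.
move=> F mF tF mUF; rewrite /dens setI_bigcupl ge0_integral_bigcup//.
- apply: is_cvg_ereal_nneg_natsum_cond => n _ _.
  by apply: integral_ge0 => t _; rewrite lee_fin normr_ge0.
- by move=> k; exact: measurableI.
- by apply/measurable_EFinP; exact: measurable_funTS.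
- by move=> t _; rewrite lee_fin normr_ge0.
- by apply: trivIset_setIr.
Qed.
HB.instance Definition _ := isMeasure.Build _ _ _ dens dens0 dens_ge0 dens_sigma_additive.

Let mCJ : measurable (~` J). Proof. exact: measurableC. Qed.

(* Agrees with the Lebesgue measure on half-open intervals. *)
Definition subst_nu (A : set (measurableTypeR R)) : \bar R :=
  (dens (Gh @^-1` A) + leb (A `&` ~` J))%E.

Let mpre (A : set (measurableTypeR R)) : measurable A -> measurable (Gh @^-1` A).
Proof. by move=> mA; rewrite -[X in measurable X]setTI; exact: mGh. Qed.

Let nu0 : subst_nu set0 = 0%E.
Proof. by rewrite /subst_nu preimage_set0 dens0 set0I measure0 adde0. Qed.
Let nu_ge0 A : (0 <= subst_nu A)%E.
Proof. by apply: adde_ge0; [exact: dens_ge0|exact: measure_ge0]. Qed.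
Let nu_sigma_additive : semi_sigma_additive subst_nu.
Proof.
move=> F mF tF mUF; rewrite /subst_nu.
under eq_fun do rewrite big_split/=.
apply: cvgeD.
- by apply: ge0_adde_def; rewrite inE; [exact: dens_ge0|exact: measure_ge0].
- rewrite preimage_bigcup; apply: dens_sigma_additive.
  + by move=> n; exact: mpre.
  + apply/trivIsetP => i j _ _ ij; rewrite -preimage_setI.
    by move/trivIsetP : tF => /(_ _ _ _ _ ij) ->//; rewrite preimage_set0.
  + by rewrite -preimage_bigcup; exact: mpre.
- rewrite setI_bigcupl; apply: measure_semi_sigma_additive.
  + by move=> n; exact: measurableI.
  + exact: trivIset_setIr.
  + by rewrite -setI_bigcupl; exact: measurableI.
Qed.
HB.instance Definition _ := isMeasure.Build _ _ _ subst_nu nu0 nu_ge0 nu_sigma_additive.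

(** The fundamental theorem of calculus settles half-open intervals, and uniqueness of Lebesgue
    measure extends this to all measurable sets. Keeping Lebesgue measure off the range of G makes
    [subst_nu] a measure on the whole line, to which uniqueness applies. *)
Lemma subst_measure (A : set R) : measurable A -> A `<=` J ->
  (leb A = \int[leb]_(t in [set t : R | (l < t <= r)%R /\ A (G t)]) (g t)%:E)%E.
Proof.
move=> mA AJ.
have GI t : I t -> [/\ l < t, t <= r, Gh t = G t & gh t = g t].
  rewrite /I /= in_itv/= => /andP[lt tr].
  have c : clip l r t = t by rewrite clip_id// ltW.
  by rewrite /Gh /gh c ger0_norm// g0// lt.
have main : leb A = subst_nu A.
  apply: (@lebesgue_measure_unique R subst_nu) => // _ [[u v] _ <-] /=.
  rewrite /subst_nu /dens.
  have mX : measurable (`]u, v]%classic : set R) by [].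
  rewrite -[X in leb X](setIT) -(setUv J) setIUr measureU//=; first last.
  - by rewrite setIACA setICr setI0.
  - exact: measurableI.
  - exact: measurableI.
  congr (_ + _)%E.
  pose u' := Num.max u (G l); pose v' := Num.min v (G r).
  have XJ : (`]u, v] `&` J = `]u', v'])%classic.
    apply/seteqP; split => t; rewrite /J /= !in_itv/= gt_max le_min.
      by move=> [/andP[-> ->] /andP[-> ->]].
    by move=> /andP[/andP[-> ->] /andP[-> ->]].
  have lerl : l <= l <= r by rewrite lexx ltW.
  have Gmono s t : l <= s -> s <= t -> t <= r -> G s <= G t.
    by move=> ls; rewrite le_eqVlt => /orP[/eqP->//|st tr]; apply: ltW; exact: G_lt.
  have key t : I t -> (u < Gh t <= v) = (u' < G t <= v').
    move=> It; have [lt tr -> _] := GI t It.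
    by rewrite gt_max le_min (G_lt (lexx l) lt tr) (Gmono t r (ltW lt) tr (lexx r)) !andbT.
  rewrite XJ; have [uv|vu] := ltP u' v'; last first.
    rewrite set_itv_ge -?leNgt ?bnd_simp// measure0.
    rewrite (_ : _ `&` I = set0) ?integral_set0//; apply/seteqP; split => // t [] /=.
    rewrite in_itv /= => k It; move: k; rewrite key// => /andP[k1 k2].
    by have := lt_le_trans k1 k2; rewrite ltNge vu.
  have ivt w : G l <= w -> w <= G r -> exists2 t, l <= t <= r & G t = w.
    move=> w1 w2; have [|t] := @IVT R G l r w (ltW lr) cG.
      by rewrite ge_min le_max w1 w2 orbT.
    by rewrite in_itv/= => tt e; exists t.
  have ul : G l <= u' by rewrite le_max lexx orbT.
  have vr : v' <= G r by rewrite ge_min lexx orbT.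
  have [s /andP[ls sr] es] := ivt u' ul (le_trans (ltW uv) vr).
  have [t /andP[lt' tr] et] := ivt v' (le_trans ul (ltW uv)) vr.
  have st : s < t.
    by rewrite ltNge; apply/negP => ts; have := Gmono t s lt' ts sr; rewrite es et leNgt uv.
  rewrite lebesgue_measure_itv /= lte_fin uv -EFinB -es -et.
  have sub : `[s, t]%classic `<=` `[l, r]%classic.
    by move=> x; rewrite /= !in_itv/= => /andP[x1 x2]; rewrite (le_trans ls x1) (le_trans x2 tr).
  have dst (x : R) : s < x < t -> is_derive x 1 G (g x).
    by move=> /andP[x1 x2]; apply: dG; rewrite (le_lt_trans ls x1) (lt_le_trans x2 tr).
  have e := ftc2 st (continuous_subspaceW sub cg) (continuous_subspaceW sub cG) dst.
  rewrite -e.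
  have -> : Gh @^-1` `]u, v] `&` I = `]s, t]%classic.
    apply/seteqP; split => x /=; rewrite !in_itv/=.
      move=> [k Ix]; move: k; rewrite key//; have [lx xr _ _] := GI x Ix; rewrite -es -et => /andP[k1 k2].
      apply/andP; split.
        by rewrite ltNge; apply/negP => xs; have := Gmono x s (ltW lx) xs sr; rewrite leNgt k1.
      by rewrite leNgt; apply/negP => tx; have := G_lt lt' tx xr; rewrite ltNge k2.
    move=> /andP[sx xt]; have Ix : I x by rewrite /I /= in_itv/= (le_lt_trans ls sx) (le_trans xt tr).
    split => //; rewrite key//; have [lx xr _ _] := GI x Ix; rewrite -es -et.
    by rewrite (G_lt ls sx xr) (Gmono x t (ltW lx) xt tr).
  have meas : measurable_fun `]s, t] (fun x => (g x)%:E).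
    apply/measurable_EFinP; apply: (@eq_measurable_fun _ _ _ _ _ gh); last exact: measurable_funTS.
    move=> x; rewrite inE /= in_itv/= => /andP[x1 x2].
    have Ix : I x by rewrite /I /= in_itv/= (le_lt_trans ls x1) (le_trans x2 tr).
    by have [_ _ _] := GI x Ix.
  rewrite -(integral_itv_obnd_cbnd meas); apply: eq_integral => x; rewrite inE /= in_itv/= => /andP[x1 x2].
  have Ix : I x by rewrite /I /= in_itv/= (le_lt_trans ls x1) (le_trans x2 tr).
  by have [_ _ _ ->] := GI x Ix.
rewrite main /subst_nu /dens.
have -> : A `&` ~` J = set0 by apply/disjoints_subset; rewrite setCK.
rewrite measure0 adde0.
have -> : Gh @^-1` A `&` I = [set t | l < t <= r /\ A (G t)].
  apply/seteqP; split => t /=.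
    by move=> [k It]; have [lt tr e _] := GI t It; rewrite lt tr -e.
  move=> [k At]; have It : I t by rewrite /I /= in_itv.
  by split => //; have [_ _ -> _] := GI t It.
apply: eq_integral => t; rewrite inE /= => -[k _].
have It : I t by rewrite /I /= in_itv.
by have [_ _ _ ->] := GI t It.
Qed.

End Substitution.

Section Reflection.
Context {R : realType}.
Implicit Types (S : set (R * R)).

Lemma reflect_measurable S : measurable S -> measurable [set x : R * R | S (- x.1, x.2)].
Proof.
move=> mS; have mf : measurable_fun setT (fun x : R * R => (- x.1, x.2)).
  apply: measurable_fun_pair; last exact: measurable_snd.
  by apply: (@measurableT_comp _ _ _ _ _ _ (-%R : R -> R)) => //; exact: measurable_fst.
by have := mf measurableT _ mS; rewrite setTI.
Qed.

Lemma right_measurable : measurable [set x : R * R | 0 < x.1].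
Proof.
have := @measurable_fst _ _ R R measurableT _ (@measurable_itv R `]0, +oo[).
by rewrite setTI; congr measurable; apply/seteqP; split => x /=; rewrite in_itv/= andbT.
Qed.

Lemma area_U S S' : measurable S -> measurable S' -> S `&` S' = set0 ->
  area (S `|` S') = (area S + area S')%E.
Proof. by move=> mS mS' SS'; rewrite /area measureU. Qed.

Lemma area_split S : measurable S ->
  area S = (area (S `&` [set x : R * R | (0 < x.1)%R]) +
    area ([set x : R * R | S (- x.1, x.2)%R] `&` [set x : R * R | (0 < x.1)%R]))%E.
Proof.
move=> mS; have mP := right_measurable; have mZ := @axis_measurable R.
have mN : measurable [set x : R * R | x.1 < 0].
  by have := reflect_measurable mP; congr measurable; apply/seteqP; split => x /=; rewrite oppr_gt0.
have eS : S = (S `&` [set x | 0 < x.1]) `|` ((S `&` [set x | x.1 < 0]) `|` (S `&` [set x | x.1 = 0])).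
  apply/seteqP; split => x; last by move=> [[]|[[]|[]]].
  move=> Sx; have [h|h|h] := ltgtP x.1 0; [by right; left|by left|by right; right].
rewrite {1}eS area_U; [|exact: measurableI|apply: measurableU; exact: measurableI|]; last first.
  by apply/seteqP; split => x // [[_ /= h] [[_ /= k]|[_ /= k]]]; have := h; rewrite ?k ?ltxx// => h'; have := lt_trans h k; rewrite ltxx.
rewrite area_U; [|exact: measurableI|exact: measurableI|]; last first.
  by apply/seteqP; split => x // [[_ /= h] [_ /= k]]; move: h; rewrite k ltxx.
have z : area (S `&` [set x : R * R | x.1 = 0]) = 0%E.
  apply/eqP; rewrite eq_le measure_ge0 andbT -(@area_axis R); apply: le_measure; rewrite ?inE; [exact: measurableI|exact: mZ|by move=> x []].
rewrite z adde0; apply: f_equal2; first by [].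
rewrite -area_reflect; last exact: measurableI.
by congr area; apply/seteqP; split => x /=; rewrite oppr_lt0.
Qed.

End Reflection.

Section Shift.
Context {R : realType}.

Lemma shift_lt (z z' s : R) : `|z - z'| <= 1 / 4 * `|s - 0| -> 0 < s -> z' < s + z.
Proof. by move=> h s0; move: h; rewrite subr0 (gtr0_norm s0) ler_norml => /andP[? ?]; lra. Qed.

Lemma shift_le (z z' s : R) : `|z - z'| <= 1 / 4 * `|4 - s| -> s <= 4 -> s + z' <= 4 + z.
Proof. by move=> h s4; move: h; rewrite (@ger0_norm _ (4 - s)) ?subr_ge0// ler_norml => /andP[? ?]; lra. Qed.

End Shift.

(** * Area preservation *)

Section PushForward.
Context {R : realType} (mu rho K : R).
Hypothesis (mu_gt0 : 0 < mu) (mu_lt : mu < 1 / 320) (rho_gt0 : 0 < rho) (rho_lt : rho < 1 / 4).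
Hypothesis (K0 : 0 <= K) (hK : forall t : R, `|dbump t| <= K).
Hypothesis (D_small : small_bd mu rho K <= 1 / 8).
Notation A := (A mu rho).
Notation B := (B mu rho).
Notation p := (p mu rho).
Notation alpha := (alpha mu rho).
Notation kap := (kap mu).
Notation bb := (bb mu rho).
Notation TT := (TT mu rho).
Notation w0 := (w0 mu rho).
Notation z0 := (z0 mu rho).
Local Notation leb := (@lebesgue_measure R).
Implicit Types (a b : R) (x y v : R * R) (S : set (R * R)).

Let mu8 : mu < 1 / 8. Proof. by have := mu_lt => ?; lra. Qed.

(** For fixed a this is the point past which B is positive: the zero that follows a negative value
    of B, or 0 if B has no negative value on (0, 4). *)
Lemma beta_ex a : 0 < a -> a <= 4 -> exists beta : R,
  [/\ 0 <= beta, beta < 4, B a beta = 0 & forall t, 0 < t -> (0 < B a t) = (beta < t)].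
Proof.
move=> a0 a4; have [_ hB _ _] := hgoodP rho mu_gt0 mu8.
have h4 := B_at4 mu_gt0 mu_lt rho_gt0 rho_lt K0 D_small (ltW a0) a4.
have B4 : 0 < B a 4 by apply: lt_trans h4.
have [[t [t0 t4 Bt]]|h] := pselect (exists t, [/\ 0 < t, t < 4 & B a t < 0]); last first.
  exists 0; split => //; first by rewrite B_b0.
  move=> t t0; rewrite t0; have [t4|t4] := leP 4 t.
    apply: (lt_le_trans B4); move: t4; rewrite le_eqVlt => /orP[/eqP->//|t4].
    by apply: ltW; apply: (B_inj_lt mu_gt0 mu_lt rho_gt0) => //; rewrite ltW.
  have t20 : 0 < t / 2 by rewrite divr_gt0.
  have t2t : t / 2 < t by rewrite ltr_pdivrMr// ltr_pMr// ltr1n.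
  have Bt2 : 0 <= B a (t / 2).
    by rewrite leNgt; apply/negP => k; apply: h; exists (t / 2); split => //; exact: lt_trans t4.
  by apply: (le_lt_trans Bt2); apply: (B_inj_lt mu_gt0 mu_lt rho_gt0).
have cB : {within `[t, 4], continuous (B a)} by exact: (cont_in_b_pos mu_gt0 hB).
have [|beta] := @IVT R (B a) t 4 0 (ltW t4) cB.
  by rewrite ge_min le_max (ltW Bt) (ltW B4) orbT.
rewrite in_itv/= => /andP[tb b4] e; have b0 := lt_le_trans t0 tb.
exists beta; split => //; first exact: ltW.
  by rewrite lt_neqAle b4 andbT; apply/eqP => k; move: B4; rewrite -k e ltxx.
move=> s s0; have [bs|sb] := ltP beta s.
  by rewrite -{1}e; apply: (B_inj_lt mu_gt0 mu_lt rho_gt0) => //; rewrite e.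
apply/negbTE; rewrite -leNgt leNgt; apply/negP => k.
move: sb; rewrite le_eqVlt => /orP[/eqP sb|sb]; first by move: k; rewrite sb e ltxx.
by have := B_inj_lt mu_gt0 mu_lt rho_gt0 a0 s0 sb (ltW k); rewrite e => /(lt_trans k); rewrite ltxx.
Qed.

Let U : set (R * R) := [set v | 0 < v.2].

Let U_open : open U.
Proof. by apply: (@open_comp _ _ (@snd R R) [set y | 0 < y]); [move=> x _; exact: cvg_snd|exact: open_gt]. Qed.

Let model_measurable (F : R -> R -> R) : hgood mu F -> measurable_fun U (fun v : R * R => F v.2 v.1).
Proof.
move=> hF; apply: cont_measurable => // x Ux e e0.
have [d d0 hd] := cont2 mu_gt0 x.1 hF Ux e0; exists d => // y yd.
by have [n1 n2] := norm_pair (y - x); apply: hd; [exact: le_lt_trans n2 yd|exact: le_lt_trans n1 yd].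
Qed.

(** Both areas equal the integral of p over the set [E] of points (b, a). For fixed a the function b
    -> B has derivative p, and for fixed b the function a -> A has the same derivative by the
    Cauchy-Riemann equations. Fubini-Tonelli and two substitutions on lines replace a change of
    variables in the plane. *)
Lemma fiber_area S S' :
  measurable S -> measurable S' ->
  (forall x, S x -> [/\ 0 < x.1, x.1 <= 7 / 3, 0 < x.2 & x.2 <= 4]) ->
  (forall y, S' y -> [/\ 0 < y.1, y.1 <= 4, A (alpha y.1) y.1 < y.2 & y.2 <= A 4 y.1]) ->
  (forall a b, 0 < a -> a <= 4 -> 0 < b -> b <= 4 -> 0 < B a b -> S (B a b, a) <-> S' (b, A a b)) ->
  area S = area S'.
Proof.
move=> mS mS' hS hS' SS'; have [hA hB hp _] := hgoodP rho mu_gt0 mu8.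
have mU : measurable U by exact: open_measurable2.
pose h v := (((fun v => B v.2 v.1) \_ U) v, v.2).
have mh : measurable_fun setT h.
  apply: measurable_fun_pair; last exact: measurable_snd.
  by apply/(measurable_restrictT _ mU); exact: model_measurable.
pose E : set (R * R) := [set v | [/\ 0 < v.1 <= 4, 0 < v.2 <= 4, 0 < B v.2 v.1 & S (B v.2 v.1, v.2)]].
have hU v : U v -> h v = (B v.2 v.1, v.2) by move=> Uv; rewrite /h patchE mem_set.
have mE : measurable E.
  have m1 : measurable (h @^-1` S) by have := mh measurableT _ mS; rewrite setTI.
  have m2 : measurable ((@fst R R) @^-1` `]0, 4]).
    by have := @measurable_fst _ _ R R measurableT _ (@measurable_itv R `]0, 4]); rewrite setTI.
  have m3 : measurable ((@snd R R) @^-1` `]0, 4]).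
    by have := @measurable_snd _ _ R R measurableT _ (@measurable_itv R `]0, 4]); rewrite setTI.
  have m4 : measurable (h @^-1` [set x | 0 < x.1]) by have := mh measurableT _ (@right_measurable R); rewrite setTI.
  have -> : E = (h @^-1` S) `&` ((@fst R R) @^-1` `]0, 4]) `&` ((@snd R R) @^-1` `]0, 4]) `&` (h @^-1` [set x | 0 < x.1]).
    apply/seteqP; split => v; rewrite /E /= !in_itv/=.
      move=> [v1 v2 Bv Sv]; have Uv : U v by case/andP: v2.
      by rewrite -[X in _ /\ 0 < X]/((h v).1) hU.
    rewrite -[X in _ /\ 0 < X]/((h v).1) => -[[[Sv v1] v2] Bv]; have Uv : U v by case/andP: v2.
    by rewrite hU// in Sv Bv.
  by apply: measurableI => //; apply: measurableI => //; exact: measurableI.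
have EU : E `<=` U by move=> v [_ /andP[]].
pose f : R * R -> \bar R := (fun v => (p v.2 v.1)%:E) \_ E.
have p0 a b : 0 < a -> 0 < b -> 0 < B a b -> 0 <= p a b.
  by move=> a0 b0 Bab; apply: ltW; apply: (p_gt0 mu_gt0 mu8 rho_gt0 a0 b0); apply: ltW; apply: B_pos_reg => //; exact: ltW.
have mf : measurable_fun setT f.
  apply/(measurable_restrictT _ mE); apply/measurable_EFinP.
  by apply: (measurable_funS mU EU); exact: model_measurable.
have f0 v : (0 <= f v)%E.
  rewrite /f patchE; case: ifPn => //; rewrite inE => -[/andP[v1 _] /andP[v2 _] Bv _].
  by rewrite lee_fin p0.
have F1 := fubini_tonelli1 (m1 := leb) (m2 := leb) f mf f0.
have F2 := fubini_tonelli2 (m1 := leb) (m2 := leb) f mf f0.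
rewrite area_ysection// [RHS]area_xsection.
transitivity (\int[leb]_y fubini_G leb f y)%E; last first.
  rewrite -F2 F1; apply: eq_integral => b _; rewrite /fubini_F.
  have -> : (\int[leb]_y f (b, y) = \int[leb]_(t in [set t | E (b, t)]) (p t b)%:E)%E.
    rewrite [RHS]integral_mkcond; apply: eq_integral => t _; rewrite /f !patchE.
    by congr (if _ then _ else _); apply/idP/idP; rewrite !inE.
  have [/andP[b0 b4]|nb] := boolP (0 < b <= 4); last first.
    rewrite (_ : xsection S' b = set0); last first.
      apply/seteqP; split => t // /xsectionP/hS'[/= k1 k2 _ _].
      by move: nb; rewrite k1 k2.
    rewrite measure0 (_ : [set t | E (b, t)] = set0) ?integral_set0//.
    by apply/seteqP; split => t // [/= k]; rewrite k in nb.
  have al0 := alpha_ge0 mu_gt0 mu8 rho_gt0 b0; have reg := reg_alpha mu_gt0 mu8 rho_gt0 b0.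
  have lt04 : 0 < 4 :> R by [].
  have al4 : alpha b < 4.
    rewrite -(B_alpha mu_gt0 mu8 rho_gt0 lt04 b0); apply: (B_large mu_gt0 mu8 rho_gt0 lt04 b0).
    by apply: ltW; apply: (lt_trans rho_lt); lra.
  have bn : b != 0 by rewrite gt_eqF.
  have mX : measurable (xsection S' b) by exact: measurable_xsection.
  have -> : (leb (xsection S' b) = \int[leb]_(t in [set t | (alpha b < t <= 4)%R /\ xsection S' b (A t b)]) (p t b)%:E)%E.
    apply: (@subst_measure R (fun a => A a b) (fun a => p a b) (alpha b) 4 al4
      (cont_in_a mu_gt0 hp al0 bn) (cont_in_a mu_gt0 hA al0 bn)).
    - by move=> t /andP[lt _]; apply: derA_a; exact: le_lt_trans lt.
    - move=> t /andP[lt tr]; have t0 := le_lt_trans al0 lt.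
      by apply: p0 => //; rewrite (B_alpha mu_gt0 mu8 rho_gt0 t0 b0).
    - move=> s t ls st _; have [] // := AB_incr_a mu_gt0 mu8 rho_gt0 (le_trans al0 ls) st b0 _.
      exact: (reg_mono mu_gt0 al0 (ltW b0) ls (lexx b) reg).
    - exact: mX.
    - by move=> t /xsectionP/hS'[_ _ /= k1 k2]; rewrite /= in_itv/= k1 k2.
  congr integral; apply/seteqP; split => t /=.
    move=> [_ /= /andP[t0 t4] Bt St]; rewrite (B_alpha mu_gt0 mu8 rho_gt0 t0 b0) in Bt.
    rewrite Bt t4; split => //; apply/xsectionP; apply/SS' => //.
    by rewrite (B_alpha mu_gt0 mu8 rho_gt0 t0 b0).
  move=> [/andP[lt t4] /xsectionP St]; have t0 := le_lt_trans al0 lt.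
  have Bt : 0 < B t b by rewrite (B_alpha mu_gt0 mu8 rho_gt0 t0 b0).
  by split; rewrite /= ?b0 ?t0//; apply/SS'.
apply: eq_integral => a _; rewrite /fubini_G.
have -> : (\int[leb]_x f (x, a) = \int[leb]_(t in [set t | E (t, a)]) (p a t)%:E)%E.
  rewrite [RHS]integral_mkcond; apply: eq_integral => t _; rewrite /f !patchE.
  by congr (if _ then _ else _); apply/idP/idP; rewrite !inE.
have [/andP[a0 a4]|na] := boolP (0 < a <= 4); last first.
  rewrite (_ : ysection S a = set0); last first.
    apply/seteqP; split => t // /ysectionP/hS[_ _ /= k1 k2].
    by move: na; rewrite k1 k2.
  rewrite measure0 (_ : [set t | E (t, a)] = set0) ?integral_set0//.
  by apply/seteqP; split => t // [_ /= k]; rewrite k in na.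
have [beta [be0 be4 eb hb]] := beta_ex a0 a4.
have h4 := B_at4 mu_gt0 mu_lt rho_gt0 rho_lt K0 D_small (ltW a0) a4.
have mX : measurable (ysection S a) by exact: measurable_ysection.
have -> : (leb (ysection S a) = \int[leb]_(t in [set t | (beta < t <= 4)%R /\ ysection S a (B a t)]) (p a t)%:E)%E.
  apply: (@subst_measure R (B a) (p a) beta 4 be4
    (cont_in_b_pos mu_gt0 hp a0) (cont_in_b_pos mu_gt0 hB a0)).
  - by move=> t _; exact: derB_b.
  - move=> t /andP[lt tr]; have t0 := le_lt_trans be0 lt.
    by apply: p0 => //; rewrite hb.
  - move=> s t ls st _; have t0 : 0 < t by apply: le_lt_trans st; exact: le_trans ls.
    move: ls; rewrite le_eqVlt => /orP[/eqP ls|ls].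
      by rewrite -ls eb hb// ls.
    have s0 : 0 < s by exact: le_lt_trans ls.
    by apply: (B_inj_lt mu_gt0 mu_lt rho_gt0) => //; rewrite ltW// hb.
  - exact: mX.
  - by move=> t /ysectionP/hS[/= k1 k2 _ _]; rewrite /= in_itv/= eb k1 (le_trans k2 (ltW h4)).
congr integral; apply/seteqP; split => t /=.
  move=> [/andP[lt t4] /ysectionP St]; have t0 := le_lt_trans be0 lt.
  by split; rewrite /= ?t0 ?a0// hb.
move=> [/= /andP[t0 t4] _ Bt St]; rewrite hb// in Bt; rewrite Bt t4; split => //.
exact/ysectionP.
Qed.

Variable Y : set (R * R).
Hypothesis Y_open : open Y.
Hypothesis YP : forall y, Y y <-> exists v,
  [/\ box 4 v, stadium (v.1 + w0 v, v.2) & y = (v.1, v.2 + z0 v)].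

Let Xr : set (R * R) := stadium `&` [set x | 0 < x.1].

Let Xr_open : open Xr.
Proof.
apply: openI; first exact: stadium_open.
by apply: (@open_comp _ _ (@fst R R) [set y | 0 < y]); [move=> x _; exact: cvg_fst|exact: open_gt].
Qed.

Let Xr_bounds x : Xr x -> [/\ 0 < x.1, x.1 <= 7 / 3, 0 < x.2 & x.2 <= 4].
Proof.
move=> [S x0]; have [x1 _] := stadium_bounds (ltW S); have /andP[x2 x3] := stadium_pos S.
split => //; first exact: le_trans (ler_norm _) x1.
by apply: (le_trans (ltW x3)); rewrite ler_nat.
Qed.

Lemma TT_right_measurable S : measurable S -> measurable (Xr `&` TT @^-1` S).
Proof.
move=> mS; have mX : measurable Xr by exact: open_measurable2.
have [hA _ _ _] := hgoodP rho mu_gt0 mu8.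
have near x : Xr x -> forall e, 0 < e -> exists2 d, 0 < d & forall y, `|y - x| < d -> Xr y /\ `|bb y - bb x| < e.
  move=> Xx e e0; have [x0 x1 x2 x4] := Xr_bounds Xx.
  have [d d0 hd] := bb_cont mu_gt0 mu_lt rho_gt0 rho_lt K0 D_small x0 x1 x2 x4 e0.
  have /nbhs_ballP[r /= r0 hr] : nbhs x Xr by exact: open_nbhs_nbhs.
  exists (Num.min d r); first by rewrite lt_min d0.
  move=> y; rewrite lt_min => /andP[yd yr].
  have Xy : Xr y by apply: hr; rewrite -ball_normE /= distrC.
  by have [_ y1 _ y4] := Xr_bounds Xy; split => //; have [] := hd y yd y1 y4.
have m1 : measurable_fun Xr bb.
  apply: cont_measurable => // x Xx e e0; have [d d0 hd] := near x Xx e e0.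
  by exists d => // y /hd[].
have m2 : measurable_fun Xr (fun x => A x.2 (bb x)).
  apply: cont_measurable => // x Xx e e0; have [_ _ x2 _] := Xr_bounds Xx.
  have [c c0 hc] := cont2 mu_gt0 (bb x) hA x2 e0.
  have [d d0 hd] := near x Xx c c0; exists (Num.min c d); first by rewrite lt_min c0.
  move=> y; rewrite lt_min => /andP[yc /hd[_ yb]]; apply: hc => //.
  by have [_ n2] := norm_pair (y - x); exact: le_lt_trans n2 yc.
pose h x := ((bb \_ Xr) x, ((fun x => A x.2 (bb x)) \_ Xr) x).
have mh : measurable_fun setT h by apply: measurable_fun_pair; exact/(measurable_restrictT _ mX).
have -> : Xr `&` TT @^-1` S = Xr `&` h @^-1` S.
  have e x : Xr x -> h x = TT x by move=> Xx; rewrite /h !patchE mem_set// TT_pos//; case: Xx.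
  by apply/seteqP; split => x [Xx] /=; [rewrite -e|rewrite e].
by apply: measurableI => //; have := mh measurableT _ mS; rewrite setTI.
Qed.

Lemma area_right S : measurable S ->
  area (Xr `&` TT @^-1` S) = area (Y `&` S `&` [set y | 0 < y.1]).
Proof.
move=> mS; apply: fiber_area.
- exact: TT_right_measurable.
- by apply: measurableI; [apply: measurableI => //; exact: open_measurable2|exact: right_measurable].
- by move=> x [/Xr_bounds].
- move=> y [[/YP[v [Bv Sv ->]] _] /= v0]; have [_ /andP[s0 s4]] := Bv.
  have v4 : v.1 <= 4 by case: Bv => /(le_trans (ler_norm _)).
  have /= /andP[sp s2] := stadium_pos Sv.
  have zl s t := @z0_lip R mu rho K mu_gt0 mu_lt rho_gt0 rho_lt K0 hK D_small v.1 s t v0 v4.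
  have e0 := @z0_at0 R mu rho rho_gt0 rho_lt v.1 v0.
  have n0 : 0 <= (0 : R) <= 4 by rewrite lexx ler0n.
  have n4 : 0 <= (4 : R) <= 4 by rewrite lexx ler0n.
  have ns : 0 <= v.2 <= 4 by rewrite s0.
  (* Comparison with the heights 0 and 4, where s + z0 equals A on the curve and A at 4, places y.2
     in the range of A. *)
  have k0 := zl v.2 0 ns n0; have k4 := zl 4 v.2 n4 ns.
  have ev : (v.1, v.2) = v by rewrite -surjective_pairing.
  have e4 : 4 + z0 (v.1, 4) = A 4 v.1.
    by rewrite /z0 chi_eq0 /=; [ring|right => /=; rewrite ler1n].
  rewrite ev e0 in k0; rewrite ev in k4.
  split => //=; [exact: shift_lt k0 sp|rewrite -e4; exact: shift_le k4 s4].
- move=> a b a0 a4 b0 b4 Bab.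
  have e := bbE mu_gt0 mu_lt rho_gt0 a0 b0 Bab.
  have T : TT (B a b, a) = (b, A a b) by rewrite TT_pos//= e.
  have im := image_iff mu_gt0 mu_lt rho_gt0 rho_lt K0 hK D_small YP b0 b4 a0 a4 Bab.
  split=> [[[Sx _] /=]|[[Yy Sy] _]]; first by rewrite T => Sy; split => //; split => //; apply/im.
  by split; [split => //; apply/im|rewrite /= T].
Qed.

Lemma TT_transport : transport_map stadium Y TT.
Proof.
have mZ := @axis_measurable R; have mX : measurable (@stadium R) by apply: open_measurable2; exact: stadium_open.
have mpre S : measurable S -> measurable (stadium `&` TT @^-1` S).
  move=> mS.
  (* The axis contributes all of its points or none, according to whether S contains the default
     value 0 of TT. *)
  have -> : stadium `&` TT @^-1` S = (Xr `&` TT @^-1` S) `|`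
     ([set x | (Xr `&` TT @^-1` [set y | S (- y.1, y.2)]) (- x.1, x.2)] `|`
      (if `[< S 0 >] then stadium `&` [set x | x.1 = 0] else set0)).
    apply/seteqP; split => x.
      move=> [Sx Tx]; have [h|h|h] := ltgtP x.1 0; last 1 first.
      - right; right; rewrite ifT; first by split.
        by apply/asboolP; move: Tx; rewrite /= /TT h ltxx.
      - right; left; split; first by split; [exact: stadium_sym|rewrite /= oppr_gt0].
        by rewrite /= TT_refl ?lt_eqF//= opprK -surjective_pairing.
      - by left; split.
    move=> [[[] //]|[[[/stadium_sym Sx /= x0] /= Tx]|]].
      move: Sx; rewrite /= opprK -surjective_pairing => Sx; split => //.
      move: Tx; rewrite TT_refl; last by rewrite -oppr_eq0 gt_eqF.
      by rewrite /= opprK -surjective_pairing.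
    case: ifPn => // /asboolP S0 [Sx /= x0]; split => //.
    by rewrite /= /TT x0 ltxx.
  apply: measurableU; first exact: TT_right_measurable.
  apply: measurableU.
    by apply: reflect_measurable; apply: TT_right_measurable; exact: reflect_measurable.
  by case: ifP => _; [exact: measurableI|exact: measurable0].
split; first by move=> _ S mS; exact: mpre.
move=> S mS; rewrite area_split; last exact: mpre.
have mYS : measurable (Y `&` S) by apply: measurableI => //; exact: open_measurable2.
rewrite [RHS](area_split mYS); apply: f_equal2.
  by rewrite -(area_right mS); congr area; apply/seteqP; split => x; [move=> [[Sx Tx] x0]|move=> [[Sx x0] Tx]].
have mS' := reflect_measurable mS.
have -> : [set x | (Y `&` S) (- x.1, x.2)] `&` [set x | 0 < x.1] =
    Y `&` [set x | S (- x.1, x.2)] `&` [set x | 0 < x.1].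
  have ys := Y_sym YP.
  apply/seteqP; split => x [[Yx Sx] x0]; split => //; split => //; last exact: ys.
  by have := ys _ Yx; rewrite /= opprK -surjective_pairing.
rewrite -(area_right mS'); congr area; apply/seteqP; split => x /=.
  move=> [[Sx Tx] x0]; split; first by split => //; have := stadium_sym Sx; rewrite /= opprK -surjective_pairing.
  by move: Tx; rewrite TT_refl ?gt_eqF.
move=> [[Sx x0] Tx]; split => //; split; first exact: stadium_sym.
by rewrite TT_refl ?gt_eqF.
Qed.

End PushForward.

(** * Duality *)

Section DotProduct.
Context {R : realType}.
Implicit Types (x y v : R * R).

Lemma enorm_sqr v : enorm v ^+ 2 = dotp v v.
Proof. by rewrite /enorm sqr_sqrtr// /dotp addr_ge0// -expr2 sqr_ge0. Qed.

Definition in_square (L : R) x := `|x.1| <= L /\ `|x.2| <= L.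

Lemma dotp_le x y (L L' : R) : in_square L x -> in_square L' y -> `|dotp x y| <= 2 * (L * L').
Proof.
move=> [x1 x2] [y1 y2]; rewrite /dotp; apply: le_trans (ler_normD _ _) _.
rewrite !normrM mulrDl mul1r lerD// ler_pM//.
Qed.

Lemma in_square_norm v : in_square `|v| v.
Proof. by rewrite /in_square prod_normE /= !le_max !lexx orbT. Qed.

Lemma measurable_dotp (D : set (R * R)) (f g : R * R -> R * R) :
  measurable_fun D f -> measurable_fun D g -> measurable_fun D (fun x => dotp (f x) (g x)).
Proof.
move=> mf mg; have m1 : measurable_fun setT (@fst R R) by exact: measurable_fst.
have m2 : measurable_fun setT (@snd R R) by exact: measurable_snd.
by apply: measurable_funD; apply: measurable_funM; apply: measurableT_comp.
Qed.

End DotProduct.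

Section AreaMeasure.
Context {R : realType}.
Let lam : {measure set (measurableTypeR R * measurableTypeR R) -> \bar R} :=
  (@lebesgue_measure R \x @lebesgue_measure R)%E.
Let area0 : area set0 = 0%E :> \bar R.
Proof. exact: (measure0 lam). Qed.
Let area_ge0 (A : set (R * R)) : (0 <= area A)%E.
Proof. exact: (measure_ge0 lam). Qed.
Let area_sigma : semi_sigma_additive (@area R).
Proof. exact: (@measure_semi_sigma_additive _ _ _ lam). Qed.
HB.instance Definition _ :=
  isMeasure.Build _ (R * R)%type R (@area R) area0 area_ge0 area_sigma.

End AreaMeasure.

Section Integration.
Context {R : realType}.
Local Notation lam := (@area R).
Implicit Types (X Y D : set (R * R)) (S : R * R -> R * R).

Lemma ge0_integral_null X D (f : R * R -> \bar R) :
  measurable X -> measurable D -> D `<=` X -> lam (X `\` D) = 0%E ->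
  measurable_fun X f -> (forall x, X x -> (0 <= f x)%E) ->
  (\int[lam]_(x in X) f x = \int[lam]_(x in D) f x)%E.
Proof.
move=> mX mD DX z mf f0; rewrite (ge0_negligible_integral (N := X `\` D))//; last exact: measurableD.
by rewrite setDD setIidr.
Qed.

Lemma transport_null X Y S : measurable Y -> transport_map X Y S ->
  lam (X `\` (X `&` S @^-1` Y)) = 0%E.
Proof.
move=> mY [mS tS]; have mC := measurableC mY; have := tS _ mC.
rewrite setICr measure0 => <-; congr area; apply/seteqP; split => x.
  by move=> [Xx nS]; split => // Yx; apply: nS.
by move=> [Xx nS]; split => // -[_].
Qed.

(** Sending the complement of X to a point y0 outside Y turns S into a total measurable map whose
    image measure agrees with [area] on the subsets of Y. *)
Lemma transport_integral X Y S y0 (V : R * R -> \bar R) :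
  measurable X -> measurable Y -> ~ Y y0 -> transport_map X Y S ->
  measurable_fun Y V -> (forall y, Y y -> (0 <= V y)%E) ->
  (\int[lam]_(y in Y) V y = \int[lam]_(x in X `&` S @^-1` Y) V (S x))%E.
Proof.
move=> mX mY ny0 [mS tS] mV V0.
pose phi x := if x \in X then S x else y0.
have pre A : phi @^-1` A = (X `&` S @^-1` A) `|` (if y0 \in A then ~` X else set0).
  apply/seteqP; split => x; rewrite /phi /=.
    case: ifPn => [|nX Ay]; first by rewrite inE; left.
    by right; rewrite mem_set//= => Xx; move: nX; rewrite mem_set.
  move=> [[Xx Ax]|]; first by rewrite mem_set.
  by case: ifPn => // ; rewrite inE => Ay nX; rewrite memNset.
have mphi : measurable_fun setT phi.
  move=> _ A mA; rewrite setTI pre; apply: measurableU; first exact: mS.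
  by case: ifP => _; [exact: measurableC|exact: measurable0].
have preY A : A `<=` Y -> phi @^-1` A = X `&` S @^-1` A.
  by move=> AY; rewrite pre memNset ?setU0// => /AY.
rewrite -(preY Y)//.
transitivity (\int[pushforward lam phi]_(y in Y) V y)%E.
  apply: eq_measure_integral => A mA AY; change (area A = area (phi @^-1` A)).
  by rewrite (preY _ AY) (tS _ mA) setIidr.
rewrite (ge0_integral_pushforward mphi)//; last by move=> y; rewrite inE; exact: V0.
apply: eq_integral => x; rewrite inE preY// => -[Xx _].
by rewrite /= /phi mem_set.
Qed.

Lemma square_area X (L : R) : measurable X -> (forall x, X x -> in_square L x) -> (lam X < +oo)%E.
Proof.
move=> mX hX; have mQ : measurable (`[- L, L]%classic `*` `[- L, L]%classic : set (R * R)) by exact: measurableX.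
apply: (@le_lt_trans _ _ (lam (`[- L, L]%classic `*` `[- L, L]%classic))).
  apply: le_measure; rewrite ?inE// => x /hX[x1 x2].
  by split; rewrite /= in_itv/= -ler_norml.
have e (I : set R) : measurable I -> area (I `*` I) = (lebesgue_measure I * lebesgue_measure I)%E.
  by move=> mI; rewrite /area product_measure1E.
rewrite e ?lebesgue_measure_itv /=; last exact: measurable_itv.
by case: ifP => _; rewrite ?mule0 ?ltry// -!EFinB -EFinM ltry.
Qed.

End Integration.

(** * Kantorovich duality for a map with a convex potential *)

Section Duality.
Context {R : realType}.
Local Notation lam := (@area R).
Variables (X X' Y : set (R * R)) (T : R * R -> R * R) (u : R * R -> R) (L M : R).
Hypotheses (mX : measurable X) (mX' : measurable X') (XX : X' `<=` X) (X0 : X' !=set0).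
Hypothesis (X_null : lam (X `\` X') = 0%E).
Hypothesis (mY : measurable Y).
Hypothesis (XL : forall x, X' x -> in_square L x).
Hypothesis (YL : forall y, Y y -> in_square L y).
Hypothesis (uM : forall x, X' x -> `|u x| <= M).
Hypothesis (TY : forall x, X' x -> Y (T x)).
Hypothesis (supp : forall x x', X' x -> X' x' -> u x + dotp (T x) (x' - x) <= u x').
Hypothesis (tT : transport_map X Y T).

Definition conjugate (y : R * R) : R := sup [set dotp x y - u x | x in X'].
Local Notation psi := conjugate.

Let L0 : 0 <= L.
Proof. by have [x /XL[h _]] := X0; apply: le_trans h. Qed.

Let psi_bounded y : has_ubound [set dotp x y - u x | x in X'].
Proof.
exists (2 * (L * `|y|) + M) => _ [x Xx <-].
have := dotp_le (XL Xx) (in_square_norm y); have := uM Xx.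
by rewrite !ler_norml => /andP[? ?] /andP[? ?]; lra.
Qed.

Lemma conjugate_ge x y : X' x -> dotp x y - u x <= psi y.
Proof. by move=> Xx; apply: ub_le_sup => //; exists x. Qed.

Lemma conjugate_le y c : (forall x, X' x -> dotp x y - u x <= c) -> psi y <= c.
Proof.
move=> h; apply: ge_sup; first by have [x Xx] := X0; exists (dotp x y - u x), x.
by move=> _ [x Xx <-]; exact: h.
Qed.

Lemma conjugate_eq x : X' x -> psi (T x) = dotp x (T x) - u x.
Proof.
move=> Xx; apply/eqP; rewrite eq_le conjugate_ge// andbT; apply: conjugate_le => x' Xx'.
by have := supp Xx Xx'; rewrite /dotp /=; lra.
Qed.

Let psi_lip y y' : psi y <= psi y' + 2 * (L * `|y - y'|).
Proof.
apply: conjugate_le => x Xx; have := conjugate_ge y' Xx.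
have := dotp_le (XL Xx) (in_square_norm (y - y')); rewrite ler_norml => /andP[_].
by move: (`|y - y'|) => n; rewrite /dotp /=; lra.
Qed.

Lemma conjugate_measurable : measurable_fun setT psi.
Proof.
apply: cont_measurable => [|y _ e e0]; first exact: openT.
exists (e / (2 * L + 1)); first by rewrite divr_gt0// ltr_wpDl// mulr_ge0.
move=> y'; rewrite ltr_pdivlMr; last by rewrite ltr_wpDl// mulr_ge0.
move=> h; have h1 := psi_lip y y'; have h2 := psi_lip y' y.
rewrite distrC in h1; move: h h1 h2; have := normr_ge0 (y' - y); move: (`|y' - y|) => n.
by move=> *; rewrite ltr_norml; apply/andP; split; lra.
Qed.

(* W and V are the Kantorovich potentials of the quadratic cost, shifted to be
   nonnegative. *)
Let C1 := 2 * M + 2 * L * L.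
Let C2 := 2 * M + 6 * L * L.
Let W x : R := 2 * (dotp x (T x) - psi (T x)) - dotp x x + C1.
Let V y : R := 2 * psi y - dotp y y + C2.

Let W_bounds x : X' x -> 0 <= W x <= 2 * C1.
Proof.
move=> Xx; rewrite /W conjugate_eq// /C1; have := uM Xx; have := dotp_le (XL Xx) (XL Xx).
by rewrite !ler_norml => /andP[? ?] /andP[? ?]; apply/andP; split; lra.
Qed.

Let V_bounds y : Y y -> 0 <= V y <= 2 * C2.
Proof.
move=> Yy; have [x0 Xx0] := X0; have h1 := conjugate_ge y Xx0.
have h2 : psi y <= 2 * (L * L) + M.
  apply: conjugate_le => x Xx; have := uM Xx; have := dotp_le (XL Xx) (YL Yy).
  by rewrite !ler_norml => /andP[? ?] /andP[? ?]; lra.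
rewrite /V /C2; have := uM Xx0; have := dotp_le (XL Xx0) (YL Yy); have := dotp_le (YL Yy) (YL Yy).
by rewrite !ler_norml => /andP[? ?] /andP[? ?] /andP[? ?]; apply/andP; split; lra.
Qed.

(** For x in X' the bracket is u x + psi y - dotp x y by [conjugate_eq], hence nonnegative, and it
    vanishes at y = T x. This is the pointwise form of duality. *)
Let gap x y : dotp (x - y) (x - y) + W x + V y = C1 + C2 + 2 * (dotp x (T x) - psi (T x) + psi y - dotp x y).
Proof. by rewrite /W /V /dotp /=; ring. Qed.

Let mV : measurable_fun setT V.
Proof.
apply: measurable_funD => //; apply: measurable_funB; last exact: measurable_dotp.
by apply: measurable_funM => //; exact: conjugate_measurable.
Qed.

Let meas (S : R * R -> R * R) : measurable_fun X S -> [/\ measurable_fun X (fun x => dotp (x - S x) (x - S x)),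
   measurable_fun X W & measurable_fun X (fun x => V (S x))].
Proof.
move=> mS; have mI : measurable_fun X (fun x : R * R => x) by exact: measurable_id.
have [mT _] := tT; split.
- have -> : (fun x => dotp (x - S x) (x - S x)) = (fun x => dotp x x - 2 * dotp x (S x) + dotp (S x) (S x)).
    by apply/funext => x; rewrite /dotp /=; ring.
  apply: measurable_funD; last exact: measurable_dotp.
  apply: measurable_funB; first exact: measurable_dotp.
  by apply: measurable_funM => //; exact: measurable_dotp.
- apply: measurable_funD => //; apply: measurable_funB; last exact: measurable_dotp.
  apply: measurable_funM => //; apply: measurable_funB; first exact: measurable_dotp.
  by apply: measurableT_comp => //; exact: conjugate_measurable.
- exact: measurableT_comp.
Qed.

Let y_out : exists y0, ~ Y y0.
Proof.
exists (L + 1, 0) => /YL[/= h _]; move: h; have l0 := L0; rewrite ger0_norm; lra.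
Qed.

Let K := (\int[lam]_(x in X') (W x)%:E + \int[lam]_(y in Y) (V y)%:E)%E.

(** Finiteness lets K be cancelled in comparisons of extended reals. *)
Let K_fin : K \is a fin_num.
Proof.
have bd (D : set (R * R)) f (c : R) : measurable D -> (forall x, D x -> in_square L x) ->
    (forall x, D x -> 0 <= f x <= c) -> measurable_fun D f ->
    (\int[lam]_(x in D) (f x)%:E)%E \is a fin_num.
  move=> mD DL fc mf; rewrite ge0_fin_numE; last first.
    by apply: integral_ge0 => x Dx; rewrite lee_fin; have /andP[] := fc x Dx.
  apply: (@le_lt_trans _ _ (\int[lam]_(x in D) c%:E)%E).
    apply: ge0_le_integral => //.
    - by move=> x Dx; rewrite lee_fin; have /andP[] := fc x Dx.
    - exact/measurable_EFinP.
    - by move=> x Dx; rewrite lee_fin; have /andP[] := fc x Dx.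
  have [D0|/set0P[x /fc/andP[h1 h2]]] := eqVneq D set0; first by rewrite D0 integral_set0.
  rewrite integral_cst//; apply: lte_mul_pinfty => //; last exact: square_area DL.
  by rewrite lee_fin (le_trans h1).
have [mT _] := tT; have [_ mW _] := meas mT.
by rewrite fin_numD; apply/andP; split; apply: bd; [exact: mX'|exact: XL|exact: W_bounds|exact: measurable_funS mW|exact: mY|exact: YL|exact: V_bounds|exact: measurable_funTS].
Qed.

(** The points of full measure at which the pointwise inequalities apply to S: the potential is
    controlled at x, and S x lies in Y. *)
Let good S := X' `&` (X `&` S @^-1` Y).

Let good_measurable S : transport_map X Y S -> measurable (good S).
Proof. by move=> [mS _]; apply: measurableI => //; exact: mS. Qed.

Let good_null S : transport_map X Y S -> lam (X `\` good S) = 0%E.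
Proof.
move=> tS; have mP : measurable (X `&` S @^-1` Y) by have [mS _] := tS; exact: mS.
apply/eqP; rewrite eq_le measure_ge0 andbT.
have -> : X `\` good S = (X `\` X') `|` (X `\` (X `&` S @^-1` Y)) by rewrite /good setDIr.
apply: (le_trans (measureU2 _ (measurableD mX mX') (measurableD mX mP))).
by rewrite [X in (X + _)%E]X_null [X in (_ + X)%E](transport_null mY tS) adde0.
Qed.

Let gap_ge S x : good S x -> C1 + C2 <= dotp (x - S x) (x - S x) + W x + V (S x).
Proof.
move=> [Xx [_ Yx]]; rewrite gap conjugate_eq// lerDl mulr_ge0//.
by have := conjugate_ge (S x) Xx; lra.
Qed.

Let cost_eq S : transport_map X Y S ->
  (transport_cost X S + K = \int[lam]_(x in good S) (dotp (x - S x) (x - S x) + W x + V (S x))%:E)%E.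
Proof.
move=> tS; have [mS _] := tS; have mG := good_measurable tS; have [m1 m2 m3] := meas mS.
have GX : good S `<=` X by move=> x [_ []].
have GX' : good S `<=` X' by move=> x [].
have GY x : good S x -> Y (S x) by move=> [_ []].
have [y0 hy0] := y_out.
have c0 x : 0 <= dotp (x - S x) (x - S x) by rewrite -enorm_sqr sqr_ge0.
have mP : measurable (X `&` S @^-1` Y) by exact: mS.
have sub A B : A `<=` X -> measurable A -> measurable B -> B `<=` A -> good S `<=` B -> lam (A `\` B) = 0%E.
  move=> AX mA mB BA GB; apply/eqP; rewrite eq_le measure_ge0 andbT -(good_null tS).
  by apply: le_measure; rewrite ?inE; [exact: measurableD|exact: measurableD|move=> x [/AX Xx nB]; split => // /GB].
have -> : transport_cost X S = (\int[lam]_(x in good S) (dotp (x - S x) (x - S x))%:E)%E.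
  rewrite /transport_cost; under eq_integral do rewrite enorm_sqr.
  by apply: ge0_integral_null => //; [exact: good_null|exact/measurable_EFinP|move=> x _; rewrite lee_fin].
rewrite /K (ge0_integral_null mX' mG GX'); first last.
- by move=> x /W_bounds/andP[h _]; rewrite lee_fin.
- by apply/measurable_EFinP; exact: measurable_funS m2.
- exact: sub.
rewrite (transport_integral mX mY hy0 tS); first last.
- by move=> y /V_bounds/andP[h _]; rewrite lee_fin.
- by apply/measurable_EFinP; exact: measurable_funTS.
rewrite (ge0_integral_null mP mG); first last.
- by move=> x [_ /V_bounds/andP[h _]]; rewrite lee_fin.
- by apply/measurable_EFinP; apply: measurable_funS m3 => // x [].
- by apply: sub => // x [].
- by move=> x [].
rewrite addeA -ge0_integralD//; first last.
- by apply/measurable_EFinP; exact: measurable_funS m2.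
- by move=> x /GX'/W_bounds/andP[h _]; rewrite lee_fin.
- by apply/measurable_EFinP; exact: measurable_funS m1.
- by move=> x _; rewrite lee_fin.
rewrite -ge0_integralD//; first last.
- by apply/measurable_EFinP; exact: measurable_funS m3.
- by move=> x /GY/V_bounds/andP[h _]; rewrite lee_fin.
- by apply/measurable_EFinP; apply: measurable_funD; [exact: measurable_funS m1|exact: measurable_funS m2].
- by move=> x /GX'/W_bounds/andP[h _]; rewrite lee_fin addr_ge0.
Qed.

Let C_ge0 : 0 <= C1 + C2.
Proof.
have [x Xx] := X0; have /andP[w0 w1] := W_bounds Xx; have /andP[v0 v1] := V_bounds (TY Xx); lra.
Qed.

Let good_area S : transport_map X Y S -> lam (good S) = lam X.
Proof.
move=> tS; have mG := good_measurable tS.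
rewrite -[in RHS](setDUK (A := good S) (B := X)); last by move=> x [_ []].
rewrite measureU//; [|exact: measurableD|by rewrite setDIK].
by rewrite [X in (_ + X)%E](good_null tS) adde0.
Qed.

Let cost_T : (transport_cost X T + K = (C1 + C2)%:E * lam X)%E.
Proof.
rewrite cost_eq// -(good_area tT) -integral_cst; last exact: good_measurable.
apply: eq_integral => x; rewrite inE => -[Xx _].
by rewrite gap subrK subrr mulr0 addr0.
Qed.

Let cost_S S : transport_map X Y S ->
  (transport_cost X S + K = \int[lam]_(x in good S) (dotp (x - S x) (x - S x) + W x + V (S x) - (C1 + C2))%:E +
    (C1 + C2)%:E * lam X)%E.
Proof.
move=> tS; have [mS _] := tS; have mG := good_measurable tS; have [m1 m2 m3] := meas mS.
have GX : good S `<=` X by move=> x [_ []].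
rewrite cost_eq// -(good_area tS) -integral_cst// -ge0_integralD//.
- by apply: eq_integral => x _; rewrite -EFinD subrK.
- by move=> x /gap_ge h; rewrite lee_fin subr_ge0.
- apply/measurable_EFinP; apply: measurable_funB => //.
  by apply: measurable_funD; [apply: measurable_funD; [exact: measurable_funS m1|exact: measurable_funS m2]|exact: measurable_funS m3].
Qed.

Let area_fin : ((C1 + C2)%:E * lam X)%E \is a fin_num.
Proof.
rewrite fin_numM// ge0_fin_numE ?measure_ge0// -(good_area tT).
by apply: (square_area (good_measurable tT)) => x [Xx _]; exact: XL.
Qed.

Lemma duality_optimal : optimal_transport X Y T.
Proof.
split=> // S tS; rewrite -(leeD2rE _ _ K_fin) cost_T cost_S// leeDr//.
by apply: integral_ge0 => x /gap_ge h; rewrite lee_fin subr_ge0.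
Qed.

(** For an optimal S the nonnegative gap has integral 0, so it vanishes almost everywhere and S x is
    a subgradient of u at x. Adding its subgradient inequality to that of T x' at x' gives
    monotonicity, which takes the place of uniqueness of the optimal map. *)
Lemma duality_monotone S : optimal_transport X Y S ->
  {ae @area R, forall x, X' x -> forall x', X' x' -> 0 <= dotp (x' - x) (T x' - S x)}.
Proof.
move=> [tS /(_ T tT)]; rewrite -(leeD2rE _ _ K_fin) cost_T cost_S// => le0.
have [mS _] := tS; have mG := good_measurable tS; have [m1 m2 m3] := meas mS.
have GX : good S `<=` X by move=> x [_ []].
pose f x := (dotp (x - S x) (x - S x) + W x + V (S x) - (C1 + C2))%:E.
have f0 x : good S x -> (0 <= f x)%E by move=> /gap_ge h; rewrite lee_fin subr_ge0.
have mf : measurable_fun (good S) f.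
  apply/measurable_EFinP; apply: measurable_funB => //.
  by apply: measurable_funD; [apply: measurable_funD; [exact: measurable_funS m1|exact: measurable_funS m2]|exact: measurable_funS m3].
have i0 : (\int[lam]_(x in good S) `|f x| = 0)%E.
  have -> : (\int[lam]_(x in good S) `|f x| = \int[lam]_(x in good S) f x)%E.
    by apply: eq_integral => x; rewrite inE => /f0 h; rewrite gee0_abs.
  apply/eqP; rewrite eq_le integral_ge0// andbT.
  by rewrite -(leeD2rE _ _ area_fin) add0e.
have [N [mN N0 hN]] := (ae_eq_integral_abs lam mG mf).1 i0.
have mD : measurable (X `\` good S) by exact: measurableD.
exists (N `|` (X `\` good S)); split; first exact: measurableU.
  apply/eqP; rewrite eq_le measure_ge0 andbT; apply: (le_trans (measureU2 _ mN mD)).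
  by rewrite [X in (X + _)%E]N0 [X in (_ + X)%E](good_null tS) adde0.
move=> x /= nx; apply: contrapT => /not_orP[nN nG]; apply: nx => Xx x' Xx'.
have Gx : good S x by apply: contrapT => h; apply: nG; split => //; exact: XX.
have e : f x = 0%E by apply: contrapT => h; apply: nN; apply: hN => /(_ Gx).
move: e => [] /eqP; rewrite gap conjugate_eq// => /eqP e.
have h1 := conjugate_ge (S x) Xx'; have h2 := supp Xx' Xx.
have h3 : psi (S x) = dotp x (S x) - u x by lra.
by move: h1 h2; rewrite h3 /dotp /=; lra.
Qed.

End Duality.

Section AlmostEverywhere.
Context {R : realType}.

Lemma ae_rectangle (P : set (R * R)) (l r s t : R) : l < r -> s < t ->
  {ae @area R, forall x, P x} -> exists x, [/\ P x, l < x.1 < r & s < x.2 < t].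
Proof.
move=> lr st [N [mN N0 hN]]; apply: contrapT => h.
have mQ : measurable (`]l, r[%classic `*` `]s, t[%classic : set (R * R)) by exact: measurableX.
have QN : `]l, r[%classic `*` `]s, t[%classic `<=` N.
  move=> x [x1 x2]; apply: hN => Px; apply: h; exists x.
  by move: x1 x2; rewrite /= !in_itv.
have : (area (`]l, r[%classic `*` `]s, t[%classic) <= 0)%E.
  by rewrite -N0; apply: le_measure; rewrite ?inE.
have e (I J : set R) : measurable I -> measurable J ->
    area (I `*` J) = (lebesgue_measure I * lebesgue_measure J)%E.
  by move=> mI mJ; rewrite /area product_measure1E.
rewrite e; [|exact: measurable_itv|exact: measurable_itv].
rewrite !lebesgue_measure_itv /= !lte_fin lr st -!EFinB -EFinM lee_fin.
by rewrite leNgt mulr_gt0// subr_gt0.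
Qed.

End AlmostEverywhere.

Section Estimates.
Context {R : realType}.
Implicit Types (s t u c r : R).

Lemma half_bounds s c r : 0 < s -> s < c -> c <= r / 8 -> r < 1 / 4 -> s / 2 <= 2 /\ 0 < s / 2.
Proof. by move=> *; split; lra. Qed.

Lemma far_apart s t u r : r / 2 < s -> t < - (r / 2) -> `|u - s| < r / 4 -> `|u - t| < r / 4 -> False.
Proof. by move=> ? ?; rewrite !ltr_norml => /andP[? ?] /andP[? ?]; lra. Qed.

End Estimates.

(** * Optimality of the map and discontinuity of every optimal map *)

Section Optimality.
Context {R : realType} (mu rho K : R).
Hypothesis (mu_gt0 : 0 < mu) (mu_lt : mu < 1 / 320) (rho_gt0 : 0 < rho) (rho_lt : rho < 1 / 4).
Hypothesis (K0 : 0 <= K) (hK : forall t : R, `|dbump t| <= K).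
Hypothesis (D_small : small_bd mu rho K <= 1 / 8).
Variable Y : set (R * R).
Hypothesis Y_open : open Y.
Hypothesis YP : forall y, Y y <-> exists v,
  [/\ box 4 v, stadium (v.1 + w0 mu rho v, v.2) & y = (v.1, v.2 + z0 mu rho v)].
Notation TT := (TT mu rho).
Notation pot := (pot mu rho).
Notation B := (B mu rho).
Notation bb := (bb mu rho).
Implicit Types (x y : R * R) (S : R * R -> R * R).

Let mu8 : mu < 1 / 8. Proof. by have := mu_lt => ?; lra. Qed.

Let X' : set (R * R) := [set x | stadium x /\ x.1 != 0].

Let X'_square x : X' x -> in_square 5 x.
Proof.
move=> [S _]; have [x1 _] := stadium_bounds (ltW S); have /andP[x2 x3] := stadium_pos S.
by split; [|rewrite gtr0_norm//]; lra.
Qed.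

Let Y_square y : Y y -> in_square 5 y.
Proof.
by move=> /(Y_bounds mu_gt0 mu_lt rho_gt0 rho_lt K0 hK D_small YP)[y1 y2]; split => //; lra.
Qed.

Let TT_Y x : X' x -> Y (TT x).
Proof. by move=> [Sx x0]; exact: (TT_in_Y mu_gt0 mu_lt rho_gt0 rho_lt K0 hK D_small YP Sx x0). Qed.

Let support x x' : X' x -> X' x' -> pot x + dotp (TT x) (x' - x) <= pot x'.
Proof.
by move=> [Sx x0] [Sx' x0']; exact: (pot_support mu_gt0 mu_lt rho_gt0 rho_lt K0 D_small Sx Sx' x0 x0').
Qed.

Let base : X' (1, 1).
Proof. by split; [apply: stadium_strip => /=; rewrite ?normr1; lra|rewrite /= oner_neq0]. Qed.

Let pot_bound x : X' x -> `|pot x| <= `|pot (1, 1)| + 100.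
Proof.
move=> Xx; have h1 := support Xx base; have h2 := support base Xx.
have tri (z z' : R) : `|z| <= 5 -> `|z'| <= 5 -> `|z - z'| <= 10.
  by rewrite !ler_norml => /andP[? ?] /andP[? ?]; apply/andP; split; lra.
have sq x0 x1 : X' x0 -> X' x1 -> in_square 10 (x1 - x0).
  by move=> /X'_square[a1 a2] /X'_square[b1 b2]; split; exact: tri.
have := dotp_le (Y_square (TT_Y Xx)) (sq _ _ Xx base).
have := dotp_le (Y_square (TT_Y base)) (sq _ _ base Xx).
have := ler_norm (pot (1, 1)); have := ler_norm (- pot (1, 1)); rewrite normrN.
move: h1 h2; move: (dotp _ _) (dotp _ _) (pot x) (pot (1, 1)) => d1 d2 p1 p2 h1 h2 n1 n2.
by rewrite !ler_norml => /andP[? ?] /andP[? ?]; apply/andP; split; lra.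
Qed.

Let mX : measurable (@stadium R). Proof. by apply: open_measurable2; exact: stadium_open. Qed.

Let mX' : measurable X'.
Proof.
have -> : X' = stadium `\` [set x | x.1 = 0].
  by apply/seteqP; split => x [Sx /eqP].
by apply: measurableD; [exact: mX|exact: axis_measurable].
Qed.

Let X'_null : area (stadium `\` X') = 0%E.
Proof.
apply/eqP; rewrite eq_le measure_ge0 andbT -(@area_axis R); apply: le_measure; rewrite ?inE.
- by apply: measurableD; [exact: mX|exact: mX'].
- exact: axis_measurable.
- by move=> x [Sx nX]; apply: contrapT => x0; apply: nX; split => //; exact/eqP.
Qed.

Lemma TT_optimal : optimal_transport stadium Y TT.
Proof.
apply: (duality_optimal mX mX' _ _ X'_null _ X'_square Y_square pot_bound TT_Y support).
- by move=> x [].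
- by exists (1, 1).
- exact: open_measurable2.
- exact: (TT_transport mu_gt0 mu_lt rho_gt0 rho_lt K0 hK D_small Y_open YP).
Qed.

(** If both x.2 and [bb x] were at most rho / 2, then kap N <= 2 (rho^2 / 2) = rho^2, against
    [B_pos_reg]. *)
Let TT_jump x : 0 < x.1 -> x.1 <= 2 -> 0 < x.2 -> x.2 <= rho / 2 -> rho / 2 < bb x.
Proof.
move=> x0 x2 a0 a2; have r4 := rho_lt.
have [||b0 b4 e] := bbP mu_gt0 mu_lt rho_gt0 rho_lt K0 D_small x0 _ a0; [lra|lra|].
have : rho ^+ 2 < kap mu * NN x.2 (bb x).
  by apply: (B_pos_reg mu_gt0 mu8 rho_gt0 a0 b0); rewrite e ltW.
move=> reg; rewrite ltNge; apply/negP => h; move: reg; apply/negP; rewrite -leNgt /NN /kap.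
have sq z : 0 < z -> z <= rho / 2 -> z ^+ 2 <= (rho / 2) ^+ 2.
  by move=> z0 zr; rewrite ler_sqr ?nnegrE//; lra.
have h1 := sq _ a0 a2.
have h2 := sq _ b0 h.
have m1 := mu8; have m0 := mu_gt0.
have : (1 + 2 * mu) * (x.2 ^+ 2 + bb x ^+ 2) <= 2 * ((rho / 2) ^+ 2 + (rho / 2) ^+ 2).
  apply: ler_pM; [lra|by rewrite addr_ge0// sqr_ge0|lra|exact: lerD].
by move=> h3; apply: (le_trans h3); rewrite expr_div_n; lra.
Qed.

(** Monotonicity is tested between x and (x.1 / 2, x.2), nearer to the axis. At equal heights only
    first components enter, so (S x).1 is at least the first component of TT at the nearer point,
    which exceeds rho / 2; on the left it is below - rho / 2. This holds at almost every point near
    (0, rho / 4), where a continuous g would be nearly constant. *)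
Lemma optimal_discontinuous S : optimal_transport stadium Y S -> discontinuous stadium S.
Proof.
move=> oS [g cg aeg].
have mono := duality_monotone mX mX' (fun x (h : X' x) => h.1) (ex_intro _ _ base) X'_null
  (open_measurable2 Y_open) X'_square Y_square pot_bound TT_Y support
  (TT_transport mu_gt0 mu_lt rho_gt0 rho_lt K0 hK D_small Y_open YP) oS.
have {aeg mono} ae : {ae @area R, forall x, (stadium x -> g x = S x) /\
    (X' x -> forall x', X' x' -> 0 <= dotp (x' - x) (TT x' - S x))}.
  by apply: filterS2 aeg mono => x; split.
have r4 := rho_lt; have r0 := rho_gt0.
have Sp : stadium ((0 : R), rho / 4) by apply: stadium_strip => /=; rewrite ?normr0; lra.
have e0 : 0 < rho / 4 by rewrite divr_gt0.
move/within_contP : cg => /(_ _ Sp _ e0)[d d0 hd].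
(* The bound rho / 8 keeps the heights between rho / 4 and rho / 4 + c below rho / 2, as [TT_jump]
   demands. *)
pose c := Num.min (d / 2) (rho / 8).
have c0 : 0 < c by rewrite lt_min !divr_gt0.
have cd : c < d by rewrite gt_min; apply/orP; left; lra.
have cr : c <= rho / 8 by rewrite ge_min lexx orbT.
clearbody c.
have near x : `|x.1| < c -> rho / 4 < x.2 < rho / 4 + c -> x.1 != 0 ->
   [/\ X' x, X' (x.1 / 2, x.2), x.2 <= rho / 2 & `|(g (0, rho / 4)).1 - (g x).1| < rho / 4].
  move=> x1 /andP[x2 x3] xn.
  have x4 : `|x.1 / 2| < c by rewrite normrM (@ger0_norm _ 2^-1)//; have := normr_ge0 x.1; lra.
  have Sx : stadium x by apply: stadium_strip; lra.
  split => //.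
  - by split => //=; [apply: stadium_strip => /=; lra|rewrite mulf_neq0// invr_eq0].
  - lra.
  have h : `|(0, rho / 4) - x| < d.
    rewrite prod_normE /= sub0r normrN gt_max (lt_trans x1 cd) ler0_norm; lra.
  by have [n1 _] := norm_pair (g (0, rho / 4) - g x); apply: le_lt_trans n1 _; exact: hd.
have rc : rho / 4 < rho / 4 + c by lra.
have [x [[gS m] /andP[x1 x2] hx]] := ae_rectangle c0 rc ae.
have nc : - c < 0 by rewrite oppr_lt0.
have [y [[gS' m'] /andP[y1 y2] hy]] := ae_rectangle nc rc ae.
have [Xx Xx' ax gx] := near x ltac:(rewrite gtr0_norm//) hx ltac:(by rewrite gt_eqF).
have [Xy Xy' ay gy] := near y ltac:(rewrite ltr0_norm//; lra) hy ltac:(by rewrite lt_eqF).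
have hx2 : 0 < x.2 by case/andP: hx => hx _; exact: lt_trans hx.
have hy2 : 0 < y.2 by case/andP: hy => hy _; exact: lt_trans hy.
have [x12 x11] := half_bounds x1 x2 cr r4.
have ny2 : 0 < - y.1 by rewrite oppr_gt0.
have ny1 : - y.1 < c by rewrite ltrNl.
have [y12 y11] := half_bounds ny2 ny1 cr r4.
have jx : rho / 2 < (TT (x.1 / 2, x.2)).1.
  by rewrite TT_pos /=; [exact: TT_jump|].
have jy : (TT (y.1 / 2, y.2)).1 < - (rho / 2).
  have -> : (y.1 / 2, y.2) = (- (- y.1 / 2), y.2) by congr pair; ring.
  rewrite (@TT_refl R mu rho (- y.1 / 2, y.2)) /=; last by rewrite gt_eqF.
  by rewrite ltrN2 TT_pos /=; [exact: TT_jump|].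
have sx : rho / 2 < (S x).1.
  have := m Xx _ Xx'; rewrite /dotp /= subrr mul0r addr0.
  have -> : x.1 / 2 - x.1 = - (x.1 / 2) by field.
  by rewrite mulNr oppr_ge0 pmulr_rle0 ?divr_gt0// subr_le0; exact: lt_le_trans.
have sy : (S y).1 < - (rho / 2).
  have := m' Xy _ Xy'; rewrite /dotp /= subrr mul0r addr0.
  have -> : y.1 / 2 - y.1 = - y.1 / 2 by field.
  rewrite pmulr_rge0//.
  by rewrite subr_ge0 => h; exact: le_lt_trans jy.
move: gx gy; rewrite gS ?gS'//; [|by case: Xy|by case: Xx].
by move=> gx gy; exact: (far_apart sx sy gx gy).
Qed.

End Optimality.

Theorem theorem2p3 (R : realType) (eps : R) (eps_gt0 : 0 < eps) :
  exists alpha : R, 0 < alpha < 1 /\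
  exists X Y : set (R * R),
    [/\ bounded_domain X, smooth_domain X & convex_set X] /\
    [/\ bounded_domain Y, area X = area Y,
        C1alpha_perturbation eps alpha X Y,
        exists T, optimal_transport X Y T &
        forall T, optimal_transport X Y T -> discontinuous X T].
Proof.
have [K K0 hK] := @bump_bounds R.
(* The bound 1 / 8 makes the shears invertible and the model close to the identity away from the
   pole; eps / 42 gives the bound on the norm. *)
have d0 : 0 < Num.min (1 / 8) (eps / 42) by rewrite lt_min !divr_gt0.
have [mu [rho [mu0 mu1 rho0 rho1]]] := small_parameters K0 d0.
rewrite le_min => /andP[D8]; rewrite ler_pdivlMr// mulrC => De.
have [Y [a0 [a00 dY pert YP]]] := perturbation_exists mu0 mu1 rho0 rho1 K0 hK D8 De.
have oY : open Y by case: dY.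
exists (Num.min a0 (1 / 2)); split; first by rewrite lt_min gt_min a00 /=; apply/andP; split; [|apply/orP; right]; lra.
exists stadium, Y; split; first by split; [exact: stadium_bounded_domain|exact: stadium_smooth|exact: stadium_convex].
have oT := TT_optimal mu0 mu1 rho0 rho1 K0 hK D8 oY YP.
split => //.
(* Equality of the areas is the transport condition tested on the whole plane. *)
- have [[_ /(_ _ measurableT) e] _] := oT.
  rewrite -[Y]setIT -e; congr area; apply/seteqP; split => x //; exact: proj1.
- by apply: pert; rewrite ?lt_min ?a00 ?ge_min ?lexx//=; lra.
- by exists (TT mu rho).
- by move=> T; exact: (optimal_discontinuous mu0 mu1 rho0 rho1 K0 hK D8 oY YP).
Qed.
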